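(* Let $\nu>0$ be real and let $z\in\mathbb{C}$ with $\mathrm{Re}\,z>0$. Then $$\frac{\partial K_\nu(z)}{\partial\nu}=\frac\nu2\left[\frac{K_\nu(z)}{\sqrt\pi}\,G_{2,4}^{3,1}\left(z^2\left|\begin{array}{c}\frac12,\ 1\\ 0,\ 0,\ \nu,\ -\nu\end{array}\right.\right)-\sqrt\pi\,I_\nu(z)\,G_{2,4}^{4,0}\left(z^2\left|\begin{array}{c}\frac12,\ 1\\ 0,\ 0,\ \nu,\ -\nu\end{array}\right.\right)\right].$$
   Context: Powers take their principal values. $I_\nu(z)=(z/2)^\nu\sum_{k\ge0}\frac{(z/2)^{2k}}{k!\,\Gamma(\nu+k+1)}$, and $K_\nu(z)=\frac\pi2\frac{I_{-\nu}(z)-I_\nu(z)}{\sin\pi\nu}$ for $\nu\notin\mathbb{Z}$ (defined by the limit in $\nu$ for integral $\nu$); $\partial/\partial\nu$ is the derivative with respect to the order at fixed $z$. The Meijer $G$-function is $$G_{p,q}^{m,n}\left(x\left|\begin{array}{c}a_1,\dots,a_p\\ b_1,\dots,b_q\end{array}\right.\right)=\frac1{2\pi i}\int_L\frac{\prod_{\ell=1}^m\Gamma(b_\ell-s)\prod_{\ell=1}^n\Gamma(1-a_\ell+s)}{\prod_{\ell=m+1}^{q}\Gamma(1-b_\ell+s)\prod_{\ell=n+1}^{p}\Gamma(a_\ell-s)}\,x^s\,ds,$$ where $L$ separates the poles of the factors $\Gamma(b_\ell-s)$ ($1\le\ell\le m$) from those of the factors $\Gamma(1-a_\ell+s)$ ($1\le\ell\le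 n$); for $p<q$ one may take $L$ to be a loop starting and ending at $+\infty$ and encircling all poles of the $\Gamma(b_\ell-s)$, but none of the $\Gamma(1-a_\ell+s)$, once in the negative (clockwise) direction. $x^s$ is the principal value. *)

(* Defs.v *)
(* Stdlib reals with Coquelicot. *)
From Stdlib Require Export Reals List Factorial ClassicalEpsilon.
From Coquelicot Require Export Coquelicot.
Export ListNotations.

Open Scope R_scope.
Open Scope C_scope.

Definition Cexp (z : C) : C :=
  RtoC (exp (Re z)) * (cos (Im z), sin (Im z)).

Definition Csin (z : C) : C :=
  (Cexp (Ci * z) - Cexp (- (Ci * z))) / (RtoC 2 * Ci).

(* Principal argument, with values in (-PI, PI]. Irrelevant value at 0. *)
Definition Carg (z : C) : R :=
  if Rle_dec 0 (Im z) then acos (Re z / Cmod z) else (- acos (Re z / Cmod z))%R.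

Definition Clog (z : C) : C := (ln (Cmod z), Carg z).

(* Principal value of [z] to the complex power [s], for [z <> 0]. *)
Definition Cpower (z s : C) : C := Cexp (s * Clog z).

Definition Cprod (l : list C) : C := fold_right Cmult (RtoC 1) l.

(* [iota] picks the unique complex number with the given property; its value
   is irrelevant when there is no such unique number. *)

Definition Clim_seq (u : nat -> C) : C :=
  @iota C_CompleteNormedModule
    (fun l : C => filterlim u eventually (locally l)).

(* Limit of [f w] as [w] tends to [w0], [w <> w0], in the complex plane.
   Coquelicot's [C_lim] only looks along the horizontal line through [w0]. *)
Definition Clim_at (f : C -> C) (w0 : C) : C :=
  @iota C_CompleteNormedModule
    (fun l : C => filterlim f (locally' w0) (locally l)).

Definition CSeries (u : nat -> C) : C :=
  @iota C_CompleteNormedModule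
    (fun l : C => @is_series C_AbsRing C_NormedModule u l).

(* The entire function 1/Gamma, by Gauss's limit
     1/Gamma(s) = lim_n  s (s+1) ... (s+n) / (n! n^s).
   It vanishes at the poles 0, -1, -2, ... of Gamma, so that factors 1/Gamma
   written with [rGamma] are right at these points too. *)
Definition rGamma (s : C) : C :=
  Clim_seq (fun n : nat =>
    Cprod (map (fun k : nat => s + RtoC (INR k)) (seq 0 (S n)))
    / (RtoC (INR (fact n)) * Cpower (RtoC (INR n)) s)).

(* Only meaningful away from the poles. *)
Definition Gamma (s : C) : C := / rGamma s.

(* The Bessel functions are meant for [z <> 0]; the order is complex. *)
Definition BesselI (nu z : C) : C :=
  Cpower (z / RtoC 2) nu
  * CSeries (fun k : nat =>
      (z / RtoC 2) ^ (2 * k) / RtoC (INR (fact k))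
      * rGamma (nu + RtoC (INR k) + RtoC 1)).

Definition BesselK_quot (nu z : C) : C :=
  RtoC (PI / 2) * ((BesselI (- nu) z - BesselI nu z) / Csin (RtoC PI * nu)).

Definition is_integer (nu : C) : Prop := exists k : Z, nu = RtoC (IZR k).

Definition BesselK (nu z : C) : C :=
  if excluded_middle_informative (is_integer nu)
  then Clim_at (fun mu : C => BesselK_quot mu z) nu
  else BesselK_quot nu z.

(* The upper parameters a_1, ..., a_p and the lower parameters b_1, ..., b_q
   of the Meijer G-function are lists; p and q are their lengths. *)

Definition MeijerG_integrand (m n : nat) (a b : list C) (x s : C) : C :=
  Cprod (map (fun bl : C => Gamma (bl - s)) (firstn m b))
  * Cprod (map (fun al : C => Gamma (RtoC 1 - al + s)) (firstn n a))
  * Cprod (map (fun bl : C => rGamma (RtoC 1 - bl + s)) (skipn m b))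
  * Cprod (map (fun al : C => rGamma (al - s)) (skipn n a))
  * Cpower x s.

(* The loop L(c, h) comes from +oo - ih to c - ih, goes up to c + ih and
   returns to +oo + ih; it thus runs once clockwise around the half-strip
   Re s > c, |Im s| < h. A loop of this shape separating the two sequences of
   poles exists as soon as Re a_l - 1 < Re b_j for all l <= n and j <= m;
   other parameters, which may call for a more tortuous loop, are not
   covered. *)

(* [g] is the integral of [f] along L(c, h). *)
Definition is_loop_int (f : C -> C) (c h : R) (g : C) : Prop :=
  exists g1 g2 g3 : C,
    @is_RInt_gen C_R_NormedModule (fun t : R => f (t, (- h)%R))
      (Rbar_locally p_infty) (at_point c) g1 /\
    @is_RInt C_R_NormedModule (fun t : R => f (c, t) * Ci) (- h)%R h g2 /\
    @is_RInt_gen C_R_NormedModule (fun t : R => f (t, h))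
      (at_point c) (Rbar_locally p_infty) g3 /\
    g = g1 + g2 + g3.

Definition inside_loop (c h : R) (s : C) : Prop :=
  (c < Re s)%R /\ (Rabs (Im s) < h)%R.

Definition outside_loop (c h : R) (s : C) : Prop :=
  (Re s < c)%R \/ (h < Rabs (Im s))%R.

(* The poles of Gamma(b_l - s) are the b_l + k, and those of
   Gamma(1 - a_l + s) are the a_l - 1 - k, with k = 0, 1, 2, ... *)
Definition separating_loop (m n : nat) (a b : list C) (c h : R) : Prop :=
  (0 < h)%R /\
  (forall (bl : C) (k : nat), In bl (firstn m b) ->
     inside_loop c h (bl + RtoC (INR k))) /\
  (forall (al : C) (k : nat), In al (firstn n a) ->
     outside_loop c h (al - RtoC 1 - RtoC (INR k))).

Definition is_MeijerG (m n : nat) (a b : list C) (x g : C) : Prop :=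
  (length a < length b)%nat /\
  exists c h : R,
    separating_loop m n a b c h /\
    exists g' : C,
      is_loop_int (MeijerG_integrand m n a b x) c h g' /\
      g = g' / (RtoC 2 * RtoC PI * Ci).

(* The common value of the integrals over all separating loops L(c, h): as
   [iota] is a unique choice, this is well defined only because the integral
   does not depend on the loop. *)
Definition MeijerG (m n : nat) (a b : list C) (x : C) : C :=
  @iota C_CompleteNormedModule (is_MeijerG m n a b x).

(* Main.v *)
Require Import Defs.
From Stdlib Require Import ZArith Classical Lra Lia FunctionalExtensionality FinFun.

(** Let [x = (z/2)^2], and let [u], [v] be the power series of [0F1(; 1 + nu; x)] and [0F1(; 1 - nu; x)].
    Variation of parameters in their differential equation gives [d u / d nu = u * M - v * P], where [M] and
    [P] are [u * v] and [u * u] integrated term by term, [x^k] being divided by [2 k] and [2 (k + nu)]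
    respectively (the constant term of [u * v] by [2 nu]). As [I_nu] and [I_(-nu)] are [u] and [v] times
    [(z/2)^nu / Gamma(1 + nu)] and [(z/2)^(-nu) / Gamma(1 - nu)], this expresses [d K_nu / d nu] through
    [K_nu], [I_nu], [M], [P], the series [Q] obtained from [P] by [nu -> -nu], and the derivatives of [1/Gamma].

    Both integrands satisfy [f (s + 1) = R s * f s] with
    [R s = z^2 s (s + 1/2) / ((s + 1)^2 (s + 1 - nu) (s + 1 + nu))]. If [2 nu] is not an integer, this recurrence
    along the poles [k], [nu + k] and [-nu + k] is the one satisfied by the coefficients of [u * v], [u * u] and
    [v * v], so that the residue sums of the two G-functions are [M], [P] and [Q] up to explicit factors, and
    the formula follows.

    If [2 nu] is an integer, then [K_nu] and the loop integrals are continuous at [nu], and the formula passes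
    to the limit by the mean value theorem. *)

(** The factors [Gamma(-s)^2 / Gamma(1 - s)] of both integrands collapse to [Gamma(-s) / (-s)], so
    that among the poles [k] only [0] is double. There [R] has a zero: the residue at [1] is [R'(0)]
    times the double-pole coefficient, which starts the recurrence of [u * v] with the right factor,
    while the residue at [0] itself, a logarithmic derivative, supplies [Log(z/2)] and the
    derivatives of [1/Gamma] at [1 + nu] and [1 - nu]. The duplication formula makes this residue
    explicit: it removes the arguments near [1/2], turns [Log(z^2)] into [2 Log(z/2)] and cancels
    the Euler constant. If [2 nu] is an integer, the classes of poles modulo 1 meet, hence the
    detour through generic orders. The recurrences of [u * v] and [u * u] come from third-order
    equations, proved by [ring] on formal series. The relation [f (s + 1) = R s * f s] with [R -> 0]
    also gives the decay that the loop integrals require. Complex analysis grows out of a residue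
    theorem for rectangles, in which a homothety contracts the contour to the pole; every pole is
    treated as a double one. *)

Ltac Rsimpl :=
  repeat (unfold minus, plus, opp, scal, mult, zero, one; simpl);
  try match goal with |- @eq _ ?a ?b => change (@eq R a b) end.

(** * Moduli, neighbourhoods and continuity in the complex plane *)

Lemma C_ext (z w : C) : Re z = Re w -> Im z = Im w -> z = w.
Proof. destruct z, w; simpl; intros; subst; reflexivity. Qed.

Lemma im_le_Cmod (z : C) : (Rabs (Im z) <= Cmod z)%R.
Proof.
  unfold Cmod; rewrite <- (sqrt_Rsqr_abs (Im z)); apply sqrt_le_1_alt.
  unfold Rsqr, Im; nra.
Qed.

Lemma Cmod_le_ReIm (z : C) : (Cmod z <= Rabs (Re z) + Rabs (Im z))%R.
Proof.
  replace z with (RtoC (Re z) + Ci * RtoC (Im z)) at 1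
    by (apply C_ext; simpl; ring).
  eapply Rle_trans; [apply Cmod_triangle|].
  rewrite Cmod_mult, !Cmod_R.
  replace (Cmod Ci) with 1%R; [lra|].
  unfold Cmod; simpl; replace (0 * (0 * 1) + 1 * (1 * 1))%R with 1%R by ring.
  symmetry; apply sqrt_1.
Qed.

Lemma Cmod_0R : Cmod (RtoC 0) = 0%R.
Proof. rewrite Cmod_R, Rabs_R0; reflexivity. Qed.

Lemma Cmod_minus_sym (a b : C) : Cmod (a - b) = Cmod (b - a).
Proof. rewrite <- Cmod_opp; f_equal; ring. Qed.

Lemma Cmod_triangle3 (a b c : C) : (Cmod (a - c) <= Cmod (a - b) + Cmod (b - c))%R.
Proof. replace (a - c) with ((a - b) + (b - c)) by ring; apply Cmod_triangle. Qed.

Lemma Cmod_rev_triangle (a b : C) : (Cmod a - Cmod b <= Cmod (a - b))%R.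
Proof.
  generalize (Cmod_triangle (a - b) b); replace (a - b + b) with a by ring; lra.
Qed.

Lemma Cmod_pos_ne (z : C) : z <> RtoC 0 -> (0 < Cmod z)%R.
Proof. apply Cmod_gt_0. Qed.

Lemma Cmod_le_eps_eq (a b : C) :
  (forall eps : R, (0 < eps)%R -> (Cmod (a - b) <= eps)%R) -> a = b.
Proof.
  intros H. apply Ceq_minus. apply Cmod_eq_0.
  destruct (Req_dec (Cmod (a - b)) 0) as [E|E]; [exact E|].
  generalize (Cmod_ge_0 (a - b)); intros.
  specialize (H (Cmod (a - b) / 2)%R ltac:(lra)); lra.
Qed.

(** The uniform structure of [C] is that of a product, with squares as balls. The modulus lies
    between the larger coordinate and the sum of both, so squares and discs are nested up to a
    factor 2. *)
Lemma locally_C_eps (x : C) (P : C -> Prop) :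
  locally x P <-> exists d : R, (0 < d)%R /\ forall y, (Cmod (y - x) < d)%R -> P y.
Proof.
  split.
  - intros [d Hd]. exists d; split; [apply cond_pos|].
    intros y Hy; apply Hd. apply C_NormedModule_mixin_compat1. exact Hy.
  - intros [d [Hd H]].
    assert (Hd2 : (0 < d / 2)%R) by lra.
    exists (mkposreal _ Hd2). intros y [H1 H2].
    apply H. eapply Rle_lt_trans; [apply Cmod_le_ReIm|].
    unfold ball in H1, H2; simpl in H1, H2.
    unfold AbsRing_ball, abs, minus, plus, opp in H1, H2; simpl in H1, H2.
    destruct x, y; simpl in *. unfold Rminus in *. lra.
Qed.

Lemma filterlim_C_eps {T : Type} (F : (T -> Prop) -> Prop) {FF : Filter F}
    (f : T -> C) (l : C) :
  filterlim f F (locally l) <->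
  forall eps : R, (0 < eps)%R -> F (fun x => (Cmod (f x - l) < eps)%R).
Proof.
  split.
  - intros H eps He. apply (H (fun y => (Cmod (y - l) < eps)%R)).
    apply locally_C_eps. exists eps; auto.
  - intros H P HP. apply locally_C_eps in HP. destruct HP as [d [Hd HP]].
    unfold filtermap. eapply filter_imp; [|apply (H d Hd)].
    simpl; auto.
Qed.

Lemma Cc_eps {U : UniformSpace} (f : U -> C) (x : U) :
  continuous f x <->
  forall eps : R, (0 < eps)%R -> locally x (fun y => (Cmod (f y - f x) < eps)%R).
Proof. apply filterlim_C_eps. apply locally_filter. Qed.

Lemma Cc_comp_iff {U : UniformSpace} (f : U -> C) (x : U) :
  continuous f x <->
  continuous (fun y => Re (f y)) x /\ continuous (fun y => Im (f y)) x.
Proof.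
  split.
  - intros H; split; apply (continuous_comp f _ x H).
    + destruct (f x) as [a b]; apply (@continuous_fst R_UniformSpace R_UniformSpace a b).
    + destruct (f x) as [a b]; apply (@continuous_snd R_UniformSpace R_UniformSpace a b).
  - intros [H1 H2]. apply Cc_eps. intros eps He.
    assert (He2 : (0 < eps / 2)%R) by lra.
    assert (A := proj1 (filterlim_locally _ _) H1 (mkposreal _ He2)).
    assert (B := proj1 (filterlim_locally _ _) H2 (mkposreal _ He2)).
    generalize (filter_and _ _ A B). apply filter_imp. intros y [HA HB].
    eapply Rle_lt_trans; [apply Cmod_le_ReIm|].
    unfold ball in HA, HB; simpl in HA, HB.
    unfold AbsRing_ball, abs, minus, plus, opp in HA, HB; simpl in HA, HB.
    destruct (f x), (f y); simpl in *. unfold Rminus in *; lra.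
Qed.

Section ContinuousC.
Context {U : UniformSpace}.
Implicit Types (f g : U -> C) (x : U).

Lemma Cc_const (c : C) x : continuous (fun _ : U => c) x.
Proof. apply continuous_const. Qed.

Lemma Cc_RtoC (f : U -> R) x : continuous f x -> continuous (fun y => RtoC (f y)) x.
Proof. intros H; apply Cc_comp_iff; simpl; split; [exact H|apply continuous_const]. Qed.

Lemma Cc_pair (f g : U -> R) x :
  continuous f x -> continuous g x -> continuous (fun y => (f y, g y) : C) x.
Proof. intros; apply Cc_comp_iff; simpl; split; assumption. Qed.

Lemma Cc_plus f g x :
  continuous f x -> continuous g x -> continuous (fun y => f y + g y) x.
Proof.
  intros Hf Hg; apply Cc_comp_iff in Hf; apply Cc_comp_iff in Hg; apply Cc_comp_iff.
  destruct Hf, Hg; split; simpl.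
  - apply (continuous_plus (V := R_NormedModule) (fun y => Re (f y)) (fun y => Re (g y))); assumption.
  - apply (continuous_plus (V := R_NormedModule) (fun y => Im (f y)) (fun y => Im (g y))); assumption.
Qed.

Lemma Cc_opp f x : continuous f x -> continuous (fun y => - f y) x.
Proof.
  intros Hf; apply Cc_comp_iff in Hf; apply Cc_comp_iff; destruct Hf; split; simpl.
  - apply (continuous_opp (V := R_NormedModule) (fun y => Re (f y))); assumption.
  - apply (continuous_opp (V := R_NormedModule) (fun y => Im (f y))); assumption.
Qed.

Lemma Cc_minus f g x :
  continuous f x -> continuous g x -> continuous (fun y => f y - g y) x.
Proof. intros; apply Cc_plus; [|apply Cc_opp]; assumption. Qed.

Lemma Cc_mult f g x :
  continuous f x -> continuous g x -> continuous (fun y => f y * g y) x.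
Proof.
  intros Hf Hg; apply Cc_comp_iff in Hf; apply Cc_comp_iff in Hg; apply Cc_comp_iff.
  destruct Hf as [Hf1 Hf2], Hg as [Hg1 Hg2]; split; simpl.
  - apply (continuous_minus (V := R_NormedModule)
      (fun y => Re (f y) * Re (g y))%R (fun y => Im (f y) * Im (g y))%R);
    apply (continuous_mult (K := R_AbsRing)); assumption.
  - apply (continuous_plus (V := R_NormedModule)
      (fun y => Re (f y) * Im (g y))%R (fun y => Im (f y) * Re (g y))%R);
    apply (continuous_mult (K := R_AbsRing)); assumption.
Qed.

Lemma Cc_inv f x :
  continuous f x -> f x <> RtoC 0 -> continuous (fun y => / f y) x.
Proof.
  intros Hf Hn; apply Cc_comp_iff in Hf; apply Cc_comp_iff.
  destruct Hf as [Hf1 Hf2].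
  assert (HN : (Re (f x) * (Re (f x) * 1) + Im (f x) * (Im (f x) * 1))%R <> 0%R).
  { intros E; apply Hn; apply C_ext; simpl; nra. }
  assert (HD : continuous (fun y => / (Re (f y) * (Re (f y) * 1) + Im (f y) * (Im (f y) * 1)))%R x).
  { apply (continuous_comp (fun y => (Re (f y) * (Re (f y) * 1) + Im (f y) * (Im (f y) * 1)))%R Rinv).
    - apply (continuous_plus (V := R_NormedModule)
       (fun y => (Re (f y) * (Re (f y) * 1))%R) (fun y => (Im (f y) * (Im (f y) * 1))%R));
      apply (continuous_mult (K := R_AbsRing)); try assumption;
      apply (continuous_mult (K := R_AbsRing)); try assumption; apply continuous_const.
    - apply continuous_Rinv; exact HN. }
  split; simpl; unfold Rdiv; apply (continuous_mult (K := R_AbsRing)); try assumption.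
  apply (continuous_opp (V := R_NormedModule) (fun y => Im (f y))); assumption.
Qed.

Lemma Cc_exp f x : continuous f x -> continuous (fun y => Cexp (f y)) x.
Proof.
  intros H; apply Cc_comp_iff in H; destruct H as [H1 H2]; unfold Cexp.
  apply (Cc_mult (fun y => RtoC (exp (Re (f y))))
    (fun y => (cos (Im (f y)), sin (Im (f y))))).
  - apply Cc_RtoC. apply (continuous_comp (fun y => Re (f y)) exp); [exact H1|].
    apply continuous_exp.
  - apply Cc_pair.
    + apply (continuous_comp (fun y => Im (f y)) cos); [exact H2|]; apply continuous_cos.
    + apply (continuous_comp (fun y => Im (f y)) sin); [exact H2|]; apply continuous_sin.
Qed.

Lemma Cc_Cmod f x : continuous f x -> continuous (fun y => Cmod (f y)) x.
Proof.
  intros H. apply filterlim_locally. intros eps.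
  generalize (proj1 (Cc_eps f x) H eps (cond_pos eps)). apply filter_imp.
  intros y Hy. unfold ball; simpl; unfold AbsRing_ball, abs, minus, plus, opp; simpl.
  apply Rabs_def1; generalize (Cmod_rev_triangle (f y) (f x)) (Cmod_rev_triangle (f x) (f y));
    rewrite (Cmod_minus_sym (f x) (f y)); lra.
Qed.
End ContinuousC.

Lemma Cc_ext_loc {U : UniformSpace} (f g : U -> C) x :
  locally x (fun y => f y = g y) -> continuous f x -> continuous g x.
Proof.
  intros H Hf. apply (continuous_ext_loc g f); [|exact Hf].
  revert H; apply filter_imp; auto.
Qed.

Lemma Cc_id (x : C) : continuous (fun y : C => y) x.
Proof. apply continuous_id. Qed.

(** * Complex and real-parameter derivatives *)

(** The difference quotient is multiplied out: [w = s] is then allowed, nothing is divided, and the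
    remainder is directly in the form that estimates consume. *)
Definition Cder (f : C -> C) (s d : C) : Prop :=
  forall eps : R, (0 < eps)%R -> exists delta : R, (0 < delta)%R /\
  forall w : C, (Cmod (w - s) < delta)%R ->
    (Cmod (f w - f s - d * (w - s)) <= eps * Cmod (w - s))%R.

Notation RCder := (@is_derive R_AbsRing C_R_NormedModule).

(** Puts the derivative of a function of a real variable in the shape of [Cder], so that both kinds
    of derivative combine in one chain rule. *)
Lemma RCder_eps (g : R -> C) (t : R) (d : C) :
  RCder g t d <->
  forall eps : R, (0 < eps)%R -> exists delta : R, (0 < delta)%R /\
  forall u : R, (Rabs (u - t) < delta)%R ->
    (Cmod (g u - g t - d * RtoC (u - t)) <= eps * Rabs (u - t))%R.
Proof.
  assert (E : forall u, minus (minus (g u : C_R_NormedModule) (g t)) (scal (minus u t : R_AbsRing) (d : C_R_NormedModule))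
     = g u - g t - d * RtoC (u - t)).
  { intros u. apply C_ext; Rsimpl; ring. }
  split.
  - intros [_ H] eps He.
    specialize (H t (fun P HP => HP) (mkposreal eps He)).
    destruct H as [delta Hd]. exists delta; split; [apply cond_pos|].
    intros u Hu. specialize (Hd u Hu). simpl in Hd.
    rewrite E in Hd. rewrite Cmod_norm. exact Hd.
  - intros H; split.
    + apply is_linear_scal_l.
    + intros x Hx eps.
      assert (x = t).
      { symmetry; apply (is_filter_lim_locally_unique (K:=R_AbsRing) (V:=R_NormedModule)); exact Hx. }
      subst x. destruct (H eps (cond_pos eps)) as [delta [Hd HH]].
      exists (mkposreal delta Hd). intros u Hu. specialize (HH u Hu).
      rewrite E. rewrite Cmod_norm in HH. exact HH.
Qed.

Lemma RCder_comp_iff (g : R -> C) (t : R) (d : C) :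
  RCder g t d <->
  is_derive (fun u => Re (g u)) t (Re d) /\ is_derive (fun u => Im (g u)) t (Im d).
Proof.
  assert (K : forall (h : R -> R) (l : R), is_derive h t l <->
    forall eps : R, (0 < eps)%R -> exists delta : R, (0 < delta)%R /\
    forall u : R, (Rabs (u - t) < delta)%R ->
    (Rabs (h u - h t - l * (u - t)) <= eps * Rabs (u - t))%R).
  { intros h l; split.
    - intros [_ H] eps He.
      specialize (H t (fun P HP => HP) (mkposreal eps He)).
      destruct H as [delta Hd]. exists delta; split; [apply cond_pos|].
      intros u Hu. specialize (Hd u Hu).
      unfold norm, minus, plus, opp, scal in Hd; simpl in Hd; unfold abs, mult in Hd; simpl in Hd.
      replace (h u - h t - l * (u - t))%R with (h u + - h t + - ((u + - t) * l))%R by ring.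
      exact Hd.
    - intros H; split; [apply is_linear_scal_l|].
      intros x Hx eps.
      assert (x = t).
      { symmetry; apply (is_filter_lim_locally_unique (K:=R_AbsRing) (V:=R_NormedModule)); exact Hx. }
      subst x. destruct (H eps (cond_pos eps)) as [delta [Hd HH]].
      exists (mkposreal delta Hd). intros u Hu. specialize (HH u Hu).
      unfold norm, minus, plus, opp, scal; simpl; unfold abs, mult; simpl.
      replace (h u + - h t + - ((u + - t) * l))%R with (h u - h t - l * (u - t))%R by ring.
      exact HH. }
  rewrite RCder_eps, (K (fun u => Re (g u))), (K (fun u => Im (g u))). split.
  - intros H; split; intros eps He; destruct (H eps He) as [delta [Hd HH]];
    exists delta; (split; [exact Hd|]); intros u Hu;
    (eapply Rle_trans; [|apply (HH u Hu)]).
    + eapply Rle_trans; [|apply re_le_Cmod]. right; f_equal.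
      unfold Cminus; rewrite !re_plus, !re_opp, re_scal_r; ring.
    + eapply Rle_trans; [|apply im_le_Cmod]. right; f_equal.
      unfold Cminus; rewrite !im_plus, !im_opp, im_scal_r; ring.
  - intros [H1 H2] eps He.
    destruct (H1 (eps/2)%R ltac:(lra)) as [d1 [Hd1 HH1]].
    destruct (H2 (eps/2)%R ltac:(lra)) as [d2 [Hd2 HH2]].
    exists (Rmin d1 d2); split; [apply Rmin_pos; assumption|].
    intros u Hu.
    specialize (HH1 u ltac:(eapply Rlt_le_trans; [exact Hu|apply Rmin_l])).
    specialize (HH2 u ltac:(eapply Rlt_le_trans; [exact Hu|apply Rmin_r])).
    eapply Rle_trans; [apply Cmod_le_ReIm|].
    unfold Cminus; rewrite !re_plus, !re_opp, !im_plus, !im_opp, re_scal_r, im_scal_r.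
    unfold Rminus in *.
    replace (eps * Rabs (u + - t))%R with (eps/2 * Rabs (u + - t) + eps/2 * Rabs (u + - t))%R by field.
    apply Rplus_le_compat; assumption.
Qed.

Lemma Cder_ext_loc (f g : C -> C) (s d : C) :
  (exists r : R, (0 < r)%R /\ forall w, (Cmod (w - s) < r)%R -> f w = g w) ->
  Cder f s d -> Cder g s d.
Proof.
  intros [r [Hr E]] H eps He. destruct (H eps He) as [dl [Hd HH]].
  exists (Rmin r dl); split; [apply Rmin_pos; assumption|].
  intros w Hw. rewrite <- !E.
  - apply HH. eapply Rlt_le_trans; [exact Hw|apply Rmin_r].
  - replace (s - s) with (RtoC 0) by ring; rewrite Cmod_0R; exact Hr.
  - eapply Rlt_le_trans; [exact Hw|apply Rmin_l].
Qed.

Lemma Cder_ext (f g : C -> C) (s d : C) :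
  (forall w, f w = g w) -> Cder f s d -> Cder g s d.
Proof. intros E; apply Cder_ext_loc; exists 1%R; split; [lra|]; auto. Qed.

Lemma Cder_eq (f : C -> C) (s d d' : C) : Cder f s d -> d = d' -> Cder f s d'.
Proof. intros H E; subst; exact H. Qed.

Lemma Cder_const (c s : C) : Cder (fun _ => c) s (RtoC 0).
Proof.
  intros eps He; exists 1%R; split; [lra|]; intros w _.
  replace (c - c - RtoC 0 * (w - s)) with (RtoC 0) by ring; rewrite Cmod_0R.
  apply Rmult_le_pos; [lra|apply Cmod_ge_0].
Qed.

Lemma Cder_id (s : C) : Cder (fun w => w) s (RtoC 1).
Proof.
  intros eps He; exists 1%R; split; [lra|]; intros w _.
  replace (w - s - RtoC 1 * (w - s)) with (RtoC 0) by ring; rewrite Cmod_0R.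
  apply Rmult_le_pos; [lra|apply Cmod_ge_0].
Qed.

Lemma Cder_plus (f g : C -> C) (s d e : C) :
  Cder f s d -> Cder g s e -> Cder (fun w => f w + g w) s (d + e).
Proof.
  intros Hf Hg eps He.
  destruct (Hf (eps/2)%R ltac:(lra)) as [d1 [Hd1 H1]].
  destruct (Hg (eps/2)%R ltac:(lra)) as [d2 [Hd2 H2]].
  exists (Rmin d1 d2); split; [apply Rmin_pos; assumption|]. intros w Hw.
  specialize (H1 w ltac:(eapply Rlt_le_trans; [exact Hw|apply Rmin_l])).
  specialize (H2 w ltac:(eapply Rlt_le_trans; [exact Hw|apply Rmin_r])).
  replace (f w + g w - (f s + g s) - (d + e) * (w - s)) with
    ((f w - f s - d * (w - s)) + (g w - g s - e * (w - s))) by ring.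
  eapply Rle_trans; [apply Cmod_triangle|]. lra.
Qed.

Lemma Cder_lip (f : C -> C) (s d : C) : Cder f s d ->
  exists r : R, (0 < r)%R /\ forall w, (Cmod (w - s) < r)%R ->
    (Cmod (f w - f s) <= (Cmod d + 1) * Cmod (w - s))%R.
Proof.
  intros H. destruct (H 1%R ltac:(lra)) as [r [Hr HH]]. exists r; split; [exact Hr|].
  intros w Hw. specialize (HH w Hw).
  replace (f w - f s) with ((f w - f s - d * (w - s)) + d * (w - s)) by ring.
  eapply Rle_trans; [apply Cmod_triangle|]. rewrite Cmod_mult. lra.
Qed.

Lemma Cder_cont (f : C -> C) (s d : C) : Cder f s d -> continuous f s.
Proof.
  intros H. destruct (Cder_lip _ _ _ H) as [r [Hr HH]].
  apply Cc_eps. intros eps He. apply locally_C_eps.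
  assert (P : (0 < Cmod d + 1)%R) by (generalize (Cmod_ge_0 d); lra).
  exists (Rmin r (eps / (Cmod d + 1)))%R; split.
  - apply Rmin_pos; [exact Hr|]. apply Rdiv_lt_0_compat; assumption.
  - intros y Hy. eapply Rle_lt_trans.
    + apply HH. eapply Rlt_le_trans; [exact Hy|apply Rmin_l].
    + assert (Cmod (y - s) < eps / (Cmod d + 1))%R
        by (eapply Rlt_le_trans; [exact Hy|apply Rmin_r]).
      apply (Rmult_lt_compat_l (Cmod d + 1)) in H0; [|exact P].
      replace ((Cmod d + 1) * (eps / (Cmod d + 1)))%R with eps in H0 by (field; lra).
      exact H0.
Qed.

Lemma Cder_mult (f g : C -> C) (s d e : C) :
  Cder f s d -> Cder g s e -> Cder (fun w => f w * g w) s (d * g s + f s * e).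
Proof.
  intros Hf Hg eps He.
  destruct (Cder_lip _ _ _ Hf) as [r [Hr HL]].
  set (A := (Cmod (f s) + 1)%R). set (B := (Cmod (g s) + 1)%R).
  assert (HA : (0 < A)%R) by (unfold A; generalize (Cmod_ge_0 (f s)); lra).
  assert (HB : (0 < B)%R) by (unfold B; generalize (Cmod_ge_0 (g s)); lra).
  assert (HD : (0 < (Cmod d + 1) * (Cmod e + 1))%R)
    by (generalize (Cmod_ge_0 d) (Cmod_ge_0 e); nra).
  destruct (Hf (eps/3/B)%R ltac:(apply Rdiv_lt_0_compat; lra)) as [d1 [Hd1 H1]].
  destruct (Hg (eps/3/A)%R ltac:(apply Rdiv_lt_0_compat; lra)) as [d2 [Hd2 H2]].
  destruct (Cder_lip _ _ _ Hg) as [r2 [Hr2 HL2]].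
  set (d3 := (eps / 3 / ((Cmod d + 1) * (Cmod e + 1)))%R).
  assert (Hd3 : (0 < d3)%R) by (apply Rdiv_lt_0_compat; lra).
  exists (Rmin (Rmin r r2) (Rmin (Rmin d1 d2) d3)); split;
   [repeat apply Rmin_pos; assumption|]. intros w Hw.
  assert (Cmod (w - s) < r /\ Cmod (w - s) < r2 /\ Cmod (w - s) < d1 /\ Cmod (w - s) < d2 /\ Cmod (w - s) < d3)%R.
  { generalize (Rmin_l (Rmin r r2) (Rmin (Rmin d1 d2) d3)) (Rmin_r (Rmin r r2) (Rmin (Rmin d1 d2) d3))
     (Rmin_l r r2) (Rmin_r r r2) (Rmin_l (Rmin d1 d2) d3) (Rmin_r (Rmin d1 d2) d3) (Rmin_l d1 d2) (Rmin_r d1 d2).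
    intros; repeat split; lra. }
  destruct H as (W1 & W2 & W3 & W4 & W5).
  specialize (H1 w W3). specialize (H2 w W4). specialize (HL w W1). specialize (HL2 w W2).
  (* Two linearization errors and a product of two increments. The latter is quadratic in [w - s],
     and [d3] is chosen to make it small; each of the three terms gets a third of [eps]. *)
  replace (f w * g w - f s * g s - (d * g s + f s * e) * (w - s)) with
    ((f w - f s - d * (w - s)) * g s + f s * (g w - g s - e * (w - s))
      + (f w - f s) * (g w - g s)) by ring.
  eapply Rle_trans; [apply Cmod_triangle|].
  eapply Rle_trans; [apply Rplus_le_compat_r, Cmod_triangle|].
  rewrite !Cmod_mult.
  assert (P0 := Cmod_ge_0 (w - s)).
  assert (T1 : (Cmod (f w - f s - d * (w - s)) * Cmod (g s) <= eps / 3 * Cmod (w - s))%R).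
  { apply Rle_trans with (eps / 3 / B * Cmod (w - s) * B)%R.
    - apply Rmult_le_compat; try apply Cmod_ge_0; [exact H1|unfold B; lra].
    - right; field; lra. }
  assert (T2 : (Cmod (f s) * Cmod (g w - g s - e * (w - s)) <= eps / 3 * Cmod (w - s))%R).
  { apply Rle_trans with (A * (eps / 3 / A * Cmod (w - s)))%R.
    - apply Rmult_le_compat; try apply Cmod_ge_0; [unfold A; lra|exact H2].
    - right; field; lra. }
  assert (T3 : (Cmod (f w - f s) * Cmod (g w - g s) <= eps / 3 * Cmod (w - s))%R).
  { apply Rle_trans with (((Cmod d + 1) * Cmod (w - s)) * ((Cmod e + 1) * d3))%R.
    - apply Rmult_le_compat; try apply Cmod_ge_0; [exact HL|].
      eapply Rle_trans; [exact HL2|]. apply Rmult_le_compat_l; [generalize (Cmod_ge_0 e); lra|lra].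
    - right; unfold d3; field; generalize (Cmod_ge_0 e) (Cmod_ge_0 d); lra. }
  lra.
Qed.

Lemma Cder_scal (c : C) (f : C -> C) (s d : C) :
  Cder f s d -> Cder (fun w => c * f w) s (c * d).
Proof.
  intros H. eapply Cder_eq; [apply (Cder_mult (fun _ => c) f s _ _ (Cder_const c s) H)|]. ring.
Qed.

Lemma Cder_opp (f : C -> C) (s d : C) : Cder f s d -> Cder (fun w => - f w) s (- d).
Proof.
  intros H. apply (Cder_ext (fun w => RtoC (-1) * f w)).
  - intros w; ring.
  - eapply Cder_eq; [apply Cder_scal, H|]. ring.
Qed.

Lemma Cder_minus (f g : C -> C) (s d e : C) :
  Cder f s d -> Cder g s e -> Cder (fun w => f w - g w) s (d - e).
Proof. intros Hf Hg; apply Cder_plus; [exact Hf|apply Cder_opp, Hg]. Qed.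

Lemma Cder_comp (f g : C -> C) (s d e : C) :
  Cder f (g s) d -> Cder g s e -> Cder (fun w => f (g w)) s (d * e).
Proof.
  intros Hf Hg eps He.
  destruct (Cder_lip _ _ _ Hg) as [r [Hr HL]].
  assert (PE : (0 < Cmod e + 1)%R) by (generalize (Cmod_ge_0 e); lra).
  assert (PD : (0 < Cmod d + 1)%R) by (generalize (Cmod_ge_0 d); lra).
  destruct (Hf (eps/2/(Cmod e + 1))%R ltac:(apply Rdiv_lt_0_compat; lra)) as [d1 [Hd1 H1]].
  destruct (Hg (eps/2/(Cmod d + 1))%R ltac:(apply Rdiv_lt_0_compat; lra)) as [d2 [Hd2 H2]].
  exists (Rmin r (Rmin (d1 / (Cmod e + 1)) d2)); split;
   [repeat apply Rmin_pos; try assumption; apply Rdiv_lt_0_compat; assumption|]. intros w Hw.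
  assert (Cmod (w - s) < r /\ Cmod (w - s) < d1 / (Cmod e + 1) /\ Cmod (w - s) < d2)%R.
  { generalize (Rmin_l r (Rmin (d1 / (Cmod e + 1)) d2)) (Rmin_r r (Rmin (d1 / (Cmod e + 1)) d2))
     (Rmin_l (d1 / (Cmod e + 1)) d2) (Rmin_r (d1 / (Cmod e + 1)) d2). intros; lra. }
  destruct H as (W1 & W2 & W3). specialize (HL w W1). specialize (H2 w W3).
  assert (W4 : (Cmod (g w - g s) < d1)%R).
  { eapply Rle_lt_trans; [exact HL|].
    apply (Rmult_lt_compat_l (Cmod e + 1)) in W2; [|exact PE].
    replace ((Cmod e + 1) * (d1 / (Cmod e + 1)))%R with d1 in W2 by (field; lra). exact W2. }
  specialize (H1 (g w) W4).
  replace (f (g w) - f (g s) - d * e * (w - s)) with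
    ((f (g w) - f (g s) - d * (g w - g s)) + d * (g w - g s - e * (w - s))) by ring.
  eapply Rle_trans; [apply Cmod_triangle|]. rewrite Cmod_mult.
  assert (P0 := Cmod_ge_0 (w - s)).
  assert (T1 : (Cmod (f (g w) - f (g s) - d * (g w - g s)) <= eps / 2 * Cmod (w - s))%R).
  { eapply Rle_trans; [exact H1|].
    apply Rle_trans with (eps / 2 / (Cmod e + 1) * ((Cmod e + 1) * Cmod (w - s)))%R.
    - apply Rmult_le_compat_l; [|exact HL]. left; apply Rdiv_lt_0_compat; lra.
    - right; field; lra. }
  assert (T2 : (Cmod d * Cmod (g w - g s - e * (w - s)) <= eps / 2 * Cmod (w - s))%R).
  { apply Rle_trans with ((Cmod d + 1) * (eps / 2 / (Cmod d + 1) * Cmod (w - s)))%R.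
    - apply Rmult_le_compat; try apply Cmod_ge_0; [lra|exact H2].
    - right; field; lra. }
  lra.
Qed.

Lemma RCder_comp (f : C -> C) (g : R -> C) (t : R) (d e : C) :
  Cder f (g t) d -> RCder g t e -> RCder (fun u => f (g u)) t (d * e).
Proof.
  intros Hf Hg; apply RCder_eps; rewrite RCder_eps in Hg. intros eps He.
  assert (PE : (0 < Cmod e + 1)%R) by (generalize (Cmod_ge_0 e); lra).
  assert (PD : (0 < Cmod d + 1)%R) by (generalize (Cmod_ge_0 d); lra).
  destruct (Hg 1%R ltac:(lra)) as [r [Hr HL]].
  destruct (Hf (eps/2/(Cmod e + 1))%R ltac:(apply Rdiv_lt_0_compat; lra)) as [d1 [Hd1 H1]].
  destruct (Hg (eps/2/(Cmod d + 1))%R ltac:(apply Rdiv_lt_0_compat; lra)) as [d2 [Hd2 H2]].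
  exists (Rmin r (Rmin (d1 / (Cmod e + 1)) d2)); split;
   [repeat apply Rmin_pos; try assumption; apply Rdiv_lt_0_compat; assumption|]. intros w Hw.
  assert (Rabs (w - t) < r /\ Rabs (w - t) < d1 / (Cmod e + 1) /\ Rabs (w - t) < d2)%R.
  { generalize (Rmin_l r (Rmin (d1 / (Cmod e + 1)) d2)) (Rmin_r r (Rmin (d1 / (Cmod e + 1)) d2))
     (Rmin_l (d1 / (Cmod e + 1)) d2) (Rmin_r (d1 / (Cmod e + 1)) d2). intros; lra. }
  destruct H as (W1 & W2 & W3). specialize (HL w W1). specialize (H2 w W3).
  assert (HL' : (Cmod (g w - g t) <= (Cmod e + 1) * Rabs (w - t))%R).
  { replace (g w - g t) with ((g w - g t - e * RtoC (w - t)) + e * RtoC (w - t)) by ring.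
    eapply Rle_trans; [apply Cmod_triangle|]. rewrite Cmod_mult, Cmod_R. lra. }
  assert (W4 : (Cmod (g w - g t) < d1)%R).
  { eapply Rle_lt_trans; [exact HL'|].
    apply (Rmult_lt_compat_l (Cmod e + 1)) in W2; [|exact PE].
    replace ((Cmod e + 1) * (d1 / (Cmod e + 1)))%R with d1 in W2 by (field; lra). exact W2. }
  specialize (H1 (g w) W4).
  replace (f (g w) - f (g t) - d * e * RtoC (w - t)) with
    ((f (g w) - f (g t) - d * (g w - g t)) + d * (g w - g t - e * RtoC (w - t))) by ring.
  eapply Rle_trans; [apply Cmod_triangle|]. rewrite Cmod_mult.
  assert (P0 := Rabs_pos (w - t)).
  assert (T1 : (Cmod (f (g w) - f (g t) - d * (g w - g t)) <= eps / 2 * Rabs (w - t))%R).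
  { eapply Rle_trans; [exact H1|].
    apply Rle_trans with (eps / 2 / (Cmod e + 1) * ((Cmod e + 1) * Rabs (w - t)))%R.
    - apply Rmult_le_compat_l; [|exact HL']. left; apply Rdiv_lt_0_compat; lra.
    - right; field; lra. }
  assert (T2 : (Cmod d * Cmod (g w - g t - e * RtoC (w - t)) <= eps / 2 * Rabs (w - t))%R).
  { apply Rle_trans with ((Cmod d + 1) * (eps / 2 / (Cmod d + 1) * Rabs (w - t)))%R.
    - apply Rmult_le_compat; try apply Cmod_ge_0; [lra|exact H2].
    - right; field; lra. }
  lra.
Qed.

Lemma Cder_unique (f : C -> C) (s d e : C) : Cder f s d -> Cder f s e -> d = e.
Proof.
  intros H1 H2. apply Cmod_le_eps_eq. intros eps He.
  destruct (H1 (eps/2)%R ltac:(lra)) as [r1 [Hr1 K1]].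
  destruct (H2 (eps/2)%R ltac:(lra)) as [r2 [Hr2 K2]].
  assert (P : (0 < Rmin r1 r2 / 2)%R) by (generalize (Rmin_pos _ _ Hr1 Hr2); lra).
  set (h := (Rmin r1 r2 / 2)%R) in *.
  assert (E : Cmod (s + RtoC h - s) = h).
  { replace (s + RtoC h - s) with (RtoC h) by ring. rewrite Cmod_R; apply Rabs_pos_eq; lra. }
  specialize (K1 (s + RtoC h) ltac:(rewrite E; unfold h in *; generalize (Rmin_l r1 r2); lra)).
  specialize (K2 (s + RtoC h) ltac:(rewrite E; unfold h in *; generalize (Rmin_r r1 r2); lra)).
  rewrite E in K1, K2.
  apply (Rmult_le_reg_r h); [exact P|].
  replace (Cmod (d - e) * h)%R with (Cmod ((d - e) * (s + RtoC h - s))) by (rewrite Cmod_mult, E; reflexivity).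
  replace ((d - e) * (s + RtoC h - s)) with
   ((f (s + RtoC h) - f s - e * (s + RtoC h - s)) - (f (s + RtoC h) - f s - d * (s + RtoC h - s))) by ring.
  eapply Rle_trans; [apply Cmod_triangle|]. rewrite Cmod_opp. lra.
Qed.

(** The real mean value theorem is applied to the scalar product of [g t] with the total increment
    [D = g b - g a]. Its increment is [Cmod D ^ 2], and its derivative is at most [Cmod D * K] by
    Cauchy-Schwarz. *)
Lemma Cmod_MVT (g dg : R -> C) (a b K : R) :
  (a <= b)%R -> (forall t, (a <= t <= b)%R -> RCder g t (dg t)) ->
  (forall t, (a <= t <= b)%R -> (Cmod (dg t) <= K)%R) ->
  (Cmod (g b - g a) <= K * (b - a))%R.
Proof.
  intros Hab Hd HK.
  set (D := g b - g a).
  destruct (Req_dec (Cmod D) 0) as [E|E].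
  { rewrite E. apply Rmult_le_pos; [|lra].
    eapply Rle_trans; [apply (Cmod_ge_0 (dg a))|apply HK; lra]. }
  assert (P : (0 < Cmod D)%R) by (generalize (Cmod_ge_0 D); lra).
  destruct (MVT_gen (fun t => Re D * Re (g t) + Im D * Im (g t))%R a b
     (fun t => Re D * Re (dg t) + Im D * Im (dg t))%R) as [c [Hc Heq]].
  - intros x Hx. rewrite Rmin_left, Rmax_right in Hx by lra.
    destruct (proj1 (RCder_comp_iff _ _ _) (Hd x ltac:(lra))) as [H1 H2].
    apply (is_derive_plus (V := R_NormedModule) (fun t => Re D * Re (g t))%R (fun t => Im D * Im (g t))%R).
    + apply (is_derive_scal (fun t => Re (g t)) x (Re D)); exact H1.
    + apply (is_derive_scal (fun t => Im (g t)) x (Im D)); exact H2.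
  - intros x Hx. rewrite Rmin_left, Rmax_right in Hx by lra.
    destruct (proj1 (RCder_comp_iff _ _ _) (Hd x ltac:(lra))) as [H1 H2].
    apply continuity_pt_filterlim.
    apply (ex_derive_continuous (V := R_NormedModule) (fun t => Re D * Re (g t) + Im D * Im (g t))%R).
    eexists. apply (is_derive_plus (V := R_NormedModule) (fun t => Re D * Re (g t))%R (fun t => Im D * Im (g t))%R).
    + apply (is_derive_scal (fun t => Re (g t)) x (Re D)); exact H1.
    + apply (is_derive_scal (fun t => Im (g t)) x (Im D)); exact H2.
  - rewrite Rmin_left, Rmax_right in Hc by lra.
    assert (S1 : (Cmod D ^ 2 = Re D * Re (dg c) * (b - a) + Im D * Im (dg c) * (b - a))%R).
    { rewrite Cmod2_alt.
      assert (E1 : (Re D = Re (g b) - Re (g a))%R) by (unfold D, Cminus; rewrite re_plus, re_opp; ring).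
      assert (E2 : (Im D = Im (g b) - Im (g a))%R) by (unfold D, Cminus; rewrite im_plus, im_opp; ring).
      replace (Re D ^ 2)%R with (Re D * (Re (g b) - Re (g a)))%R by (rewrite <- E1; ring).
      replace (Im D ^ 2)%R with (Im D * (Im (g b) - Im (g a)))%R by (rewrite <- E2; ring).
      lra. }
    assert (S2 : (Re D * Re (dg c) + Im D * Im (dg c) <= Cmod D * Cmod (dg c))%R).
    { replace (Re D * Re (dg c) + Im D * Im (dg c))%R with (Re (Cconj D * dg c))
        by (rewrite re_mult, re_conj, im_conj; ring).
      eapply Rle_trans; [apply Rle_abs|]. eapply Rle_trans; [apply re_le_Cmod|].
      rewrite Cmod_mult, Cmod_conj. lra. }
    assert (S3 : (Cmod D * Cmod D <= Cmod D * (K * (b - a)))%R).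
    { replace (Cmod D * Cmod D)%R with (Cmod D ^ 2)%R by ring. rewrite S1.
      apply Rle_trans with ((Cmod D * Cmod (dg c)) * (b - a))%R.
      - rewrite <- Rmult_plus_distr_r. apply Rmult_le_compat_r; lra.
      - rewrite Rmult_assoc. apply Rmult_le_compat_l; [lra|].
        apply Rmult_le_compat_r; [lra|apply HK; lra]. }
    apply Rmult_le_reg_l in S3; assumption.
Qed.

Lemma RCder_id (c : C) (t : R) : RCder (fun u => RtoC u * c) t c.
Proof.
  apply RCder_eps. intros eps He; exists 1%R; split; [lra|]. intros u _.
  replace (RtoC u * c - RtoC t * c - c * RtoC (u - t)) with (RtoC 0)
    by (rewrite RtoC_minus; ring).
  rewrite Cmod_0R. apply Rmult_le_pos; [lra|apply Rabs_pos].
Qed.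

Lemma RCder_const (c : C) (t : R) : RCder (fun u => c) t (RtoC 0).
Proof. exact (is_derive_const (K := R_AbsRing) (V := C_R_NormedModule) c t). Qed.

Lemma RCder_plus (f g : R -> C) (t : R) (d e : C) :
  RCder f t d -> RCder g t e -> RCder (fun u => f u + g u) t (d + e).
Proof. intros; apply (is_derive_plus (V := C_R_NormedModule) f g); assumption. Qed.

Lemma RCder_scalC (c : C) (f : R -> C) (t : R) (d : C) :
  RCder f t d -> RCder (fun u => c * f u) t (c * d).
Proof.
  intros H. apply (RCder_comp (fun w => c * w) f); [|exact H].
  eapply Cder_eq; [apply Cder_scal, Cder_id|ring].
Qed.

Lemma RCder_minus (f g : R -> C) (t : R) (d e : C) :
  RCder f t d -> RCder g t e -> RCder (fun u => f u - g u) t (d - e).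
Proof. intros; apply (is_derive_minus (V := C_R_NormedModule) f g); assumption. Qed.

Lemma RCder_eq (g : R -> C) (t : R) (d e : C) : RCder g t d -> d = e -> RCder g t e.
Proof. intros H E; subst; exact H. Qed.

Lemma RCder_line (p c : C) (t : R) : RCder (fun u => p + RtoC u * c) t c.
Proof.
  eapply RCder_eq; [apply RCder_plus; [apply RCder_const|apply RCder_id]|]. ring.
Qed.

Lemma RCder_ext (f g : R -> C) (t : R) (d : C) :
  (forall u, f u = g u) -> RCder f t d -> RCder g t d.
Proof. intros H. apply is_derive_ext; exact H. Qed.

Lemma RCder_mult (f g : R -> C) (t : R) (d e : C) :
  RCder f t d -> RCder g t e -> RCder (fun u => f u * g u) t (d * g t + f t * e).
Proof.
  intros Hf Hg. apply RCder_comp_iff in Hf; apply RCder_comp_iff in Hg.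
  destruct Hf as [f1 f2], Hg as [g1 g2]. apply RCder_comp_iff; split.
  - evar (l : R). replace (Re (d * g t + f t * e)) with l; [subst l|].
    + apply (is_derive_minus (V := R_NormedModule)
        (fun u => Re (f u) * Re (g u))%R (fun u => Im (f u) * Im (g u))%R);
      apply (is_derive_mult (K := R_AbsRing)); try eassumption; intros; apply Rmult_comm.
    + subst l. rewrite re_plus, !re_mult. Rsimpl. ring.
  - evar (l : R). replace (Im (d * g t + f t * e)) with l; [subst l|].
    + apply (is_derive_plus (V := R_NormedModule)
        (fun u => Re (f u) * Im (g u))%R (fun u => Im (f u) * Re (g u))%R);
      apply (is_derive_mult (K := R_AbsRing)); try eassumption; intros; apply Rmult_comm.
    + subst l. rewrite im_plus, !im_mult. Rsimpl. ring.
Qed.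

(** * The exponential *)

Lemma Cexp_plus (z w : C) : Cexp (z + w) = Cexp z * Cexp w.
Proof.
  unfold Cexp. apply C_ext; simpl; unfold Re, Im; rewrite exp_plus, ?cos_plus, ?sin_plus; ring.
Qed.

Lemma Cexp_0 : Cexp (RtoC 0) = RtoC 1.
Proof. unfold Cexp; apply C_ext; simpl; rewrite exp_0, cos_0, sin_0; ring. Qed.

Lemma Cexp_RtoC (x : R) : Cexp (RtoC x) = RtoC (exp x).
Proof. unfold Cexp; simpl; rewrite cos_0, sin_0; apply C_ext; simpl; ring. Qed.

Lemma Cmod_Cexp (z : C) : Cmod (Cexp z) = exp (Re z).
Proof.
  unfold Cexp. rewrite Cmod_mult, Cmod_R, Rabs_pos_eq by (left; apply exp_pos).
  replace (Cmod (cos (Im z), sin (Im z))) with 1%R; [ring|].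
  unfold Cmod; simpl. transitivity (sqrt 1); [symmetry; apply sqrt_1|f_equal].
  generalize (sin2_cos2 (Im z)); unfold Rsqr, Im; lra.
Qed.

Lemma Cexp_neq_0 (z : C) : Cexp z <> RtoC 0.
Proof.
  intros E. generalize (Cmod_Cexp z). rewrite E, Cmod_0R. generalize (exp_pos (Re z)); lra.
Qed.

Lemma Cexp_opp (z : C) : Cexp (- z) = / Cexp z.
Proof.
  assert (H : Cexp (- z) * Cexp z = RtoC 1).
  { rewrite <- Cexp_plus. replace (- z + z) with (RtoC 0) by ring. apply Cexp_0. }
  replace (Cexp (- z)) with (Cexp (- z) * Cexp z * / Cexp z) by (field; apply Cexp_neq_0).
  rewrite H; ring.
Qed.

Lemma RCder_Cexp_line (c : C) (t : R) :
  RCder (fun u => Cexp (RtoC u * c)) t (c * Cexp (RtoC t * c)).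
Proof.
  destruct c as [c1 c2].
  apply RCder_comp_iff; unfold Cexp; split; simpl.
  - auto_derive; [trivial|unfold Rminus; ring].
  - auto_derive; [trivial|unfold Rminus; ring].
Qed.

Lemma Cmod_Cexp_line (w : C) (t : R) :
  (0 <= t <= 1)%R -> (Cmod (Cexp (RtoC t * w)) <= exp (Cmod w))%R.
Proof.
  intros Ht. rewrite Cmod_Cexp.
  assert (Re (RtoC t * w) <= Cmod w)%R.
  { rewrite re_scal_l. generalize (re_le_Cmod w) (Cmod_ge_0 w) (Rle_abs (Re w)). nra. }
  destruct H as [H|H]; [left; apply exp_increasing, H|rewrite H; lra].
Qed.

(** Mean value inequality along the segment from 0 to [w], where the exponential is at most
    [exp (Cmod w)] in modulus. *)
Lemma Cexp_bound1 (w : C) : (Cmod (Cexp w - RtoC 1) <= Cmod w * exp (Cmod w))%R.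
Proof.
  replace (Cexp w - RtoC 1) with (Cexp (RtoC 1 * w) - Cexp (RtoC 0 * w))
    by (rewrite Cmult_0_l, Cexp_0, Cmult_1_l; reflexivity).
  eapply Rle_trans; [apply (Cmod_MVT (fun u => Cexp (RtoC u * w)) (fun t => w * Cexp (RtoC t * w)) 0 1
    (Cmod w * exp (Cmod w)))|].
  - lra.
  - intros; apply RCder_Cexp_line.
  - intros t Ht; rewrite Cmod_mult. apply Rmult_le_compat_l; [apply Cmod_ge_0|].
    apply Cmod_Cexp_line, Ht.
  - lra.
Qed.

Lemma Cexp_bound2 (w : C) :
  (Cmod (Cexp w - RtoC 1 - w) <= Cmod w ^ 2 * exp (Cmod w))%R.
Proof.
  replace (Cexp w - RtoC 1 - w) with
    ((Cexp (RtoC 1 * w) - RtoC 1 * w) - (Cexp (RtoC 0 * w) - RtoC 0 * w))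
    by (rewrite !Cmult_0_l, Cexp_0, !Cmult_1_l; ring).
  eapply Rle_trans; [apply (Cmod_MVT (fun u => Cexp (RtoC u * w) - RtoC u * w)
     (fun t => w * Cexp (RtoC t * w) - w) 0 1 (Cmod w ^ 2 * exp (Cmod w)))|].
  - lra.
  - intros; apply RCder_minus; [apply RCder_Cexp_line|apply RCder_id].
  - intros t Ht. replace (w * Cexp (RtoC t * w) - w) with (w * (Cexp (RtoC t * w) - RtoC 1)) by ring.
    rewrite Cmod_mult. replace (Cmod w ^ 2 * exp (Cmod w))%R with (Cmod w * (Cmod w * exp (Cmod w)))%R by ring.
    apply Rmult_le_compat_l; [apply Cmod_ge_0|].
    eapply Rle_trans; [apply Cexp_bound1|].
    rewrite Cmod_mult, Cmod_R, Rabs_pos_eq by lra.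
    assert (t * Cmod w <= Cmod w)%R by (generalize (Cmod_ge_0 w); nra).
    apply Rmult_le_compat; try lra.
    + generalize (Cmod_ge_0 w); nra.
    + left; apply exp_pos.
    + destruct H as [H|H]; [left; apply exp_increasing, H|rewrite H; lra].
  - lra.
Qed.

Lemma Cder_Cexp (s : C) : Cder Cexp s (Cexp s).
Proof.
  intros eps He.
  assert (P : (0 < Cmod (Cexp s))%R) by (rewrite Cmod_Cexp; apply exp_pos).
  exists (Rmin 1 (eps / (Cmod (Cexp s) * exp 1)))%R; split.
  { apply Rmin_pos; [lra|]. apply Rdiv_lt_0_compat; [exact He|].
    apply Rmult_lt_0_compat; [exact P|apply exp_pos]. }
  intros w Hw.
  assert (H1 : (Cmod (w - s) < 1)%R) by (eapply Rlt_le_trans; [exact Hw|apply Rmin_l]).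
  assert (H2 : (Cmod (w - s) < eps / (Cmod (Cexp s) * exp 1))%R)
    by (eapply Rlt_le_trans; [exact Hw|apply Rmin_r]).
  replace (Cexp w - Cexp s - Cexp s * (w - s)) with (Cexp s * (Cexp (w - s) - RtoC 1 - (w - s))).
  2:{ replace (Cexp w) with (Cexp (s + (w - s))) by (f_equal; ring). rewrite Cexp_plus; ring. }
  rewrite Cmod_mult.
  eapply Rle_trans; [apply Rmult_le_compat_l; [lra|apply Cexp_bound2]|].
  assert (P1 := exp_pos 1). assert (P2 := Cmod_ge_0 (w - s)).
  assert (E1 : (exp (Cmod (w - s)) <= exp 1)%R) by (left; apply exp_increasing; lra).
  apply Rle_trans with (Cmod (Cexp s) * (Cmod (w - s) ^ 2 * exp 1))%R.
  { apply Rmult_le_compat_l; [lra|]. apply Rmult_le_compat_l; [nra|exact E1]. }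
  replace (Cmod (Cexp s) * (Cmod (w - s) ^ 2 * exp 1))%R with
    ((Cmod (w - s) * (Cmod (Cexp s) * exp 1)) * Cmod (w - s))%R by ring.
  apply Rmult_le_compat_r; [exact P2|].
  assert (PP : (0 < Cmod (Cexp s) * exp 1)%R) by (apply Rmult_lt_0_compat; assumption).
  apply (Rmult_lt_compat_r _ _ _ PP) in H2. unfold Rdiv in H2.
  rewrite Rmult_assoc, Rinv_l in H2; lra.
Qed.

Lemma Cder_inv (s : C) : s <> RtoC 0 -> Cder Cinv s (- / (s * s)).
Proof.
  intros Hs eps He.
  assert (P : (0 < Cmod s)%R) by (apply Cmod_gt_0, Hs).
  set (m := Cmod s) in *.
  assert (P3 : (0 < m * m * m)%R) by (repeat apply Rmult_lt_0_compat; assumption).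
  exists (Rmin (m / 2) (eps * (m * m * m) / 2))%R; split.
  { apply Rmin_pos; [lra|]. apply Rdiv_lt_0_compat; [|lra]. apply Rmult_lt_0_compat; assumption. }
  intros w Hw.
  assert (H1 : (Cmod (w - s) < m / 2)%R) by (eapply Rlt_le_trans; [exact Hw|apply Rmin_l]).
  assert (H2 : (Cmod (w - s) < eps * (m * m * m) / 2)%R)
    by (eapply Rlt_le_trans; [exact Hw|apply Rmin_r]).
  assert (Hm : (m / 2 < Cmod w)%R).
  { generalize (Cmod_rev_triangle s w). rewrite Cmod_minus_sym. fold m. lra. }
  assert (Hw0 : w <> RtoC 0) by (apply Cmod_gt_0; lra).
  replace (/ w - / s - - / (s * s) * (w - s)) with ((w - s) * (w - s) * / (s * s * w))
    by (field; auto).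
  rewrite !Cmod_mult, Cmod_inv by (repeat apply Cmult_neq_0; assumption).
  rewrite !Cmod_mult. fold m. rewrite (Rmult_comm eps), Rmult_assoc.
  apply Rmult_le_compat_l; [apply Cmod_ge_0|].
  apply Rle_trans with (eps * (m * m * m) / 2 * / (m * m * (m / 2)))%R.
  - apply Rmult_le_compat; [apply Cmod_ge_0| |lra|].
    + left; apply Rinv_0_lt_compat. repeat apply Rmult_lt_0_compat; lra.
    + apply Rinv_le_contravar; [repeat apply Rmult_lt_0_compat; lra|].
      apply Rmult_le_compat_l; [nra|lra].
  - right; field. lra.
Qed.

(** * Functions holomorphic on a set, with continuous derivative *)

(** Continuity of the derivative is built in because the residue theorem below differentiates
    integrals over a contracting contour with respect to the contraction factor. *)
Definition hol (U : C -> Prop) (f : C -> C) : Prop :=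
  exists f' : C -> C, forall s, U s -> Cder f s (f' s) /\ continuous f' s.

Section Hol.
Variable U : C -> Prop.
Implicit Types (f g : C -> C).

Lemma hol_ext f g : (forall s, f s = g s) -> hol U f -> hol U g.
Proof.
  intros E [f' H]. exists f'. intros s Hs; destruct (H s Hs) as [H1 H2]; split; [|exact H2].
  apply (Cder_ext f); assumption.
Qed.

Lemma hol_const c : hol U (fun _ => c).
Proof. exists (fun _ => RtoC 0); intros; split; [apply Cder_const|apply Cc_const]. Qed.

Lemma hol_id : hol U (fun s => s).
Proof. exists (fun _ => RtoC 1); intros; split; [apply Cder_id|apply Cc_const]. Qed.

Lemma hol_plus f g : hol U f -> hol U g -> hol U (fun s => f s + g s).
Proof.
  intros [f' Hf] [g' Hg]; exists (fun s => f' s + g' s); intros s Hs.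
  destruct (Hf s Hs), (Hg s Hs); split; [apply Cder_plus|apply Cc_plus]; assumption.
Qed.

Lemma hol_mult f g : hol U f -> hol U g -> hol U (fun s => f s * g s).
Proof.
  intros [f' Hf] [g' Hg]; exists (fun s => f' s * g s + f s * g' s); intros s Hs.
  destruct (Hf s Hs) as [f1 f2], (Hg s Hs) as [g1 g2]; split; [apply Cder_mult; assumption|].
  apply Cc_plus; apply Cc_mult; try assumption; eapply Cder_cont; eassumption.
Qed.

Lemma hol_opp f : hol U f -> hol U (fun s => - f s).
Proof.
  intros [f' Hf]; exists (fun s => - f' s); intros s Hs.
  destruct (Hf s Hs); split; [apply Cder_opp|apply Cc_opp]; assumption.
Qed.

Lemma hol_minus f g : hol U f -> hol U g -> hol U (fun s => f s - g s).
Proof. intros; apply hol_plus; [|apply hol_opp]; assumption. Qed.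

Lemma hol_comp (V : C -> Prop) f g :
  hol V f -> hol U g -> (forall s, U s -> V (g s)) -> hol U (fun s => f (g s)).
Proof.
  intros [f' Hf] [g' Hg] HV; exists (fun s => f' (g s) * g' s); intros s Hs.
  destruct (Hf _ (HV s Hs)) as [f1 f2], (Hg s Hs) as [g1 g2]; split; [apply Cder_comp; assumption|].
  apply Cc_mult; [|assumption]. apply (continuous_comp g f'); [|exact f2].
  eapply Cder_cont; eassumption.
Qed.

Lemma hol_exp f : hol U f -> hol U (fun s => Cexp (f s)).
Proof.
  intros H. apply (hol_comp (fun _ => True)); [|exact H|trivial].
  exists Cexp; intros s _; split; [apply Cder_Cexp|apply Cc_exp, Cc_id].
Qed.

Lemma hol_inv f : hol U f -> (forall s, U s -> f s <> RtoC 0) -> hol U (fun s => / f s).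
Proof.
  intros H Hn. apply (hol_comp (fun z => z <> RtoC 0)); [|exact H|exact Hn].
  exists (fun s => - / (s * s)); intros s Hs; split; [apply Cder_inv, Hs|].
  apply Cc_opp, Cc_inv; [apply Cc_mult; apply Cc_id|apply Cmult_neq_0; assumption].
Qed.

Lemma hol_cont f s : hol U f -> U s -> continuous f s.
Proof. intros [f' H] Hs; eapply Cder_cont; apply (H s Hs). Qed.

Lemma hol_der f s : hol U f -> U s -> exists d, Cder f s d.
Proof. intros [f' H] Hs; exists (f' s); apply (H s Hs). Qed.
End Hol.

Lemma hol_sub (U V : C -> Prop) f : (forall s, V s -> U s) -> hol U f -> hol V f.
Proof. intros H [f' Hf]; exists f'; auto. Qed.

(** * Integrals of complex-valued functions of a real variable *)

Notation CisRInt := (@is_RInt C_R_NormedModule).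
Definition CRInt (f : R -> C) (a b : R) : C := @RInt C_R_CompleteNormedModule f a b.

Lemma CRInt_unique (f : R -> C) (a b : R) (l : C) : CisRInt f a b l -> CRInt f a b = l.
Proof. apply (is_RInt_unique (V := C_R_CompleteNormedModule)). Qed.

Lemma CRInt_correct (f : R -> C) (a b : R) (l : C) : CisRInt f a b l -> CisRInt f a b (CRInt f a b).
Proof. intros H; rewrite (CRInt_unique _ _ _ _ H); exact H. Qed.

Lemma CisRInt_cont (f : R -> C) (a b : R) : (a <= b)%R ->
  (forall t, (a <= t <= b)%R -> continuous f t) -> CisRInt f a b (CRInt f a b).
Proof.
  intros Hab H. apply (RInt_correct (V := C_R_CompleteNormedModule)).
  apply (ex_RInt_continuous (V := C_R_CompleteNormedModule)).
  intros z Hz; apply H; rewrite Rmin_left, Rmax_right in Hz; assumption.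
Qed.

Lemma CisRInt_minus (f g : R -> C) (a b : R) (k l : C) :
  CisRInt f a b k -> CisRInt g a b l -> CisRInt (fun t => f t - g t) a b (k - l).
Proof. apply (is_RInt_minus (V := C_R_NormedModule)). Qed.

Lemma CisRInt_ext (f g : R -> C) (a b : R) (l : C) : (a <= b)%R -> (forall t, (a < t < b)%R -> f t = g t) ->
  CisRInt f a b l -> CisRInt g a b l.
Proof.
  intros Hab H. apply (is_RInt_ext (V := C_R_NormedModule)).
  intros x Hx; apply H; rewrite Rmin_left, Rmax_right in Hx; assumption.
Qed.

Lemma CisRInt_iff (f : R -> C) (a b : R) (l : C) : CisRInt f a b l <->
  is_RInt (fun t => Re (f t)) a b (Re l) /\ is_RInt (fun t => Im (f t)) a b (Im l).
Proof.
  split.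
  - intros H; split.
    + exact (is_RInt_fct_extend_fst (U := R_NormedModule) (V := R_NormedModule) f a b l H).
    + exact (is_RInt_fct_extend_snd (U := R_NormedModule) (V := R_NormedModule) f a b l H).
  - intros [H1 H2]. destruct l as [l1 l2].
    exact (is_RInt_fct_extend_pair (U := R_NormedModule) (V := R_NormedModule) f a b l1 l2 H1 H2).
Qed.

Lemma CisRInt_Cmult (c : C) (f : R -> C) (a b : R) (l : C) : CisRInt f a b l -> CisRInt (fun t => c * f t) a b (c * l).
Proof.
  intros H; apply CisRInt_iff in H; destruct H as [H1 H2]; apply CisRInt_iff; split; simpl.
  - apply (is_RInt_minus (V := R_NormedModule) (fun t => Re c * Re (f t))%R (fun t => Im c * Im (f t))%R);
    apply (is_RInt_scal (V := R_NormedModule)); assumption.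
  - apply (is_RInt_plus (V := R_NormedModule) (fun t => Re c * Im (f t))%R (fun t => Im c * Re (f t))%R);
    apply (is_RInt_scal (V := R_NormedModule)); assumption.
Qed.

Lemma CisRInt_bound (f : R -> C) (a b : R) (l : C) (M : R) : (a <= b)%R -> (forall t, (a <= t <= b)%R -> (Cmod (f t) <= M)%R) ->
  CisRInt f a b l -> (Cmod l <= (b - a) * M)%R.
Proof.
  intros Hab HM H. rewrite Cmod_norm.
  apply (norm_RInt_le_const (V := C_R_NormedModule) f a b l M Hab); [|exact H].
  intros t Ht. generalize (HM t Ht). rewrite Cmod_norm. auto.
Qed.

Lemma CisRInt_derive (f df : R -> C) (a b : R) : (a <= b)%R ->
  (forall t, (a <= t <= b)%R -> RCder f t (df t)) ->
  (forall t, (a <= t <= b)%R -> continuous df t) -> CisRInt df a b (f b - f a).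
Proof.
  intros Hab H1 H2. apply (is_RInt_derive (V := C_R_CompleteNormedModule) f df);
  intros x Hx; rewrite Rmin_left, Rmax_right in Hx by assumption; auto.
Qed.

Lemma CisRInt_Chasles (f : R -> C) (a b c : R) (l1 l2 : C) :
  CisRInt f a b l1 -> CisRInt f b c l2 -> CisRInt f a c (l1 + l2).
Proof. apply (is_RInt_Chasles (V := C_R_NormedModule)). Qed.

Lemma CisRInt_unique2 (f : R -> C) (a b : R) (l1 l2 : C) : CisRInt f a b l1 -> CisRInt f a b l2 -> l1 = l2.
Proof. intros H1 H2; rewrite <- (CRInt_unique _ _ _ _ H1); apply CRInt_unique, H2. Qed.

Lemma locally_2d_eps (P : R * R -> Prop) (x y : R) :
  locally ((x, y) : prod_UniformSpace R_UniformSpace R_UniformSpace) P ->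
  exists d : R, (0 < d)%R /\ forall u v, (Rabs (u - x) < d)%R -> (Rabs (v - y) < d)%R -> P (u, v).
Proof.
  intros [d Hd]. exists d; split; [apply cond_pos|]. intros u v Hu Hv. apply Hd.
  split; assumption.
Qed.

(** Tube lemma: joint continuity at every point of the compact segment [x0] times [[a, b]] becomes
    closeness in [x] uniformly in [t]. *)
Lemma tube (phi : R -> R -> C) (x0 a b : R) :
  (forall t, (a <= t <= b)%R -> continuous (fun p : R * R => phi (fst p) (snd p)) (x0, t)) ->
  forall eps : R, (0 < eps)%R -> exists d : R, (0 < d)%R /\
  forall x t, (Rabs (x - x0) < d)%R -> (a <= t <= b)%R -> (Cmod (phi x t - phi x0 t) < eps)%R.
Proof.
  intros H eps He.
  (* The compactness lemma takes a radius for every real [t]; outside [[a, b]] the radius 1 is a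
     dummy. *)
  assert (K : forall t : R, exists d : posreal, (a <= t <= b)%R ->
     forall u v, (Rabs (u - x0) < d)%R -> (Rabs (v - t) < d)%R ->
      (Cmod (phi u v - phi x0 t) < eps / 2)%R).
  { intros t. destruct (Rle_dec a t) as [h1|h1]; [destruct (Rle_dec t b) as [h2|h2]|].
    - specialize (H t (conj h1 h2)).
      destruct (locally_2d_eps _ _ _ (proj1 (Cc_eps _ _) H (eps / 2)%R ltac:(lra))) as [d [Hd HH]].
      exists (mkposreal d Hd). intros _ u v Hu Hv. exact (HH u v Hu Hv).
    - exists (mkposreal 1 Rlt_0_1); intros; lra.
    - exists (mkposreal 1 Rlt_0_1); intros; lra. }
  pose (delta := fun t => proj1_sig (constructive_indefinite_description _ (K t))).
  assert (Hdelta : forall t, (a <= t <= b)%R ->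
     forall u v, (Rabs (u - x0) < delta t)%R -> (Rabs (v - t) < delta t)%R ->
      (Cmod (phi u v - phi x0 t) < eps / 2)%R).
  { intros t. exact (proj2_sig (constructive_indefinite_description _ (K t))). }
  destruct (compactness_value_1d a b delta) as [d Hd].
  exists d; split; [apply cond_pos|]. intros x t Hx Ht.
  (* [compactness_value_1d] delivers its centre [t'] only under a double negation, which the
     refutation of [E] can open. *)
  destruct (Rlt_dec (Cmod (phi x t - phi x0 t)) eps) as [E|E]; [exact E|exfalso].
  apply (Hd t Ht). intros (t' & Ht' & H1 & H2). apply E.
  eapply Rle_lt_trans; [apply (Cmod_triangle3 _ (phi x0 t') _)|].
  rewrite (Cmod_minus_sym (phi x0 t')).
  assert (P := cond_pos (delta t')).
  assert (A1 := Hdelta t' Ht' x t ltac:(lra) H1).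
  assert (A2 := Hdelta t' Ht' x0 t ltac:(rewrite Rminus_diag, Rabs_R0; lra) H1). lra.
Qed.

(** Differentiation under the integral sign: the linearization error of [phi] in [x] is bounded by
    the mean value inequality, uniformly in [t] because [tube] makes [psi x t - psi x0 t] uniformly
    small. *)
Lemma RCder_param (phi psi : R -> R -> C) (x0 a b r : R) : (a <= b)%R -> (0 < r)%R ->
  (forall x t, (Rabs (x - x0) < r)%R -> (a <= t <= b)%R -> RCder (fun u => phi u t) x (psi x t)) ->
  (forall t, (a <= t <= b)%R -> continuous (fun p : R * R => psi (fst p) (snd p)) (x0, t)) ->
  (forall x, (Rabs (x - x0) < r)%R -> CisRInt (phi x) a b (CRInt (phi x) a b)) ->
  CisRInt (psi x0) a b (CRInt (psi x0) a b) ->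
  RCder (fun x => CRInt (phi x) a b) x0 (CRInt (psi x0) a b).
Proof.
  intros Hab Hr Hder Hc Hi Hp. apply RCder_eps. intros eps He.
  destruct (tube psi x0 a b Hc (eps / (b - a + 1))%R ltac:(apply Rdiv_lt_0_compat; lra))
    as [d [Hd HT]].
  exists (Rmin d r); split; [apply Rmin_pos; assumption|]. intros u Hu.
  assert (Hu1 : (Rabs (u - x0) < d)%R) by (eapply Rlt_le_trans; [exact Hu|apply Rmin_l]).
  assert (Hu2 : (Rabs (u - x0) < r)%R) by (eapply Rlt_le_trans; [exact Hu|apply Rmin_r]).
  assert (P0 := Rabs_pos (u - x0)).
  assert (I : CisRInt (fun t => phi u t - phi x0 t - RtoC (u - x0) * psi x0 t) a b
    (CRInt (phi u) a b - CRInt (phi x0) a b - RtoC (u - x0) * CRInt (psi x0) a b)).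
  { apply CisRInt_minus; [apply CisRInt_minus; apply Hi|apply CisRInt_Cmult, Hp].
    - exact Hu2.
    - rewrite Rminus_diag, Rabs_R0; exact Hr. }
  rewrite (Cmult_comm (CRInt (psi x0) a b)).
  eapply Rle_trans; [refine (CisRInt_bound _ a b _ (eps / (b - a + 1) * Rabs (u - x0))%R Hab _ I)|].
  - intros t Ht.
    (* With the linear part subtracted, the derivative in [v] is [psi v t - psi x0 t], the quantity
       controlled by [tube]. *)
    pose (g := fun v => phi v t - RtoC v * psi x0 t).
    assert (Hg : forall v, (Rabs (v - x0) < Rmin d r)%R -> RCder g v (psi v t - psi x0 t)).
    { intros v Hv. apply RCder_minus; [apply Hder; [|exact Ht]|apply RCder_id].
      eapply Rlt_le_trans; [exact Hv|apply Rmin_r]. }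
    assert (Hb : forall v, (Rabs (v - x0) < Rmin d r)%R -> (Cmod (psi v t - psi x0 t) <= eps / (b - a + 1))%R).
    { intros v Hv. left; apply HT; [|exact Ht]. eapply Rlt_le_trans; [exact Hv|apply Rmin_l]. }
    replace (phi u t - phi x0 t - RtoC (u - x0) * psi x0 t) with (g u - g x0)
      by (unfold g; rewrite RtoC_minus; ring).
    destruct (Rle_dec x0 u) as [h|h].
    + rewrite (Rabs_pos_eq (u - x0)) by lra.
      apply (Cmod_MVT g (fun v => psi v t - psi x0 t)); [exact h| |];
      intros v Hv; [apply Hg|apply Hb];
      rewrite (Rabs_pos_eq (u - x0)) in Hu by lra; rewrite Rabs_pos_eq by lra; lra.
    + rewrite Cmod_minus_sym. rewrite (Rabs_left (u - x0)) by lra.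
      replace (- (u - x0))%R with (x0 - u)%R by ring.
      apply (Cmod_MVT g (fun v => psi v t - psi x0 t)); [lra| |];
      intros v Hv; [apply Hg|apply Hb];
      rewrite (Rabs_left (u - x0)) in Hu by lra; rewrite Rabs_left1 by lra; lra.
  - apply Rle_trans with ((b - a) / (b - a + 1) * (eps * Rabs (u - x0)))%R.
    + right; field; lra.
    + rewrite <- (Rmult_1_l (eps * Rabs (u - x0))) at 2. apply Rmult_le_compat_r; [nra|].
      apply (Rmult_le_reg_r (b - a + 1)); [lra|]. unfold Rdiv; rewrite Rmult_assoc, Rinv_l; lra.
Qed.

(** * The residue theorem for a rectangle *)

Definition segI (F : C -> C) (A B : C) : C :=
  CRInt (fun t => F (A + RtoC t * (B - A)) * (B - A)) 0 1.

Lemma segI_correct (F : C -> C) (A B : C) :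
  (forall t, (0 <= t <= 1)%R -> continuous F (A + RtoC t * (B - A))) ->
  CisRInt (fun t => F (A + RtoC t * (B - A)) * (B - A)) 0 1 (segI F A B).
Proof.
  intros H. apply CisRInt_cont; [lra|]. intros t Ht.
  apply Cc_mult; [|apply Cc_const].
  apply (continuous_comp (fun t => A + RtoC t * (B - A)) F); [|apply H, Ht].
  apply Cc_plus; [apply Cc_const|apply Cc_mult; [|apply Cc_const]].
  apply Cc_RtoC, continuous_id.
Qed.

Section Segment.
Variables (U : C -> Prop) (H H' : C -> C) (p A B : C).
Hypothesis HU : forall s, U s -> Cder H s (H' s) /\ continuous H' s.
Let w (t : R) : C := A + RtoC t * (B - A).
Hypothesis Hw : forall t, (0 <= t <= 1)%R -> w t <> RtoC 0.
Hypothesis Hin : forall x t, (0 <= x <= 1)%R -> (0 <= t <= 1)%R -> U (p + RtoC x * w t).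

(** One side of a contour about [p], contracted towards [p] by the factor [x]. [segN] is the
    derivative of [segM] in [x]. At [x = 1], [segM] is the integral wanted in the residue theorem;
    at [x = 0], [segN] is [H' p] times the integral of [1 / v]. *)
Definition segM (x : R) : C := segI (fun v => H (p + RtoC x * v) * / (v * v)) A B.
Definition segN (x : R) : C := segI (fun v => H' (p + RtoC x * v) * / v) A B.

Let Cc_w (t : R) : continuous w t.
Proof.
  unfold w. apply Cc_plus; [apply Cc_const|apply Cc_mult; [|apply Cc_const]].
  apply Cc_RtoC, continuous_id.
Qed.

Lemma segM_correct x : (0 <= x <= 1)%R ->
  CisRInt (fun t => H (p + RtoC x * w t) * / (w t * w t) * (B - A)) 0 1 (segM x).
Proof.
  intros Hx. unfold segM. refine (segI_correct (fun v => H (p + RtoC x * v) * / (v * v)) A B _).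
  intros t Ht. fold (w t).
  apply Cc_mult.
  - apply (continuous_comp (fun v => p + RtoC x * v) H).
    + apply Cc_plus; [apply Cc_const|apply Cc_mult; [apply Cc_const|apply Cc_id]].
    + destruct (HU _ (Hin x t Hx Ht)) as [Hd _]; eapply Cder_cont; exact Hd.
  - apply Cc_inv; [apply Cc_mult; apply Cc_id|]. apply Cmult_neq_0; apply Hw, Ht.
Qed.

Lemma segN_correct x : (0 <= x <= 1)%R ->
  CisRInt (fun t => H' (p + RtoC x * w t) * / w t * (B - A)) 0 1 (segN x).
Proof.
  intros Hx. unfold segN. refine (segI_correct (fun v => H' (p + RtoC x * v) * / v) A B _).
  intros t Ht. fold (w t).
  apply Cc_mult.
  - apply (continuous_comp (fun v => p + RtoC x * v) H').
    + apply Cc_plus; [apply Cc_const|apply Cc_mult; [apply Cc_const|apply Cc_id]].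
    + apply (HU _ (Hin x t Hx Ht)).
  - apply Cc_inv; [apply Cc_id|]. apply Hw, Ht.
Qed.

Let Cc_psi x t : (0 <= x <= 1)%R -> (0 <= t <= 1)%R ->
  continuous (fun q : R * R => H' (p + RtoC (fst q) * w (snd q)) * / w (snd q) * (B - A)) (x, t).
Proof.
  intros Hx Ht.
  assert (W : continuous (fun q : R * R => w (snd q)) (x, t)).
  { apply (continuous_comp (fun q : R * R => snd q) w); [|apply Cc_w].
    apply (@continuous_snd R_UniformSpace R_UniformSpace x t). }
  apply Cc_mult; [apply Cc_mult|apply Cc_const].
  - apply (continuous_comp (fun q : R * R => p + RtoC (fst q) * w (snd q)) H').
    + apply Cc_plus; [apply Cc_const|apply Cc_mult; [|exact W]].
      apply Cc_RtoC. apply (@continuous_fst R_UniformSpace R_UniformSpace x t).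
    + simpl. apply (HU _ (Hin x t Hx Ht)).
  - apply Cc_inv; [exact W|]. simpl; apply Hw, Ht.
Qed.

Lemma segM_der x : (0 < x < 1)%R -> RCder segM x (segN x).
Proof.
  intros Hx. pose (r := Rmin x (1 - x)).
  assert (Hr : (0 < r)%R) by (apply Rmin_pos; lra).
  assert (Hb : forall y, (Rabs (y - x) < r)%R -> (0 <= y <= 1)%R).
  { intros y Hy. apply Rabs_def2 in Hy. generalize (Rmin_l x (1 - x)) (Rmin_r x (1 - x)); fold r; lra. }
  refine (RCder_param (fun x t => H (p + RtoC x * w t) * / (w t * w t) * (B - A))
    (fun x t => H' (p + RtoC x * w t) * / w t * (B - A)) x 0 1 r _ Hr _ _ _ _); [lra| | | |].
  - intros y t Hy Ht. specialize (Hb y Hy).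
    eapply RCder_eq.
    + apply (RCder_comp (fun s => H s * / (w t * w t) * (B - A)) (fun u => p + RtoC u * w t) y).
      * apply (Cder_mult (fun s => H s * / (w t * w t)) (fun _ => B - A)); [|apply Cder_const].
        apply (Cder_mult H (fun _ => / (w t * w t))); [|apply Cder_const].
        apply (HU _ (Hin y t Hb Ht)).
      * apply RCder_line.
    + field. apply Hw, Ht.
  - intros t Ht. apply Cc_psi; [lra|exact Ht].
  - intros y Hy. apply (CRInt_correct _ _ _ (segM y)), segM_correct, Hb, Hy.
  - apply (CRInt_correct _ _ _ (segN x)), segN_correct. lra.
Qed.

Lemma segN_cont x0 : (0 <= x0 <= 1)%R -> forall eps, (0 < eps)%R -> exists d, (0 < d)%R /\
  forall x, (0 <= x <= 1)%R -> (Rabs (x - x0) < d)%R -> (Cmod (segN x - segN x0) <= eps)%R.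
Proof.
  intros Hx0 eps He.
  destruct (tube (fun x t => H' (p + RtoC x * w t) * / w t * (B - A)) x0 0 1
    (fun t Ht => Cc_psi x0 t Hx0 Ht) eps He) as [d [Hd HT]].
  exists d; split; [exact Hd|]. intros x Hx Hxd.
  replace eps with ((1 - 0) * eps)%R by ring.
  refine (CisRInt_bound _ 0 1 _ _ _ _ (CisRInt_minus _ _ _ _ _ _ (segN_correct x Hx) (segN_correct x0 Hx0)));
   [lra|]. intros t Ht. left; apply HT; assumption.
Qed.

(** Integration by parts: along the side, [H (p + x v) / v] is a primitive of
    [x H' (p + x v) / v - H (p + x v) / v^2]. Its end point terms cancel around a closed polygon. *)
Lemma segMN x : (0 <= x <= 1)%R ->
  RtoC x * segN x = segM x + (H (p + RtoC x * B) * / B - H (p + RtoC x * A) * / A).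
Proof.
  intros Hx.
  assert (I1 := CisRInt_Cmult (RtoC x) _ _ _ _ (segN_correct x Hx)).
  assert (I2 := CisRInt_minus _ _ _ _ _ _ I1 (segM_correct x Hx)).
  pose (g := fun t => H (p + RtoC x * w t) * / w t).
  assert (Hw' : forall t, RCder w t (B - A)) by (intros; apply RCder_line).
  assert (I3 : CisRInt (fun t => RtoC x * (H' (p + RtoC x * w t) * / w t * (B - A))
     - H (p + RtoC x * w t) * / (w t * w t) * (B - A)) 0 1 (g 1%R - g 0%R)).
  { apply CisRInt_derive; [lra| |].
    - intros t Ht. unfold g. eapply RCder_eq.
      + apply (RCder_mult (fun t => H (p + RtoC x * w t)) (fun t => / w t)).
        * apply (RCder_comp (fun s => H (p + RtoC x * s)) w); [|apply Hw'].
          apply (Cder_comp H (fun s => p + RtoC x * s)); [apply (HU _ (Hin x t Hx Ht))|].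
          apply Cder_plus; [apply Cder_const|apply Cder_scal, Cder_id].
        * apply (RCder_comp Cinv w); [|apply Hw']. apply Cder_inv, Hw, Ht.
      + field. apply Hw, Ht.
    - intros t Ht.
      assert (CH : continuous (fun t => p + RtoC x * w t) t)
        by (apply Cc_plus; [apply Cc_const|apply Cc_mult; [apply Cc_const|apply Cc_w]]).
      apply Cc_minus.
      + apply Cc_mult; [apply Cc_const|]. apply Cc_mult; [apply Cc_mult|apply Cc_const].
        * apply (continuous_comp _ H' _ CH). apply (HU _ (Hin x t Hx Ht)).
        * apply Cc_inv; [apply Cc_w|apply Hw, Ht].
      + apply Cc_mult; [apply Cc_mult|apply Cc_const].
        * apply (continuous_comp _ H _ CH). destruct (HU _ (Hin x t Hx Ht)) as [D _].
          eapply Cder_cont, D.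
        * apply Cc_inv; [apply Cc_mult; apply Cc_w|apply Cmult_neq_0; apply Hw, Ht]. }
  generalize (CisRInt_unique2 _ _ _ _ _ I2 I3). unfold g, w.
  replace (A + RtoC 1 * (B - A)) with B by ring. replace (A + RtoC 0 * (B - A)) with A by ring.
  intros E. rewrite <- E. ring.
Qed.
End Segment.

(** In the right half-plane, [ln (x^2 + y^2) / 2 + i atan (y / x)] is the logarithm, hence a
    primitive of [1 / v] along the vertical segment. *)
Lemma segI_inv_vertical (x y1 y2 : R) : (0 < x)%R ->
  segI Cinv (x, y1) (x, y2) =
  ((ln (x * x + y2 * y2) / 2 - ln (x * x + y1 * y1) / 2)%R, (atan (y2 / x) - atan (y1 / x))%R).
Proof.
  intros Hx. apply CRInt_unique.
  pose (y := fun t => (y1 + t * (y2 - y1))%R).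
  pose (g := fun t : R => ((ln (x * x + y t * y t) / 2)%R, atan (y t / x)) : C).
  match goal with |- is_RInt _ _ _ ?l => replace l with (g 1%R - g 0%R) end.
  2:{ unfold g, y. apply C_ext; simpl; replace (y1 + 1 * (y2 - y1))%R with y2 by ring;
      replace (y1 + 0 * (y2 - y1))%R with y1 by ring; ring. }
  assert (Hp : forall t, (0 < x * x + y t * y t)%R) by (intros; generalize (y t); intros; nra).
  apply CisRInt_derive; [lra| |].
  - intros t Ht. apply RCder_comp_iff; unfold g, y; split; simpl.
    + auto_derive; [apply Hp|]. specialize (Hp t). unfold y in Hp. field.
      replace (x + t * (x + - x))%R with x by ring. unfold Rminus in Hp; lra.
    + auto_derive; [lra|]. specialize (Hp t). unfold y in Hp. field.
      replace (x + t * (x + - x))%R with x by ring. unfold Rminus in Hp; lra.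
  - intros t Ht. apply Cc_mult; [|apply Cc_const]. apply Cc_inv.
    + apply Cc_plus; [apply Cc_const|apply Cc_mult; [|apply Cc_const]]. apply Cc_RtoC, continuous_id.
    + intros E. apply (f_equal Re) in E. simpl in E. nra.
Qed.

Lemma segI_inv_scal (c A B : C) : c <> RtoC 0 ->
  (forall t, (0 <= t <= 1)%R -> A + RtoC t * (B - A) <> RtoC 0) ->
  segI Cinv (c * A) (c * B) = segI Cinv A B.
Proof.
  intros Hc Hn. apply CRInt_unique.
  eapply CisRInt_ext; [lra| |apply (segI_correct Cinv A B)].
  - intros t Ht. simpl.
    replace (c * A + RtoC t * (c * B - c * A)) with (c * (A + RtoC t * (B - A))) by ring.
    field. split; [apply Hn; lra|exact Hc].
  - intros t Ht. apply Cc_inv; [apply Cc_id|apply Hn; lra].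
Qed.

Definition polyI (F : C -> C) (A B C' D : C) : C :=
  segI F A B + segI F B C' + segI F C' D + segI F D A.

Lemma segment_neq_0_re (x y1 y2 t : R) : x <> 0%R ->
  ((x, y1) : C) + RtoC t * ((x, y2) - (x, y1)) <> RtoC 0.
Proof. intros Hx E. apply (f_equal Re) in E. simpl in E. lra. Qed.

Lemma segment_neq_0_im (x1 x2 y t : R) : y <> 0%R ->
  ((x1, y) : C) + RtoC t * ((x2, y) - (x1, y)) <> RtoC 0.
Proof. intros Hx E. apply (f_equal Im) in E. simpl in E. lra. Qed.

(* Each side is rotated onto a vertical segment of the right half-plane. *)
Lemma polyI_winding (al be h : R) : (0 < al)%R -> (0 < be)%R -> (0 < h)%R ->
  polyI Cinv (- al, - h)%R (be, - h)%R (be, h) (- al, h)%R = RtoC (2 * PI) * Ci.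
Proof.
  intros Ha Hb Hh. unfold polyI.
  assert (Ci0 : - Ci <> RtoC 0) by (intros E; apply (f_equal Im) in E; simpl in E; lra).
  replace ((- al, - h)%R : C) with (- Ci * (h, (- al)%R)) by (apply C_ext; simpl; ring).
  replace ((be, - h)%R : C) with (- Ci * (h, be)) by (apply C_ext; simpl; ring).
  rewrite segI_inv_scal; [|exact Ci0|intros; apply segment_neq_0_re; lra].
  rewrite segI_inv_vertical by exact Hh.
  replace (- Ci * (h, be)) with ((be, - h)%R : C) by (apply C_ext; simpl; ring).
  rewrite segI_inv_vertical by exact Hb.
  replace (segI Cinv (be, h) (- al, h)%R) with (segI Cinv (h, - be)%R (h, al)).
  2:{ rewrite <- (segI_inv_scal Ci); [f_equal; apply C_ext; simpl; ring| |].
      - intros E; apply (f_equal Im) in E; simpl in E; lra.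
      - intros; apply segment_neq_0_re; lra. }
  rewrite segI_inv_vertical by exact Hh.
  replace (segI Cinv (- al, h)%R (- Ci * (h, - al)%R)) with (segI Cinv (al, - h)%R (al, h)).
  2:{ rewrite <- (segI_inv_scal (RtoC (-1))); [f_equal; apply C_ext; simpl; ring| |].
      - intros E; apply (f_equal Re) in E; simpl in E; lra.
      - intros; apply segment_neq_0_re; lra. }
  rewrite segI_inv_vertical by exact Ha.
  assert (K : forall u v, (0 < u)%R -> (0 < v)%R -> (atan (u / v) + atan (v / u) = PI / 2)%R).
  { intros u v Hu Hv. replace (v / u)%R with (/ (u / v))%R by (field; lra).
    rewrite atan_inv; [ring|]. apply Rdiv_lt_0_compat; assumption. }
  assert (K1 := K be h Hb Hh). assert (K2 := K al h Ha Hh).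
  assert (N : forall u v, (atan (- u / v) = - atan (u / v))%R).
  { intros u v. replace (- u / v)%R with (- (u / v))%R by (unfold Rdiv; ring). apply atan_opp. }
  apply C_ext; simpl.
  - replace (- al * - al)%R with (al * al)%R by ring. replace (- be * - be)%R with (be * be)%R by ring.
    replace (- h * - h)%R with (h * h)%R by ring.
    rewrite (Rplus_comm (be * be) (h * h)), (Rplus_comm (al * al) (h * h)). field.
  - rewrite !N. lra.
Qed.

Section Residue.
Variables (U : C -> Prop) (H H' : C -> C) (p : C) (al be h : R).
Hypothesis HU : forall s, U s -> Cder H s (H' s) /\ continuous H' s.
Hypotheses (Ha : (0 < al)%R) (Hb : (0 < be)%R) (Hh : (0 < h)%R).
Hypothesis Hin : forall u v, (- al <= u <= be)%R -> (- h <= v <= h)%R -> U (p + (u, v)).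

Let A : C := (- al, - h)%R.
Let B : C := (be, - h)%R.
Let C' : C := (be, h).
Let D : C := (- al, h)%R.

Let side (P Q : C) : Prop :=
  (forall t, (0 <= t <= 1)%R -> P + RtoC t * (Q - P) <> RtoC 0) /\
  (forall x t, (0 <= x <= 1)%R -> (0 <= t <= 1)%R -> U (p + RtoC x * (P + RtoC t * (Q - P)))).

Let conv (x t u v lo hi : R) : (0 <= x <= 1)%R -> (0 <= t <= 1)%R -> (lo < 0 < hi)%R ->
  (lo <= u <= hi)%R -> (lo <= v <= hi)%R -> (lo <= x * (u + t * (v - u)) <= hi)%R.
Proof.
  intros Hx Ht Hlo Hu Hv.
  assert (lo <= u + t * (v - u) <= hi)%R.
  { replace (u + t * (v - u))%R with ((1 - t) * u + t * v)%R by ring. nra. }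
  generalize dependent (u + t * (v - u))%R. intros r Hr. nra.
Qed.

Let in_conv (P Q : C) x t : (0 <= x <= 1)%R -> (0 <= t <= 1)%R ->
  (- al <= Re P <= be)%R -> (- al <= Re Q <= be)%R -> (- h <= Im P <= h)%R -> (- h <= Im Q <= h)%R ->
  U (p + RtoC x * (P + RtoC t * (Q - P))).
Proof.
  intros Hx Ht H1 H2 H3 H4.
  replace (RtoC x * (P + RtoC t * (Q - P))) with
    ((x * (Re P + t * (Re Q - Re P)), x * (Im P + t * (Im Q - Im P)))%R : C)
    by (destruct P, Q; apply C_ext; simpl; ring).
  apply Hin; apply conv; auto; lra.
Qed.

Let sAB : side A B.
Proof.
  split; [intros; apply segment_neq_0_im; lra|]. intros; apply in_conv; auto; unfold A, B; simpl; lra.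
Qed.
Let sBC : side B C'.
Proof.
  split; [intros; apply segment_neq_0_re; lra|]. intros; apply in_conv; auto; unfold C', B; simpl; lra.
Qed.
Let sCD : side C' D.
Proof.
  split; [intros; apply segment_neq_0_im; lra|]. intros; apply in_conv; auto; unfold C', D; simpl; lra.
Qed.
Let sDA : side D A.
Proof.
  split; [intros; apply segment_neq_0_re; lra|]. intros; apply in_conv; auto; unfold A, D; simpl; lra.
Qed.

Let M (x : R) : C := segM H p A B x + segM H p B C' x + segM H p C' D x + segM H p D A x.
Let N (x : R) : C := segN H' p A B x + segN H' p B C' x + segN H' p C' D x + segN H' p D A x.

(** The boundary terms of [segMN] telescope around the closed rectangle. *)
Let MN x : (0 <= x <= 1)%R -> RtoC x * N x = M x.
Proof.
  intros Hx. unfold N, M. rewrite !Cmult_plus_distr_l.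
  rewrite (segMN U H H' p A B HU (proj1 sAB) (proj2 sAB) x Hx),
   (segMN U H H' p B C' HU (proj1 sBC) (proj2 sBC) x Hx),
   (segMN U H H' p C' D HU (proj1 sCD) (proj2 sCD) x Hx),
   (segMN U H H' p D A HU (proj1 sDA) (proj2 sDA) x Hx). ring.
Qed.

Let Mder x : (0 < x < 1)%R -> RCder M x (N x).
Proof.
  intros Hx. unfold M, N. repeat apply RCder_plus.
  - exact (segM_der U H H' p A B HU (proj1 sAB) (proj2 sAB) x Hx).
  - exact (segM_der U H H' p B C' HU (proj1 sBC) (proj2 sBC) x Hx).
  - exact (segM_der U H H' p C' D HU (proj1 sCD) (proj2 sCD) x Hx).
  - exact (segM_der U H H' p D A HU (proj1 sDA) (proj2 sDA) x Hx).
Qed.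

Let Ncont x0 : (0 <= x0 <= 1)%R -> forall eps, (0 < eps)%R -> exists d, (0 < d)%R /\
  forall x, (0 <= x <= 1)%R -> (Rabs (x - x0) < d)%R -> (Cmod (N x - N x0) <= eps)%R.
Proof.
  intros Hx0 eps He. assert (He4 : (0 < eps / 4)%R) by lra.
  destruct (segN_cont U H H' p A B HU (proj1 sAB) (proj2 sAB) x0 Hx0 _ He4) as [d1 [Hd1 K1]].
  destruct (segN_cont U H H' p B C' HU (proj1 sBC) (proj2 sBC) x0 Hx0 _ He4) as [d2 [Hd2 K2]].
  destruct (segN_cont U H H' p C' D HU (proj1 sCD) (proj2 sCD) x0 Hx0 _ He4) as [d3 [Hd3 K3]].
  destruct (segN_cont U H H' p D A HU (proj1 sDA) (proj2 sDA) x0 Hx0 _ He4) as [d4 [Hd4 K4]].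
  exists (Rmin (Rmin d1 d2) (Rmin d3 d4)); split; [repeat apply Rmin_pos; assumption|].
  intros x Hx Hxd.
  assert (Rabs (x - x0) < d1 /\ Rabs (x - x0) < d2 /\ Rabs (x - x0) < d3 /\ Rabs (x - x0) < d4)%R.
  { generalize (Rmin_l (Rmin d1 d2) (Rmin d3 d4)) (Rmin_r (Rmin d1 d2) (Rmin d3 d4))
     (Rmin_l d1 d2) (Rmin_r d1 d2) (Rmin_l d3 d4) (Rmin_r d3 d4). lra. }
  destruct H0 as (E1 & E2 & E3 & E4). unfold N.
  replace (segN H' p A B x + segN H' p B C' x + segN H' p C' D x + segN H' p D A x -
   (segN H' p A B x0 + segN H' p B C' x0 + segN H' p C' D x0 + segN H' p D A x0)) with
   ((segN H' p A B x - segN H' p A B x0) + (segN H' p B C' x - segN H' p B C' x0) +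
    (segN H' p C' D x - segN H' p C' D x0) + (segN H' p D A x - segN H' p D A x0)) by ring.
  specialize (K1 x Hx E1). specialize (K2 x Hx E2). specialize (K3 x Hx E3). specialize (K4 x Hx E4).
  eapply Rle_trans; [apply Cmod_triangle|].
  eapply Rle_trans; [apply Rplus_le_compat_r, Cmod_triangle|].
  eapply Rle_trans; [apply Rplus_le_compat_r, Rplus_le_compat_r, Cmod_triangle|]. lra.
Qed.

(** [N = M / x] and [M' = N], so the derivative of [N] is [N / x - M / x^2 = 0]. *)
Let Nconst x y : (0 < x)%R -> (x <= y)%R -> (y < 1)%R -> N x = N y.
Proof.
  intros Hx Hxy Hy.
  pose (g := fun u => M u * / RtoC u).
  assert (Hg : forall u, (0 < u < 1)%R -> g u = N u).
  { intros u Hu. unfold g. rewrite <- MN by lra. field. intros E; apply (f_equal Re) in E; simpl in E; lra. }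
  rewrite <- !Hg by lra. apply Cmod_le_eps_eq. intros eps He.
  rewrite Cmod_minus_sym.
  eapply Rle_trans; [apply (Cmod_MVT g (fun _ => RtoC 0) x y 0 Hxy)|].
  - intros t Ht.
    assert (T : RtoC t <> RtoC 0) by (intros E; apply (f_equal Re) in E; simpl in E; lra).
    unfold g. eapply RCder_eq.
    + apply (RCder_mult M (fun u => / RtoC u)); [apply Mder; lra|].
      apply (RCder_comp Cinv RtoC); [apply Cder_inv, T|].
      apply (RCder_ext (fun u => RtoC u * RtoC 1)); [intros; ring|apply RCder_id].
    + rewrite <- (MN t) by lra. field. exact T.
  - intros; rewrite Cmod_0R; lra.
  - rewrite Rmult_0_l; lra.
Qed.

(** The constancy holds in the open interval, where the derivative of [M] is available from both
    sides; continuity of [N] carries it to both ends. *)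
Let N01 : N 1%R = N 0%R.
Proof.
  apply Cmod_le_eps_eq. intros eps He.
  destruct (Ncont 0%R ltac:(lra) (eps/2)%R ltac:(lra)) as [d0 [Hd0 K0]].
  destruct (Ncont 1%R ltac:(lra) (eps/2)%R ltac:(lra)) as [d1 [Hd1 K1]].
  pose (m := Rmin (Rmin d0 d1) (1/2)).
  assert (Hm : (0 < m <= 1/2)%R /\ (m <= d0)%R /\ (m <= d1)%R).
  { unfold m. generalize (Rmin_l (Rmin d0 d1) (1/2)) (Rmin_r (Rmin d0 d1) (1/2)) (Rmin_l d0 d1) (Rmin_r d0 d1).
    assert (0 < Rmin (Rmin d0 d1) (1/2))%R by (repeat apply Rmin_pos; lra). lra. }
  specialize (K0 (m/2)%R ltac:(lra) ltac:(rewrite Rminus_0_r, Rabs_pos_eq; lra)).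
  specialize (K1 (1 - m/2)%R ltac:(lra) ltac:(rewrite Rabs_left; lra)).
  rewrite <- (Nconst (m/2)%R (1 - m/2)%R) in K1 by lra.
  eapply Rle_trans; [apply (Cmod_triangle3 _ (N (m/2)%R))|].
  rewrite (Cmod_minus_sym (N 1%R)). lra.
Qed.

(** The integral is [M 1 = N 1 = N 0]: the contour has been shrunk to [p], and [N 0] is [H' p] times
    the integral of [1 / v], known from [polyI_winding]. *)
Lemma residue_rectangle :
  polyI (fun w => H (p + w) * / (w * w)) A B C' D = RtoC (2 * PI) * Ci * H' p.
Proof.
  assert (E1 : polyI (fun w => H (p + w) * / (w * w)) A B C' D = M 1%R).
  { unfold polyI, M, segM.
    replace (fun v => H (p + RtoC 1 * v) * / (v * v)) with (fun w => H (p + w) * / (w * w))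
      by (apply functional_extensionality; intros; rewrite Cmult_1_l; reflexivity).
    reflexivity. }
  rewrite E1, <- MN, Cmult_1_l, N01 by lra.
  unfold A, B, C', D; rewrite <- (polyI_winding al be h Ha Hb Hh); fold A B C' D.
  assert (K : forall P Q, side P Q -> segN H' p P Q 0 = segI Cinv P Q * H' p).
  { intros P Q [S1 S2]. unfold segN, segI at 1. apply CRInt_unique.
    rewrite Cmult_comm.
    eapply CisRInt_ext; [lra| |apply CisRInt_Cmult, (segI_correct Cinv P Q)].
    - intros t Ht. simpl. rewrite Cmult_0_l, Cplus_0_r. ring.
    - intros t Ht. apply Cc_inv; [apply Cc_id|apply S1, Ht]. }
  unfold N, polyI. rewrite (K _ _ sAB), (K _ _ sBC), (K _ _ sCD), (K _ _ sDA). ring.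
Qed.
End Residue.

(** * Sequences of complex numbers *)

Definition is_Clim (u : nat -> C) (l : C) : Prop :=
  forall eps : R, (0 < eps)%R -> exists N : nat, forall n, (N <= n)%nat -> (Cmod (u n - l) < eps)%R.

Lemma is_Clim_filterlim u l : is_Clim u l <-> filterlim u Hierarchy.eventually (locally l).
Proof. symmetry. apply (filterlim_C_eps Hierarchy.eventually). Qed.

Lemma is_Clim_unique u l l' : is_Clim u l -> is_Clim u l' -> l = l'.
Proof.
  intros H1 H2. apply Cmod_le_eps_eq. intros eps He.
  destruct (H1 (eps/2)%R ltac:(lra)) as [N1 K1]. destruct (H2 (eps/2)%R ltac:(lra)) as [N2 K2].
  specialize (K1 (max N1 N2) ltac:(lia)). specialize (K2 (max N1 N2) ltac:(lia)).
  rewrite Cmod_minus_sym in K1.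
  eapply Rle_trans; [apply (Cmod_triangle3 _ (u (max N1 N2)))|]. lra.
Qed.

Lemma Clim_seq_unique u l : is_Clim u l -> Clim_seq u = l.
Proof.
  intros H. unfold Clim_seq. apply (iota_unique (V := C_CompleteNormedModule)).
  - intros y Hy. apply is_Clim_filterlim in Hy. eapply is_Clim_unique; eassumption.
  - apply is_Clim_filterlim, H.
Qed.

Lemma is_Clim_ext u v l : (exists N, forall n, (N <= n)%nat -> u n = v n) -> is_Clim u l -> is_Clim v l.
Proof.
  intros [N E] H eps He. destruct (H eps He) as [N' K]. exists (max N N'). intros n Hn.
  rewrite <- E by lia. apply K; lia.
Qed.

Lemma is_Clim_eq u l l' : is_Clim u l -> l = l' -> is_Clim u l'.
Proof. intros H E; subst; exact H. Qed.

Lemma is_Clim_const c : is_Clim (fun _ => c) c.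
Proof.
  intros eps He; exists 0%nat; intros. replace (c - c) with (RtoC 0) by ring. rewrite Cmod_0R; exact He.
Qed.

Lemma is_Clim_plus u v l m : is_Clim u l -> is_Clim v m -> is_Clim (fun n => u n + v n) (l + m).
Proof.
  intros H1 H2 eps He.
  destruct (H1 (eps/2)%R ltac:(lra)) as [N1 K1]. destruct (H2 (eps/2)%R ltac:(lra)) as [N2 K2].
  exists (max N1 N2); intros n Hn. specialize (K1 n ltac:(lia)). specialize (K2 n ltac:(lia)).
  replace (u n + v n - (l + m)) with ((u n - l) + (v n - m)) by ring.
  eapply Rle_lt_trans; [apply Cmod_triangle|]. lra.
Qed.

Lemma is_Clim_comp (f : C -> C) u l : continuous f l -> is_Clim u l -> is_Clim (fun n => f (u n)) (f l).
Proof.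
  intros Hf Hu. apply is_Clim_filterlim. apply is_Clim_filterlim in Hu.
  eapply filterlim_comp; [exact Hu|exact Hf].
Qed.

Lemma is_Clim_scal c u l : is_Clim u l -> is_Clim (fun n => c * u n) (c * l).
Proof. apply (is_Clim_comp (fun z => c * z)). apply Cc_mult; [apply Cc_const|apply Cc_id]. Qed.

Lemma is_Clim_opp u l : is_Clim u l -> is_Clim (fun n => - u n) (- l).
Proof. apply (is_Clim_comp (fun z => - z)). apply Cc_opp, Cc_id. Qed.

Lemma is_Clim_minus u v l m : is_Clim u l -> is_Clim v m -> is_Clim (fun n => u n - v n) (l - m).
Proof. intros; apply is_Clim_plus; [|apply is_Clim_opp]; assumption. Qed.

Lemma is_Clim_bound u l K N : is_Clim u l -> (forall n, (N <= n)%nat -> (Cmod (u n) <= K)%R) -> (Cmod l <= K)%R.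
Proof.
  intros H HK. apply Rle_plus_epsilon. intros eps He. destruct (H eps He) as [N' HN].
  specialize (HN (max N N') ltac:(lia)). specialize (HK (max N N') ltac:(lia)).
  rewrite Cmod_minus_sym in HN. generalize (Cmod_rev_triangle l (u (max N N'))). lra.
Qed.

Lemma is_Clim_mult u v l m : is_Clim u l -> is_Clim v m -> is_Clim (fun n => u n * v n) (l * m).
Proof.
  intros H1 H2.
  apply (is_Clim_ext (fun n => (u n - l) * (v n - m) + (l * v n + (u n * m - l * m)))).
  { exists 0%nat; intros; ring. }
  apply (is_Clim_eq _ (RtoC 0 + (l * m + (l * m - l * m)))); [|ring].
  apply is_Clim_plus.
  - intros eps He.
    destruct (H1 1%R ltac:(lra)) as [N1 K1]. destruct (H2 eps He) as [N2 K2].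
    exists (max N1 N2); intros n Hn. specialize (K1 n ltac:(lia)). specialize (K2 n ltac:(lia)).
    replace ((u n - l) * (v n - m) - RtoC 0) with ((u n - l) * (v n - m)) by ring.
    rewrite Cmod_mult. generalize (Cmod_ge_0 (u n - l)) (Cmod_ge_0 (v n - m)). nra.
  - apply is_Clim_plus; [apply is_Clim_scal, H2|]. apply is_Clim_minus; [|apply is_Clim_const].
    apply (is_Clim_comp (fun z => z * m)); [|exact H1]. apply Cc_mult; [apply Cc_id|apply Cc_const].
Qed.

Lemma is_Clim_subseq u l (phi : nat -> nat) : (forall n, (n <= phi n)%nat) ->
  is_Clim u l -> is_Clim (fun n => u (phi n)) l.
Proof.
  intros Hphi H eps He. destruct (H eps He) as [N K]. exists N; intros n Hn. apply K.
  specialize (Hphi n); lia.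
Qed.

Lemma is_Clim_shift u l k : is_Clim (fun n => u (k + n)%nat) l -> is_Clim u l.
Proof.
  intros H eps He. destruct (H eps He) as [N K]. exists (k + N)%nat; intros n Hn.
  replace n with (k + (n - k))%nat by lia. apply K; lia.
Qed.

Lemma Ccauchy_lim (u : nat -> C) :
  (forall eps, (0 < eps)%R -> exists N, forall n m, (N <= n)%nat -> (N <= m)%nat ->
    (Cmod (u n - u m) < eps)%R) -> exists l, is_Clim u l.
Proof.
  intros H.
  assert (K : forall f : C -> R, (forall z w, (Rabs (f z - f w) <= Cmod (z - w))%R) ->
    exists l : R, Un_cv (fun n => f (u n)) l).
  { intros f Hf. assert (HC : Cauchy_crit (fun n => f (u n))).
    2:{ destruct (Rcomplete.R_complete _ HC) as [l Hl]; exists l; exact Hl. }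
    intros eps He. destruct (H eps He) as [N HN]. exists N. intros n m Hn Hm.
    unfold R_dist. eapply Rle_lt_trans; [apply Hf|]. apply HN; lia. }
  destruct (K Re) as [a Ha].
  { intros z w. replace (Re z - Re w)%R with (Re (z - w)) by (unfold Cminus; rewrite re_plus, re_opp; ring).
    apply re_le_Cmod. }
  destruct (K Im) as [b Hb].
  { intros z w. replace (Im z - Im w)%R with (Im (z - w)) by (unfold Cminus; rewrite im_plus, im_opp; ring).
    apply im_le_Cmod. }
  exists (a, b). intros eps He.
  destruct (Ha (eps/2)%R ltac:(lra)) as [N1 K1]. destruct (Hb (eps/2)%R ltac:(lra)) as [N2 K2].
  exists (max N1 N2); intros n Hn. specialize (K1 n ltac:(lia)). specialize (K2 n ltac:(lia)).
  unfold R_dist in *. eapply Rle_lt_trans; [apply Cmod_le_ReIm|].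
  unfold Cminus. rewrite re_plus, im_plus, re_opp, im_opp. simpl. unfold Rminus in *. lra.
Qed.

(** * Cauchy's estimate and limits of holomorphic functions *)

Lemma segI_bound (F : C -> C) (A B : C) (K : R) :
  (forall t, (0 <= t <= 1)%R -> continuous F (A + RtoC t * (B - A))) ->
  (forall t, (0 <= t <= 1)%R -> (Cmod (F (A + RtoC t * (B - A))%C) <= K)%R) ->
  (Cmod (segI F A B) <= K * Cmod (B - A))%R.
Proof.
  intros Hc HK. replace (K * Cmod (B - A))%R with ((1 - 0) * (K * Cmod (B - A)))%R by ring.
  apply (CisRInt_bound (fun t => F (A + RtoC t * (B - A)) * (B - A)) 0 1); [lra| |apply segI_correct, Hc].
  intros t Ht. rewrite Cmod_mult. apply Rmult_le_compat_r; [apply Cmod_ge_0|apply HK, Ht].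
Qed.

(** Squares take the place of discs because the residue theorem is at hand for rectangles. *)
Definition box (p : C) (r : R) (s : C) : Prop :=
  (Rabs (Re s - Re p) < r)%R /\ (Rabs (Im s - Im p) < r)%R.

Lemma box_Cmod p r s : (Cmod (s - p) < r)%R -> box p r s.
Proof.
  intros H; split; (eapply Rle_lt_trans; [|exact H]).
  - replace (Re s - Re p)%R with (Re (s - p)) by (unfold Cminus; rewrite re_plus, re_opp; ring).
    apply re_le_Cmod.
  - replace (Im s - Im p)%R with (Im (s - p)) by (unfold Cminus; rewrite im_plus, im_opp; ring).
    apply im_le_Cmod.
Qed.

Lemma box_open p r s : box p r s -> exists d, (0 < d)%R /\ forall w, (Cmod (w - s) < d)%R -> box p r w.
Proof.
  intros [H1 H2]. exists (Rmin (r - Rabs (Re s - Re p)) (r - Rabs (Im s - Im p))).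
  split; [apply Rmin_pos; lra|]. intros w Hw.
  destruct (box_Cmod _ _ _ Hw) as [K1 K2]. split.
  - replace (Re w - Re p)%R with ((Re w - Re s) + (Re s - Re p))%R by ring.
    eapply Rle_lt_trans; [apply Rabs_triang|].
    generalize (Rmin_l (r - Rabs (Re s - Re p)) (r - Rabs (Im s - Im p))). lra.
  - replace (Im w - Im p)%R with ((Im w - Im s) + (Im s - Im p))%R by ring.
    eapply Rle_lt_trans; [apply Rabs_triang|].
    generalize (Rmin_r (r - Rabs (Re s - Re p)) (r - Rabs (Im s - Im p))). lra.
Qed.

Lemma box_plus p r q s w : box p r s -> (Cmod w <= q)%R -> box p (r + q) (s + w).
Proof.
  intros [H1 H2] Hw. assert (K1 := re_le_Cmod w). assert (K2 := im_le_Cmod w).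
  split; rewrite ?re_plus, ?im_plus.
  - replace (Re s + Re w - Re p)%R with ((Re s - Re p) + Re w)%R by ring.
    eapply Rle_lt_trans; [apply Rabs_triang|]. lra.
  - replace (Im s + Im w - Im p)%R with ((Im s - Im p) + Im w)%R by ring.
    eapply Rle_lt_trans; [apply Rabs_triang|]. lra.
Qed.

Lemma box_plus_pair p r q s u v : box p r s -> (- q <= u <= q)%R -> (- q <= v <= q)%R ->
  box p (r + q) (s + (u, v)).
Proof.
  intros [H1 H2] Hu Hv. split; rewrite ?re_plus, ?im_plus; simpl.
  - replace (Re s + u - Re p)%R with ((Re s - Re p) + u)%R by ring.
    eapply Rle_lt_trans; [apply Rabs_triang|]. generalize (Rabs_le u q Hu). lra.
  - replace (Im s + v - Im p)%R with ((Im s - Im p) + v)%R by ring.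
    eapply Rle_lt_trans; [apply Rabs_triang|]. generalize (Rabs_le v q Hv). lra.
Qed.

(** On the square of half-side [r], each of the four sides has length [2 r] and the integrand is at
    most [M / r^2]. Hence [2 PI] times the derivative is at most [8 M / r] in modulus, and [PI >= 2]
    gives the stated constant. *)
Lemma Cauchy_estimate (U : C -> Prop) (f f' : C -> C) (p : C) (r M : R) : (0 < r)%R ->
  (forall s, U s -> Cder f s (f' s) /\ continuous f' s) ->
  (forall u v, (- r <= u <= r)%R -> (- r <= v <= r)%R -> U (p + (u, v))) ->
  (forall s, U s -> (Cmod (f s) <= M)%R) ->
  (Cmod (f' p) <= 2 * M / r)%R.
Proof.
  intros Hr HU Hin HM.
  assert (E := residue_rectangle U f f' p r r r HU Hr Hr Hr Hin).
  assert (M0 : (0 <= M)%R).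
  { eapply Rle_trans; [apply Cmod_ge_0|apply (HM (p + (0, 0)%R)), Hin; lra]. }
  assert (K : forall P Q : C,
    (forall t, (0 <= t <= 1)%R -> (r <= Cmod (P + RtoC t * (Q - P)))%R /\
       - r <= Re (P + RtoC t * (Q - P)) <= r /\ - r <= Im (P + RtoC t * (Q - P)) <= r)%R ->
    (Cmod (Q - P) = 2 * r)%R ->
    (Cmod (segI (fun w => f (p + w)%C * / (w * w))%C P Q) <= M / (r * r) * (2 * r))%R).
  { intros P Q HPQ HL. rewrite <- HL. apply segI_bound.
    - intros t Ht. destruct (HPQ t Ht) as (h1 & h2 & h3).
      assert (Hn : P + RtoC t * (Q - P) <> RtoC 0) by (apply Cmod_gt_0; lra).
      apply Cc_mult.
      + apply (continuous_comp (fun w => p + w) f); [apply Cc_plus; [apply Cc_const|apply Cc_id]|].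
        specialize (Hin _ _ h2 h3). rewrite <- surjective_pairing in Hin.
        destruct (HU _ Hin) as [D _]; eapply Cder_cont, D.
      + apply Cc_inv; [apply Cc_mult; apply Cc_id|apply Cmult_neq_0; exact Hn].
    - intros t Ht. destruct (HPQ t Ht) as (h1 & h2 & h3).
      assert (Hn : P + RtoC t * (Q - P) <> RtoC 0) by (apply Cmod_gt_0; lra).
      rewrite Cmod_mult, Cmod_inv, Cmod_mult by (apply Cmult_neq_0; exact Hn).
      apply Rmult_le_compat; [apply Cmod_ge_0| | |].
      + left; apply Rinv_0_lt_compat. nra.
      + apply HM. specialize (Hin _ _ h2 h3). rewrite <- surjective_pairing in Hin. exact Hin.
      + apply Rinv_le_contravar; nra. }
  assert (V : forall x y : R, (Rabs x = r \/ Rabs y = r) -> (r <= Cmod (x, y))%R).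
  { intros x y [H|H]; rewrite <- H.
    - apply (re_le_Cmod (x, y)).
    - apply (im_le_Cmod (x, y)). }
  assert (B1 : forall x y1 y2 : R, (x = r \/ x = - r)%R -> (- r <= y1 <= r)%R -> (- r <= y2 <= r)%R ->
     forall t, (0 <= t <= 1)%R -> (r <= Cmod ((x, y1) + RtoC t * ((x, y2) - (x, y1)))%C /\
       - r <= Re ((x, y1) + RtoC t * ((x, y2) - (x, y1)))%C <= r /\
       - r <= Im ((x, y1) + RtoC t * ((x, y2) - (x, y1)))%C <= r)%R).
  { intros x y1 y2 Hx H1 H2 t Ht.
    replace ((x, y1) + RtoC t * ((x, y2) - (x, y1))) with ((x, (1 - t) * y1 + t * y2)%R : C)
      by (apply C_ext; simpl; ring). simpl.
    split; [|split; [|nra]].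
    - apply V; left. destruct Hx; subst x; [apply Rabs_pos_eq; lra|rewrite Rabs_Ropp; apply Rabs_pos_eq; lra].
    - destruct Hx; subst x; lra. }
  assert (B2 : forall y x1 x2 : R, (y = r \/ y = - r)%R -> (- r <= x1 <= r)%R -> (- r <= x2 <= r)%R ->
     forall t, (0 <= t <= 1)%R -> (r <= Cmod ((x1, y) + RtoC t * ((x2, y) - (x1, y)))%C /\
       - r <= Re ((x1, y) + RtoC t * ((x2, y) - (x1, y)))%C <= r /\
       - r <= Im ((x1, y) + RtoC t * ((x2, y) - (x1, y)))%C <= r)%R).
  { intros y x1 x2 Hx H1 H2 t Ht.
    replace ((x1, y) + RtoC t * ((x2, y) - (x1, y))) with (((1 - t) * x1 + t * x2)%R, y)
      by (apply C_ext; simpl; ring). simpl.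
    split; [|split; [nra|]].
    - apply V; right. destruct Hx; subst y; [apply Rabs_pos_eq; lra|rewrite Rabs_Ropp; apply Rabs_pos_eq; lra].
    - destruct Hx; subst y; lra. }
  assert (Lr : forall d : R, Rabs d = (2 * r)%R -> Cmod (d, 0)%R = (2 * r)%R).
  { intros d Hd. change ((d, 0)%R : C) with (RtoC d). rewrite Cmod_R; exact Hd. }
  assert (Li : forall d : R, Rabs d = (2 * r)%R -> Cmod (0, d)%R = (2 * r)%R).
  { intros d Hd. replace ((0, d)%R : C) with (Ci * RtoC d) by (apply C_ext; simpl; ring).
    rewrite Cmod_mult, Cmod_R, Hd. replace (Cmod Ci) with 1%R; [ring|].
    unfold Cmod; simpl. replace (0 * (0 * 1) + 1 * (1 * 1))%R with 1%R by ring. symmetry; apply sqrt_1. }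
  assert (T : (Cmod (RtoC (2 * PI) * Ci * f' p) <= 4 * (M / (r * r) * (2 * r)))%R).
  { rewrite <- E. unfold polyI.
    eapply Rle_trans; [apply Cmod_triangle|].
    eapply Rle_trans; [apply Rplus_le_compat_r, Cmod_triangle|].
    eapply Rle_trans; [apply Rplus_le_compat_r, Rplus_le_compat_r, Cmod_triangle|].
    assert (k1 := K (- r, - r)%R (r, - r)%R (B2 (- r)%R (- r)%R r ltac:(auto) ltac:(lra) ltac:(lra))).
    assert (k2 := K (r, - r)%R (r, r)%R (B1 r (- r)%R r ltac:(auto) ltac:(lra) ltac:(lra))).
    assert (k3 := K (r, r)%R (- r, r)%R (B2 r r (- r)%R ltac:(auto) ltac:(lra) ltac:(lra))).
    assert (k4 := K (- r, r)%R (- r, - r)%R (B1 (- r)%R r (- r)%R ltac:(auto) ltac:(lra) ltac:(lra))).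
    refine (Rle_trans _ _ _ (Rplus_le_compat _ _ _ _ (Rplus_le_compat _ _ _ _ (Rplus_le_compat _ _ _ _ (k1 _) (k2 _)) (k3 _)) (k4 _)) _).
    - replace (((r, - r)%R : C) - (- r, - r)%R) with ((2 * r, 0)%R : C) by (apply C_ext; simpl; ring).
      apply Lr, Rabs_pos_eq; lra.
    - replace (((r, r)%R : C) - (r, - r)%R) with ((0, 2 * r)%R : C) by (apply C_ext; simpl; ring).
      apply Li, Rabs_pos_eq; lra.
    - replace (((- r, r)%R : C) - (r, r)%R) with ((- (2 * r), 0)%R : C) by (apply C_ext; simpl; ring).
      apply Lr. rewrite Rabs_Ropp; apply Rabs_pos_eq; lra.
    - replace (((- r, - r)%R : C) - (- r, r)%R) with ((0, - (2 * r))%R : C) by (apply C_ext; simpl; ring).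
      apply Li. rewrite Rabs_Ropp; apply Rabs_pos_eq; lra.
    - lra. }
  rewrite !Cmod_mult, Cmod_R in T.
  replace (Cmod Ci) with 1%R in T.
  2:{ unfold Cmod; simpl. replace (0 * (0 * 1) + 1 * (1 * 1))%R with 1%R by ring. symmetry; apply sqrt_1. }
  assert (P2 := PI2_1). rewrite Rabs_pos_eq in T by lra.
  replace (4 * (M / (r * r) * (2 * r)))%R with (4 * (2 * M / r))%R in T by (field; lra).
  assert (Q : (0 <= Cmod (f' p))%R) by apply Cmod_ge_0.
  nra.
Qed.

Lemma Cmod_MVT_C (f f' : C -> C) (s w : C) (K : R) :
  (forall t, (0 <= t <= 1)%R -> Cder f (s + RtoC t * w) (f' (s + RtoC t * w))) ->
  (forall t, (0 <= t <= 1)%R -> (Cmod (f' (s + RtoC t * w)%C) <= K)%R) ->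
  (Cmod (f (s + w)%C - f s) <= K * Cmod w)%R.
Proof.
  intros Hd HK.
  replace (f (s + w) - f s) with (f (s + RtoC 1 * w) - f (s + RtoC 0 * w))
    by (rewrite Cmult_1_l, Cmult_0_l, Cplus_0_r; reflexivity).
  eapply Rle_trans; [apply (Cmod_MVT (fun t => f (s + RtoC t * w)) (fun t => f' (s + RtoC t * w) * w) 0 1 (K * Cmod w))|].
  - lra.
  - intros t Ht. apply (RCder_comp f (fun t => s + RtoC t * w)); [apply Hd, Ht|apply RCder_line].
  - intros t Ht. rewrite Cmod_mult. apply Rmult_le_compat_r; [apply Cmod_ge_0|apply HK, Ht].
  - lra.
Qed.

Section HolLimit.
Variables (f f' : nat -> C -> C) (F : C -> C) (p : C) (r M : R).
Hypothesis Hr : (0 < r)%R.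
Hypothesis Hder : forall n s, box p (4 * r) s -> Cder (f n) s (f' n s) /\ continuous (f' n) s.
Hypothesis HM : forall n s, box p (4 * r) s -> (Cmod (f n s) <= M)%R.
Hypothesis Hlim : forall s, box p (4 * r) s -> is_Clim (fun n => f n s) (F s).

Let scale t (w : C) q : (0 <= t <= 1)%R -> (Cmod w <= q)%R -> (Cmod (RtoC t * w) <= q)%R.
Proof.
  intros Ht Hw. rewrite Cmod_mult, Cmod_R, Rabs_pos_eq by lra. generalize (Cmod_ge_0 w). nra.
Qed.

Let box_le q q' s : (q <= q')%R -> box p q s -> box p q' s.
Proof. intros Hq [H1 H2]; split; lra. Qed.

(** Each estimate of this section spends a margin [r] of the box of half-side [4 * r]: one for the
    bound on [f'], one for moving along [w], one for the Cauchy estimate of [D2]. *)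
Let D1 n s : box p (3 * r) s -> (Cmod (f' n s) <= 2 * M / r)%R.
Proof.
  intros Hs. apply (Cauchy_estimate (box p (4 * r)) (f n) (f' n) s r M Hr (Hder n)); [|apply HM].
  intros u v Hu Hv. replace (4 * r)%R with (3 * r + r)%R by ring. apply box_plus_pair; assumption.
Qed.

Let L := (2 * (2 * M / r) / r)%R.

(** Cauchy's estimate is applied to the function [z -> f n (z + w) - f n z], which is of size
    [Cmod w] by [D1]. This gives a Lipschitz constant for [f' n] independent of [n] without touching
    second derivatives. *)
Let D2 n s w : box p r s -> (Cmod w <= r)%R -> (Cmod (f' n (s + w)%C - f' n s) <= L * Cmod w)%R.
Proof.
  intros Hs Hw.
  replace (L * Cmod w)%R with (2 * (2 * M / r * Cmod w) / r)%R by (unfold L; field; lra).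
  apply (Cauchy_estimate (box p (2 * r)) (fun z => f n (z + w) - f n z) (fun z => f' n (z + w) - f' n z) s r _ Hr).
  - intros z Hz.
    assert (Bz : box p (4 * r) z) by (apply (box_le (2 * r)); [lra|exact Hz]).
    assert (Bw : box p (4 * r) (z + w)).
    { apply (box_le (2 * r + r)); [lra|]. apply box_plus; assumption. }
    destruct (Hder n z Bz), (Hder n (z + w) Bw).
    assert (TR : Cder (fun z => z + w) z (RtoC 1)).
    { eapply Cder_eq; [apply Cder_plus; [apply Cder_id|apply Cder_const]|ring]. }
    split.
    + apply Cder_minus; [|assumption].
      eapply Cder_eq; [apply (Cder_comp (f n) (fun z => z + w)); eassumption|ring].
    + apply Cc_minus; [|assumption]. apply (continuous_comp (fun z => z + w) (f' n)); [|assumption].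
      apply Cc_plus; [apply Cc_id|apply Cc_const].
  - intros u v Hu Hv. replace (2 * r)%R with (r + r)%R by ring. apply box_plus_pair; assumption.
  - intros z Hz. apply (Cmod_MVT_C (f n) (f' n)).
    + intros t Ht. apply Hder. apply (box_le (2 * r + r)); [lra|].
      apply box_plus; [exact Hz|apply scale; assumption].
    + intros t Ht. apply D1. apply (box_le (2 * r + r)); [lra|].
      apply box_plus; [exact Hz|apply scale; assumption].
Qed.

Let L0 : (0 <= L)%R.
Proof.
  assert (B : box p (4 * r) p) by (split; rewrite Rminus_diag, Rabs_R0; lra).
  assert (0 <= M)%R by (eapply Rle_trans; [apply (Cmod_ge_0 (f 0%nat p))|apply HM, B]).
  unfold L. apply Rmult_le_pos; [|left; apply Rinv_0_lt_compat, Hr].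
  apply Rmult_le_pos; [lra|]. apply Rmult_le_pos; [lra|left; apply Rinv_0_lt_compat, Hr].
Qed.

(** Taylor remainder of second order, uniform in [n]: the mean value inequality for [f n] minus its
    linear part, with [D2] bounding the derivative. *)
Let D3 n s w : box p r s -> (Cmod w <= r)%R ->
  (Cmod (f n (s + w)%C - f n s - f' n s * w) <= L * Cmod w * Cmod w)%R.
Proof.
  intros Hs Hw.
  replace (f n (s + w) - f n s - f' n s * w) with
    ((f n (s + w) - f' n s * (s + w)) - (f n s - f' n s * s)) by ring.
  apply (Cmod_MVT_C (fun z => f n z - f' n s * z) (fun z => f' n z - f' n s)).
  - intros t Ht. apply Cder_minus.
    + apply Hder. apply (box_le (r + r)); [lra|]. apply box_plus; [exact Hs|apply scale; assumption].
    + eapply Cder_eq; [apply Cder_scal, Cder_id|ring].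
  - intros t Ht. eapply Rle_trans; [apply D2; [exact Hs|apply scale; assumption]|].
    apply Rmult_le_compat_l; [exact L0|]. apply scale; [exact Ht|lra].
Qed.

(** For a fixed step [h], the difference quotients of [f n] converge with [n], and by [D3] they are
    within [L * h] of [f' n s] whatever [n] is; so the derivatives form a Cauchy sequence. *)
Let Dlim s : box p r s -> exists g, is_Clim (fun n => f' n s) g.
Proof.
  intros Hs. apply Ccauchy_lim. intros eps He.
  pose (h := Rmin (r / 2) (eps / (4 * (L + 1)))).
  assert (Hh : (0 < h)%R) by (apply Rmin_pos; [lra|apply Rdiv_lt_0_compat; lra]).
  assert (Hh1 : (h <= r / 2)%R) by apply Rmin_l.
  assert (Hh2 : (h * (4 * (L + 1)) <= eps)%R).
  { apply Rle_trans with (eps / (4 * (L + 1)) * (4 * (L + 1)))%R.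
    - apply Rmult_le_compat_r; [lra|apply Rmin_r].
    - right; field; lra. }
  assert (Ch : Cmod (RtoC h) = h) by (rewrite Cmod_R; apply Rabs_pos_eq; lra).
  assert (B1 : box p (4 * r) s) by (apply (box_le r); [lra|exact Hs]).
  assert (B2 : box p (4 * r) (s + RtoC h)).
  { apply (box_le (r + r)); [lra|]. apply box_plus; [exact Hs|lra]. }
  assert (HE : (0 < eps * h / 16)%R) by (apply Rdiv_lt_0_compat; [apply Rmult_lt_0_compat; lra|lra]).
  destruct (Hlim _ B1 _ HE) as [N1 K1]. destruct (Hlim _ B2 _ HE) as [N2 K2].
  exists (max N1 N2). intros n m Hn Hm.
  assert (a1 := K1 n ltac:(lia)). assert (a2 := K1 m ltac:(lia)).
  assert (a3 := K2 n ltac:(lia)). assert (a4 := K2 m ltac:(lia)).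
  rewrite Cmod_minus_sym in a2, a4.
  assert (d1 := D3 n s (RtoC h) Hs ltac:(lra)). assert (d2 := D3 m s (RtoC h) Hs ltac:(lra)).
  rewrite Ch in d1, d2. rewrite Cmod_minus_sym in d1.
  assert (T : (Cmod ((f' n s - f' m s) * RtoC h) < eps * h)%R).
  { replace ((f' n s - f' m s) * RtoC h) with
     ((f' n s * RtoC h - (f n (s + RtoC h) - f n s)) + (f m (s + RtoC h) - f m s - f' m s * RtoC h)
      + ((f n (s + RtoC h) - F (s + RtoC h)) + (F (s + RtoC h) - f m (s + RtoC h))
      - ((f n s - F s) + (F s - f m s)))) by ring.
    eapply Rle_lt_trans; [apply Cmod_triangle|].
    eapply Rle_lt_trans; [apply Rplus_le_compat; [apply Cmod_triangle|apply Cmod_triangle]|].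
    rewrite Cmod_opp.
    eapply Rle_lt_trans; [apply Rplus_le_compat_l, Rplus_le_compat; apply Cmod_triangle|].
    replace (f' n s * RtoC h - (f n (s + RtoC h) - f n s)) with
      (f' n s * RtoC h - (f n (s + RtoC h) - f n s)) by ring.
    assert (L * h * h <= eps * h / 4)%R by nra.
    nra. }
  rewrite Cmod_mult, Ch in T. apply Rmult_lt_reg_r in T; assumption.
Qed.

(** In the limit, [D3] becomes a quadratic remainder bound for [F], which makes [g] its derivative,
    and [D2] a Lipschitz bound for [g]. *)
Lemma hol_limit : exists g : C -> C, forall s, box p r s ->
  Cder F s (g s) /\ continuous g s /\ is_Clim (fun n => f' n s) (g s).
Proof.
  exists (fun s => Clim_seq (fun n => f' n s)).
  assert (G : forall s, box p r s -> is_Clim (fun n => f' n s) (Clim_seq (fun n => f' n s))).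
  { intros s Hs. destruct (Dlim s Hs) as [g Hg]. rewrite (Clim_seq_unique _ _ Hg). exact Hg. }
  intros s Hs. split; [|split; [|apply G, Hs]].
  - set (g := Clim_seq (fun n => f' n s)).
    assert (E3 : forall w, (Cmod w <= r)%R -> (Cmod (F (s + w)%C - F s - g * w) <= L * Cmod w * Cmod w)%R).
    { intros w Hw.
      apply (is_Clim_bound (fun n => f n (s + w) - f n s - f' n s * w) _ _ 0).
      - apply is_Clim_minus; [apply is_Clim_minus; apply Hlim|].
        + apply (box_le (r + r)); [lra|]. apply box_plus; assumption.
        + apply (box_le r); [lra|exact Hs].
        + apply is_Clim_mult; [apply G, Hs|apply is_Clim_const].
      - intros n _; apply D3; assumption. }
    intros eps He.
    exists (Rmin r (eps / (L + 1))); split; [apply Rmin_pos; [lra|apply Rdiv_lt_0_compat; lra]|].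
    intros w Hw.
    assert (Hw1 : (Cmod (w - s) < r)%R) by (eapply Rlt_le_trans; [exact Hw|apply Rmin_l]).
    assert (Hw2 : (Cmod (w - s) < eps / (L + 1))%R) by (eapply Rlt_le_trans; [exact Hw|apply Rmin_r]).
    specialize (E3 (w - s) ltac:(lra)). replace (s + (w - s)) with w in E3 by ring.
    eapply Rle_trans; [exact E3|]. apply Rmult_le_compat_r; [apply Cmod_ge_0|].
    apply (Rmult_lt_compat_r (L + 1)) in Hw2; [|lra].
    unfold Rdiv in Hw2; rewrite Rmult_assoc, Rinv_l, Rmult_1_r in Hw2 by lra.
    generalize (Cmod_ge_0 (w - s)); nra.
  - apply Cc_eps. intros eps He. apply locally_C_eps.
    destruct (box_open _ _ _ Hs) as [d [Hd HB]].
    exists (Rmin (Rmin d r) (eps / (L + 1))); split; [repeat apply Rmin_pos; try lra; apply Rdiv_lt_0_compat; lra|].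
    intros y Hy.
    assert (Hw1 : (Cmod (y - s) < d /\ Cmod (y - s) < r /\ Cmod (y - s) < eps / (L + 1))%R).
    { generalize (Rmin_l (Rmin d r) (eps / (L + 1))) (Rmin_r (Rmin d r) (eps / (L + 1))) (Rmin_l d r) (Rmin_r d r). lra. }
    destruct Hw1 as (h1 & h2 & h3).
    apply Rle_lt_trans with (L * Cmod (y - s))%R.
    + apply (is_Clim_bound (fun n => f' n y - f' n s) _ _ 0).
      * apply is_Clim_minus; apply G; [apply HB, h1|exact Hs].
      * intros n _. replace y with (s + (y - s)) at 1 by ring. apply D2; [exact Hs|lra].
    + apply (Rmult_lt_compat_r (L + 1)) in h3; [|lra].
      unfold Rdiv in h3; rewrite Rmult_assoc, Rinv_l, Rmult_1_r in h3 by lra.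
      generalize (Cmod_ge_0 (y - s)); nra.
Qed.
End HolLimit.

Definition entire (f : C -> C) : Prop := hol (fun _ => True) f.

(** Local boundedness turns pointwise convergence into convergence of the derivatives, by the Cauchy
    estimates of the preceding section. The second conclusion serves to differentiate series term by
    term. *)
Lemma entire_limit (f : nat -> C -> C) (F : C -> C) :
  (forall n, entire (f n)) ->
  (forall r, exists M, forall n s, (Cmod s <= r)%R -> (Cmod (f n s) <= M)%R) ->
  (forall s, is_Clim (fun n => f n s) (F s)) ->
  entire F /\ forall s d, (forall n, Cder (f n) s (d n)) -> exists D, Cder F s D /\ is_Clim d D.
Proof.
  intros Hf HM Hl.
  pose (f' := fun n => proj1_sig (constructive_indefinite_description _ (Hf n))).
  assert (Hf' : forall n s, Cder (f n) s (f' n s) /\ continuous (f' n) s).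
  { intros n s. unfold f'. destruct (constructive_indefinite_description _ (Hf n)) as [g Hg]. apply Hg; trivial. }
  assert (K : forall p, exists g : C -> C, forall s, box p 1 s ->
    Cder F s (g s) /\ continuous g s /\ is_Clim (fun n => f' n s) (g s)).
  { intros p. destruct (HM (Cmod p + 8)%R) as [M HM'].
    apply (hol_limit f f' F p 1 M); [lra|auto| |auto].
    intros n s [H1 H2]. apply HM'.
    generalize (Cmod_ge_0 p) (Cmod_rev_triangle s p) (Cmod_le_ReIm (s - p)).
    unfold Cminus; rewrite re_plus, im_plus, re_opp, im_opp. unfold Rminus in *. lra. }
  (* Each box has its own derivative function; they are glued by evaluating the one about [p] at
     [p]. Uniqueness of derivatives then makes [F'] agree with each of them on its box. *)
  pose (F' := fun p => (proj1_sig (constructive_indefinite_description _ (K p))) p).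
  assert (HF' : forall p, Cder F p (F' p) /\ is_Clim (fun n => f' n p) (F' p)).
  { intros p. unfold F'. destruct (constructive_indefinite_description _ (K p)) as [g Hg]. simpl.
    destruct (Hg p) as (h1 & h2 & h3); [|split; assumption].
    apply box_Cmod. replace (p - p) with (RtoC 0) by ring. rewrite Cmod_0R; lra. }
  split.
  - exists F'. intros s _. split; [apply HF'|].
    destruct (K s) as [g Hg].
    assert (Bs : box s 1 s) by (apply box_Cmod; replace (s - s) with (RtoC 0) by ring; rewrite Cmod_0R; lra).
    apply (Cc_ext_loc g); [|apply Hg, Bs].
    apply locally_C_eps. exists 1%R; split; [lra|]. intros y Hy.
    destruct (Hg y (box_Cmod _ _ _ Hy)) as (h1 & _ & _).
    eapply Cder_unique; [exact h1|apply HF'].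
  - intros s d Hd. exists (F' s). split; [apply HF'|].
    apply (is_Clim_ext (fun n => f' n s)); [|apply HF'].
    exists 0%nat; intros n _. eapply Cder_unique; [apply Hf'|apply Hd].
Qed.

(** * The reciprocal Gamma function *)

Lemma RtoC_neq_0 (x : R) : x <> 0%R -> RtoC x <> RtoC 0.
Proof. intros H E; apply H; exact (RtoC_inj _ _ E). Qed.

Lemma Clog_RtoC (x : R) : (0 < x)%R -> Clog (RtoC x) = RtoC (ln x).
Proof.
  intros Hx. unfold Clog, Carg. rewrite Cmod_R, Rabs_pos_eq by lra. simpl.
  destruct (Rle_dec 0 0) as [_|n]; [|lra].
  replace (x / x)%R with 1%R by (field; lra). rewrite acos_1. reflexivity.
Qed.

Definition pochC (n : nat) (s : C) : C := Cprod (map (fun k => s + RtoC (INR k)) (seq 0 n)).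

Definition gauss (n : nat) (s : C) : C :=
  pochC (S n) s / (RtoC (INR (fact n)) * Cpower (RtoC (INR n)) s).

Lemma Cprod_app l1 l2 : Cprod (l1 ++ l2) = Cprod l1 * Cprod l2.
Proof. induction l1; simpl; [ring|]. rewrite IHl1; ring. Qed.

Lemma pochC_S n s : pochC (S n) s = pochC n s * (s + RtoC (INR n)).
Proof.
  unfold pochC. rewrite seq_S, map_app, Cprod_app. simpl. ring.
Qed.

Lemma pochC_shift n s : pochC (S n) s = s * pochC n (s + RtoC 1).
Proof.
  induction n; [unfold pochC; simpl; ring|].
  rewrite pochC_S, IHn, (pochC_S n (s + RtoC 1)), S_INR, RtoC_plus. ring.
Qed.

Lemma gauss_pow n s : (0 < n)%nat -> Cpower (RtoC (INR n)) s = Cexp (s * RtoC (ln (INR n))).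
Proof. intros Hn; unfold Cpower; rewrite Clog_RtoC; [reflexivity|]. apply lt_0_INR, Hn. Qed.

Lemma RtoC_fact_neq_0 n : RtoC (INR (fact n)) <> RtoC 0.
Proof. apply RtoC_neq_0, INR_fact_neq_0. Qed.

Lemma RtoC_INR_neq_0 n : (0 < n)%nat -> RtoC (INR n) <> RtoC 0.
Proof. intros H; apply RtoC_neq_0, not_0_INR; lia. Qed.

Definition gstep (n : nat) (s : C) : C :=
  (RtoC 1 + s / RtoC (INR (n + 2))) * Cexp (- (s * RtoC (ln (INR (n + 2)) - ln (INR (n + 1))))).

Lemma gauss_S n s : gauss (S (S n)) s = gauss (S n) s * gstep n s.
Proof.
  unfold gauss, gstep. rewrite (pochC_S (S (S n))), !gauss_pow by lia.
  replace (n + 2)%nat with (S (S n)) by lia. replace (n + 1)%nat with (S n) by lia.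
  replace (s * RtoC (ln (INR (S (S n))))) with
    (s * RtoC (ln (INR (S n))) + s * RtoC (ln (INR (S (S n))) - ln (INR (S n))))
    by (rewrite RtoC_minus; ring).
  rewrite Cexp_plus, Cexp_opp. rewrite (fact_simpl (S n)), mult_INR, RtoC_mult.
  field. repeat split; try apply Cexp_neq_0; try apply RtoC_fact_neq_0; apply RtoC_INR_neq_0; lia.
Qed.

Lemma ln_step n : (/ INR (n + 2) <= ln (INR (n + 2)) - ln (INR (n + 1)) <= / INR (n + 1))%R.
Proof.
  assert (H1 : (0 < INR (n + 1))%R) by (apply lt_0_INR; lia).
  assert (E : INR (n + 2) = (INR (n + 1) + 1)%R) by (rewrite <- S_INR; f_equal; lia).
  rewrite E. set (x := INR (n + 1)) in *.
  assert (L : forall y, (0 < y)%R -> (ln y <= y - 1)%R).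
  { intros y Hy. rewrite <- (ln_exp (y - 1)). apply ln_le; [exact Hy|].
    generalize (exp_ineq1_le (y - 1)); lra. }
  split.
  - assert (A := L (x / (x + 1))%R ltac:(apply Rdiv_lt_0_compat; lra)).
    unfold Rdiv in A. rewrite ln_mult, ln_Rinv in A by (try apply Rinv_0_lt_compat; lra).
    replace (x * / (x + 1) - 1)%R with (- / (x + 1))%R in A by (field; lra). lra.
  - assert (A := L ((x + 1) / x)%R ltac:(apply Rdiv_lt_0_compat; lra)).
    unfold Rdiv in A. rewrite ln_mult, ln_Rinv in A by (try apply Rinv_0_lt_compat; lra).
    replace ((x + 1) * / x - 1)%R with (/ x)%R in A by (field; lra). lra.
Qed.

(** The factor is 1 up to a term of order [1 / n^2]. That order is written as a difference of
    consecutive inverses so that sums and products over [n] telescope. *)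
Lemma gstep_bound (r : R) : (0 <= r)%R -> exists D, (0 <= D)%R /\ forall n s, (Cmod s <= r)%R ->
  (Cmod (gstep n s - RtoC 1) <= D * (/ INR (n + 1) - / INR (n + 2)))%R.
Proof.
  intros Hr. exists (r + r * r + 2 * ((1 + r) * (r * r * exp r)))%R.
  assert (Pe := exp_pos r).
  split. { assert (0 <= (1 + r) * (r * r * exp r))%R by (repeat apply Rmult_le_pos; lra). nra. }
  intros n s Hs.
  assert (H1 : (1 <= INR (n + 1))%R) by (apply (le_INR 1); lia).
  assert (E : INR (n + 2) = (INR (n + 1) + 1)%R) by (rewrite <- S_INR; f_equal; lia).
  assert (Hl := ln_step n). unfold gstep. set (d := (ln (INR (n + 2)) - ln (INR (n + 1)))%R) in *.
  rewrite E in *. set (x := INR (n + 1)) in *.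
  set (w := - (s * RtoC d)).
  assert (Ix : (0 < / (x + 1) <= / x /\ / x <= 1)%R).
  { split; [split; [apply Rinv_0_lt_compat; lra|apply Rinv_le_contravar; lra]|].
    rewrite <- Rinv_1; apply Rinv_le_contravar; lra. }
  assert (Dx : (/ x - / (x + 1) = / x * / (x + 1))%R) by (field; lra).
  assert (Dx2 : (/ x * / x <= 2 * (/ x * / (x + 1)))%R).
  { assert (/ x <= 2 * / (x + 1))%R; [|nra].
    apply (Rmult_le_reg_l (x * (x + 1))); [nra|]. field_simplify; [lra|lra|lra]. }
  assert (Hw : (Cmod w <= r * d)%R).
  { unfold w. rewrite Cmod_opp, Cmod_mult, Cmod_R, Rabs_pos_eq by lra. apply Rmult_le_compat_r; lra. }
  assert (B := Cexp_bound2 w).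
  assert (B' : (Cmod (Cexp w - RtoC 1 - w) <= r * r * exp r * (/ x * / x))%R).
  { eapply Rle_trans; [exact B|].
    assert (Cw := Cmod_ge_0 w).
    apply Rle_trans with ((r * d) ^ 2 * exp r)%R.
    - apply Rmult_le_compat; [nra|left; apply exp_pos|nra|].
      assert (h : (Cmod w <= r)%R) by nra.
      destruct h as [h|h]; [left; apply exp_increasing, h|rewrite h; lra].
    - replace ((r * d) ^ 2 * exp r)%R with (r * r * exp r * (d * d))%R by ring.
      apply Rmult_le_compat_l; [repeat apply Rmult_le_pos; lra|]. apply Rmult_le_compat; lra. }
  (* The first-order parts of the two factors, [s / (x + 1)] and [- s d], nearly cancel; there
     remain their product and the second-order remainder of the exponential. *)
  replace ((RtoC 1 + s / RtoC (x + 1)) * Cexp w - RtoC 1) with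
    (s * RtoC (/ (x + 1) - d) + (- (s * s * RtoC (d * / (x + 1))) +
     (RtoC 1 + s * RtoC (/ (x + 1))) * (Cexp w - RtoC 1 - w))).
  2:{ unfold w. rewrite RtoC_minus, RtoC_mult, !RtoC_inv by lra.
      field. apply RtoC_neq_0; lra. }
  assert (T1 : (Cmod (s * RtoC (/ (x + 1) - d)) <= r * (/ x * / (x + 1)))%R).
  { rewrite Cmod_mult, Cmod_R. apply Rmult_le_compat; [apply Cmod_ge_0|apply Rabs_pos|lra|].
    rewrite Rabs_left1 by lra. lra. }
  assert (T2 : (Cmod (- (s * s * RtoC (d * / (x + 1)))) <= r * r * (/ x * / (x + 1)))%R).
  { rewrite Cmod_opp, !Cmod_mult, Cmod_R.
    assert (0 <= d * / (x + 1))%R by (apply Rmult_le_pos; lra).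
    rewrite Rabs_pos_eq by assumption.
    apply Rmult_le_compat; [generalize (Cmod_ge_0 s); nra|assumption|generalize (Cmod_ge_0 s); nra|].
    apply Rmult_le_compat_r; lra. }
  assert (T3 : (Cmod ((RtoC 1 + s * RtoC (/ (x + 1))) * (Cexp w - RtoC 1 - w)) <=
     (1 + r) * (r * r * exp r * (/ x * / x)))%R).
  { rewrite Cmod_mult. apply Rmult_le_compat; [apply Cmod_ge_0|apply Cmod_ge_0| |exact B'].
    eapply Rle_trans; [apply Cmod_triangle|]. rewrite Cmod_mult, !Cmod_R.
    rewrite (Rabs_pos_eq 1), (Rabs_pos_eq (/ (x + 1))) by lra.
    generalize (Cmod_ge_0 s). nra. }
  assert (T4 : ((1 + r) * (r * r * exp r * (/ x * / x)) <= 2 * ((1 + r) * (r * r * exp r)) * (/ x * / (x + 1)))%R).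
  { assert (0 <= (1 + r) * (r * r * exp r))%R by (repeat apply Rmult_le_pos; lra). nra. }
  eapply Rle_trans; [apply Cmod_triangle|].
  eapply Rle_trans; [apply Rplus_le_compat_l, Cmod_triangle|].
  rewrite Dx. lra.
Qed.

Section Products.
Variables (b : nat -> C) (D : R).
Hypothesis HD : (0 <= D)%R.
Hypothesis Hb : forall n, (Cmod (b (S n) - b n) <= Cmod (b n) * (D * (/ INR (n + 1) - / INR (n + 2))))%R.

Let gap n : (0 <= / INR (n + 1) - / INR (n + 2))%R.
Proof.
  assert (1 <= INR (n + 1))%R by (apply (le_INR 1); lia).
  assert (INR (n + 1) <= INR (n + 2))%R by (apply le_INR; lia).
  assert (/ INR (n + 2) <= / INR (n + 1))%R by (apply Rinv_le_contravar; lra). lra.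
Qed.

(** Each step multiplies the modulus by at most [1 + x <= exp x], and the exponents telescope. *)
Let bd n : (Cmod (b n) <= Cmod (b 0%nat) * exp (D * (1 - / INR (n + 1))))%R.
Proof.
  induction n.
  - simpl. rewrite Rinv_1, Rminus_diag, Rmult_0_r, exp_0. lra.
  - set (x := (D * (/ INR (n + 1) - / INR (n + 2)))%R).
    assert (Hx : (0 <= x)%R) by (apply Rmult_le_pos; [exact HD|apply gap]).
    apply Rle_trans with (Cmod (b n) * (1 + x))%R.
    { generalize (Hb n) (Cmod_rev_triangle (b (S n)) (b n)). fold x. nra. }
    apply Rle_trans with (Cmod (b 0%nat) * exp (D * (1 - / INR (n + 1))) * exp x)%R.
    { apply Rmult_le_compat; [apply Cmod_ge_0|lra|exact IHn|apply exp_ineq1_le]. }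
    rewrite Rmult_assoc, <- exp_plus. right; do 2 f_equal. unfold x.
    replace (S n + 1)%nat with (n + 2)%nat by lia. ring.
Qed.

Lemma product_bound n : (Cmod (b n) <= Cmod (b 0%nat) * exp D)%R.
Proof.
  eapply Rle_trans; [apply bd|]. apply Rmult_le_compat_l; [apply Cmod_ge_0|].
  assert (0 < / INR (n + 1))%R by (apply Rinv_0_lt_compat, lt_0_INR; lia).
  assert (h : (D * (1 - / INR (n + 1)) <= D)%R) by nra.
  destruct h as [h|h]; [left; apply exp_increasing, h|rewrite h; lra].
Qed.

Lemma product_cv : exists l, is_Clim b l.
Proof.
  set (K := (Cmod (b 0%nat) * exp D * D)%R).
  assert (HK : (0 <= K)%R).
  { unfold K. repeat apply Rmult_le_pos; [apply Cmod_ge_0|left; apply exp_pos|exact HD]. }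
  assert (T : forall n k, (Cmod (b (n + k)%nat - b n) <= K * (/ INR (n + 1) - / INR (n + k + 1)))%R).
  { intros n k. induction k.
    - rewrite Nat.add_0_r. replace (b n - b n) with (RtoC 0) by ring. rewrite Cmod_0R. lra.
    - rewrite Nat.add_succ_r.
      eapply Rle_trans; [apply (Cmod_triangle3 _ (b (n + k)%nat))|].
      assert (A := Hb (n + k)). assert (B := product_bound (n + k)).
      assert (A' : (Cmod (b (S (n + k)) - b (n + k)%nat) <= K * (/ INR (n + k + 1) - / INR (n + k + 2)))%R).
      { eapply Rle_trans; [exact A|]. unfold K. rewrite <- Rmult_assoc.
        apply Rmult_le_compat_r; [apply gap|]. apply Rmult_le_compat_r; [exact HD|exact B]. }
      replace (S (n + k) + 1)%nat with (n + k + 2)%nat by lia. lra. }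
  apply Ccauchy_lim. intros eps He.
  destruct (archimed_cor1 (eps / (2 * (K + 1)))%R ltac:(apply Rdiv_lt_0_compat; lra)) as [N [HN HN0]].
  exists N. intros n m Hn Hm.
  assert (Z : forall j, (N <= j)%nat -> (Cmod (b j - b N) < eps / 2)%R).
  { intros j Hj. replace j with (N + (j - N))%nat by lia.
    eapply Rle_lt_trans; [apply T|].
    assert (0 < / INR (N + (j - N) + 1))%R by (apply Rinv_0_lt_compat, lt_0_INR; lia).
    assert (0 < INR N)%R by (apply lt_0_INR; lia).
    assert (/ INR (N + 1) <= / INR N)%R by (apply Rinv_le_contravar; [assumption|apply le_INR; lia]).
    apply Rle_lt_trans with (K * / INR N)%R; [apply Rmult_le_compat_l; lra|].
    apply Rle_lt_trans with ((K + 1) * / INR N)%R; [apply Rmult_le_compat_r; [left; apply Rinv_0_lt_compat|]; lra|].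
    apply (Rmult_lt_compat_l (K + 1)) in HN; [|lra].
    replace ((K + 1) * (eps / (2 * (K + 1))))%R with (eps / 2)%R in HN by (field; lra). exact HN. }
  eapply Rle_lt_trans; [apply (Cmod_triangle3 _ (b N))|].
  rewrite (Cmod_minus_sym (b N)). generalize (Z n Hn) (Z m Hm). lra.
Qed.
End Products.

Lemma gauss_step_bound r : (0 <= r)%R -> exists D, (0 <= D)%R /\ forall n s, (Cmod s <= r)%R ->
  (Cmod (gauss (S (S n)) s - gauss (S n) s) <=
    Cmod (gauss (S n) s) * (D * (/ INR (n + 1) - / INR (n + 2))))%R.
Proof.
  intros Hr. destruct (gstep_bound r Hr) as [D [HD H]]. exists D; split; [exact HD|].
  intros n s Hs. rewrite gauss_S.
  replace (gauss (S n) s * gstep n s - gauss (S n) s) with (gauss (S n) s * (gstep n s - RtoC 1)) by ring.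
  rewrite Cmod_mult. apply Rmult_le_compat_l; [apply Cmod_ge_0|apply H, Hs].
Qed.

Lemma rGamma_Clim s : is_Clim (fun n => gauss n s) (rGamma s).
Proof.
  destruct (gauss_step_bound (Cmod s) (Cmod_ge_0 s)) as [D [HD H]].
  destruct (product_cv (fun n => gauss (S n) s) D HD (fun n => H n s (Rle_refl _))) as [l Hl].
  (* The products start at index 1: the term of index 0 contains a power of 0. *)
  assert (L : is_Clim (fun n => gauss n s) l) by (apply (is_Clim_shift _ _ 1); exact Hl).
  replace (rGamma s) with l; [exact L|]. symmetry. exact (Clim_seq_unique _ _ L).
Qed.

Lemma hol_pochC U n : hol U (pochC n).
Proof.
  induction n.
  - apply (hol_ext U (fun _ => RtoC 1)); [intros; reflexivity|apply hol_const].
  - apply (hol_ext U (fun s => pochC n s * (s + RtoC (INR n)))); [intros; symmetry; apply pochC_S|].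
    apply hol_mult; [exact IHn|]. apply hol_plus; [apply hol_id|apply hol_const].
Qed.

Lemma entire_gauss n : entire (gauss (S n)).
Proof.
  apply (hol_ext _ (fun s => pochC (S (S n)) s * (/ RtoC (INR (fact (S n))) * Cexp (- (s * RtoC (ln (INR (S n)))))))).
  { intros s. unfold gauss. rewrite gauss_pow, Cexp_opp by lia. field.
    split; [apply Cexp_neq_0|apply RtoC_fact_neq_0]. }
  apply hol_mult; [apply hol_pochC|]. apply hol_mult; [apply hol_const|].
  apply hol_exp, hol_opp, hol_mult; [apply hol_id|apply hol_const].
Qed.

Lemma pochC_bound n s r : (Cmod s <= r)%R -> (Cmod (pochC n s) <= (r + INR n) ^ n)%R.
Proof.
  intros Hs. assert (0 <= r)%R by (generalize (Cmod_ge_0 s); lra).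
  assert (K : forall m, (m <= n)%nat -> (Cmod (pochC m s) <= (r + INR n) ^ m)%R).
  { induction m; intros Hm.
    - unfold pochC; simpl. rewrite Cmod_R, Rabs_R1; lra.
    - rewrite pochC_S, Cmod_mult. simpl. rewrite Rmult_comm. apply Rmult_le_compat; try apply Cmod_ge_0.
      + eapply Rle_trans; [apply Cmod_triangle|]. rewrite Cmod_R, Rabs_pos_eq by apply pos_INR.
        apply Rplus_le_compat; [exact Hs|apply le_INR; lia].
      + apply IHm; lia. }
  apply K; lia.
Qed.

Lemma entire_rGamma : entire rGamma.
Proof.
  apply (entire_limit (fun n => gauss (S n))).
  - apply entire_gauss.
  - intros r. destruct (Rle_dec 0 r) as [Hr|Hr].
    2:{ exists 0%R. intros n s Hs. generalize (Cmod_ge_0 s); lra. }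
    destruct (gauss_step_bound r Hr) as [D [HD H]].
    exists ((r + INR 2) ^ 2 * exp D)%R. intros n s Hs.
    eapply Rle_trans; [apply (product_bound (fun n => gauss (S n) s) D HD (fun n => H n s Hs))|].
    apply Rmult_le_compat_r; [left; apply exp_pos|].
    unfold gauss. rewrite gauss_pow by lia. simpl (INR 1). rewrite ln_1.
    replace (s * RtoC 0) with (RtoC 0) by ring. rewrite Cexp_0. simpl (fact 1). simpl (INR 1).
    replace (pochC 2 s / (RtoC 1 * RtoC 1)) with (pochC 2 s) by field.
    apply pochC_bound, Hs.
  - intros s. apply (is_Clim_subseq (fun n => gauss n s) _ S); [lia|]. apply rGamma_Clim.
Qed.

Lemma is_Clim_inv_INR : is_Clim (fun n => / RtoC (INR n)) (RtoC 0).
Proof.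
  intros eps He. destruct (archimed_cor1 eps He) as [N [HN HN0]]. exists N. intros n Hn.
  assert (0 < INR N)%R by (apply lt_0_INR; lia).
  assert (INR N <= INR n)%R by (apply le_INR; lia).
  replace (/ RtoC (INR n) - RtoC 0) with (RtoC (/ INR n)).
  - rewrite Cmod_R, Rabs_pos_eq by (left; apply Rinv_0_lt_compat; lra).
    eapply Rle_lt_trans; [|exact HN]. apply Rinv_le_contravar; lra.
  - rewrite RtoC_inv by lra. ring.
Qed.

Lemma is_Clim_ratio c d : is_Clim (fun n => (c + RtoC (INR n) * d) / RtoC (INR n)) d.
Proof.
  apply (is_Clim_ext (fun n => c * / RtoC (INR n) + d)).
  - exists 1%nat; intros n Hn. field. apply RtoC_INR_neq_0; lia.
  - apply (is_Clim_eq _ (c * RtoC 0 + d)); [|ring].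
    apply is_Clim_plus; [apply is_Clim_scal, is_Clim_inv_INR|apply is_Clim_const].
Qed.

(** [s * gauss n (s + 1)] is [gauss n s] times [(s + 1 + n) / n], a factor that tends to 1. *)
Lemma rGamma_rec s : rGamma s = s * rGamma (s + RtoC 1).
Proof.
  apply (is_Clim_unique (fun n => gauss n s * ((s + RtoC 1 + RtoC (INR n) * RtoC 1) / RtoC (INR n)))).
  - apply (is_Clim_eq _ (rGamma s * RtoC 1)); [|ring].
    apply is_Clim_mult; [apply rGamma_Clim|apply is_Clim_ratio].
  - apply (is_Clim_ext (fun n => s * gauss n (s + RtoC 1))); [|apply is_Clim_scal, rGamma_Clim].
    exists 1%nat; intros n Hn. unfold gauss. rewrite !gauss_pow by lia.
    replace ((s + RtoC 1) * RtoC (ln (INR n))) with (s * RtoC (ln (INR n)) + RtoC (ln (INR n))) by ring.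
    rewrite Cexp_plus. replace (Cexp (RtoC (ln (INR n)))) with (RtoC (INR n)).
    2:{ rewrite Cexp_RtoC, exp_ln by (apply lt_0_INR; lia). reflexivity. }
    assert (E : s * pochC (S n) (s + RtoC 1) = pochC (S n) s * (s + RtoC 1 + RtoC (INR n))).
    { rewrite <- pochC_shift, (pochC_S (S n)), S_INR, RtoC_plus. ring. }
    replace (s * (pochC (S n) (s + RtoC 1) / (RtoC (INR (fact n)) * (Cexp (s * RtoC (ln (INR n))) * RtoC (INR n)))))
     with (s * pochC (S n) (s + RtoC 1) / (RtoC (INR (fact n)) * (Cexp (s * RtoC (ln (INR n))) * RtoC (INR n)))).
    + rewrite E. field. repeat split; [apply RtoC_INR_neq_0; lia|apply Cexp_neq_0|apply RtoC_fact_neq_0].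
    + field. repeat split; [apply RtoC_INR_neq_0; lia|apply Cexp_neq_0|apply RtoC_fact_neq_0].
Qed.

Lemma pochC_1 n : pochC n (RtoC 1) = RtoC (INR (fact n)).
Proof.
  induction n; [reflexivity|]. rewrite pochC_S, IHn, fact_simpl, mult_INR, S_INR, RtoC_mult, RtoC_plus. ring.
Qed.

Lemma gauss_1 n : (0 < n)%nat -> gauss n (RtoC 1) = (RtoC 1 + RtoC (INR n) * RtoC 1) / RtoC (INR n).
Proof.
  intros Hn. unfold gauss. rewrite pochC_1, gauss_pow by assumption.
  replace (Cexp (RtoC 1 * RtoC (ln (INR n)))) with (RtoC (INR n)).
  - rewrite fact_simpl, mult_INR, S_INR, RtoC_mult, RtoC_plus. field.
    split; [apply RtoC_INR_neq_0, Hn|apply RtoC_fact_neq_0].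
  - rewrite Cmult_1_l, Cexp_RtoC, exp_ln by (apply lt_0_INR; lia). reflexivity.
Qed.

Lemma rGamma_1 : rGamma (RtoC 1) = RtoC 1.
Proof.
  apply (is_Clim_unique (fun n => gauss n (RtoC 1))); [apply rGamma_Clim|].
  apply (is_Clim_ext (fun n => (RtoC 1 + RtoC (INR n) * RtoC 1) / RtoC (INR n))); [|apply is_Clim_ratio].
  exists 1%nat; intros n Hn; symmetry; apply gauss_1; lia.
Qed.

Lemma rGamma_nat k : rGamma (RtoC (INR k) + RtoC 1) = / RtoC (INR (fact k)).
Proof.
  induction k.
  - simpl. rewrite Cplus_0_l, rGamma_1. field.
  - rewrite rGamma_rec in IHk. rewrite S_INR, RtoC_plus.
    assert (N : RtoC (INR k) + RtoC 1 <> RtoC 0) by (rewrite <- RtoC_plus, <- S_INR; apply RtoC_INR_neq_0; lia).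
    rewrite fact_simpl, mult_INR, S_INR, RtoC_mult, RtoC_plus.
    replace (rGamma (RtoC (INR k) + RtoC 1 + RtoC 1)) with
     (/ (RtoC (INR k) + RtoC 1) * ((RtoC (INR k) + RtoC 1) * rGamma (RtoC (INR k) + RtoC 1 + RtoC 1)))
     by (field; exact N).
    rewrite IHk. field. split; [apply RtoC_fact_neq_0|exact N].
Qed.

Lemma rGamma_0 : rGamma (RtoC 0) = RtoC 0.
Proof. rewrite rGamma_rec; ring. Qed.

Lemma rGamma_opp_nat k : rGamma (- RtoC (INR k)) = RtoC 0.
Proof.
  induction k; [simpl; replace (- RtoC 0) with (RtoC 0) by ring; apply rGamma_0|].
  rewrite rGamma_rec, S_INR, RtoC_plus.
  replace (- (RtoC (INR k) + RtoC 1) + RtoC 1) with (- RtoC (INR k)) by ring. rewrite IHk; ring.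
Qed.

(** * Reflection and duplication formulas *)

Definition Ccos (w : C) : C := (Cexp (Ci * w) + Cexp (- (Ci * w))) / RtoC 2.

Lemma Ci_neq_0 : Ci <> RtoC 0.
Proof. intros E; apply (f_equal Im) in E; simpl in E; lra. Qed.

Lemma Ccos_0 : Ccos (RtoC 0) = RtoC 1.
Proof.
  unfold Ccos. replace (- (Ci * RtoC 0)) with (RtoC 0) by ring.
  replace (Ci * RtoC 0) with (RtoC 0) by ring. rewrite Cexp_0. field.
Qed.

Lemma Csin_0 : Csin (RtoC 0) = RtoC 0.
Proof.
  unfold Csin. replace (- (Ci * RtoC 0)) with (RtoC 0) by ring.
  replace (Ci * RtoC 0) with (RtoC 0) by ring. rewrite Cexp_0. field. apply Ci_neq_0.
Qed.

Lemma RCder_cos_line (c : C) (t : R) :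
  RCder (fun u => Ccos (RtoC u * c)) t (- c * Csin (RtoC t * c)).
Proof.
  apply (RCder_ext (fun u => / RtoC 2 * (Cexp (RtoC u * (Ci * c)) + Cexp (RtoC u * (- (Ci * c)))))).
  { intros u. unfold Ccos. replace (RtoC u * (Ci * c)) with (Ci * (RtoC u * c)) by ring.
    replace (RtoC u * - (Ci * c)) with (- (Ci * (RtoC u * c))) by ring. field. }
  eapply RCder_eq; [apply RCder_scalC, RCder_plus; apply RCder_Cexp_line|].
  unfold Csin. replace (RtoC t * (Ci * c)) with (Ci * (RtoC t * c)) by ring.
  replace (RtoC t * - (Ci * c)) with (- (Ci * (RtoC t * c))) by ring.
  replace (- c * ((Cexp (Ci * (RtoC t * c)) - Cexp (- (Ci * (RtoC t * c)))) / (RtoC 2 * Ci))) with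
   (/ RtoC 2 * - c * (Cexp (Ci * (RtoC t * c)) - Cexp (- (Ci * (RtoC t * c)))) * / Ci) by (field; apply Ci_neq_0).
  rewrite Ci_inv. ring.
Qed.

Lemma RCder_sin_line (c : C) (t : R) :
  RCder (fun u => Csin (RtoC u * c)) t (c * Ccos (RtoC t * c)).
Proof.
  apply (RCder_ext (fun u => / (RtoC 2 * Ci) * (Cexp (RtoC u * (Ci * c)) - Cexp (RtoC u * (- (Ci * c)))))).
  { intros u. unfold Csin. replace (RtoC u * (Ci * c)) with (Ci * (RtoC u * c)) by ring.
    replace (RtoC u * - (Ci * c)) with (- (Ci * (RtoC u * c))) by ring. field. apply Ci_neq_0. }
  eapply RCder_eq; [apply RCder_scalC, RCder_minus; apply RCder_Cexp_line|].
  unfold Ccos. replace (RtoC t * (Ci * c)) with (Ci * (RtoC t * c)) by ring.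
  replace (RtoC t * - (Ci * c)) with (- (Ci * (RtoC t * c))) by ring. field. apply Ci_neq_0.
Qed.

Lemma Ccos_bound (w : C) : (Cmod (Ccos w - RtoC 1) <= Cmod w ^ 2 * exp (Cmod w))%R.
Proof.
  unfold Ccos.
  replace ((Cexp (Ci * w) + Cexp (- (Ci * w))) / RtoC 2 - RtoC 1) with
   (RtoC (/ 2) * ((Cexp (Ci * w) - RtoC 1 - Ci * w) + (Cexp (- (Ci * w)) - RtoC 1 - - (Ci * w))))
   by (rewrite RtoC_inv by lra; field).
  assert (E : Cmod (Ci * w) = Cmod w).
  { rewrite Cmod_mult. replace (Cmod Ci) with 1%R; [ring|].
    unfold Cmod; simpl. replace (0 * (0 * 1) + 1 * (1 * 1))%R with 1%R by ring. symmetry; apply sqrt_1. }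
  rewrite Cmod_mult, Cmod_R, Rabs_pos_eq by lra.
  assert (B1 := Cexp_bound2 (Ci * w)). assert (B2 := Cexp_bound2 (- (Ci * w))).
  rewrite Cmod_opp, E in B2. rewrite E in B1.
  generalize (Cmod_triangle (Cexp (Ci * w) - RtoC 1 - Ci * w) (Cexp (- (Ci * w)) - RtoC 1 - - (Ci * w))). lra.
Qed.

Lemma Cc_cos_line c (t : R) : continuous (fun u : R => Ccos (RtoC u * c)) t.
Proof. apply (ex_derive_continuous (V := C_R_NormedModule)). eexists; apply RCder_cos_line. Qed.

(** The integrals behind an elementary proof of Euler's product for the sine: integration by parts
    relates consecutive [m] by the factor [m^2 - x^2], the case [m = 0] is a sine, and for large [m]
    the weight concentrates at [t = 0], where the first cosine is 1. *)
Definition cosint (m : nat) (x : C) : C :=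
  CRInt (fun t => Ccos (RtoC t * (RtoC 2 * x)) * RtoC (cos t ^ (2 * m))) 0 (PI / 2).

Lemma cosint_correct m x :
  CisRInt (fun t => Ccos (RtoC t * (RtoC 2 * x)) * RtoC (cos t ^ (2 * m))) 0 (PI / 2) (cosint m x).
Proof.
  apply CisRInt_cont; [generalize PI2_1; lra|]. intros t _. apply Cc_mult; [apply Cc_cos_line|].
  apply Cc_RtoC. apply (ex_derive_continuous (V := R_NormedModule)). auto_derive. trivial.
Qed.

(* Two integrations by parts, packaged as an explicit primitive. *)
Lemma cosint_rec m x :
  RtoC (INR (2 * m + 2)) * RtoC (INR (2 * m + 1)) * cosint m x =
  RtoC 4 * (RtoC (INR (m + 1)) * RtoC (INR (m + 1)) - x * x) * cosint (m + 1) x.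
Proof.
  set (c := RtoC 2 * x).
  pose (G := fun t : R => RtoC (INR (2 * m + 2) * (cos t ^ (2 * m + 1) * sin t)) * Ccos (RtoC t * c)
     - c * (RtoC (cos t ^ (2 * m + 2)) * Csin (RtoC t * c))).
  pose (g := fun t : R => RtoC 4 * (RtoC (INR (m + 1)) * RtoC (INR (m + 1)) - x * x) *
      (Ccos (RtoC t * c) * RtoC (cos t ^ (2 * (m + 1))))
     - RtoC (INR (2 * m + 2)) * RtoC (INR (2 * m + 1)) * (Ccos (RtoC t * c) * RtoC (cos t ^ (2 * m)))).
  assert (I1 : CisRInt g 0 (PI / 2) (RtoC 4 * (RtoC (INR (m + 1)) * RtoC (INR (m + 1)) - x * x) * cosint (m + 1) x
     - RtoC (INR (2 * m + 2)) * RtoC (INR (2 * m + 1)) * cosint m x)).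
  { apply CisRInt_minus; apply CisRInt_Cmult; apply cosint_correct. }
  assert (RR : forall (f : R -> R) t d, is_derive f t d -> RCder (fun u => RtoC (f u)) t (RtoC d)).
  { intros f t d Hd. apply RCder_comp_iff; simpl; split; [exact Hd|].
    apply (is_derive_const (K := R_AbsRing) (V := R_NormedModule) 0%R t). }
  assert (I2 : CisRInt g 0 (PI / 2) (G (PI / 2)%R - G 0%R)).
  { apply CisRInt_derive; [generalize PI2_1; lra| |].
    - intros t _. eapply RCder_eq.
      + unfold G. apply RCder_minus.
        * apply (RCder_mult (fun t => RtoC (INR (2 * m + 2) * (cos t ^ (2 * m + 1) * sin t)))).
          -- apply RR. auto_derive; [trivial|reflexivity].
          -- apply RCder_cos_line.
        * apply RCder_scalC. apply (RCder_mult (fun t => RtoC (cos t ^ (2 * m + 2)))).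
          -- apply RR. auto_derive; [trivial|reflexivity].
          -- apply RCder_sin_line.
      + unfold g.
        replace (m + (m + 0) + 1)%nat with (S (m + (m + 0))) by lia.
        replace (m + (m + 0) + 2)%nat with (S (S (m + (m + 0)))) by lia.
        replace (2 * m + 2)%nat with (S (S (2 * m))) by lia. replace (2 * (m + 1))%nat with (S (S (2 * m))) by lia.
        replace (2 * m + 1)%nat with (S (2 * m)) by lia. replace (m + 1)%nat with (S m) by lia.
        simpl Nat.pred. simpl (cos t ^ S _)%R.
        rewrite !S_INR. replace (m + (m + 0))%nat with (2 * m)%nat by lia. rewrite (mult_INR 2). simpl (INR 2).
        set (M := INR m). set (q := (cos t ^ (2 * m))%R).
        unfold c.
        assert (E : (sin t * sin t = 1 - cos t * cos t)%R) by (generalize (sin2_cos2 t); unfold Rsqr; lra).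
        assert (E' : RtoC (sin t) * RtoC (sin t) = RtoC 1 - RtoC (cos t) * RtoC (cos t))
          by (rewrite <- !RtoC_mult, <- RtoC_minus; f_equal; exact E).
        repeat (rewrite ?RtoC_mult, ?RtoC_plus, ?RtoC_opp).
        set (cC := RtoC (cos t)) in *. set (sC := RtoC (sin t)) in *.
        set (K := Ccos _). set (Sn := Csin _). set (Mc := RtoC M). set (Q := RtoC q).
        replace (_ * K) with ((RtoC 1 + RtoC 1) * (Mc + RtoC 1) * Q * (cC * cC - ((RtoC 1 + RtoC 1) * Mc + RtoC 1) * (sC * sC)) * K).
        * rewrite E'. ring.
        * ring.
    - intros t _. unfold g.
      apply Cc_minus; (apply Cc_mult; [apply Cc_const|]; apply Cc_mult; [apply Cc_cos_line|];
        apply Cc_RtoC; apply (ex_derive_continuous (V := R_NormedModule)); auto_derive; trivial). }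
  assert (E := CisRInt_unique2 _ _ _ _ _ I1 I2).
  assert (Z : G (PI / 2)%R - G 0%R = RtoC 0).
  { unfold G. rewrite cos_PI2, sin_0. rewrite !pow_i by lia.
    replace (RtoC 0 * c) with (RtoC 0) by ring. rewrite Csin_0.
    rewrite !Rmult_0_l, !Rmult_0_r. ring. }
  rewrite Z in E. apply Ceq_minus.
  match goal with |- ?a = _ => transitivity (- RtoC 0); [rewrite <- E; ring|ring] end.
Qed.

Fixpoint wallis (m : nat) : R :=
  match m with O => (PI / 2)%R | S k => (wallis k * (INR (2 * k + 1) / INR (2 * k + 2)))%R end.

Lemma wallis_S k : wallis (S k) = (wallis k * (INR (2 * k + 1) / INR (2 * k + 2)))%R.
Proof. reflexivity. Qed.

Lemma wallis_pos m : (0 < wallis m)%R.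
Proof.
  induction m; [simpl; generalize PI_RGT_0; lra|rewrite wallis_S].
  apply Rmult_lt_0_compat; [exact IHm|]. apply Rdiv_lt_0_compat; apply lt_0_INR; lia.
Qed.

Lemma cosint_0 m : cosint m (RtoC 0) = RtoC (wallis m).
Proof.
  induction m.
  - apply CRInt_unique. simpl wallis.
    apply (CisRInt_ext (fun _ => RtoC 1)); [generalize PI2_1; lra| |].
    + intros t _. replace (RtoC t * (RtoC 2 * RtoC 0)) with (RtoC 0) by ring. rewrite Ccos_0. simpl. ring.
    + replace (RtoC (PI / 2)) with (RtoC (PI / 2) * RtoC 1 - RtoC 0 * RtoC 1) by ring.
      apply (CisRInt_derive (fun u => RtoC u * RtoC 1)); [generalize PI2_1; lra| |].
      * intros; apply RCder_id.
      * intros; apply Cc_const.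
  - generalize (cosint_rec m (RtoC 0)). rewrite IHm. replace (m + 1)%nat with (S m) by lia. intros E.
    assert (N1 : RtoC (INR (S m)) <> RtoC 0) by (apply RtoC_INR_neq_0; lia).
    replace (cosint (S m) (RtoC 0)) with
     (/ (RtoC 4 * (RtoC (INR (S m)) * RtoC (INR (S m)))) * (RtoC 4 * (RtoC (INR (S m)) * RtoC (INR (S m)) - RtoC 0 * RtoC 0) * cosint (S m) (RtoC 0)))
     by (field; exact N1).
    rewrite <- E, wallis_S.
    replace (INR (2 * m + 2)) with (2 * INR (S m))%R.
    2:{ replace (2 * m + 2)%nat with (2 * S m)%nat by lia. rewrite mult_INR. reflexivity. }
    assert (N4 : (2 * INR (S m) <> 0)%R) by (assert (h := lt_0_INR (S m) ltac:(lia)); lra).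
    rewrite (RtoC_mult (wallis m)), RtoC_div, !RtoC_mult by exact N4.
    field. exact N1.
Qed.

(** Partial products of Euler's product for [sin (PI x) / (PI x)]. *)
Fixpoint sprod (n : nat) (x : C) : C :=
  match n with O => RtoC 1
  | S k => sprod k x * (RtoC 1 - x * x / (RtoC (INR (S k)) * RtoC (INR (S k)))) end.

Lemma sprod_S k x : sprod (S k) x =
  sprod k x * (RtoC 1 - x * x / (RtoC (INR (S k)) * RtoC (INR (S k)))).
Proof. reflexivity. Qed.

Definition cosratio (n : nat) (x : C) : C := cosint n x / RtoC (wallis n).

Lemma cosratio_rec m x : cosratio m x =
  (RtoC 1 - x * x / (RtoC (INR (S m)) * RtoC (INR (S m)))) * cosratio (S m) x.
Proof.
  unfold cosratio. generalize (cosint_rec m x). replace (m + 1)%nat with (S m) by lia. intros E.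
  assert (N1 : RtoC (INR (S m)) <> RtoC 0) by (apply RtoC_INR_neq_0; lia).
  assert (N2 : RtoC (INR (2 * m + 1)) <> RtoC 0) by (apply RtoC_INR_neq_0; lia).
  assert (N3 : RtoC (wallis m) <> RtoC 0) by (apply RtoC_neq_0; generalize (wallis_pos m); lra).
  rewrite wallis_S.
  replace (INR (2 * m + 2)) with (2 * INR (S m))%R in *.
  2:{ replace (2 * m + 2)%nat with (2 * S m)%nat by lia. rewrite mult_INR. reflexivity. }
  assert (N4 : (2 * INR (S m) <> 0)%R) by (assert (h := lt_0_INR (S m) ltac:(lia)); lra).
  rewrite (RtoC_mult (wallis m)), RtoC_div, RtoC_mult by exact N4.
  rewrite RtoC_mult in E.
  replace (cosint m x) with (/ (RtoC 2 * RtoC (INR (S m)) * RtoC (INR (2 * m + 1))) *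
    (RtoC 2 * RtoC (INR (S m)) * RtoC (INR (2 * m + 1)) * cosint m x)) by (field; auto).
  rewrite E. field. auto.
Qed.

Lemma cosratio_0 x : x <> RtoC 0 -> cosratio 0 x = Csin (RtoC PI * x) / (RtoC PI * x).
Proof.
  intros Hx. unfold cosratio. simpl wallis.
  assert (NP : RtoC PI <> RtoC 0) by (apply RtoC_neq_0, PI_neq0).
  assert (N2 : RtoC 2 * x <> RtoC 0) by (apply Cmult_neq_0; [apply RtoC_neq_0; lra|exact Hx]).
  replace (cosint 0 x) with (/ (RtoC 2 * x) * Csin (RtoC (PI / 2) * (RtoC 2 * x)) -
     / (RtoC 2 * x) * Csin (RtoC 0 * (RtoC 2 * x))).
  - replace (RtoC (PI / 2) * (RtoC 2 * x)) with (RtoC PI * x) by (rewrite RtoC_div by lra; field).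
    replace (RtoC 0 * (RtoC 2 * x)) with (RtoC 0) by ring. rewrite Csin_0, RtoC_div by lra. field. auto.
  - symmetry. apply CRInt_unique.
    apply (CisRInt_derive (fun u => / (RtoC 2 * x) * Csin (RtoC u * (RtoC 2 * x)))); [generalize PI2_1; lra| |].
    + intros t _. eapply RCder_eq; [apply RCder_scalC, RCder_sin_line|]. simpl. field. exact Hx.
    + intros t _. apply Cc_mult; [apply Cc_cos_line|]. apply Cc_RtoC. apply continuous_const.
Qed.

Lemma sprod_cosratio n x : sprod n x * cosratio n x = cosratio 0 x.
Proof.
  induction n; [simpl; ring|]. rewrite <- IHn, (cosratio_rec n x), sprod_S. ring.
Qed.

Lemma t_cos_le_sin t : (0 <= t <= PI / 2)%R -> (t * cos t <= sin t)%R.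
Proof.
  intros Ht.
  destruct (MVT_gen (fun u => sin u - u * cos u)%R 0 t (fun u => u * sin u)%R) as [c [Hc E]].
  - intros u _. auto_derive; [trivial|ring].
  - intros u _. apply continuity_pt_filterlim.
    apply (ex_derive_continuous (V := R_NormedModule) (fun u => sin u - u * cos u)%R). auto_derive; trivial.
  - rewrite Rmin_left, Rmax_right in Hc by lra. rewrite sin_0 in E.
    assert (0 <= sin c)%R by (apply sin_ge_0; generalize PI_RGT_0; lra).
    assert (0 <= c * sin c * (t - 0))%R by (repeat apply Rmult_le_pos; lra). lra.
Qed.

(** [cos w - 1] is of order [t^2], and [t cos t <= sin t] turns [t^2 cos^(2n+2) t] into at most
    [cos^(2n) t sin^2 t], whose integral is [wallis n - wallis (S n)]. Divided by [wallis (S n)],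
    this is [1 / (2 n + 1)]. *)
Lemma cosratio_bound x : exists K, (0 <= K)%R /\ forall n,
  (Cmod (cosratio (S n) x - RtoC 1) <= K * / INR (2 * n + 1))%R.
Proof.
  (* The argument is [w = 2 x t] with [0 <= t <= PI / 2 <= 2], so [Cmod w ^ 2 = 4 Cmod x ^ 2 t^2]
     and [Cmod w <= 4 Cmod x]. *)
  set (K := (4 * Cmod x ^ 2 * exp (4 * Cmod x))%R).
  assert (HK : (0 <= K)%R).
  { unfold K. apply Rmult_le_pos; [|left; apply exp_pos]. generalize (Cmod_ge_0 x); nra. }
  exists K. split; [exact HK|]. intros n.
  assert (W := wallis_pos (S n)). assert (W' := wallis_pos n).
  assert (NW : RtoC (wallis (S n)) <> RtoC 0) by (apply RtoC_neq_0; lra).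
  assert (I := CisRInt_minus _ _ _ _ _ _ (cosint_correct (S n) x) (cosint_correct (S n) (RtoC 0))).
  assert (J := CisRInt_minus _ _ _ _ _ _ (cosint_correct n (RtoC 0)) (cosint_correct (S n) (RtoC 0))).
  apply CisRInt_iff in J. destruct J as [J _].
  apply (is_RInt_scal (V := R_NormedModule) _ _ _ K) in J.
  assert (B : (Cmod (cosint (S n) x - cosint (S n) (RtoC 0)) <= K * (wallis n - wallis (S n)))%R).
  { rewrite Cmod_norm.
    replace (K * (wallis n - wallis (S n)))%R with (scal K (Re (cosint n (RtoC 0) - cosint (S n) (RtoC 0)))).
    2:{ rewrite !cosint_0. reflexivity. }
    refine (norm_RInt_le (V := C_R_NormedModule) _ _ 0 (PI / 2) _ _ _ _ I J); [generalize PI2_1; lra|].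
    intros t Ht. rewrite <- Cmod_norm.
    replace (RtoC t * (RtoC 2 * RtoC 0)) with (RtoC 0) by ring. rewrite Ccos_0.
    set (w := RtoC t * (RtoC 2 * x)).
    replace (Ccos w * RtoC (cos t ^ (2 * S n)) - RtoC 1 * RtoC (cos t ^ (2 * S n))) with
      ((Ccos w - RtoC 1) * RtoC (cos t ^ (2 * S n))) by ring.
    assert (P4 := PI_4).
    assert (Hw : (Cmod w = t * (2 * Cmod x))%R).
    { unfold w. rewrite !Cmod_mult, !Cmod_R, !Rabs_pos_eq by lra. reflexivity. }
    assert (Cx := Cmod_ge_0 x).
    assert (Bw := Ccos_bound w). rewrite Hw in Bw.
    assert (C0 : (0 <= cos t)%R) by (apply cos_ge_0; lra).
    rewrite Cmod_mult, Cmod_R.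
    replace (2 * S n)%nat with (S (S (2 * n))) by lia.
    unfold scal; simpl; unfold mult; simpl.
    replace (n + (n + 0))%nat with (2 * n)%nat by lia. set (q := (cos t ^ (2 * n))%R).
    assert (Q0 : (0 <= q)%R) by (apply pow_le; exact C0).
    rewrite Rabs_pos_eq by (repeat apply Rmult_le_pos; assumption).
    assert (E1 : (exp (t * (2 * Cmod x)) <= exp (4 * Cmod x))%R).
    { assert (h : (t * (2 * Cmod x) <= 4 * Cmod x)%R) by nra.
      destruct h as [h|h]; [left; apply exp_increasing, h|rewrite h; lra]. }
    assert (TS : (t * cos t * (t * cos t) <= sin t * sin t)%R).
    { generalize (t_cos_le_sin t Ht). assert (0 <= t * cos t)%R by (apply Rmult_le_pos; lra). nra. }
    assert (E : (sin t * sin t = 1 - cos t * cos t)%R) by (generalize (sin2_cos2 t); unfold Rsqr; lra).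
    apply Rle_trans with ((t * (2 * Cmod x)) ^ 2 * exp (4 * Cmod x) * (cos t * (cos t * q)))%R.
    { apply Rmult_le_compat_r; [repeat apply Rmult_le_pos; assumption|].
      eapply Rle_trans; [exact Bw|]. apply Rmult_le_compat_l; [nra|exact E1]. }
    replace ((t * (2 * Cmod x)) ^ 2 * exp (4 * Cmod x) * (cos t * (cos t * q)))%R with
      (K * q * (t * cos t * (t * cos t)))%R by (unfold K; ring).
    match goal with |- (_ <= ?r)%R => replace r with (K * q * (sin t * sin t))%R by (rewrite E; ring) end.
    apply Rmult_le_compat_l; [apply Rmult_le_pos; assumption|exact TS]. }
  unfold cosratio.
  replace (cosint (S n) x / RtoC (wallis (S n)) - RtoC 1) with
   ((cosint (S n) x - RtoC (wallis (S n))) * RtoC (/ wallis (S n))) by (rewrite RtoC_inv by lra; field; exact NW).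
  rewrite cosint_0 in B.
  rewrite Cmod_mult, Cmod_R, Rabs_pos_eq by (left; apply Rinv_0_lt_compat, W).
  apply Rle_trans with (K * (wallis n - wallis (S n)) * / wallis (S n))%R.
  { apply Rmult_le_compat_r; [left; apply Rinv_0_lt_compat, W|exact B]. }
  right. rewrite wallis_S.
  assert (0 < INR (2 * n + 1))%R by (apply lt_0_INR; lia).
  replace (INR (2 * n + 2)) with (INR (2 * n + 1) + 1)%R by (rewrite <- S_INR; f_equal; lia).
  field. repeat split; lra.
Qed.

(** The product [sprod n x * cosratio n x] does not depend on [n], and its second factor tends to
    1. *)
Lemma sprod_Clim x : x <> RtoC 0 -> is_Clim (fun n => sprod n x) (Csin (RtoC PI * x) / (RtoC PI * x)).
Proof.
  intros Hx. rewrite <- cosratio_0 by exact Hx.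
  destruct (cosratio_bound x) as [K [HK B]].
  assert (L : is_Clim (fun n => cosratio n x) (RtoC 1)).
  { apply (is_Clim_shift _ _ 1). intros eps He.
    destruct (archimed_cor1 (eps / (K + 1))%R ltac:(apply Rdiv_lt_0_compat; lra)) as [N [HN HN0]].
    exists N. intros n Hn. simpl. eapply Rle_lt_trans; [apply B|].
    assert (0 < INR N)%R by (apply lt_0_INR; lia).
    assert (INR N <= INR (2 * n + 1))%R by (apply le_INR; lia).
    assert (/ INR (2 * n + 1) <= / INR N)%R by (apply Rinv_le_contravar; lra).
    assert (0 < / INR (2 * n + 1))%R by (apply Rinv_0_lt_compat; lra).
    apply Rle_lt_trans with ((K + 1) * / INR N)%R.
    { apply Rmult_le_compat; lra. }
    apply (Rmult_lt_compat_l (K + 1)) in HN; [|lra].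
    replace ((K + 1) * (eps / (K + 1)))%R with eps in HN by (field; lra). exact HN. }
  (* Within [1/2] of its limit 1, [cosratio] cannot vanish, so it may be divided by. *)
  destruct (L (1/2)%R ltac:(lra)) as [N HN].
  assert (NZ : forall n, (N <= n)%nat -> cosratio n x <> RtoC 0).
  { intros n Hn E. specialize (HN n Hn). rewrite E in HN. rewrite Cmod_minus_sym in HN.
    replace (RtoC 1 - RtoC 0) with (RtoC 1) in HN by ring. rewrite Cmod_R, Rabs_R1 in HN. lra. }
  apply (is_Clim_ext (fun n => cosratio 0 x * / cosratio n x)).
  { exists N. intros n Hn. rewrite <- (sprod_cosratio n x). field. apply NZ, Hn. }
  apply (is_Clim_eq _ (cosratio 0 x * / RtoC 1)); [|field].
  apply is_Clim_scal. apply (is_Clim_comp Cinv); [|exact L].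
  apply Cc_inv; [apply Cc_id|apply RtoC_neq_0; lra].
Qed.

Lemma pochC_sprod n s :
  pochC (S n) s * pochC (S n) (- s) = - (s * s) * (RtoC (INR (fact n)) * RtoC (INR (fact n))) * sprod n s.
Proof.
  induction n; [unfold pochC; simpl; ring|].
  rewrite (pochC_S (S n) s), (pochC_S (S n) (- s)).
  replace (pochC (S n) s * (s + RtoC (INR (S n))) * (pochC (S n) (- s) * (- s + RtoC (INR (S n))))) with
   ((pochC (S n) s * pochC (S n) (- s)) * ((RtoC (INR (S n)) * RtoC (INR (S n))) - s * s)) by ring.
  rewrite IHn, fact_simpl, mult_INR, RtoC_mult, sprod_S.
  field. apply RtoC_INR_neq_0; lia.
Qed.

(** In [gauss n s * gauss n (- s)] the powers of [n] cancel and the linear factors pair up to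
    [k^2 - s^2], which leaves the partial product of the sine. The value 0 is apart, since the limit
    of that product is divided by [s]. *)
Lemma rGamma_reflection s : rGamma s * rGamma (- s) = - s * Csin (RtoC PI * s) / RtoC PI.
Proof.
  destruct (Ceq_dec s (RtoC 0)) as [E|E].
  { subst s. rewrite rGamma_0. field. apply RtoC_neq_0, PI_neq0. }
  apply (is_Clim_unique (fun n => gauss n s * gauss n (- s))).
  { apply is_Clim_mult; apply rGamma_Clim. }
  apply (is_Clim_eq _ (- (s * s) * (Csin (RtoC PI * s) / (RtoC PI * s)))).
  2:{ field. split; [apply RtoC_neq_0, PI_neq0|exact E]. }
  apply (is_Clim_ext (fun n => - (s * s) * sprod n s)).
  2:{ apply is_Clim_scal, sprod_Clim, E. }
  exists 1%nat; intros n Hn. unfold gauss. rewrite !gauss_pow by lia.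
  replace (- s * RtoC (ln (INR n))) with (- (s * RtoC (ln (INR n)))) by ring. rewrite Cexp_opp.
  transitivity (pochC (S n) s * pochC (S n) (- s) / (RtoC (INR (fact n)) * RtoC (INR (fact n)))).
  - rewrite pochC_sprod. field. apply RtoC_fact_neq_0.
  - field. split; [apply Cexp_neq_0|apply RtoC_fact_neq_0].
Qed.

Lemma Csin_RtoC x : Csin (RtoC x) = RtoC (sin x).
Proof.
  unfold Csin, Cexp. replace (Ci * RtoC x) with ((0, x)%R : C) by (apply C_ext; simpl; ring). simpl.
  rewrite Ropp_0, cos_neg, sin_neg, exp_0.
  replace ((RtoC 1 * (cos x, sin x) - RtoC 1 * (cos x, (- sin x)%R))) with (RtoC (sin x) * (RtoC 2 * Ci))
    by (apply C_ext; simpl; ring).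
  field. apply Ci_neq_0.
Qed.

(** A zero equates [Cexp (Ci * w)] with its inverse; comparing moduli gives [Im w = 0], and the real
    sine concludes. *)
Lemma Csin_eq_0 w : Csin w = RtoC 0 -> exists k : Z, w = RtoC (IZR k * PI).
Proof.
  intros H.
  assert (E : Cexp (Ci * w) = Cexp (- (Ci * w))).
  { apply Ceq_minus. unfold Csin in H.
    replace (Cexp (Ci * w) - Cexp (- (Ci * w))) with
     ((Cexp (Ci * w) - Cexp (- (Ci * w))) / (RtoC 2 * Ci) * (RtoC 2 * Ci)) by (field; apply Ci_neq_0).
    rewrite H; ring. }
  assert (M : Im w = 0%R).
  { generalize (f_equal Cmod E). rewrite !Cmod_Cexp. intros X. apply exp_inv in X.
    destruct w as [a b]; simpl in *. lra. }
  assert (W : w = RtoC (Re w)) by (apply C_ext; simpl; [reflexivity|exact M]).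
  rewrite W, Csin_RtoC in H. apply RtoC_inj in H.
  destruct (sin_eq_0_0 _ H) as [k Hk]. exists k. rewrite W, Hk. reflexivity.
Qed.

(** By reflection, a zero of [rGamma] is a zero of the sine, so [s] is an integer. It is positive by
    hypothesis, and there the value is the inverse of a factorial. *)
Lemma rGamma_neq_0 s : (forall k : nat, s <> - RtoC (INR k)) -> rGamma s <> RtoC 0.
Proof.
  intros Hs E.
  assert (NP : RtoC PI <> RtoC 0) by (apply RtoC_neq_0, PI_neq0).
  assert (S0 : s <> RtoC 0) by (intros X; apply (Hs 0%nat); rewrite X; simpl; ring).
  generalize (rGamma_reflection s). rewrite E, Cmult_0_l. intros R.
  assert (Z : Csin (RtoC PI * s) = RtoC 0).
  { replace (Csin (RtoC PI * s)) with (- s * Csin (RtoC PI * s) / RtoC PI * (- RtoC PI / s)) by (field; auto).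
    rewrite <- R; ring. }
  destruct (Csin_eq_0 _ Z) as [k Hk].
  assert (Sk : s = RtoC (IZR k)).
  { replace s with (RtoC PI * s / RtoC PI) by (field; exact NP). rewrite Hk, RtoC_mult. field. exact NP. }
  destruct (Z.le_gt_cases k 0) as [h|h].
  - apply (Hs (Z.to_nat (- k))). rewrite Sk, INR_IZR_INZ, Z2Nat.id, opp_IZR by lia.
    rewrite RtoC_opp; ring.
  - assert (Sn : s = RtoC (INR (Z.to_nat (k - 1))) + RtoC 1).
    { rewrite Sk, INR_IZR_INZ, Z2Nat.id by lia. rewrite minus_IZR, RtoC_minus. ring. }
    rewrite Sn, rGamma_nat in E.
    apply (f_equal (fun z => RtoC (INR (fact (Z.to_nat (k - 1)))) * z)) in E.
    rewrite Cmult_0_r, Cinv_r in E by apply RtoC_fact_neq_0. apply RtoC_inj in E. lra.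
Qed.

Lemma gauss_pos n x : (0 < n)%nat -> (0 < x)%R -> exists r, (0 < r)%R /\ gauss n (RtoC x) = RtoC r.
Proof.
  intros Hn Hx.
  assert (P : forall m, exists r, (0 < r)%R /\ pochC m (RtoC x) = RtoC r).
  { induction m as [|m [r [Hr E]]]; [exists 1%R; split; [lra|reflexivity]|].
    exists (r * (x + INR m))%R. split; [apply Rmult_lt_0_compat; generalize (pos_INR m); lra|].
    rewrite pochC_S, E, RtoC_mult, RtoC_plus. reflexivity. }
  destruct (P (S n)) as [r [Hr E]].
  exists (r / (INR (fact n) * exp (x * ln (INR n))))%R.
  assert (H : (0 < INR (fact n) * exp (x * ln (INR n)))%R).
  { apply Rmult_lt_0_compat; [apply INR_fact_lt_0|apply exp_pos]. }
  split; [apply Rdiv_lt_0_compat; assumption|].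
  unfold gauss. rewrite E, gauss_pow by exact Hn.
  rewrite <- RtoC_mult, Cexp_RtoC, RtoC_div, RtoC_mult by lra. reflexivity.
Qed.

(** Reflection at [1/2] gives the square [1 / PI]; the sign is settled by the positivity of the
    approximants [gauss n (1/2)]. *)
Lemma rGamma_half : rGamma (RtoC (1/2)) = RtoC (/ sqrt PI).
Proof.
  assert (P := PI_RGT_0). assert (SP := sqrt_lt_R0 _ P).
  assert (NP : RtoC PI <> RtoC 0) by (apply RtoC_neq_0; lra).
  set (g := rGamma (RtoC (1/2))).
  assert (E : g * g = RtoC (/ PI)).
  { generalize (rGamma_reflection (RtoC (1/2))). rewrite (rGamma_rec (- RtoC (1/2))).
    replace (- RtoC (1/2) + RtoC 1) with (RtoC (1/2)) by (rewrite RtoC_div by lra; field). fold g.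
    replace (RtoC PI * RtoC (1/2)) with (RtoC (PI / 2)) by (rewrite <- RtoC_mult; f_equal; field).
    rewrite Csin_RtoC, sin_PI2. intros H.
    replace (g * g) with (- RtoC 2 * (g * (- RtoC (1/2) * g))) by (rewrite RtoC_div by lra; field).
    rewrite H, RtoC_inv, RtoC_div by lra. field. exact NP. }
  assert (G : (0 <= Re g)%R).
  { destruct (Rle_dec 0 (Re g)) as [h|h]; [exact h|exfalso].
    destruct (rGamma_Clim (RtoC (1/2)) (- Re g)%R ltac:(lra)) as [N HN].
    specialize (HN (S N) ltac:(lia)). destruct (gauss_pos (S N) (1/2) ltac:(lia) ltac:(lra)) as [r [Hr Er]].
    rewrite Er in HN. fold g in HN.
    assert (A := re_le_Cmod (RtoC r - g)).
    replace (Re (RtoC r - g)) with (r - Re g)%R in A by (unfold Cminus; rewrite re_plus, re_opp; reflexivity).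
    generalize (Rle_abs (r - Re g)). lra. }
  assert (F : (g - RtoC (/ sqrt PI)) * (g + RtoC (/ sqrt PI)) = RtoC 0).
  { replace ((g - RtoC (/ sqrt PI)) * (g + RtoC (/ sqrt PI))) with (g * g - RtoC (/ sqrt PI) * RtoC (/ sqrt PI)) by ring.
    rewrite E, <- RtoC_mult, <- Rinv_mult, sqrt_sqrt by lra. ring. }
  destruct (Ceq_dec (g - RtoC (/ sqrt PI)) (RtoC 0)) as [h|h].
  - apply Ceq_minus. exact h.
  - exfalso. destruct (Ceq_dec (g + RtoC (/ sqrt PI)) (RtoC 0)) as [h'|h'].
    + apply (f_equal Re) in h'. rewrite re_plus in h'. change (Re g + / sqrt PI = 0)%R in h'.
      assert (0 < / sqrt PI)%R by (apply Rinv_0_lt_compat, SP). lra.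
    + exact (Cmult_neq_0 _ _ h h' F).
Qed.

(** The factor of [gauss_double] that is independent of [s], found by solving the case [s = 1/2].
    Written this way, its limit follows from the values of [rGamma] at [1/2] and [1]. *)
Definition dupC (n : nat) : C := gauss n (RtoC (1/2)) * gauss n (RtoC 1)
   / (RtoC (INR (2 * n + 1)) / RtoC (INR n) * gauss (2 * n + 1) (RtoC 1)).

Lemma pochC_double n s : pochC n s * pochC n (s + RtoC (1/2)) = pochC (2 * n) (RtoC 2 * s) / RtoC (4 ^ n).
Proof.
  induction n.
  - unfold pochC; simpl. field.
  - replace (2 * S n)%nat with (S (S (2 * n))) by lia.
    rewrite !pochC_S. replace (pochC n s * (s + RtoC (INR n)) * (pochC n (s + RtoC (1/2)) * (s + RtoC (1/2) + RtoC (INR n))))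
      with ((pochC n s * pochC n (s + RtoC (1/2))) * ((s + RtoC (INR n)) * (s + RtoC (1/2) + RtoC (INR n)))) by ring.
    rewrite IHn, S_INR, mult_INR. simpl (INR 2). simpl (4 ^ S n)%R.
    assert (N : RtoC (4 ^ n) <> RtoC 0) by (apply RtoC_neq_0, pow_nonzero; lra).
    rewrite RtoC_plus, !RtoC_mult, RtoC_plus, RtoC_div by lra. field. exact N.
Qed.

(** The [n + 1] linear factors on each side interlace to the [2 n + 2] factors of
    [gauss (2 * n + 1)] at [2 s]; hence the odd index, and the quotient of powers of [2 n + 1] and
    [n], which tends to a power of 2. *)
Lemma gauss_double n s : (0 < n)%nat -> gauss n s * gauss n (s + RtoC (1/2)) =
  dupC n * (Cexp (RtoC 2 * s * RtoC (ln (INR (2 * n + 1)) - ln (INR n))) * gauss (2 * n + 1) (RtoC 2 * s)).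
Proof.
  intros Hn.
  assert (G : forall s, gauss n s * gauss n (s + RtoC (1/2)) =
   pochC (2 * n + 2) (RtoC 2 * s) / (RtoC (4 ^ (S n)) * (RtoC (INR (fact n)) * RtoC (INR (fact n)))) *
   (Cexp (- (RtoC 2 * s * RtoC (ln (INR n)))) * Cexp (- (RtoC (1/2) * RtoC (ln (INR n)))))).
  { intros s'. unfold gauss. rewrite !gauss_pow by lia.
    replace (2 * n + 2)%nat with (2 * S n)%nat by lia.
    assert (N : RtoC (4 ^ S n) <> RtoC 0) by (apply RtoC_neq_0, pow_nonzero; lra).
    replace (pochC (2 * S n) (RtoC 2 * s')) with (pochC (2 * S n) (RtoC 2 * s') / RtoC (4 ^ S n) * RtoC (4 ^ S n))
      by (field; exact N).
    rewrite <- pochC_double, !Cexp_opp.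
    replace ((s' + RtoC (1/2)) * RtoC (ln (INR n))) with (s' * RtoC (ln (INR n)) + RtoC (1/2) * RtoC (ln (INR n))) by ring.
    replace (RtoC 2 * s' * RtoC (ln (INR n))) with (s' * RtoC (ln (INR n)) + s' * RtoC (ln (INR n))) by ring.
    rewrite !Cexp_plus. field. repeat split; try apply Cexp_neq_0; try apply RtoC_fact_neq_0; exact N. }
  assert (N : RtoC (4 ^ S n) <> RtoC 0) by (apply RtoC_neq_0, pow_nonzero; lra).
  assert (X1 : forall k, (0 < k)%nat -> Cexp (RtoC (ln (INR k))) = RtoC (INR k)).
  { intros k Hk. rewrite Cexp_RtoC, exp_ln by (apply lt_0_INR; lia). reflexivity. }
  unfold dupC. replace (RtoC 1) with (RtoC (1/2) + RtoC (1/2)) at 1 by (rewrite RtoC_div by lra; field).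
  rewrite !G. replace (RtoC 2 * RtoC (1/2)) with (RtoC 1) by (rewrite RtoC_div by lra; field).
  unfold gauss. rewrite !gauss_pow by lia.
  replace (2 * n + 2)%nat with (S (2 * n + 1)) by lia. rewrite pochC_1.
  rewrite RtoC_minus.
  replace (RtoC 2 * s * (RtoC (ln (INR (2 * n + 1))) - RtoC (ln (INR n)))) with
   (RtoC 2 * s * RtoC (ln (INR (2 * n + 1))) + - (RtoC 2 * s * RtoC (ln (INR n)))) by ring.
  rewrite !Cexp_plus, !Cexp_opp. rewrite !Cmult_1_l, !X1 by lia.
  field. repeat split; try apply Cexp_neq_0; try apply RtoC_fact_neq_0; try exact N; apply RtoC_INR_neq_0; lia.
Qed.

Lemma rGamma_duplication s : rGamma (s + RtoC (1/2)) * rGamma (s + RtoC 1) =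
  Cexp (RtoC 2 * s * RtoC (ln 2)) / RtoC (sqrt PI) * rGamma (RtoC 2 * s + RtoC 1).
Proof.
  assert (P := PI_RGT_0). assert (SP := sqrt_lt_R0 _ P).
  assert (NS : RtoC (sqrt PI) <> RtoC 0) by (apply RtoC_neq_0; lra).
  assert (Q : is_Clim (fun n => RtoC (INR (2 * n + 1)) / RtoC (INR n)) (RtoC 2)).
  { apply (is_Clim_ext (fun n => (RtoC 1 + RtoC (INR n) * RtoC 2) / RtoC (INR n))); [|apply is_Clim_ratio].
    exists 0%nat; intros n _. rewrite plus_INR, mult_INR, RtoC_plus, RtoC_mult. change (INR 2) with 2%R. change (INR 1) with 1%R.
    unfold Cdiv. ring. }
  assert (S2 : forall s, is_Clim (fun n => gauss (2 * n + 1) s) (rGamma s)).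
  { intros s'. apply (is_Clim_subseq (fun n => gauss n s') _ (fun n => (2 * n + 1)%nat)); [lia|apply rGamma_Clim]. }
  assert (D : is_Clim dupC (RtoC (/ sqrt PI) * RtoC 1 * / (RtoC 2 * RtoC 1))).
  { unfold dupC. apply is_Clim_mult.
    - apply is_Clim_mult.
      + apply (is_Clim_eq _ (rGamma (RtoC (1/2)))); [apply rGamma_Clim|apply rGamma_half].
      + apply (is_Clim_eq _ (rGamma (RtoC 1))); [apply rGamma_Clim|apply rGamma_1].
    - apply (is_Clim_comp Cinv).
      + apply Cc_inv; [apply Cc_id|]. rewrite <- RtoC_mult. apply RtoC_neq_0; lra.
      + apply is_Clim_mult; [exact Q|].
        apply (is_Clim_eq _ (rGamma (RtoC 1))); [apply S2|apply rGamma_1]. }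
  assert (X : is_Clim (fun n => RtoC (ln (INR (2 * n + 1)) - ln (INR n))) (RtoC (ln 2))).
  { apply (is_Clim_ext (fun n => RtoC (ln (Re (RtoC (INR (2 * n + 1)) / RtoC (INR n)))))).
    - exists 1%nat; intros n Hn. f_equal.
      assert (0 < INR n)%R by (apply lt_0_INR; lia). assert (0 < INR (2 * n + 1))%R by (apply lt_0_INR; lia).
      rewrite <- RtoC_div by lra.
      change (ln (INR (2 * n + 1) / INR n) = ln (INR (2 * n + 1)) - ln (INR n))%R.
      unfold Rdiv; rewrite ln_mult, ln_Rinv by (try apply Rinv_0_lt_compat; lra). ring.
    - apply (is_Clim_comp (fun z => RtoC (ln (Re z))) _ (RtoC 2)); [|exact Q].
      apply Cc_RtoC. apply (continuous_comp Re ln).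
      + apply (proj1 (proj1 (Cc_comp_iff (fun z : C => z) _) (Cc_id _))).
      + apply continuity_pt_filterlim. apply derivable_continuous_pt. exists (/ 2)%R. apply derivable_pt_lim_ln.
        change (0 < 2)%R; lra. }
  assert (main : forall s, rGamma s * rGamma (s + RtoC (1/2)) =
    RtoC (/ sqrt PI) * RtoC 1 * / (RtoC 2 * RtoC 1) * (Cexp (RtoC 2 * s * RtoC (ln 2)) * rGamma (RtoC 2 * s))).
  { intros s'. apply (is_Clim_unique (fun n => gauss n s' * gauss n (s' + RtoC (1/2)))).
    - apply is_Clim_mult; apply rGamma_Clim.
    - apply (is_Clim_ext (fun n => dupC n * (Cexp (RtoC 2 * s' * RtoC (ln (INR (2 * n + 1)) - ln (INR n))) * gauss (2 * n + 1) (RtoC 2 * s')))).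
      { exists 1%nat; intros n Hn; symmetry; apply gauss_double; lia. }
      apply is_Clim_mult; [exact D|]. apply is_Clim_mult; [|apply S2].
      apply (is_Clim_comp (fun z => Cexp (RtoC 2 * s' * z)) _ _); [|exact X].
      apply Cc_exp, Cc_mult; [apply Cc_const|apply Cc_id]. }
  replace (s + RtoC 1) with (s + RtoC (1/2) + RtoC (1/2)) by (rewrite RtoC_div by lra; field).
  rewrite main.
  replace (RtoC 2 * (s + RtoC (1/2))) with (RtoC 2 * s + RtoC 1) by (rewrite RtoC_div by lra; field).
  replace ((RtoC 2 * s + RtoC 1) * RtoC (ln 2)) with (RtoC 2 * s * RtoC (ln 2) + RtoC (ln 2)) by ring.
  rewrite Cexp_plus. replace (Cexp (RtoC (ln 2))) with (RtoC 2).
  2:{ rewrite Cexp_RtoC, exp_ln by lra. reflexivity. }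
  rewrite RtoC_inv by lra. field. exact NS.
Qed.

(** * Formal power series *)

(** Cauchy product, with the leading coefficient of [a] peeled off at each step: the ring axioms
    then go by induction, with no reindexing of sums. *)
Fixpoint conv_aux (n : nat) (a b : nat -> C) : C :=
  match n with
  | O => a O * b O
  | S k => a O * b (S k) + conv_aux k (fun j => a (S j)) b
  end.
Definition conv (a b : nat -> C) : nat -> C := fun n => conv_aux n a b.
Definition fadd (a b : nat -> C) : nat -> C := fun n => a n + b n.
Definition fsub (a b : nat -> C) : nat -> C := fun n => a n - b n.
Definition fopp (a : nat -> C) : nat -> C := fun n => - a n.
Definition fconst (c : C) : nat -> C := fun n => match n with O => c | _ => RtoC 0 end.
Definition fX : nat -> C := fun n => match n with S O => RtoC 1 | _ => RtoC 0 end.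
(** The Euler operator [x d/dx], a derivation for the Cauchy product. *)
Definition theta (a : nat -> C) : nat -> C := fun n => RtoC (INR n) * a n.

Lemma conv_addl n : forall a b c, conv_aux n (fadd a b) c = conv_aux n a c + conv_aux n b c.
Proof.
  induction n; intros a b c; simpl; unfold fadd; [ring|].
  generalize (IHn (fun j => a (S j)) (fun j => b (S j)) c). unfold fadd. intros E; rewrite E. ring.
Qed.

Lemma conv_scall n : forall k a c, conv_aux n (fun j => k * a j) c = k * conv_aux n a c.
Proof. induction n; intros k a c; simpl; [ring|]. rewrite IHn. ring. Qed.

Lemma conv_comm_S n : forall a b, conv_aux (S n) a b = conv_aux n a (fun j => b (S j)) + a (S n) * b O.
Proof.
  induction n; intros a b; [simpl; ring|].
  change (conv_aux (S (S n)) a b) with (a O * b (S (S n)) + conv_aux (S n) (fun j => a (S j)) b).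
  rewrite IHn. simpl. ring.
Qed.

Lemma conv_comm_aux n : forall a b, conv_aux n a b = conv_aux n b a.
Proof.
  induction n; intros a b; [simpl; ring|].
  rewrite conv_comm_S. simpl. rewrite IHn. ring.
Qed.

Lemma conv_assoc_aux n : forall a b c, conv_aux n (conv a b) c = conv_aux n a (conv b c).
Proof.
  induction n; intros a b c; [simpl; unfold conv; simpl; ring|].
  cbn [conv_aux].
  replace (fun j => conv a b (S j)) with (fadd (fun j => a O * b (S j)) (conv (fun j => a (S j)) b))
    by (apply functional_extensionality; intros; reflexivity).
  rewrite conv_addl, conv_scall, IHn. unfold conv. simpl. ring.
Qed.

Lemma conv_const_aux n : forall c a, conv_aux n (fconst c) a = c * a n.
Proof.
  intros c a; destruct n; cbn [conv_aux]; [reflexivity|].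
  replace (fun j => fconst c (S j)) with (fun j : nat => RtoC 0 * a j)
    by (apply functional_extensionality; intros; simpl; ring).
  rewrite conv_scall. simpl. ring.
Qed.

Lemma conv_const c a : conv (fconst c) a = fun n => c * a n.
Proof. apply functional_extensionality; intros n; apply conv_const_aux. Qed.

(** Registered as a ring, formal series let [ring] verify differential identities once [theta] has
    been pushed to the generators; scalars enter as constant series. *)
Lemma f_ring : ring_theory (fconst (RtoC 0)) (fconst (RtoC 1)) fadd conv fsub fopp eq.
Proof.
  constructor; intros; apply functional_extensionality; intros n; unfold fadd, fsub, fopp.
  - destruct n; simpl; ring.
  - ring.
  - ring.
  - unfold conv; rewrite conv_const_aux; ring.
  - apply conv_comm_aux.
  - symmetry; apply conv_assoc_aux.
  - apply conv_addl.
  - ring.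
  - destruct n; simpl; ring.
Qed.
Add Ring formal_series : f_ring.

Declare Scope formal_scope.
Delimit Scope formal_scope with fps.
Notation "a + b" := (fadd a b) : formal_scope.
Notation "a - b" := (fsub a b) : formal_scope.
Notation "a * b" := (conv a b) : formal_scope.
Notation "- a" := (fopp a) : formal_scope.

Lemma theta_add a b : theta (a + b)%fps = (theta a + theta b)%fps.
Proof. apply functional_extensionality; intros; unfold theta, fadd; ring. Qed.
Lemma theta_sub a b : theta (a - b)%fps = (theta a - theta b)%fps.
Proof. apply functional_extensionality; intros; unfold theta, fsub; ring. Qed.
Lemma theta_const c : theta (fconst c) = fconst (RtoC 0).
Proof. apply functional_extensionality; intros n; unfold theta; destruct n; simpl; ring. Qed.

Lemma theta_mul_aux n : forall a b, RtoC (INR n) * conv_aux n a b =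
  conv_aux n (theta a) b + conv_aux n a (theta b).
Proof.
  induction n; intros a b; [simpl; unfold theta; simpl; ring|].
  cbn [conv_aux]. rewrite Cmult_plus_distr_l, S_INR, RtoC_plus.
  replace ((RtoC (INR n) + RtoC 1) * conv_aux n (fun j => a (S j)) b) with
   (RtoC (INR n) * conv_aux n (fun j => a (S j)) b + conv_aux n (fun j => a (S j)) b) by ring.
  rewrite IHn.
  replace (fun j => theta a (S j)) with (fadd (theta (fun j => a (S j))) (fun j => a (S j))).
  2:{ apply functional_extensionality; intros j; unfold fadd, theta. rewrite S_INR, RtoC_plus; ring. }
  rewrite conv_addl. change (theta a O) with (RtoC 0 * a O).
  change (theta b (S n)) with (RtoC (INR (S n)) * b (S n)). rewrite S_INR, RtoC_plus. ring.
Qed.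

Lemma theta_mul a b : theta (a * b)%fps = (theta a * b + a * theta b)%fps.
Proof. apply functional_extensionality; intros n. exact (theta_mul_aux n a b). Qed.

Lemma conv_X_S a n : (fX * a)%fps (S n) = a n.
Proof.
  unfold conv; cbn [conv_aux]. replace (fun j => fX (S j)) with (fconst (RtoC 1))
    by (apply functional_extensionality; intros [|[|j]]; reflexivity).
  rewrite conv_const_aux. simpl. ring.
Qed.

Lemma conv_X_0 a : (fX * a)%fps O = RtoC 0.
Proof. unfold conv; simpl; ring. Qed.

Lemma theta_X : theta fX = fX.
Proof. apply functional_extensionality; intros [|[|n]]; unfold theta; simpl; ring. Qed.

Lemma INR_S_neq_0 n : RtoC (INR (S n)) <> RtoC 0.
Proof. apply RtoC_INR_neq_0; lia. Qed.

Lemma theta_eq_0 a : theta a = fconst (RtoC 0) -> a = fconst (a O).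
Proof.
  intros H. apply functional_extensionality; intros [|n]; [reflexivity|]. simpl.
  assert (E := f_equal (fun f => f (S n)) H). unfold theta in E. cbn [fconst] in E.
  replace (a (S n)) with (/ RtoC (INR (S n)) * (RtoC (INR (S n)) * a (S n))) by (field; apply INR_S_neq_0).
  rewrite E; ring.
Qed.

(** * Solutions of [theta (theta + nu) u = X u]: Wronskian, variation of parameters, products of
    solutions *)

Section ODE.
Variables (nu : C) (u v : nat -> C).
Let k := fconst nu.
Let h := fconst (RtoC (/ 2)).
Let one := fconst (RtoC 1).
Let zero := fconst (RtoC 0).
Hypothesis Hu : (theta (theta u) + k * theta u)%fps = (fX * u)%fps.
Hypothesis Hv : (theta (theta v) - k * theta v)%fps = (fX * v)%fps.
Hypotheses (u0 : u O = RtoC 1) (v0 : v O = RtoC 1).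

Let Ddu : theta (theta u) = (fX * u - k * theta u)%fps.
Proof. rewrite <- Hu; ring. Qed.
Let Ddv : theta (theta v) = (fX * v + k * theta v)%fps.
Proof. rewrite <- Hv; ring. Qed.
Let hh : (h + h)%fps = one.
Proof.
  apply functional_extensionality; intros [|n]; unfold h, one, fadd; simpl; [|ring].
  rewrite RtoC_inv by lra; field.
Qed.
Let Dk : theta k = zero. Proof. apply theta_const. Qed.
Let Dh : theta h = zero. Proof. apply theta_const. Qed.
Let Done : theta one = zero. Proof. apply theta_const. Qed.

(** The two equations make [theta] of the left side vanish, so only its constant term survives, and
    [u O = v O = 1]. *)
Lemma formal_wronskian : (u * theta v - v * theta u - k * (u * v))%fps = (zero - k)%fps.
Proof.
  set (W := (u * theta v - v * theta u - k * (u * v))%fps).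
  assert (E : theta W = fconst (RtoC 0)).
  { unfold W. rewrite !theta_sub, !theta_mul, Dk, Ddu, Ddv. unfold zero. ring. }
  rewrite (theta_eq_0 W E).
  apply functional_extensionality; intros [|n]; unfold W, fsub, zero, k, conv, theta; simpl; [|ring].
  rewrite u0, v0. ring.
Qed.

Let Wr : (u * theta v)%fps = (v * theta u + k * (u * v) - k)%fps.
Proof.
  generalize formal_wronskian. intros E.
  replace (u * theta v)%fps with ((u * theta v - v * theta u - k * (u * v)) + (v * theta u + k * (u * v)))%fps by ring.
  rewrite E. unfold zero; ring.
Qed.

Section Product.
Variables (m p y : nat -> C).
Hypothesis Hm : theta m = (h * (u * v - one))%fps.
Hypothesis Hp : (theta p + k * p)%fps = (h * (u * u))%fps.
Hypothesis Hy : (theta (theta y) + k * theta y + theta u)%fps = (fX * y)%fps.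
Hypothesis Hy0 : y O = m O - p O.
Hypothesis Hnu : forall n : nat, nu + RtoC (INR (S n)) <> RtoC 0.

Let Dp : theta p = (h * (u * u) - k * p)%fps.
Proof. rewrite <- Hp; ring. Qed.

(* Variation of parameters for the operator theta (theta + nu) - X. *)
Lemma formal_variation : y = (u * m - v * p)%fps.
Proof.
  set (Y := (u * m - v * p)%fps).
  assert (E1 : theta Y = (theta u * m + u * (h * (u * v - one)) - theta v * p - v * (h * (u * u) - k * p))%fps).
  { unfold Y. rewrite !theta_sub, !theta_mul, Hm, Dp. ring. }
  assert (E2 : (theta (theta Y) + k * theta Y + theta u)%fps = (fX * Y)%fps).
  { rewrite E1. rewrite !theta_sub, !theta_add, !theta_mul, !theta_sub, !theta_mul, Dk, Dh, Done, Dp, Hm, Ddu, Ddv.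
    unfold Y.
    (* Both added terms are zero, one by the Wronskian and one because [1/2 + 1/2 = 1]; with them
       the identity is one of the polynomial ring. *)
    match goal with |- ?l = ?r =>
      transitivity (r + (h * u * (v * theta u + k * (u * v) - k - u * theta v) + (one - (h + h)) * theta u))%fps end.
    - unfold zero, one. ring.
    - rewrite hh, Wr. unfold one; ring. }
  (* The difference solves the homogeneous equation with constant term 0. Since the factor
     [N (N + nu)] never vanishes for [N >= 1], all its coefficients vanish. *)
  set (d := (y - Y)%fps).
  assert (E3 : (theta (theta d) + k * theta d)%fps = (fX * d)%fps).
  { unfold d. rewrite !theta_sub.
    replace (theta (theta y) - theta (theta Y) + k * (theta y - theta Y))%fps with
     ((theta (theta y) + k * theta y + theta u) - (theta (theta Y) + k * theta Y + theta u))%fps by ring.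
    rewrite Hy, E2. ring. }
  assert (Z : forall n, d n = RtoC 0).
  { induction n.
    - unfold d, Y, fsub, conv; simpl. rewrite Hy0, u0, v0. ring.
    - assert (E := f_equal (fun f => f (S n)) E3). cbv beta in E. rewrite conv_X_S, IHn in E.
      unfold k in E. rewrite conv_const in E. unfold fadd, theta in E.
      assert (N := INR_S_neq_0 n). set (N1 := RtoC (INR (S n))) in *.
      assert (F : N1 * (nu + N1) * d (S n) = RtoC 0) by (rewrite <- E; ring).
      replace (d (S n)) with (/ (N1 * (nu + N1)) * (N1 * (nu + N1) * d (S n))) by (field; split; [apply Hnu|exact N]).
      rewrite F; ring. }
  apply functional_extensionality; intros n. specialize (Z n). unfold d, fsub in Z.
  apply Ceq_minus. exact Z.
Qed.
End Product.

(** The product satisfies [theta^3 w = 4 X theta w + 2 X w + nu^2 theta w], where the Wronskian has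
    eliminated the asymmetric terms. Comparing coefficients gives the recurrence. *)
Lemma formal_product_rec n : let w := (u * v)%fps in let N := RtoC (INR (S n)) in
  N * (N * N - nu * nu) * w (S n) = (RtoC 4 * N - RtoC 2) * w n.
Proof.
  intros w N.
  pose (two := fadd one one).
  assert (Dtwo : theta two = zero) by (unfold two; rewrite theta_add, Done; unfold zero; ring).
  assert (E2 : theta (theta w) = (two * fX * w + two * (theta u * theta v) + k * (k * w - k))%fps).
  { unfold w. rewrite !theta_mul, theta_add, !theta_mul, Ddu, Ddv.
    match goal with |- ?l = ?r => transitivity (r + k * (u * theta v - (v * theta u + k * (u * v) - k)))%fps end.
    - unfold two, one. ring.
    - rewrite Wr. ring. }
  assert (E3 : theta (theta (theta w)) = (two * fX * w + two * two * fX * theta w + k * k * theta w)%fps).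
  { rewrite E2. rewrite !theta_add, !theta_mul, theta_sub, theta_mul, Dtwo, Dk, Ddu, Ddv, theta_X.
    unfold w. rewrite theta_mul. unfold two, zero, one. ring. }
  assert (F := f_equal (fun f => f (S n)) E3). cbv beta in F.
  unfold two in F.
  replace ((one + one) * fX * w + (one + one) * (one + one) * fX * theta w + k * k * theta w)%fps with
    (fX * (w + w + (theta w + theta w + theta w + theta w)) + k * (k * theta w))%fps in F by (unfold one; ring).
  unfold k in F. rewrite !conv_const in F. unfold fadd at 1 in F. rewrite conv_X_S in F.
  unfold fadd, theta in F. fold N in F.
  assert (EN : RtoC (INR n) = N - RtoC 1) by (unfold N; rewrite S_INR, RtoC_plus; ring).
  rewrite EN in F.
  match goal with |- ?a = ?b => replace a with (N * (N * (N * w (S n))) - nu * (nu * (N * w (S n)))) by ring end.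
  rewrite F. ring.
Qed.

(** The square satisfies [theta^3 g = 4 X theta g + (2 + 4 nu) X g - 3 nu theta^2 g - 2 nu^2 theta
    g], obtained by eliminating the square of [theta u] between the second and third derivatives. *)
Lemma formal_square_rec n : let g := (u * u)%fps in let N := RtoC (INR (S n)) in
  N * (N + nu) * (N + RtoC 2 * nu) * g (S n) = (RtoC 4 * N - RtoC 2 + RtoC 4 * nu) * g n.
Proof.
  intros g N.
  pose (two := fadd one one).
  assert (Dtwo : theta two = zero) by (unfold two; rewrite theta_add, Done; unfold zero; ring).
  assert (E1 : theta g = (two * u * theta u)%fps) by (unfold g; rewrite theta_mul; unfold two, one; ring).
  assert (E2 : theta (theta g) = (two * (theta u * theta u) + two * fX * g - k * theta g)%fps).
  { rewrite E1 at 1. rewrite !theta_mul, Dtwo, Ddu. rewrite E1. unfold g, two, zero, one. ring. }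
  assert (E3 : theta (theta (theta g)) =
    (two * fX * g + two * two * fX * theta g + two * two * k * fX * g
      - (one + two) * k * theta (theta g) - two * k * k * theta g)%fps).
  { rewrite E2 at 1. rewrite !theta_sub, !theta_add, !theta_mul, Dtwo, Dk, Ddu, theta_X.
    match goal with |- ?l = ?r => transitivity
      (r + two * k * (theta (theta g) - (two * (theta u * theta u) + two * fX * g - k * theta g)))%fps end.
    - rewrite E1. unfold g, two, zero, one. ring.
    - rewrite <- E2. ring. }
  assert (F := f_equal (fun f => f (S n)) E3). cbv beta in F.
  replace (two * fX * g + two * two * fX * theta g + two * two * k * fX * g
      - (one + two) * k * theta (theta g) - two * k * k * theta g)%fps with
    (fX * (g + g + (theta g + theta g + theta g + theta g) + k * (g + g + g + g))
      - k * (theta (theta g) + theta (theta g) + theta (theta g) + k * (theta g + theta g)))%fps in F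
    by (unfold two, one; ring).
  unfold k in F. rewrite !conv_const in F. unfold fsub at 1 in F. rewrite conv_X_S in F.
  unfold fadd, theta in F. fold N in F.
  assert (EN : RtoC (INR n) = N - RtoC 1) by (unfold N; rewrite S_INR, RtoC_plus; ring).
  rewrite EN in F.
  match goal with |- ?a = ?b => replace a with
    (N * (N * (N * g (S n))) + nu * (RtoC 3 * (N * (N * g (S n))) + nu * (RtoC 2 * (N * g (S n))))) by ring end.
  rewrite F. ring.
Qed.
End ODE.

(* Coefficients of 0F1(; 1 + nu; x). *)
Definition bes (nu : C) (n : nat) : C := / (RtoC (INR (fact n)) * pochC n (nu + RtoC 1)).

(** Logarithmic derivative of the Pochhammer symbol [pochC n (nu + 1)] with respect to [nu]. *)
Fixpoint harm (nu : C) (n : nat) : C :=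
  match n with O => RtoC 0 | S k => harm nu k + / (nu + RtoC (INR (S k))) end.

Definition generic (nu : C) : Prop := forall n : nat, nu + RtoC (INR (S n)) <> RtoC 0.

Lemma pochC_neq_0 nu n : generic nu -> pochC n (nu + RtoC 1) <> RtoC 0.
Proof.
  intros H; induction n; [unfold pochC; simpl; apply RtoC_neq_0; lra|].
  rewrite pochC_S. apply Cmult_neq_0; [exact IHn|].
  replace (nu + RtoC 1 + RtoC (INR n)) with (nu + RtoC (INR (S n))) by (rewrite S_INR, RtoC_plus; ring).
  apply H.
Qed.

Lemma bes_S nu n : generic nu ->
  RtoC (INR (S n)) * (nu + RtoC (INR (S n))) * bes nu (S n) = bes nu n.
Proof.
  intros H. unfold bes. rewrite pochC_S, fact_simpl, mult_INR, RtoC_mult.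
  replace (nu + RtoC 1 + RtoC (INR n)) with (nu + RtoC (INR (S n))) by (rewrite S_INR, RtoC_plus; ring).
  field. repeat split; first [apply H|apply (pochC_neq_0 _ _ H)|apply RtoC_fact_neq_0|apply INR_S_neq_0].
Qed.

Lemma bes_0 nu : bes nu 0 = RtoC 1.
Proof. unfold bes, pochC; simpl. field. Qed.

Lemma bes_ode nu : generic nu ->
  (theta (theta (bes nu)) + fconst nu * theta (bes nu))%fps = (fX * bes nu)%fps.
Proof.
  intros H. apply functional_extensionality; intros n. unfold fadd. rewrite conv_const.
  destruct n.
  - rewrite conv_X_0. unfold theta; simpl; ring.
  - rewrite conv_X_S, <- (bes_S nu n H). unfold theta. ring.
Qed.

(** The constant term is a constant of integration. It equals that of [coefP], because the
    derivative of [bes] in [nu] has constant term 0. *)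
Definition coefM (nu : C) (n : nat) : C :=
  match n with O => / (RtoC 2 * nu) | S _ => (bes nu * bes (- nu))%fps n / (RtoC 2 * RtoC (INR n)) end.
Definition coefP (nu : C) (n : nat) : C := (bes nu * bes nu)%fps n / (RtoC 2 * (nu + RtoC (INR n))).

(* The derivative of 0F1 with respect to its parameter. *)
Lemma bes_variation nu : generic nu -> generic (- nu) -> nu <> RtoC 0 ->
  (fun n => - bes nu n * harm nu n) = (bes nu * coefM nu - bes (- nu) * coefP nu)%fps.
Proof.
  intros H H' N0.
  assert (Hv : (theta (theta (bes (- nu))) - fconst nu * theta (bes (- nu)))%fps = (fX * bes (- nu))%fps).
  { rewrite <- (bes_ode (- nu) H').
    replace (fconst (- nu)) with (fopp (fconst nu)); [ring|].
    apply functional_extensionality; intros [|n]; unfold fopp; simpl; ring. }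
  apply (formal_variation nu (bes nu) (bes (- nu)) (bes_ode nu H) Hv (bes_0 nu) (bes_0 _)).
  - apply functional_extensionality; intros n. rewrite conv_const. unfold theta, coefM, fsub.
    destruct n; [|cbn [fconst]; rewrite RtoC_inv by lra; field; apply INR_S_neq_0].
    unfold conv; simpl. rewrite !bes_0. ring.
  - apply functional_extensionality; intros n. unfold fadd; rewrite !conv_const. unfold theta, coefP.
    rewrite RtoC_inv by lra. field.
    destruct n; [|apply H]. simpl. rewrite Cplus_0_r. exact N0.
  - apply functional_extensionality; intros n. unfold fadd. rewrite conv_const.
    destruct n; [rewrite conv_X_0; unfold theta; simpl; ring|].
    rewrite conv_X_S, <- (bes_S nu n H). unfold theta. cbn [harm]. field. apply H.
  - unfold coefM, coefP, conv; simpl. rewrite !bes_0, Cplus_0_r. field. exact N0.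
  - exact H.
Qed.

Lemma bes_product_rec nu n : generic nu -> generic (- nu) ->
  let w := (bes nu * bes (- nu))%fps in let N := RtoC (INR (S n)) in
  N * (N * N - nu * nu) * w (S n) = (RtoC 4 * N - RtoC 2) * w n.
Proof.
  intros H H'.
  assert (Hv : (theta (theta (bes (- nu))) - fconst nu * theta (bes (- nu)))%fps = (fX * bes (- nu))%fps).
  { rewrite <- (bes_ode (- nu) H').
    replace (fconst (- nu)) with (fopp (fconst nu)); [ring|].
    apply functional_extensionality; intros [|m]; unfold fopp; simpl; ring. }
  apply (formal_product_rec nu (bes nu) (bes (- nu)) (bes_ode nu H) Hv (bes_0 nu) (bes_0 _)).
Qed.

Lemma bes_square_rec nu n : generic nu ->
  let g := (bes nu * bes nu)%fps in let N := RtoC (INR (S n)) in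
  N * (N + nu) * (N + RtoC 2 * nu) * g (S n) = (RtoC 4 * N - RtoC 2 + RtoC 4 * nu) * g n.
Proof. intros H. apply (formal_square_rec nu (bes nu) (bes_ode nu H)). Qed.

(** * Principal logarithms in the right half-plane *)

Lemma Re_div_Cmod_bound (z : C) : z <> RtoC 0 -> (-1 <= Re z / Cmod z <= 1)%R.
Proof.
  intros Hz. assert (P := Cmod_pos_ne _ Hz). assert (B := re_le_Cmod z).
  apply Rabs_le_between in B.
  split; apply (Rmult_le_reg_r (Cmod z)); try exact P; unfold Rdiv;
   rewrite ?Rmult_assoc, Rinv_l by lra; lra.
Qed.

Lemma Cmod_sqr (z : C) : (Cmod z * Cmod z = Re z * Re z + Im z * Im z)%R.
Proof. generalize (Cmod2_alt z). simpl. lra. Qed.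

Lemma Re_pos_neq_0 (z : C) : (0 < Re z)%R -> z <> RtoC 0.
Proof. intros H E; subst; simpl in H; lra. Qed.

Lemma Cexp_Clog (z : C) : z <> RtoC 0 -> Cexp (Clog z) = z.
Proof.
  intros Hz. assert (P := Cmod_pos_ne _ Hz). assert (B := Re_div_Cmod_bound z Hz).
  unfold Cexp, Clog, Carg; simpl. rewrite exp_ln by exact P.
  set (c := (Re z / Cmod z)%R) in *. set (r := Cmod z) in *.
  assert (C1 : (r * c = Re z)%R) by (unfold c; field; lra).
  assert (S1 : (sin (acos c) * sin (acos c) = 1 - c * c)%R).
  { generalize (sin2_cos2 (acos c)). rewrite cos_acos by exact B. unfold Rsqr; lra. }
  assert (S0 : (0 <= sin (acos c))%R) by (apply sin_ge_0; apply acos_bound).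
  assert (Sq := Cmod_sqr z). fold r in Sq.
  assert (S2 : (r * sin (acos c) * (r * sin (acos c)) = Im z * Im z)%R).
  { replace (r * sin (acos c) * (r * sin (acos c)))%R with (r * r * (sin (acos c) * sin (acos c)))%R by ring.
    rewrite S1. replace (r * r * (1 - c * c))%R with (r * r - (r * c) * (r * c))%R by ring. rewrite C1. lra. }
  assert (S3 : (0 <= r * sin (acos c))%R) by (apply Rmult_le_pos; lra).
  destruct (Rle_dec 0 (Im z)) as [h|h]; apply C_ext; simpl; unfold Re, Im in *.
  - rewrite cos_acos by exact B. lra.
  - assert (r * sin (acos c) = snd z)%R by (apply Rsqr_inj; [exact S3|exact h|unfold Rsqr; exact S2]). lra.
  - rewrite cos_neg, cos_acos by exact B. lra.
  - rewrite sin_neg. assert (r * sin (acos c) = - snd z)%R by (apply Rsqr_inj; [exact S3|lra|unfold Rsqr; lra]). lra.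
Qed.

(** In the right half-plane the argument lies within [PI / 2] of 0, so its double is still
    principal. [acos] is doubled by the formula for the cosine of a double angle, and the sign of
    [Im (z ^ 2)] is that of [Im z]. *)
Lemma Clog_sqr (z : C) : (0 < Re z)%R -> Clog (z ^ 2) = RtoC 2 * Clog z.
Proof.
  intros Hz. assert (Hz0 := Re_pos_neq_0 z Hz). assert (P := Cmod_pos_ne _ Hz0).
  assert (B := Re_div_Cmod_bound z Hz0). assert (Sq := Cmod_sqr z).
  unfold Clog, Carg. rewrite Cmod_pow.
  replace (Re (z ^ 2)) with (Re z * Re z - Im z * Im z)%R by (simpl; unfold Re, Im; ring).
  replace (Im (z ^ 2)) with (2 * (Re z * Im z))%R by (simpl; unfold Re, Im; ring).
  set (r := Cmod z) in *. set (c := (Re z / r)%R) in *.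
  assert (C0 : (0 < c)%R) by (apply Rdiv_lt_0_compat; lra).
  assert (A1 := acos_bound c).
  assert (A2 : (acos c <= PI / 2)%R).
  { rewrite <- acos_0. destruct (Rle_lt_or_eq_dec 0 c ltac:(lra)) as [h|h]; [|rewrite <- h; lra].
    destruct (Rle_dec (acos c) (acos 0)) as [k|k]; [exact k|exfalso].
    assert (cos (acos c) < cos (acos 0))%R.
    { apply cos_decreasing_1; try lra; try apply acos_bound; apply acos_bound. }
    rewrite !cos_acos in H by lra. lra. }
  assert (E : ((Re z * Re z - Im z * Im z) / r ^ 2 = cos (2 * acos c))%R).
  { rewrite cos_2a_cos, cos_acos by exact B. unfold c. replace (Im z * Im z)%R with (r * r - Re z * Re z)%R by lra.
    field. lra. }
  rewrite E, acos_cos by (generalize PI_RGT_0; lra).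
  simpl (r ^ 2)%R. rewrite Rmult_1_r, ln_mult by exact P.
  destruct (Rle_dec 0 (Im z)) as [h|h]; destruct (Rle_dec 0 (2 * (Re z * Im z))) as [k|k].
  - apply C_ext; simpl; ring.
  - exfalso; apply k. assert (0 <= Re z * Im z)%R by (apply Rmult_le_pos; lra). lra.
  - exfalso; apply h. destruct (Rle_dec 0 (Im z)) as [q|q]; [exact q|].
    assert (Re z * (- Im z) > 0)%R by (apply Rmult_lt_0_compat; lra). lra.
  - apply C_ext; simpl; ring.
Qed.

Lemma Clog_half (z : C) : (0 < Re z)%R -> Clog z = Clog (z / RtoC 2) + RtoC (ln 2).
Proof.
  intros Hz. assert (Hz0 := Re_pos_neq_0 z Hz). assert (P := Cmod_pos_ne _ Hz0).
  unfold Clog, Carg. rewrite Cmod_div by (apply RtoC_neq_0; lra). rewrite Cmod_R, (Rabs_pos_eq 2) by lra.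
  assert (E : z / RtoC 2 = RtoC (/ 2) * z) by (rewrite RtoC_inv by lra; field).
  replace (Re (z / RtoC 2)) with (Re z / 2)%R by (rewrite E, re_scal_l; field).
  replace (Im (z / RtoC 2)) with (Im z / 2)%R by (rewrite E, im_scal_l; field).
  replace (Re z / 2 / (Cmod z / 2))%R with (Re z / Cmod z)%R by (field; lra).
  replace (ln (Cmod z / 2)) with (ln (Cmod z) - ln 2)%R by (unfold Rdiv; rewrite ln_mult, ln_Rinv by lra; ring).
  destruct (Rle_dec 0 (Im z)); destruct (Rle_dec 0 (Im z / 2)); try (exfalso; lra); apply C_ext; simpl; ring.
Qed.

(** * Series of complex numbers *)

(** The [n] terms of index below [n], one fewer than in [sum_n]; hence the shifts by one below. *)
Fixpoint csum (a : nat -> C) (n : nat) : C :=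
  match n with O => RtoC 0 | S k => csum a k + a k end.

Definition is_Csum (a : nat -> C) (l : C) : Prop := is_Clim (csum a) l.

Lemma is_Csum_unique a l m : is_Csum a l -> is_Csum a m -> l = m.
Proof. apply is_Clim_unique. Qed.

Lemma csum_ext a b n : (forall k, a k = b k) -> csum a n = csum b n.
Proof. intros H; induction n; simpl; [reflexivity|]. rewrite IHn, H; reflexivity. Qed.

Lemma is_Csum_ext a b l : (forall k, a k = b k) -> is_Csum a l -> is_Csum b l.
Proof. intros H; apply is_Clim_ext. exists 0%nat; intros; apply csum_ext, H. Qed.

Lemma csum_plus a b n : csum (fun k => a k + b k) n = csum a n + csum b n.
Proof. induction n; simpl; [ring|]. rewrite IHn; ring. Qed.

Lemma csum_scal c a n : csum (fun k => c * a k) n = c * csum a n.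
Proof. induction n; simpl; [ring|]. rewrite IHn; ring. Qed.

Lemma is_Csum_plus a b l m : is_Csum a l -> is_Csum b m -> is_Csum (fun k => a k + b k) (l + m).
Proof.
  intros Ha Hb. apply (is_Clim_ext (fun n => csum a n + csum b n)).
  - exists 0%nat; intros; symmetry; apply csum_plus.
  - apply is_Clim_plus; assumption.
Qed.

Lemma is_Csum_scal c a l : is_Csum a l -> is_Csum (fun k => c * a k) (c * l).
Proof.
  intros Ha. apply (is_Clim_ext (fun n => c * csum a n)).
  - exists 0%nat; intros; symmetry; apply csum_scal.
  - apply is_Clim_scal; assumption.
Qed.

Lemma sum_n_csum (a : nat -> C) n : @sum_n C_AbelianMonoid a n = csum a (S n).
Proof.
  induction n.
  - rewrite sum_O. simpl. ring.
  - rewrite sum_Sn, IHn. reflexivity.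
Qed.

Lemma CSeries_unique a l : is_Csum a l -> CSeries a = l.
Proof.
  intros H. unfold CSeries. apply (iota_unique (V := C_CompleteNormedModule)).
  - intros y Hy. apply (is_Csum_unique a); [|exact H].
    apply (is_Clim_shift _ _ 1). apply is_Clim_filterlim.
    eapply filterlim_ext; [|exact Hy]. intros n. simpl. exact (sum_n_csum a n).
  - unfold is_series. apply is_Clim_filterlim.
    apply (is_Clim_ext (fun n => csum a (S n))).
    + exists 0%nat; intros n _. symmetry; exact (sum_n_csum a n).
    + apply (is_Clim_subseq (csum a) _ S); [lia|exact H].
Qed.

Lemma is_Csum_comp a l : is_Csum a l <->
  is_series (fun n => Re (a n)) (Re l) /\ is_series (fun n => Im (a n)) (Im l).
Proof.
  assert (R1 : forall n, Re (csum a (S n)) = sum_n (fun n => Re (a n)) n).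
  { induction n; [rewrite sum_O; simpl csum; rewrite Cplus_0_l; reflexivity|]. rewrite sum_Sn, <- IHn.
    change (csum a (S (S n))) with (csum a (S n) + a (S n)). rewrite re_plus; reflexivity. }
  assert (I1 : forall n, Im (csum a (S n)) = sum_n (fun n => Im (a n)) n).
  { induction n; [rewrite sum_O; simpl csum; rewrite Cplus_0_l; reflexivity|]. rewrite sum_Sn, <- IHn.
    change (csum a (S (S n))) with (csum a (S n) + a (S n)). rewrite im_plus; reflexivity. }
  split.
  - intros H.
    assert (H' := proj1 (is_Clim_filterlim _ _) (is_Clim_subseq _ _ S (fun n => Nat.le_succ_diag_r n) H)).
    split.
    + unfold is_series. eapply filterlim_ext; [intros n; apply R1|].
      apply (filterlim_comp _ _ _ (fun n => csum a (S n)) Re Hierarchy.eventually (locally l) (locally (Re l)) H').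
      apply (proj1 (proj1 (Cc_comp_iff (fun z : C => z) l) (Cc_id l))).
    + unfold is_series. eapply filterlim_ext; [intros n; apply I1|].
      apply (filterlim_comp _ _ _ (fun n => csum a (S n)) Im Hierarchy.eventually (locally l) (locally (Im l)) H').
      apply (proj2 (proj1 (Cc_comp_iff (fun z : C => z) l) (Cc_id l))).
  - intros [H1 H2]. apply (is_Clim_shift _ _ 1). intros eps He.
    assert (He2 : (0 < eps / 2)%R) by lra.
    destruct (proj1 (filterlim_locally _ _) H1 (mkposreal _ He2)) as [N1 K1].
    destruct (proj1 (filterlim_locally _ _) H2 (mkposreal _ He2)) as [N2 K2].
    exists (max N1 N2). intros n Hn. specialize (K1 n ltac:(lia)). specialize (K2 n ltac:(lia)).
    rewrite <- R1 in K1. rewrite <- I1 in K2. simpl (1 + n)%nat.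
    unfold ball in K1, K2; simpl in K1, K2; unfold AbsRing_ball, abs, minus, plus, opp in K1, K2; simpl in K1, K2.
    change (csum a n + a n) with (csum a (S n)) in *.
    eapply Rle_lt_trans; [apply Cmod_le_ReIm|]. unfold Cminus. rewrite re_plus, im_plus, re_opp, im_opp.
    unfold Re, Im in *. simpl in *. lra.
Qed.

(** A crude sufficient condition for absolute convergence, stable enough here: the ratios of
    consecutive terms of all series below tend to 0, so they are eventually at most [1/2]. *)
Definition geo (a : nat -> C) : Prop :=
  exists K : R, forall n, (Cmod (a n) <= K * (1/2) ^ n)%R.

Lemma geo_abs (f : C -> R) a : (forall z, (Rabs (f z) <= Cmod z)%R) -> geo a ->
  ex_series (fun n => Rabs (f (a n))).
Proof.
  intros Hf [K HK].
  apply (ex_series_le (K := R_AbsRing) (V := R_CompleteNormedModule) _ (fun n => scal K ((1/2) ^ n)%R)).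
  - intros n. unfold norm; simpl. unfold abs; simpl. rewrite Rabs_Rabsolu. eapply Rle_trans; [apply Hf|apply HK].
  - apply (ex_series_scal (V := R_NormedModule) K). apply ex_series_geom. rewrite Rabs_pos_eq; lra.
Qed.

Lemma geo_cv a : geo a -> exists l, is_Csum a l.
Proof.
  intros Ha.
  destruct (ex_series_Rabs _ (geo_abs Re a re_le_Cmod Ha)) as [l1 H1].
  destruct (ex_series_Rabs _ (geo_abs Im a im_le_Cmod Ha)) as [l2 H2].
  exists (l1, l2). apply is_Csum_comp. split; assumption.
Qed.

Lemma conv_aux_sum n : forall a b, conv_aux n a b =
  ((sum_f_R0 (fun k => Re (a k) * Re (b (n - k)%nat)) n - sum_f_R0 (fun k => Im (a k) * Im (b (n - k)%nat)) n)%R,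
   (sum_f_R0 (fun k => Re (a k) * Im (b (n - k)%nat)) n + sum_f_R0 (fun k => Im (a k) * Re (b (n - k)%nat)) n)%R).
Proof.
  induction n; intros a b.
  - simpl. apply C_ext; simpl; reflexivity.
  - cbn [conv_aux]. rewrite IHn. rewrite !(decomp_sum _ (S n)) by lia. cbn [Nat.pred].
    rewrite Nat.sub_0_r.
    change (fun i : nat => (Re (a (S i)) * Re (b (S n - S i)%nat))%R) with (fun i : nat => (Re (a (S i)) * Re (b (n - i)%nat))%R).
    change (fun i : nat => (Im (a (S i)) * Im (b (S n - S i)%nat))%R) with (fun i : nat => (Im (a (S i)) * Im (b (n - i)%nat))%R).
    change (fun i : nat => (Re (a (S i)) * Im (b (S n - S i)%nat))%R) with (fun i : nat => (Re (a (S i)) * Im (b (n - i)%nat))%R).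
    change (fun i : nat => (Im (a (S i)) * Re (b (S n - S i)%nat))%R) with (fun i : nat => (Im (a (S i)) * Re (b (n - i)%nat))%R).
    apply C_ext; rewrite ?re_plus, ?im_plus, ?re_mult, ?im_mult; cbn [Re Im fst snd]; unfold Re, Im; ring.
Qed.

(** The real and imaginary parts of the product are combinations of four real Cauchy products of
    absolutely convergent series. *)
Lemma is_Csum_conv a b l m : geo a -> geo b -> is_Csum a l -> is_Csum b m -> is_Csum (conv a b) (l * m).
Proof.
  intros Ga Gb Ha Hb. apply is_Csum_comp in Ha. apply is_Csum_comp in Hb.
  destruct Ha as [a1 a2], Hb as [b1 b2].
  assert (ga1 := geo_abs Re a re_le_Cmod Ga). assert (ga2 := geo_abs Im a im_le_Cmod Ga).
  assert (gb1 := geo_abs Re b re_le_Cmod Gb). assert (gb2 := geo_abs Im b im_le_Cmod Gb).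
  apply is_Csum_comp. rewrite re_mult, im_mult. split.
  - eapply is_series_ext; [|apply (is_series_minus (V := R_NormedModule) _ _ _ _
      (is_series_mult _ _ _ _ a1 b1 ga1 gb1) (is_series_mult _ _ _ _ a2 b2 ga2 gb2))].
    intros n. unfold conv. rewrite conv_aux_sum. reflexivity.
  - eapply is_series_ext; [|apply (is_series_plus (V := R_NormedModule) _ _ _ _
      (is_series_mult _ _ _ _ a1 b2 ga1 gb2) (is_series_mult _ _ _ _ a2 b1 ga2 gb1))].
    intros n. unfold conv. rewrite conv_aux_sum. reflexivity.
Qed.

(** The constant is explicit in [N] and [B], so that the bound is uniform whenever these do not
    depend on a parameter. *)
Lemma geo_tail a N B : (forall k, (k <= N)%nat -> (Cmod (a k) <= B)%R) ->
  (forall k, (N <= k)%nat -> (Cmod (a (S k)) <= / 2 * Cmod (a k))%R) ->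
  forall k, (Cmod (a k) <= B * 2 ^ N * (1/2) ^ k)%R.
Proof.
  intros HB HR.
  assert (B0 : (0 <= B)%R) by (eapply Rle_trans; [apply (Cmod_ge_0 (a O))|apply HB; lia]).
  assert (P2 : forall n, (2 ^ n * (1/2) ^ n = 1)%R).
  { intros n. rewrite <- Rpow_mult_distr. replace (2 * (1/2))%R with 1%R by field. apply pow1. }
  assert (H1 : forall k, (k <= N)%nat -> (Cmod (a k) <= B * 2 ^ N * (1/2) ^ k)%R).
  { intros k Hk. eapply Rle_trans; [apply HB, Hk|].
    replace N with ((N - k) + k)%nat by lia. rewrite pow_add.
    replace (B * (2 ^ (N - k) * 2 ^ k) * (1/2) ^ k)%R with (B * 2 ^ (N - k) * (2 ^ k * (1/2) ^ k))%R by ring.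
    rewrite P2, Rmult_1_r. assert (1 <= 2 ^ (N - k))%R by (apply pow_R1_Rle; lra). nra. }
  assert (H2 : forall j, (Cmod (a (N + j)%nat) <= B * 2 ^ N * (1/2) ^ (N + j))%R).
  { induction j; [rewrite Nat.add_0_r; apply H1; lia|].
    rewrite Nat.add_succ_r. eapply Rle_trans; [apply HR; lia|].
    simpl ((1/2) ^ S _)%R. lra. }
  intros k. destruct (Nat.le_gt_cases k N) as [h|h]; [apply H1, h|].
  replace k with (N + (k - N))%nat by lia. apply H2.
Qed.

Lemma finite_bound (a : nat -> C) N : exists B, forall k, (k <= N)%nat -> (Cmod (a k) <= B)%R.
Proof.
  induction N as [|N [B HB]].
  - exists (Cmod (a O)). intros k Hk. replace k with O by lia. lra.
  - exists (Rmax B (Cmod (a (S N)))). intros k Hk.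
    destruct (Nat.eq_dec k (S N)) as [E|E]; [subst; apply Rmax_r|].
    eapply Rle_trans; [apply HB; lia|apply Rmax_l].
Qed.

Lemma geo_ratio a N : (forall k, (N <= k)%nat -> (Cmod (a (S k)) <= / 2 * Cmod (a k))%R) -> geo a.
Proof.
  intros H. destruct (finite_bound a N) as [B HB]. exists (B * 2 ^ N)%R.
  apply geo_tail; assumption.
Qed.

Lemma csum_geo_bound a K : (forall n, (Cmod (a n) <= K * (1/2) ^ n)%R) ->
  forall n, (Cmod (csum a n) <= 2 * K)%R.
Proof.
  intros H.
  assert (K0 : (0 <= K)%R) by (generalize (H O) (Cmod_ge_0 (a O)); simpl; lra).
  assert (T : forall n, (Cmod (csum a n) <= K * (2 - 2 * (1/2) ^ n))%R).
  { induction n; simpl.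
    - rewrite Cmod_0R. lra.
    - eapply Rle_trans; [apply Cmod_triangle|]. specialize (H n). lra. }
  intros n. eapply Rle_trans; [apply T|]. assert (0 <= (1/2) ^ n)%R by (apply pow_le; lra). nra.
Qed.

(** * The modified Bessel function of the first kind *)

Lemma rGamma_bounded r : exists M, (0 <= M)%R /\ forall s, (Cmod s <= r)%R -> (Cmod (rGamma s) <= M)%R.
Proof.
  destruct (Rle_dec 0 r) as [Hr|Hr].
  2:{ exists 0%R. split; [lra|]. intros s Hs. generalize (Cmod_ge_0 s); lra. }
  destruct (gauss_step_bound r Hr) as [D [HD H]].
  exists ((r + INR 2) ^ 2 * exp D)%R. split.
  { apply Rmult_le_pos; [apply pow_le; generalize (pos_INR 2); lra|left; apply exp_pos]. }
  intros s Hs.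
  apply (is_Clim_bound (fun n => gauss (S n) s) _ _ 0).
  - apply (is_Clim_subseq (fun n => gauss n s) _ S); [lia|apply rGamma_Clim].
  - intros n _.
    eapply Rle_trans; [apply (product_bound (fun n => gauss (S n) s) D HD (fun n => H n s Hs))|].
    apply Rmult_le_compat_r; [left; apply exp_pos|].
    unfold gauss. rewrite gauss_pow by lia. simpl (INR 1). rewrite ln_1.
    replace (s * RtoC 0) with (RtoC 0) by ring. rewrite Cexp_0. simpl (fact 1). simpl (INR 1).
    replace (pochC 2 s / (RtoC 1 * RtoC 1)) with (pochC 2 s) by field.
    apply pochC_bound, Hs.
Qed.

Definition besT (x nu : C) (k : nat) : C :=
  x ^ k / RtoC (INR (fact k)) * rGamma (nu + RtoC (INR k) + RtoC 1).

Lemma besT_S x nu k :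
  RtoC (INR (S k)) * (nu + RtoC (INR (S k))) * besT x nu (S k) = x * besT x nu k.
Proof.
  unfold besT.
  rewrite (rGamma_rec (nu + RtoC (INR k) + RtoC 1)).
  replace (nu + RtoC (INR k) + RtoC 1) with (nu + RtoC (INR (S k))) by (rewrite S_INR, RtoC_plus; ring).
  rewrite fact_simpl, mult_INR, RtoC_mult. simpl (x ^ S k). field.
  split; [apply RtoC_fact_neq_0|apply INR_S_neq_0].
Qed.

Lemma INR_large (r : R) : exists N, forall k, (N <= k)%nat -> (r <= INR (S k))%R.
Proof.
  destruct (INR_unbounded r) as [N HN]. exists N. intros k Hk.
  assert (INR N <= INR (S k))%R by (apply le_INR; lia). lra.
Qed.

Lemma Cmod_plus_INR nu k : (INR (S k) - Cmod nu <= Cmod (nu + RtoC (INR (S k))))%R.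
Proof.
  generalize (Cmod_rev_triangle (RtoC (INR (S k))) (- nu)).
  replace (RtoC (INR (S k)) - - nu) with (nu + RtoC (INR (S k))) by ring.
  rewrite Cmod_opp, Cmod_R, Rabs_pos_eq by apply pos_INR. lra.
Qed.

(** Consecutive terms have ratio [x / ((k + 1) (nu + k + 1))], at most [1/2] from an index on that
    depends only on [x] and [r]; the earlier terms are bounded because [rGamma] is locally
    bounded. *)
Lemma besT_bound x r : exists K, forall nu, (Cmod nu <= r)%R -> forall k,
  (Cmod (besT x nu k) <= K * (1/2) ^ k)%R.
Proof.
  destruct (INR_large (Rmax (r + 1) (2 * Cmod x))) as [N HN].
  destruct (rGamma_bounded (r + INR N + 1)) as [M [M0 HM]].
  exists ((1 + Cmod x) ^ N * M * 2 ^ N)%R. intros nu Hnu.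
  assert (X0 := Cmod_ge_0 x).
  apply geo_tail.
  - intros k Hk. unfold besT. rewrite Cmod_mult. apply Rmult_le_compat; try apply Cmod_ge_0.
    + unfold Cdiv. rewrite Cmod_mult, Cmod_pow, Cmod_inv, Cmod_R, Rabs_pos_eq by (try apply pos_INR; apply RtoC_fact_neq_0).
      assert (F1 : (1 <= INR (fact k))%R) by (apply (le_INR 1), lt_O_fact).
      assert (F2 : (0 < / INR (fact k) <= 1)%R).
      { split; [apply Rinv_0_lt_compat; lra|]. rewrite <- Rinv_1. apply Rinv_le_contravar; lra. }
      assert (Q : (Cmod x ^ k <= (1 + Cmod x) ^ N)%R).
      { apply Rle_trans with ((1 + Cmod x) ^ k)%R; [apply pow_incr; lra|apply Rle_pow; [lra|exact Hk]]. }
      assert (0 <= Cmod x ^ k)%R by (apply pow_le, X0). nra.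
    + apply HM. eapply Rle_trans; [apply Cmod_triangle|]. rewrite Cmod_R, Rabs_R1.
      eapply Rle_trans; [apply Rplus_le_compat_r, Cmod_triangle|]. rewrite Cmod_R, Rabs_pos_eq by apply pos_INR.
      assert (INR k <= INR N)%R by (apply le_INR, Hk). lra.
  - intros k Hk. specialize (HN k Hk).
    assert (H1 : (r + 1 <= INR (S k))%R) by (eapply Rle_trans; [apply Rmax_l|exact HN]).
    assert (H2 : (2 * Cmod x <= INR (S k))%R) by (eapply Rle_trans; [apply Rmax_r|exact HN]).
    assert (E := f_equal Cmod (besT_S x nu k)). rewrite !Cmod_mult, Cmod_R, Rabs_pos_eq in E by apply pos_INR.
    assert (P := Cmod_plus_INR nu k).
    assert (I1 : (0 < INR (S k))%R) by (apply lt_0_INR; lia).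
    set (t := Cmod (besT x nu (S k))) in *. assert (t0 : (0 <= t)%R) by apply Cmod_ge_0.
    set (q := Cmod (besT x nu k)) in *. assert (q0 : (0 <= q)%R) by apply Cmod_ge_0.
    apply (Rmult_le_reg_l (INR (S k))); [exact I1|].
    apply Rle_trans with (INR (S k) * Cmod (nu + RtoC (INR (S k))) * t)%R.
    + assert (0 <= INR (S k) * t)%R by (apply Rmult_le_pos; lra).
      replace (INR (S k) * Cmod (nu + RtoC (INR (S k))) * t)%R with (Cmod (nu + RtoC (INR (S k))) * (INR (S k) * t))%R by ring.
      nra.
    + rewrite E. nra.
Qed.

Definition besS (x nu : C) : C := CSeries (besT x nu).

Lemma besS_Csum x nu : is_Csum (besT x nu) (besS x nu).
Proof.
  destruct (besT_bound x (Cmod nu)) as [K HK].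
  destruct (geo_cv (besT x nu)) as [l Hl]; [exists K; apply HK; lra|].
  unfold besS. rewrite (CSeries_unique _ _ Hl). exact Hl.
Qed.

Lemma entire_comp_plus f c : entire f -> entire (fun s => f (s + c)).
Proof.
  intros H. apply (hol_comp _ (fun _ => True) f (fun s => s + c)); [exact H| |trivial].
  apply hol_plus; [apply hol_id|apply hol_const].
Qed.

Lemma entire_besT x k : entire (fun nu => besT x nu k).
Proof.
  unfold besT. apply hol_mult; [apply hol_const|].
  apply (hol_ext _ (fun nu => rGamma (nu + (RtoC (INR k) + RtoC 1)))).
  - intros s. f_equal. ring.
  - apply entire_comp_plus, entire_rGamma.
Qed.

(** The partial sums are entire in [nu] and locally bounded, so [entire_limit] applies and allows
    differentiation in the order term by term. *)
Lemma besS_limit x : entire (besS x) /\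
  forall nu d, (forall k, Cder (fun nu => besT x nu k) nu (d k)) -> exists D, Cder (besS x) nu D /\ is_Csum d D.
Proof.
  destruct (entire_limit (fun n nu => csum (besT x nu) n) (besS x)) as [H1 H2].
  - intros n. induction n; [exact (hol_const (fun _ => True) (RtoC 0))|].
    apply (hol_plus _ (fun nu => csum (besT x nu) n) (fun nu => besT x nu n)); [exact IHn|apply entire_besT].
  - intros r. destruct (besT_bound x r) as [K HK]. exists (2 * K)%R. intros n s Hs.
    apply csum_geo_bound. apply HK, Hs.
  - intros s; apply besS_Csum.
  - split; [exact H1|]. intros nu d Hd. apply (H2 nu (csum d)).
    intros n; induction n; [exact (Cder_const (RtoC 0) nu)|].
    apply (Cder_plus (fun nu => csum (besT x nu) n) (fun nu => besT x nu n)); [exact IHn|apply Hd].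
Qed.

Lemma BesselI_besS nu z : BesselI nu z = Cexp (nu * Clog (z / RtoC 2)) * besS ((z / RtoC 2) ^ 2) nu.
Proof.
  unfold BesselI, besS, Cpower. f_equal. f_equal.
  apply functional_extensionality; intros k. unfold besT. rewrite Cpow_mult_r. reflexivity.
Qed.

Lemma entire_BesselI z : entire (fun nu => BesselI nu z).
Proof.
  apply (hol_ext _ (fun nu => Cexp (nu * Clog (z / RtoC 2)) * besS ((z / RtoC 2) ^ 2) nu)).
  - intros; symmetry; apply BesselI_besS.
  - apply hol_mult; [|apply besS_limit]. apply hol_exp, hol_mult; [apply hol_id|apply hol_const].
Qed.

Definition fscale (x : C) (a : nat -> C) : nat -> C := fun k => a k * x ^ k.

Lemma conv_fscale x a b k : conv (fscale x a) (fscale x b) k = conv a b k * x ^ k.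
Proof.
  unfold conv. revert a; induction k; intros a; [unfold fscale; simpl; ring|].
  cbn [conv_aux].
  replace (fun j => fscale x a (S j)) with (fun j => x * fscale x (fun j => a (S j)) j).
  2:{ apply functional_extensionality; intros j; unfold fscale; simpl; ring. }
  rewrite conv_scall, IHk. unfold fscale; simpl; ring.
Qed.

Lemma geo_rec (a c d : nat -> C) N :
  (forall k, (N <= k)%nat -> c k * a (S k) = d k * a k /\ (0 < Cmod (c k))%R /\ (2 * Cmod (d k) <= Cmod (c k))%R) ->
  geo a.
Proof.
  intros H. apply (geo_ratio a N). intros k Hk. destruct (H k Hk) as (E & P & B).
  apply (f_equal Cmod) in E. rewrite !Cmod_mult in E.
  apply (Rmult_le_reg_l (Cmod (c k))); [exact P|]. rewrite E.
  generalize (Cmod_ge_0 (a k)). nra.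
Qed.

Lemma geo_bes nu x : generic nu -> geo (fscale x (bes nu)).
Proof.
  intros H. destruct (INR_large (Cmod nu + 1 + 2 * Cmod x)) as [N HN].
  apply (geo_rec _ (fun k => RtoC (INR (S k)) * (nu + RtoC (INR (S k)))) (fun _ => x) N).
  intros k Hk. specialize (HN k Hk). assert (P := Cmod_plus_INR nu k).
  assert (X0 := Cmod_ge_0 x). assert (V0 := Cmod_ge_0 nu).
  rewrite Cmod_mult, Cmod_R, Rabs_pos_eq by apply pos_INR.
  split; [|split; nra].
  unfold fscale. rewrite <- (bes_S nu k H). simpl. ring.
Qed.

Lemma geo_coefM nu x : generic nu -> generic (- nu) -> geo (fscale x (coefM nu)).
Proof.
  intros H H'. destruct (INR_large (4 * Cmod nu + 1 + 16 * Cmod x)) as [N0 HN].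
  (* The recurrence of the product is divided by the indices [k] and [k + 1]; it starts at [S N0]
     because the constant term of [coefM] does not obey it. *)
  apply (geo_rec _ (fun k => let N := RtoC (INR (S k)) in N * N * (N * N - nu * nu))
    (fun k => (RtoC 4 * RtoC (INR (S k)) - RtoC 2) * RtoC (INR k) * x) (S N0)).
  intros k Hk. specialize (HN k ltac:(lia)).
  assert (X0 := Cmod_ge_0 x). assert (V0 := Cmod_ge_0 nu).
  set (N := INR (S k)) in *. cbv zeta.
  assert (Hk1 : (0 <= INR k <= N)%R) by (split; [apply pos_INR|apply le_INR; lia]).
  assert (B : (N * N - Cmod nu * Cmod nu <= Cmod (RtoC N * RtoC N - nu * nu))%R).
  { eapply Rle_trans; [|apply Cmod_rev_triangle]. rewrite !Cmod_mult, Cmod_R, Rabs_pos_eq by lra. lra. }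
  assert (B1 : (8 * Cmod x + 1/2 <= N * N - Cmod nu * Cmod nu)%R) by nra.
  assert (B2 : (Cmod (RtoC 4 * RtoC N - RtoC 2) <= 4 * N)%R).
  { rewrite <- RtoC_mult, <- RtoC_minus, Cmod_R. apply Rabs_le. lra. }
  rewrite !Cmod_mult, !Cmod_R, (Rabs_pos_eq N), (Rabs_pos_eq (INR k)) by lra.
  assert (NN : (1 <= N * N)%R) by nra.
  split; [|split].
  - unfold fscale. destruct k; [lia|]. unfold coefM at 1 2.
    assert (E := bes_product_rec nu (S k) H H'). cbv zeta in E. fold N in E.
    assert (NZ : RtoC N <> RtoC 0) by (apply RtoC_neq_0; lra).
    transitivity (RtoC N * (RtoC N * RtoC N - nu * nu) * (bes nu * bes (- nu))%fps (S (S k)) * x ^ S (S k) / RtoC 2);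
      [fold N; field; exact NZ|].
    rewrite E. simpl (x ^ S (S k)). simpl (x ^ S k). field. apply INR_S_neq_0.
  - apply Rmult_lt_0_compat; lra.
  - apply Rle_trans with (2 * (4 * N * N * Cmod x))%R.
    + apply Rmult_le_compat_l; [lra|]. apply Rmult_le_compat_r; [exact X0|].
      apply Rmult_le_compat; try apply Cmod_ge_0; lra.
    + apply Rle_trans with (N * N * (8 * Cmod x))%R; [lra|]. apply Rmult_le_compat_l; lra.
Qed.

Lemma geo_coefP nu x : generic nu -> nu <> RtoC 0 -> geo (fscale x (coefP nu)).
Proof.
  intros H N0'. destruct (INR_large (4 * Cmod nu + 1 + 64 * Cmod x)) as [N0 HN].
  apply (geo_rec _ (fun k => let N := RtoC (INR (S k)) in N * (N + nu) * (N + RtoC 2 * nu) * (nu + N))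
    (fun k => (RtoC 4 * RtoC (INR (S k)) - RtoC 2 + RtoC 4 * nu) * (nu + RtoC (INR k)) * x) N0).
  intros k Hk. specialize (HN k ltac:(lia)).
  assert (X0 := Cmod_ge_0 x). assert (V0 := Cmod_ge_0 nu).
  assert (P := Cmod_plus_INR nu k). assert (P2 := Cmod_plus_INR (RtoC 2 * nu) k).
  set (N := INR (S k)) in *. cbv zeta.
  rewrite Cmod_mult, Cmod_R, (Rabs_pos_eq 2) in P2 by lra.
  assert (Hk1 : (0 <= INR k <= N)%R) by (split; [apply pos_INR|apply le_INR; lia]).
  replace (RtoC N + nu) with (nu + RtoC N) by ring.
  replace (RtoC N + RtoC 2 * nu) with (RtoC 2 * nu + RtoC N) by ring.
  assert (B2 : (Cmod (RtoC 4 * RtoC N - RtoC 2 + RtoC 4 * nu) <= 5 * N)%R).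
  { eapply Rle_trans; [apply Cmod_triangle|].
    rewrite Cmod_mult, <- RtoC_mult, <- RtoC_minus, !Cmod_R, !Rabs_pos_eq by lra. lra. }
  assert (B3 : (Cmod (nu + RtoC (INR k)) <= 5 / 4 * N)%R).
  { eapply Rle_trans; [apply Cmod_triangle|]. rewrite Cmod_R, Rabs_pos_eq by lra. lra. }
  rewrite !Cmod_mult, !Cmod_R, (Rabs_pos_eq N) by lra.
  set (A := Cmod (nu + RtoC N)) in *. set (B := Cmod (RtoC 2 * nu + RtoC N)) in *.
  assert (A1 : (3 / 4 * N <= A)%R) by lra. assert (B1 : (1 / 2 * N <= B)%R) by lra.
  split; [|split].
  - unfold fscale, coefP.
    assert (E := bes_square_rec nu k H). cbv zeta in E. fold N in E.
    transitivity (RtoC N * (RtoC N + nu) * (RtoC N + RtoC 2 * nu) * (bes nu * bes nu)%fps (S k) * x ^ S k / RtoC 2);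
      [fold N; field; apply H|].
    rewrite E. simpl (x ^ S k). field.
    destruct k; [simpl; rewrite Cplus_0_r; exact N0'|apply H].
  - repeat apply Rmult_lt_0_compat; lra.
  - apply Rle_trans with (2 * (5 * N * (5 / 4 * N) * Cmod x))%R.
    + apply Rmult_le_compat_l; [lra|]. apply Rmult_le_compat_r; [exact X0|].
      apply Rmult_le_compat; try apply Cmod_ge_0; lra.
    + apply Rle_trans with (N * (3 / 4 * N) * (1 / 2 * N) * (3 / 4 * N))%R.
      * assert (N2 : (64 * Cmod x <= N * N)%R) by nra.
        replace (N * (3 / 4 * N) * (1 / 2 * N) * (3 / 4 * N))%R with ((N * N) * (9 / 32 * (N * N)))%R by field.
        replace (2 * (5 * N * (5 / 4 * N) * Cmod x))%R with ((N * N) * (25 / 2 * Cmod x))%R by field.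
        apply Rmult_le_compat_l; [nra|lra].
      * assert (0 <= N * (3 / 4 * N))%R by nra.
        assert (N * (3 / 4 * N) <= N * A)%R by nra.
        assert (0 <= N * (3 / 4 * N) * (1 / 2 * N))%R by nra.
        assert (N * (3 / 4 * N) * (1 / 2 * N) <= N * A * B)%R by (apply Rmult_le_compat; lra).
        apply Rmult_le_compat; lra.
Qed.

Lemma pochC_rGamma s k : rGamma (s + RtoC 1) = pochC k (s + RtoC 1) * rGamma (s + RtoC (INR k) + RtoC 1).
Proof.
  induction k.
  - unfold pochC; simpl. replace (s + RtoC 0 + RtoC 1) with (s + RtoC 1) by ring. ring.
  - rewrite IHk, pochC_S, (rGamma_rec (s + RtoC (INR k) + RtoC 1)), S_INR, RtoC_plus.
    replace (s + (RtoC (INR k) + RtoC 1) + RtoC 1) with (s + RtoC (INR k) + RtoC 1 + RtoC 1) by ring. ring.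
Qed.

Lemma besT_bes x nu k : generic nu -> besT x nu k = rGamma (nu + RtoC 1) * fscale x (bes nu) k.
Proof.
  intros H. unfold besT, fscale, bes. rewrite (pochC_rGamma nu k). field.
  split; [apply pochC_neq_0, H|apply RtoC_fact_neq_0].
Qed.

Lemma Cder_pochC nu k : generic nu ->
  Cder (fun s => pochC k (s + RtoC 1)) nu (pochC k (nu + RtoC 1) * harm nu k).
Proof.
  intros H. induction k.
  - apply (Cder_ext (fun _ => RtoC 1)); [intros; reflexivity|]. eapply Cder_eq; [apply Cder_const|simpl; ring].
  - apply (Cder_ext (fun s => pochC k (s + RtoC 1) * (s + RtoC (INR (S k))))).
    { intros w; rewrite pochC_S, S_INR, RtoC_plus. ring. }
    eapply Cder_eq.
    + apply (Cder_mult (fun s => pochC k (s + RtoC 1)) (fun s => s + RtoC (INR (S k)))); [exact IHk|].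
      apply Cder_plus; [apply Cder_id|apply Cder_const].
    + rewrite pochC_S. cbn [harm].
      replace (nu + RtoC 1 + RtoC (INR k)) with (nu + RtoC (INR (S k))) by (rewrite S_INR, RtoC_plus; ring).
      field. apply H.
Qed.

Lemma Cder_shift (f : C -> C) (s c d : C) : Cder f (s + c) d -> Cder (fun w => f (w + c)) s d.
Proof.
  intros Hf. eapply Cder_eq; [apply (Cder_comp f (fun w => w + c) s d (RtoC 1) Hf)|ring].
  eapply Cder_eq; [apply Cder_plus; [apply Cder_id|apply Cder_const]|ring].
Qed.

(** Differentiating [rGamma (s + 1) = pochC k (s + 1) * rGamma (s + k + 1)] expresses the derivative
    at [nu + k + 1] through the one at [nu + 1] and [harm]: the recurrence of the digamma function
    in disguise. *)
Lemma Cder_besT x nu k g : generic nu -> Cder rGamma (nu + RtoC 1) g ->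
  Cder (fun s => besT x s k) nu
    (g * fscale x (bes nu) k + rGamma (nu + RtoC 1) * fscale x (fun n => - bes nu n * harm nu n) k).
Proof.
  intros H Hg.
  destruct (hol_der _ rGamma (nu + RtoC (INR k) + RtoC 1) entire_rGamma I) as [d Hd].
  assert (Hd' : Cder (fun s => rGamma (s + RtoC (INR k) + RtoC 1)) nu d).
  { apply (Cder_shift (fun s => rGamma (s + RtoC 1))). apply (Cder_shift rGamma). exact Hd. }
  assert (E : g = pochC k (nu + RtoC 1) * harm nu k * rGamma (nu + RtoC (INR k) + RtoC 1) + pochC k (nu + RtoC 1) * d).
  { apply (Cder_unique (fun s => rGamma (s + RtoC 1)) nu); [apply (Cder_shift rGamma), Hg|].
    apply (Cder_ext (fun s => pochC k (s + RtoC 1) * rGamma (s + RtoC (INR k) + RtoC 1))).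
    { intros w; symmetry; apply pochC_rGamma. }
    apply (Cder_mult (fun s => pochC k (s + RtoC 1)) (fun s => rGamma (s + RtoC (INR k) + RtoC 1))); [apply Cder_pochC, H|exact Hd']. }
  unfold besT. eapply Cder_eq; [apply Cder_scal, Hd'|].
  rewrite (pochC_rGamma nu k), E. unfold fscale, bes. field.
  split; [apply pochC_neq_0, H|apply RtoC_fact_neq_0].
Qed.

Lemma generic_opp_opp nu : generic nu -> generic (- - nu).
Proof. replace (- - nu) with nu by ring. auto. Qed.

(** The product [bes nu * bes (- nu)] is even in [nu]; only the constant of integration [1 / (2 nu)]
    changes sign. *)
Lemma coefM_opp nu k : nu <> RtoC 0 -> coefM (- nu) k = coefM nu k + fconst (- / nu) k.
Proof.
  intros H. destruct k.
  - simpl. field. exact H.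
  - unfold coefM. cbn [fconst]. replace (- - nu) with nu by ring. unfold conv. rewrite (conv_comm_aux (S k) (bes (- nu))). ring.
Qed.

Lemma is_Csum_const c : is_Csum (fconst c) c.
Proof.
  apply (is_Clim_ext (fun _ => c)); [|apply is_Clim_const].
  exists 1%nat; intros n Hn. destruct n; [lia|]. clear Hn.
  induction n; [simpl; ring|]. change (csum (fconst c) (S (S n))) with (csum (fconst c) (S n) + RtoC 0).
  rewrite <- IHn; ring.
Qed.

(** Sums the formal identity [bes_variation]. The case of [- nu] is the same one with [U] and [V]
    exchanged, [Q] for [P], and [M - / nu] for [M]. *)
Lemma besS_generic x nu : generic nu -> generic (- nu) -> nu <> RtoC 0 ->
  exists U V M P Q : C,
    is_Csum (fscale x (coefM nu)) M /\ is_Csum (fscale x (coefP nu)) P /\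
    is_Csum (fscale x (coefP (- nu))) Q /\
    besS x nu = rGamma (nu + RtoC 1) * U /\ besS x (- nu) = rGamma (- nu + RtoC 1) * V /\
    (forall g, Cder rGamma (nu + RtoC 1) g ->
       Cder (besS x) nu (g * U + rGamma (nu + RtoC 1) * (U * M - V * P))) /\
    (forall g, Cder rGamma (- nu + RtoC 1) g ->
       Cder (besS x) (- nu) (g * V + rGamma (- nu + RtoC 1) * (V * (M - / nu) - U * Q))).
Proof.
  intros H H' N0.
  assert (N0' : - nu <> RtoC 0) by (intros E; apply N0; replace nu with (- - nu) by ring; rewrite E; ring).
  assert (gU := geo_bes nu x H). assert (gV := geo_bes (- nu) x H').
  assert (gM := geo_coefM nu x H H'). assert (gP := geo_coefP nu x H N0). assert (gQ := geo_coefP (- nu) x H' N0').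
  assert (gM' := geo_coefM (- nu) x H' (generic_opp_opp nu H)).
  destruct (geo_cv _ gU) as [U HU]. destruct (geo_cv _ gV) as [V HV]. destruct (geo_cv _ gM) as [M HM].
  destruct (geo_cv _ gP) as [P HP]. destruct (geo_cv _ gQ) as [Q HQ].
  assert (HM' : is_Csum (fscale x (coefM (- nu))) (M - / nu)).
  { apply (is_Csum_ext (fun k => fscale x (coefM nu) k + fconst (- / nu) k)).
    - intros k. unfold fscale. rewrite coefM_opp by exact N0. destruct k; simpl; ring.
    - apply is_Csum_plus; [exact HM|apply is_Csum_const]. }
  exists U, V, M, P, Q. split; [exact HM|]. split; [exact HP|]. split; [exact HQ|].
  assert (main : forall mu U' V' M' P', generic mu -> generic (- mu) -> mu <> RtoC 0 ->
    geo (fscale x (bes mu)) -> geo (fscale x (bes (- mu))) -> geo (fscale x (coefM mu)) -> geo (fscale x (coefP mu)) ->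
    is_Csum (fscale x (bes mu)) U' -> is_Csum (fscale x (bes (- mu))) V' ->
    is_Csum (fscale x (coefM mu)) M' -> is_Csum (fscale x (coefP mu)) P' ->
    besS x mu = rGamma (mu + RtoC 1) * U' /\
    forall g, Cder rGamma (mu + RtoC 1) g ->
       Cder (besS x) mu (g * U' + rGamma (mu + RtoC 1) * (U' * M' - V' * P'))).
  { clear. intros mu U V M P H H' N0 gU gV gM gP HU HV HM HP. split.
    - apply CSeries_unique. apply (is_Csum_ext (fun k => rGamma (mu + RtoC 1) * fscale x (bes mu) k)).
      + intros k; symmetry; apply besT_bes, H.
      + apply is_Csum_scal, HU.
    - intros g Hg.
      destruct (proj2 (besS_limit x) mu _ (fun k => Cder_besT x mu k g H Hg)) as [D [HD HS]].
      apply (Cder_eq _ _ D); [exact HD|]. apply (is_Csum_unique _ _ _ HS).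
      apply is_Csum_plus; [apply is_Csum_scal, HU|]. apply is_Csum_scal.
      rewrite bes_variation by assumption.
      apply (is_Csum_ext (fun k => conv (fscale x (bes mu)) (fscale x (coefM mu)) k +
         RtoC (-1) * conv (fscale x (bes (- mu))) (fscale x (coefP mu)) k)).
      + intros k. rewrite !conv_fscale. unfold fscale, fsub. ring.
      + replace (U * M - V * P) with (U * M + RtoC (-1) * (V * P)) by ring.
        apply is_Csum_plus; [|apply is_Csum_scal]; apply is_Csum_conv; assumption. }
  destruct (main nu U V M P) as [A1 A2]; try assumption.
  assert (OO : - - nu = nu) by ring.
  destruct (main (- nu) V U (M - / nu) Q) as [B1 B2]; rewrite ?OO; try assumption.
  split; [exact A1|]. split; [exact B1|]. split; assumption.
Qed.

(** * The modified Bessel function of the second kind *)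

Lemma Csin_rGamma nu : Csin (RtoC PI * nu) =
  RtoC PI * nu * rGamma (nu + RtoC 1) * rGamma (- nu + RtoC 1).
Proof.
  assert (NP : RtoC PI <> RtoC 0) by (apply RtoC_neq_0, PI_neq0).
  destruct (Ceq_dec nu (RtoC 0)) as [E|E].
  { subst. replace (RtoC PI * RtoC 0) with (RtoC 0) by ring. rewrite Csin_0. ring. }
  generalize (rGamma_reflection nu). rewrite (rGamma_rec nu), (rGamma_rec (- nu)). intros R.
  replace (Csin (RtoC PI * nu)) with (- nu * Csin (RtoC PI * nu) / RtoC PI * (- RtoC PI / nu)) by (field; auto).
  rewrite <- R. field. exact E.
Qed.

Definition noninteger (t : R) : Prop := forall k : Z, t <> IZR k.

Lemma noninteger_not_is_integer t : noninteger t -> ~ is_integer (RtoC t).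
Proof. intros H [k Hk]. apply (H k). exact (RtoC_inj _ _ Hk). Qed.

Lemma noninteger_locally t : noninteger t ->
  exists d : R, (0 < d)%R /\ forall u, (Rabs (u - t) < d)%R -> noninteger u.
Proof.
  intros H. destruct (archimed t) as [A1 A2].
  set (m := up t) in *.
  assert (N1 := H m). assert (N2 := H (m - 1)%Z). rewrite minus_IZR in N2.
  exists (Rmin (IZR m - t) (t - (IZR m - 1))). split; [apply Rmin_pos; lra|].
  intros u Hu k E. apply Rabs_def2 in Hu.
  assert (B1 := Rmin_l (IZR m - t) (t - (IZR m - 1))). assert (B2 := Rmin_r (IZR m - t) (t - (IZR m - 1))).
  assert (k < m)%Z by (apply lt_IZR; lra).
  assert (m - 1 < k)%Z by (apply lt_IZR; rewrite minus_IZR; lra). lia.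
Qed.

Lemma noninteger_near t (n : Z) : t <> IZR n -> (Rabs (t - IZR n) < 1)%R -> noninteger t.
Proof.
  intros H Ht k E. apply Rabs_def2 in Ht. apply H. rewrite E in *. f_equal.
  assert (k < n + 1)%Z by (apply lt_IZR; rewrite plus_IZR; lra).
  assert (n - 1 < k)%Z by (apply lt_IZR; rewrite minus_IZR; lra). lia.
Qed.

Lemma noninteger_generic t : noninteger t -> generic (RtoC t) /\ generic (- RtoC t) /\ RtoC t <> RtoC 0.
Proof.
  intros H. repeat split.
  - intros n E. rewrite <- RtoC_plus in E. apply RtoC_inj in E.
    apply (H (- Z.of_nat (S n))%Z). rewrite opp_IZR, <- INR_IZR_INZ. lra.
  - intros n E. rewrite <- RtoC_opp, <- RtoC_plus in E. apply RtoC_inj in E.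
    apply (H (Z.of_nat (S n))). rewrite <- INR_IZR_INZ. lra.
  - intros E. apply RtoC_inj in E. apply (H 0%Z). exact E.
Qed.

Lemma generic_rGamma nu : generic nu -> rGamma (nu + RtoC 1) <> RtoC 0.
Proof.
  intros H. apply rGamma_neq_0. intros k E. apply (H k). rewrite S_INR, RtoC_plus.
  replace (nu + (RtoC (INR k) + RtoC 1)) with (nu + RtoC 1 + RtoC (INR k)) by ring. rewrite E. ring.
Qed.

Lemma BesselK_noninteger t z : noninteger t -> BesselK (RtoC t) z = BesselK_quot (RtoC t) z.
Proof.
  intros H. unfold BesselK. destruct (excluded_middle_informative _) as [h|h]; [|reflexivity].
  exfalso. exact (noninteger_not_is_integer t H h).
Qed.

Lemma Cder_comp_opp (f : C -> C) (s d : C) : Cder f (- s) d -> Cder (fun w => f (- w)) s (- d).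
Proof.
  intros H. eapply Cder_eq; [apply (Cder_comp f (fun w => - w) s d (- RtoC 1) H)|ring].
  apply Cder_opp, Cder_id.
Qed.

Lemma RCder_RtoC t : RCder RtoC t (RtoC 1).
Proof. apply (RCder_ext (fun u => RtoC u * RtoC 1)); [intros; ring|apply RCder_id]. Qed.

(** Here [a] and [b] are the factors of the 0F1 series in [I_nu] and [I_(-nu)], and [kappa] is
    [PI / (2 sin (PI nu))]. The result is arranged as a multiple of [K_nu] minus a multiple of
    [I_nu], each multiplier having the shape of one of the two residue sums. *)
Lemma BesselK_derivative_generic (t : R) (z M P Q g gm : C) :
  let nu := RtoC t in
  let L := Clog (z / RtoC 2) in let x := (z / RtoC 2) ^ 2 in
  let ra := rGamma (nu + RtoC 1) in let rb := rGamma (- nu + RtoC 1) in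
  let a := Cexp (nu * L) * ra in let b := Cexp (- nu * L) * rb in
  let kappa := / (RtoC 2 * nu * ra * rb) in
  noninteger t ->
  is_Csum (fscale x (coefM nu)) M -> is_Csum (fscale x (coefP nu)) P ->
  is_Csum (fscale x (coefP (- nu))) Q ->
  Cder rGamma (nu + RtoC 1) g -> Cder rGamma (- nu + RtoC 1) gm ->
  RCder (fun t : R => BesselK (RtoC t) z) t
    (nu / RtoC 2 *
      (BesselK nu z * (- (RtoC 2 / nu) * (L + g / ra + M - a / b * P))
       - BesselI nu z * (RtoC 2 * kappa / nu *
           (RtoC 2 * L + g / ra + gm / rb + RtoC 2 * M - / nu - a / b * P - b / a * Q)))).
Proof.
  intros nu L x ra rb a b kappa Ht HM HP HQ Hg Hgm.
  destruct (noninteger_generic t Ht) as (G1 & G2 & N0). fold nu in G1, G2, N0.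
  assert (Ra := generic_rGamma nu G1). assert (Rb := generic_rGamma (- nu) G2). fold ra in Ra. fold rb in Rb.
  assert (NP : RtoC PI <> RtoC 0) by (apply RtoC_neq_0, PI_neq0).
  destruct (besS_generic x nu G1 G2 N0) as (U & V & M' & P' & Q' & sM & sP & sQ & SU & SV & DU & DV).
  rewrite (is_Csum_unique _ _ _ sM HM), (is_Csum_unique _ _ _ sP HP), (is_Csum_unique _ _ _ sQ HQ) in *.
  clear sM sP sQ. specialize (DU g Hg). specialize (DV gm Hgm). fold ra in SU, DU, DV. fold rb in SV, DU, DV.
  (* By reflection the sine in the denominator becomes a product of values of [rGamma], so the
     derivative is expressed by [g] and [gm] alone. *)
  pose (q := fun s => / (RtoC 2 * s * rGamma (s + RtoC 1) * rGamma (- s + RtoC 1)) *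
     (Cexp (- s * L) * besS x (- s) - Cexp (s * L) * besS x s)).
  assert (Kq : forall u, noninteger u -> BesselK (RtoC u) z = q (RtoC u)).
  { intros u Hu. rewrite BesselK_noninteger by exact Hu. unfold BesselK_quot, q.
    destruct (noninteger_generic u Hu) as (h1 & h2 & h3).
    rewrite !BesselI_besS, Csin_rGamma. fold L x. rewrite RtoC_div by lra. field.
    repeat split; try assumption; [exact (generic_rGamma _ h2)|exact (generic_rGamma _ h1)]. }
  assert (KN : BesselK nu z = q nu) by exact (Kq t Ht). rewrite KN.
  apply (is_derive_ext_loc (V := C_R_NormedModule) (fun u => q (RtoC u))).
  { destruct (noninteger_locally t Ht) as [d [Hd HH]]. exists (mkposreal d Hd). intros u Hu.
    symmetry. apply Kq, HH. exact Hu. }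
  eapply RCder_eq; [apply (RCder_comp q RtoC); [|apply RCder_RtoC]|].
  - unfold q. apply (Cder_mult (fun s => / (RtoC 2 * s * rGamma (s + RtoC 1) * rGamma (- s + RtoC 1)))
      (fun s => Cexp (- s * L) * besS x (- s) - Cexp (s * L) * besS x s)).
    + apply (Cder_comp Cinv (fun s => RtoC 2 * s * rGamma (s + RtoC 1) * rGamma (- s + RtoC 1))).
      * apply Cder_inv. repeat apply Cmult_neq_0; try assumption. apply RtoC_neq_0; lra.
      * apply Cder_mult; [apply Cder_mult|].
        -- apply Cder_scal, Cder_id.
        -- apply (Cder_shift rGamma). exact Hg.
        -- apply (Cder_comp_opp (fun s => rGamma (s + RtoC 1))). apply (Cder_shift rGamma). exact Hgm.
    + apply Cder_minus; apply Cder_mult.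
      * apply (Cder_comp Cexp (fun s => - s * L)); [apply Cder_Cexp|].
        apply Cder_mult; [apply Cder_opp, Cder_id|apply Cder_const].
      * apply (Cder_comp_opp (besS x)). exact DV.
      * apply (Cder_comp Cexp (fun s => s * L)); [apply Cder_Cexp|].
        apply Cder_mult; [apply Cder_id|apply Cder_const].
      * exact DU.
  - rewrite BesselI_besS. fold L x nu. unfold q. fold ra rb. rewrite SU, SV.
    unfold a, b, kappa. fold ra rb.
    replace (- nu * L) with (- (nu * L)) by ring. rewrite Cexp_opp.
    set (e := Cexp (nu * L)). assert (Ne : e <> RtoC 0) by apply Cexp_neq_0.
    field. repeat split; assumption.
Qed.

(** The first [n] terms at order [- n] contain zeros of [rGamma]; the others are those at order [n],
    shifted by [n]. *)
Lemma besS_opp_nat x n : besS x (- RtoC (INR n)) = x ^ n * besS x (RtoC (INR n)).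
Proof.
  apply CSeries_unique. apply (is_Clim_shift _ _ n).
  apply (is_Clim_ext (fun m => x ^ n * csum (besT x (RtoC (INR n))) m)); [|apply is_Clim_scal, besS_Csum].
  exists 0%nat. intros m _. rewrite <- csum_scal.
  assert (Z : csum (besT x (- RtoC (INR n))) n = RtoC 0).
  { assert (K : forall j, (j <= n)%nat -> csum (besT x (- RtoC (INR n))) j = RtoC 0); [|apply K; lia].
    induction j; intros Hj; [reflexivity|]. simpl. rewrite IHj by lia.
    unfold besT. replace (- RtoC (INR n) + RtoC (INR j) + RtoC 1) with (- RtoC (INR (n - S j))).
    - rewrite rGamma_opp_nat; ring.
    - rewrite minus_INR, S_INR, RtoC_minus, RtoC_plus by lia. ring. }
  induction m.
  - rewrite Nat.add_0_r, Z. reflexivity.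
  - rewrite Nat.add_succ_r. simpl. rewrite <- IHm. f_equal.
    unfold besT.
    replace (- RtoC (INR n) + RtoC (INR (n + m)) + RtoC 1) with (RtoC (INR m) + RtoC 1)
      by (rewrite plus_INR, RtoC_plus; ring).
    replace (RtoC (INR n) + RtoC (INR m) + RtoC 1) with (RtoC (INR (n + m)) + RtoC 1)
      by (rewrite plus_INR, RtoC_plus; ring).
    rewrite !rGamma_nat, Cpow_add_r. field. split; apply RtoC_fact_neq_0.
Qed.

Lemma BesselI_opp_nat z n : z <> RtoC 0 -> BesselI (- RtoC (INR n)) z = BesselI (RtoC (INR n)) z.
Proof.
  intros Hz. rewrite !BesselI_besS, besS_opp_nat.
  assert (Z2 : z / RtoC 2 <> RtoC 0).
  { apply Cmult_neq_0; [exact Hz|]. rewrite <- RtoC_inv by lra. apply RtoC_neq_0; lra. }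
  set (w := z / RtoC 2) in *.
  assert (E : forall m, Cexp (RtoC (INR m) * Clog w) = w ^ m).
  { induction m; [simpl; rewrite Cmult_0_l; apply Cexp_0|].
    rewrite S_INR, RtoC_plus. replace ((RtoC (INR m) + RtoC 1) * Clog w) with (RtoC (INR m) * Clog w + Clog w) by ring.
    rewrite Cexp_plus, IHm, Cexp_Clog by exact Z2. simpl. ring. }
  replace (- RtoC (INR n) * Clog w) with (- (RtoC (INR n) * Clog w)) by ring.
  rewrite Cexp_opp, E, <- Cpow_mult_r. replace (2 * n)%nat with (n + n)%nat by lia. rewrite Cpow_add_r.
  field. apply Cpow_nz, Z2.
Qed.

(** L'Hospital's rule: [f / (s - p)] and [g / (s - p)] extend continuously to [p] by the
    derivatives, and their quotient is [f / g] off [p]. *)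
Lemma quotient_limit (f g : C -> C) (p a b : C) : f p = RtoC 0 -> g p = RtoC 0 ->
  Cder f p a -> Cder g p b -> b <> RtoC 0 ->
  filterlim (fun s => f s / g s) (locally' p) (locally (a / b)).
Proof.
  intros Hf Hg Df Dg Hb.
  assert (K : forall (h : C -> C) d, h p = RtoC 0 -> Cder h p d ->
    continuous (fun s => if Ceq_dec s p then d else h s / (s - p)) p).
  { intros h d H0 Hd. apply Cc_eps. intros eps He. apply locally_C_eps.
    destruct (Hd (eps / 2)%R ltac:(lra)) as [dl [Hdl HH]]. exists dl. split; [exact Hdl|].
    intros y Hy. destruct (Ceq_dec p p) as [_|n]; [|contradiction].
    destruct (Ceq_dec y p) as [E|E].
    - replace (d - d) with (RtoC 0) by ring. rewrite Cmod_0R; exact He.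
    - specialize (HH y Hy). rewrite H0 in HH.
      assert (Ny : y - p <> RtoC 0) by (apply Cminus_eq_contra, E).
      assert (Py := Cmod_pos_ne _ Ny).
      replace (h y / (y - p) - d) with ((h y - RtoC 0 - d * (y - p)) * / (y - p)) by (field; exact Ny).
      rewrite Cmod_mult, Cmod_inv by exact Ny.
      apply Rle_lt_trans with (eps / 2 * Cmod (y - p) * / Cmod (y - p))%R.
      + apply Rmult_le_compat_r; [left; apply Rinv_0_lt_compat, Py|exact HH].
      + rewrite Rmult_assoc, Rinv_r; lra. }
  assert (Q : continuous (fun s => (if Ceq_dec s p then a else f s / (s - p)) *
     / (if Ceq_dec s p then b else g s / (s - p))) p).
  { apply Cc_mult; [apply K; assumption|]. apply Cc_inv; [apply K; assumption|].
    destruct (Ceq_dec p p); [exact Hb|contradiction]. }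
  unfold continuous in Q. destruct (Ceq_dec p p) as [_|n]; [|contradiction].
  assert (Q' : filterlim (fun s => (if Ceq_dec s p then a else f s / (s - p)) *
     / (if Ceq_dec s p then b else g s / (s - p))) (locally' p) (locally (a / b))).
  { eapply filterlim_filter_le_1; [|exact Q]. intros S HS. unfold locally', within. revert HS.
    apply filter_imp. auto. }
  assert (GN : locally' p (fun s => g s <> RtoC 0)).
  { destruct (Dg (Cmod b / 2)%R ltac:(generalize (Cmod_pos_ne _ Hb); lra)) as [dl [Hdl HH]].
    unfold locally', within. apply locally_C_eps. exists dl. split; [exact Hdl|].
    intros y Hy Hn E. specialize (HH y Hy). rewrite Hg, E in HH.
    replace (RtoC 0 - RtoC 0 - b * (y - p)) with (- (b * (y - p))) in HH by ring.
    rewrite Cmod_opp, Cmod_mult in HH.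
    assert (0 < Cmod (y - p))%R by (apply Cmod_gt_0, Cminus_eq_contra, Hn).
    generalize (Cmod_pos_ne _ Hb). nra. }
  eapply filterlim_ext_loc; [|exact Q'].
  assert (NE : locally' p (fun s => s <> p)).
  { unfold locally', within. apply locally_C_eps. exists 1%R. split; [lra|]. auto. }
  generalize (filter_and _ _ GN NE). apply filter_imp. intros s [h1 h2].
  destruct (Ceq_dec s p) as [h|h]; [contradiction|].
  field. repeat split; try assumption; apply Cminus_eq_contra; assumption.
Qed.

Lemma Clim_at_unique (f : C -> C) (p l : C) :
  filterlim f (locally' p) (locally l) -> Clim_at f p = l.
Proof.
  intros H. unfold Clim_at. apply (iota_unique (V := C_CompleteNormedModule)); [|exact H].
  intros y Hy. apply Cmod_le_eps_eq. intros eps He.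
  assert (E1 := proj1 (filterlim_C_eps (locally' p) f l) H (eps / 2)%R ltac:(lra)).
  assert (E2 := proj1 (filterlim_C_eps (locally' p) f y) Hy (eps / 2)%R ltac:(lra)).
  assert (E := filter_and _ _ E1 E2). unfold locally', within in E. apply locally_C_eps in E.
  destruct E as [d [Hd HH]].
  destruct (HH (p + RtoC (d / 2))) as [h1 h2].
  - replace (p + RtoC (d / 2) - p) with (RtoC (d / 2)) by ring. rewrite Cmod_R, Rabs_pos_eq; lra.
  - intros E. assert (E' : RtoC (d / 2) = RtoC 0).
    { replace (RtoC (d / 2)) with (p + RtoC (d / 2) - p) by ring. rewrite E. ring. }
    apply RtoC_inj in E'. lra.
  - rewrite Cmod_minus_sym in h2.
    eapply Rle_trans; [apply (Cmod_triangle3 _ (f (p + RtoC (d / 2))))|]. lra.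
Qed.

Lemma Cder_Csin_PI s : Cder (fun w => Csin (RtoC PI * w)) s (RtoC PI * Ccos (RtoC PI * s)).
Proof.
  apply (Cder_ext (fun w => / (RtoC 2 * Ci) * (Cexp (Ci * (RtoC PI * w)) - Cexp (- (Ci * (RtoC PI * w)))))).
  { intros w; unfold Csin. field. apply Ci_neq_0. }
  assert (D : Cder (fun w => Ci * (RtoC PI * w)) s (Ci * (RtoC PI * RtoC 1))) by (apply Cder_scal, Cder_scal, Cder_id).
  eapply Cder_eq.
  - apply Cder_scal, Cder_minus.
    + apply (Cder_comp Cexp (fun w => Ci * (RtoC PI * w))); [apply Cder_Cexp|exact D].
    + apply (Cder_comp Cexp (fun w => - (Ci * (RtoC PI * w)))); [apply Cder_Cexp|apply Cder_opp, D].
  - unfold Ccos. field. apply Ci_neq_0.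
Qed.

Lemma Ccos_PI_nat n : Ccos (RtoC PI * RtoC (INR n)) <> RtoC 0.
Proof.
  unfold Ccos, Cexp. rewrite <- RtoC_mult.
  replace (Ci * RtoC (PI * INR n)) with ((0, PI * INR n)%R : C) by (apply C_ext; simpl; ring). simpl.
  rewrite Ropp_0, cos_neg, sin_neg, exp_0.
  intros E.
  assert (E' : RtoC (cos (PI * INR n)) = RtoC 0).
  { rewrite <- E. apply C_ext; simpl; field. }
  apply RtoC_inj in E'.
  assert (Hs : sin (PI * INR n) = 0%R).
  { rewrite INR_IZR_INZ, Rmult_comm. apply sin_eq_0_1. exists (Z.of_nat n). reflexivity. }
  generalize (sin2_cos2 (PI * INR n)). rewrite E', Hs. unfold Rsqr. lra.
Qed.

(** Since [I_(-n) = I_n], numerator and denominator both vanish at [n], and the derivative of the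
    sine there does not. *)
Lemma BesselK_quot_limit z n : z <> RtoC 0 -> exists l,
  filterlim (fun mu => BesselK_quot mu z) (locally' (RtoC (INR n))) (locally l).
Proof.
  intros Hz. set (p := RtoC (INR n)).
  destruct (hol_der _ _ p (entire_BesselI z) I) as [d1 D1].
  destruct (hol_der _ _ (- p) (entire_BesselI z) I) as [d2 D2].
  eexists.
  assert (Q := quotient_limit (fun mu => RtoC (PI / 2) * (BesselI (- mu) z - BesselI mu z)) (fun mu => Csin (RtoC PI * mu)) p
     (RtoC (PI / 2) * (- d2 - d1)) (RtoC PI * Ccos (RtoC PI * p))).
  eapply filterlim_ext; [|apply Q].
  - intros s. unfold BesselK_quot, Cdiv. ring.
  - unfold p. rewrite BesselI_opp_nat by exact Hz. ring.
  - unfold p. rewrite <- RtoC_mult, Csin_RtoC. f_equal.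
    rewrite INR_IZR_INZ, Rmult_comm. apply sin_eq_0_1. exists (Z.of_nat n). reflexivity.
  - apply Cder_scal, Cder_minus; [|exact D1].
    apply (Cder_comp_opp (fun mu => BesselI mu z)). exact D2.
  - apply Cder_Csin_PI.
  - apply Cmult_neq_0; [apply RtoC_neq_0, PI_neq0|apply Ccos_PI_nat].
Qed.

(** At a noninteger order this is continuity of the quotient. At an integer the value is by
    definition the limit of that quotient, and all other orders within distance 1 are
    nonintegers. *)
Lemma BesselK_continuous z t : z <> RtoC 0 -> (0 < t)%R -> continuous (fun u : R => BesselK (RtoC u) z) t.
Proof.
  intros Hz Ht.
  destruct (excluded_middle_informative (noninteger t)) as [H|H].
  - apply (Cc_ext_loc (fun u => BesselK_quot (RtoC u) z)).
    { destruct (noninteger_locally t H) as [d [Hd HH]]. exists (mkposreal d Hd). intros u Hu.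
      symmetry. apply BesselK_noninteger, HH. exact Hu. }
    destruct (noninteger_generic t H) as (G1 & G2 & N0).
    unfold BesselK_quot. apply Cc_mult; [apply Cc_const|].
    assert (CI : forall s : C, continuous (fun mu => BesselI mu z) s).
    { intros s. apply (hol_cont (fun _ => True)); [apply entire_BesselI|trivial]. }
    apply Cc_mult; [apply Cc_minus|apply Cc_inv].
    + apply (continuous_comp (fun u : R => - RtoC u) (fun mu => BesselI mu z)); [|apply CI].
      apply Cc_opp, Cc_RtoC, continuous_id.
    + apply (continuous_comp (fun u : R => RtoC u) (fun mu => BesselI mu z)); [|apply CI].
      apply Cc_RtoC, continuous_id.
    + apply (continuous_comp (fun u : R => RtoC u) (fun w => Csin (RtoC PI * w))).
      * apply Cc_RtoC, continuous_id.
      * eapply Cder_cont, Cder_Csin_PI.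
    + rewrite Csin_rGamma. repeat apply Cmult_neq_0; try assumption.
      * apply RtoC_neq_0, PI_neq0.
      * apply generic_rGamma, G1.
      * apply (generic_rGamma (- RtoC t)), G2.
  - assert (Hn : exists n : nat, t = INR n).
    { apply not_all_ex_not in H. destruct H as [k Hk]. apply NNPP in Hk.
      exists (Z.to_nat k). rewrite INR_IZR_INZ, Z2Nat.id; [exact Hk|]. apply le_IZR. lra. }
    destruct Hn as [n En]. subst t.
    destruct (BesselK_quot_limit z n Hz) as [l Hl].
    assert (V : BesselK (RtoC (INR n)) z = l).
    { unfold BesselK. destruct (excluded_middle_informative _) as [h|h].
      - apply Clim_at_unique, Hl.
      - exfalso. apply h. exists (Z.of_nat n). rewrite INR_IZR_INZ. reflexivity. }
    apply Cc_eps. rewrite V. intros eps He.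
    assert (E := proj1 (filterlim_C_eps _ _ _) Hl eps He). unfold locally', within in E.
    apply locally_C_eps in E. destruct E as [d [Hd HH]].
    assert (Hd1 : (0 < Rmin d 1)%R) by (apply Rmin_pos; lra).
    exists (mkposreal _ Hd1). intros u Hu.
    assert (Hu' : (Rabs (u - INR n) < Rmin d 1)%R) by exact Hu.
    destruct (Req_dec u (INR n)) as [E|E].
    + subst u. rewrite V. replace (l - l) with (RtoC 0) by ring. rewrite Cmod_0R; exact He.
    + rewrite BesselK_noninteger.
      * apply HH.
        -- rewrite <- RtoC_minus, Cmod_R. eapply Rlt_le_trans; [exact Hu'|apply Rmin_l].
        -- intros X; apply E. exact (RtoC_inj _ _ X).
      * apply (noninteger_near u (Z.of_nat n)); rewrite <- INR_IZR_INZ; [exact E|].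
        eapply Rlt_le_trans; [exact Hu'|apply Rmin_r].
Qed.

(** * Integrals along half-lines *)

Definition HL (f : R -> C) (c : R) : C :=
  @RInt_gen C_R_CompleteNormedModule f (at_point c) (Rbar_locally p_infty).

Lemma exp_neg_small eps : (0 < eps)%R -> exists b, forall t, (b <= t)%R -> (exp (- t) < eps)%R.
Proof.
  intros He. exists (1 - ln eps)%R. intros t Ht.
  apply Rlt_le_trans with (exp (ln eps)); [apply exp_increasing; lra|]. rewrite exp_ln by exact He. lra.
Qed.

Section HalfLine.
Variables (f : R -> C) (c K : R).
Hypothesis Hc : forall t, (c <= t)%R -> continuous f t.
Hypothesis HK : forall t, (c <= t)%R -> (Cmod (f t) <= K * exp (- t))%R.

Let K0 : (0 <= K)%R.
Proof.
  specialize (HK c ltac:(lra)). generalize (Cmod_ge_0 (f c)) (exp_pos (- c)). intros.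
  destruct (Rle_dec 0 K) as [h|h]; [exact h|]. nra.
Qed.

Let int a b : (c <= a <= b)%R -> CisRInt f a b (CRInt f a b).
Proof. intros Hab. apply CisRInt_cont; [lra|]. intros t Ht; apply Hc; lra. Qed.

Let bnd a b : (c <= a <= b)%R -> (Cmod (CRInt f a b) <= K * exp (- a))%R.
Proof.
  intros Hab.
  assert (I : is_RInt (fun t => K * exp (- t))%R a b (K * (exp (- a) - exp (- b)))%R).
  { replace (K * (exp (- a) - exp (- b)))%R with (minus (- (K * exp (- b)))%R (- (K * exp (- a)))%R : R)
      by (unfold minus, plus, opp; simpl; ring).
    apply (is_RInt_derive (V := R_CompleteNormedModule) (fun t => - (K * exp (- t)))%R).
    - intros t _. auto_derive; [trivial|ring].
    - intros t _. apply (ex_derive_continuous (V := R_NormedModule)). auto_derive; trivial. }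
  apply Rle_trans with (K * (exp (- a) - exp (- b)))%R.
  - rewrite Cmod_norm.
    refine (norm_RInt_le (V := C_R_NormedModule) f (fun t => K * exp (- t))%R a b _ _ _ _ (int a b Hab) I); [lra|].
    intros t Ht. rewrite <- Cmod_norm. apply HK; lra.
  - apply Rmult_le_compat_l; [exact K0|]. generalize (exp_pos (- b)); lra.
Qed.

Let chas a b d : (c <= a)%R -> (a <= b)%R -> (b <= d)%R -> CRInt f a d = CRInt f a b + CRInt f b d.
Proof.
  intros h1 h2 h3. apply CRInt_unique. apply (CisRInt_Chasles f a b d); apply int; lra.
Qed.

(** The exponential bound makes the integrals over [[c, c + n]] a Cauchy sequence. The tail estimate
    carries the same constant [K], which is what uniform limits rest on. *)
Lemma HL_spec : @is_RInt_gen C_R_NormedModule f (at_point c) (Rbar_locally p_infty) (HL f c) /\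
  forall b, (c <= b)%R -> (Cmod (HL f c - CRInt f c b) <= K * exp (- b))%R.
Proof.
  assert (L : exists l, is_Clim (fun n => CRInt f c (c + INR n)) l).
  { apply Ccauchy_lim. intros eps He.
    destruct (exp_neg_small (eps / (K + 1)) ltac:(apply Rdiv_lt_0_compat; lra)) as [b Hb].
    destruct (INR_unbounded (b - c)) as [N HN]. exists N.
    assert (T : forall n m, (N <= n)%nat -> (n <= m)%nat -> (Cmod (CRInt f c (c + INR m) - CRInt f c (c + INR n)) < eps)%R).
    { intros n m Hn Hm. assert (INR N <= INR n)%R by (apply le_INR; lia). assert (INR n <= INR m)%R by (apply le_INR; lia).
      assert (0 <= INR n)%R by apply pos_INR.
      rewrite (chas c (c + INR n) (c + INR m)) by lra.
      replace (CRInt f c (c + INR n) + CRInt f (c + INR n) (c + INR m) - CRInt f c (c + INR n))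
        with (CRInt f (c + INR n) (c + INR m)) by ring.
      eapply Rle_lt_trans; [apply bnd; lra|].
      specialize (Hb (c + INR n)%R ltac:(lra)). generalize (exp_pos (- (c + INR n))). intros.
      apply Rle_lt_trans with ((K + 1) * exp (- (c + INR n)))%R; [nra|].
      apply (Rmult_lt_compat_l (K + 1)) in Hb; [|lra].
      replace ((K + 1) * (eps / (K + 1)))%R with eps in Hb by (field; lra). exact Hb. }
    intros n m Hn Hm. destruct (Nat.le_gt_cases n m) as [h|h].
    - rewrite Cmod_minus_sym. apply T; lia.
    - apply T; lia. }
  destruct L as [l Hl].
  assert (B : forall b, (c <= b)%R -> (Cmod (l - CRInt f c b) <= K * exp (- b))%R).
  { intros b Hb. destruct (INR_unbounded (b - c)) as [N HN].
    apply (is_Clim_bound (fun n => CRInt f c (c + INR n) - CRInt f c b) _ _ N).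
    - apply is_Clim_minus; [exact Hl|apply is_Clim_const].
    - intros n Hn. assert (INR N <= INR n)%R by (apply le_INR; lia).
      rewrite (chas c b (c + INR n)) by lra.
      replace (CRInt f c b + CRInt f b (c + INR n) - CRInt f c b) with (CRInt f b (c + INR n)) by ring.
      apply bnd; lra. }
  assert (G : @is_RInt_gen C_R_NormedModule f (at_point c) (Rbar_locally p_infty) l).
  { intros P HP. apply locally_C_eps in HP. destruct HP as [eps [He HP]].
    destruct (exp_neg_small (eps / (K + 1)) ltac:(apply Rdiv_lt_0_compat; lra)) as [b Hb].
    unfold filtermapi. apply (Filter_prod _ _ _ (fun a => a = c) (fun d => (Rmax b c < d)%R)).
    - reflexivity.
    - exists (Rmax b c). auto.
    - intros a d Ha Hd. subst a. simpl.
      assert (b <= d /\ c <= d)%R by (generalize (Rmax_l b c) (Rmax_r b c); lra).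
      exists (CRInt f c d). split; [apply int; lra|]. apply HP.
      rewrite Cmod_minus_sym. eapply Rle_lt_trans; [apply B; lra|].
      specialize (Hb d ltac:(lra)). generalize (exp_pos (- d)). intros.
      apply Rle_lt_trans with ((K + 1) * exp (- d))%R; [nra|].
      apply (Rmult_lt_compat_l (K + 1)) in Hb; [|lra].
      replace ((K + 1) * (eps / (K + 1)))%R with eps in Hb by (field; lra). exact Hb. }
  assert (E : HL f c = l) by exact (is_RInt_gen_unique (V := C_R_CompleteNormedModule) f l G).
  rewrite E. split; assumption.
Qed.
End HalfLine.

Lemma HL_Chasles (f : R -> C) (c b K : R) : (c <= b)%R ->
  (forall t, (c <= t)%R -> continuous f t) ->
  (forall t, (c <= t)%R -> (Cmod (f t) <= K * exp (- t))%R) ->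
  HL f c = CRInt f c b + HL f b.
Proof.
  intros Hcb Hc HK.
  destruct (HL_spec f c K Hc HK) as [_ B1].
  destruct (HL_spec f b K ltac:(intros; apply Hc; lra) ltac:(intros; apply HK; lra)) as [_ B2].
  assert (K0 : (0 <= K)%R).
  { specialize (HK c ltac:(lra)). generalize (Cmod_ge_0 (f c)) (exp_pos (- c)). intros.
    destruct (Rle_dec 0 K) as [h|h]; [exact h|]. nra. }
  apply Cmod_le_eps_eq. intros eps He.
  destruct (exp_neg_small (eps / (2 * (K + 1))) ltac:(apply Rdiv_lt_0_compat; lra)) as [d Hd].
  set (D := Rmax b d). assert (D1 : (b <= D)%R) by apply Rmax_l. assert (D2 : (d <= D)%R) by apply Rmax_r.
  specialize (B1 D ltac:(lra)). specialize (B2 D D1). specialize (Hd D D2).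
  assert (E : CRInt f c D = CRInt f c b + CRInt f b D).
  { apply CRInt_unique. apply (CisRInt_Chasles f c b D); apply CisRInt_cont; try lra; intros; apply Hc; lra. }
  replace (HL f c - (CRInt f c b + HL f b)) with ((HL f c - CRInt f c D) - (HL f b - CRInt f b D)) by (rewrite E; ring).
  eapply Rle_trans; [apply Cmod_triangle|]. rewrite Cmod_opp.
  apply (Rmult_lt_compat_l (2 * (K + 1))) in Hd; [|lra].
  replace (2 * (K + 1) * (eps / (2 * (K + 1))))%R with eps in Hd by (field; lra).
  generalize (exp_pos (- D)). nra.
Qed.

(** A contraction by [exp (-1)] per unit step propagates a bound on [[c, T + 1]] to all of the
    half-line; the factor [exp (T + 1)] makes the bound true at the start. *)
Lemma decay_extend (f : R -> C) (c T B : R) : (c <= T)%R ->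
  (forall t, (T <= t)%R -> (Cmod (f (t + 1)%R) <= exp (-1) * Cmod (f t))%R) ->
  (forall t, (c <= t <= T + 1)%R -> (Cmod (f t) <= B)%R) ->
  forall t, (c <= t)%R -> (Cmod (f t) <= B * exp (T + 1) * exp (- t))%R.
Proof.
  intros HcT Hd HB.
  assert (B0 : (0 <= B)%R) by (eapply Rle_trans; [apply (Cmod_ge_0 (f c))|apply HB; lra]).
  assert (K : forall n : nat, forall t, (c <= t <= T + 1 + INR n)%R -> (Cmod (f t) <= B * exp (T + 1) * exp (- t))%R).
  { induction n; intros t Ht.
    - simpl in Ht. eapply Rle_trans; [apply HB; lra|].
      rewrite Rmult_assoc, <- exp_plus. rewrite <- (Rmult_1_r B) at 1. apply Rmult_le_compat_l; [exact B0|].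
      generalize (exp_ineq1_le (T + 1 + - t)); lra.
    - rewrite S_INR in Ht. destruct (Rle_dec t (T + 1 + INR n)) as [h|h]; [apply IHn; lra|].
      assert (0 <= INR n)%R by apply pos_INR.
      replace t with ((t - 1) + 1)%R at 1 by ring.
      eapply Rle_trans; [apply Hd; lra|].
      apply Rle_trans with (exp (-1) * (B * exp (T + 1) * exp (- (t - 1))))%R.
      + apply Rmult_le_compat_l; [left; apply exp_pos|]. apply IHn; lra.
      + right. replace (exp (- t)) with (exp (-1) * exp (- (t - 1)))%R by (rewrite <- exp_plus; f_equal; ring). ring. }
  intros t Ht. destruct (INR_unbounded (t - (T + 1))) as [n Hn]. apply (K n). lra.
Qed.

Lemma compact_bound (f : R -> C) a b : (a <= b)%R -> (forall t, (a <= t <= b)%R -> continuous f t) ->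
  exists B, forall t, (a <= t <= b)%R -> (Cmod (f t) <= B)%R.
Proof.
  intros Hab Hc.
  destruct (continuity_ab_maj (fun t => Cmod (f t)) a b Hab) as [m [Hm _]].
  - intros t Ht. apply continuity_pt_filterlim. apply (Cc_Cmod f t), Hc, Ht.
  - exists (Cmod (f m)). exact Hm.
Qed.

Section Param.
Variables (phi : R -> R -> C) (x0 c T r : R).
Hypothesis Hr : (0 < r)%R.
Hypothesis HcT : (c <= T)%R.
Hypothesis Hj : forall t, (c <= t)%R -> continuous (fun p : R * R => phi (fst p) (snd p)) (x0, t).
Hypothesis Hs : forall x t, (Rabs (x - x0) < r)%R -> (c <= t)%R -> continuous (phi x) t.
Hypothesis Hd : forall x t, (Rabs (x - x0) < r)%R -> (T <= t)%R ->
  (Cmod (phi x (t + 1)%R) <= exp (-1) * Cmod (phi x t))%R.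

(** On [[c, T + 1]], [phi x] stays within 1 of the bounded function [phi x0]; the contraction per
    unit step, uniform in [x], does the rest. *)
Lemma uniform_decay : exists K d, (0 < d)%R /\ (d <= r)%R /\ forall x t, (Rabs (x - x0) < d)%R -> (c <= t)%R ->
  (Cmod (phi x t) <= K * exp (- t))%R.
Proof.
  destruct (tube phi x0 c (T + 1) (fun t Ht => Hj t (proj1 Ht)) 1 Rlt_0_1) as [d [Hd0 HT]].
  assert (R0 : (Rabs (x0 - x0) < r)%R) by (rewrite Rminus_diag, Rabs_R0; exact Hr).
  destruct (compact_bound (phi x0) c (T + 1) ltac:(lra) (fun t Ht => Hs x0 t R0 (proj1 Ht))) as [B HB].
  exists ((B + 1) * exp (T + 1))%R, (Rmin d r).
  split; [apply Rmin_pos; assumption|]. split; [apply Rmin_r|].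
  intros x t Hx Ht.
  assert (Hx1 : (Rabs (x - x0) < d)%R) by (eapply Rlt_le_trans; [exact Hx|apply Rmin_l]).
  assert (Hx2 : (Rabs (x - x0) < r)%R) by (eapply Rlt_le_trans; [exact Hx|apply Rmin_r]).
  apply (decay_extend (phi x) c T (B + 1) HcT); [intros; apply Hd; assumption| |exact Ht].
  intros u Hu. specialize (HT x u Hx1 Hu). specialize (HB u Hu).
  generalize (Cmod_rev_triangle (phi x u) (phi x0 u)). lra.
Qed.

(** Beyond a common [b] both tails are below [eps / 4] by [uniform_decay]; on [[c, b]] the
    integrands are uniformly close by [tube]. *)
Lemma HL_continuous : forall eps, (0 < eps)%R -> exists d, (0 < d)%R /\
  forall x, (Rabs (x - x0) < d)%R -> (Cmod (HL (phi x) c - HL (phi x0) c) < eps)%R.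
Proof.
  intros eps He.
  destruct uniform_decay as (K & d & Hd0 & Hdr & HK).
  assert (K0 : (0 <= K)%R).
  { specialize (HK x0 c ltac:(rewrite Rminus_diag, Rabs_R0; exact Hd0) ltac:(lra)).
    generalize (Cmod_ge_0 (phi x0 c)) (exp_pos (- c)). intros.
    destruct (Rle_dec 0 K) as [h|h]; [exact h|]. nra. }
  destruct (exp_neg_small (eps / (4 * (K + 1))) ltac:(apply Rdiv_lt_0_compat; lra)) as [b' Hb'].
  set (b := Rmax b' c). assert (b1 : (b' <= b)%R) by apply Rmax_l. assert (b2 : (c <= b)%R) by apply Rmax_r.
  specialize (Hb' b b1).
  apply (Rmult_lt_compat_l (4 * (K + 1))) in Hb'; [|lra].
  replace (4 * (K + 1) * (eps / (4 * (K + 1))))%R with eps in Hb' by (field; lra).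
  assert (Eb := exp_pos (- b)).
  destruct (tube phi x0 c b (fun t Ht => Hj t (proj1 Ht)) (eps / (4 * (b - c + 1)))%R ltac:(apply Rdiv_lt_0_compat; lra))
    as [d2 [Hd2 HT]].
  exists (Rmin d d2). split; [apply Rmin_pos; assumption|]. intros x Hx.
  assert (Hx1 : (Rabs (x - x0) < d)%R) by (eapply Rlt_le_trans; [exact Hx|apply Rmin_l]).
  assert (Hx2 : (Rabs (x - x0) < d2)%R) by (eapply Rlt_le_trans; [exact Hx|apply Rmin_r]).
  assert (R0 : (Rabs (x0 - x0) < d)%R) by (rewrite Rminus_diag, Rabs_R0; exact Hd0).
  assert (Cx : forall t, (c <= t)%R -> continuous (phi x) t) by (intros; apply Hs; lra).
  assert (C0 : forall t, (c <= t)%R -> continuous (phi x0) t) by (intros; apply Hs; lra).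
  destruct (HL_spec (phi x) c K Cx (fun t Ht => HK x t Hx1 Ht)) as [_ B1].
  destruct (HL_spec (phi x0) c K C0 (fun t Ht => HK x0 t R0 Ht)) as [_ B2].
  specialize (B1 b b2). specialize (B2 b b2).
  assert (B3 : (Cmod (CRInt (phi x) c b - CRInt (phi x0) c b) <= (b - c) * (eps / (4 * (b - c + 1))))%R).
  { refine (CisRInt_bound _ c b _ _ b2 _ (CisRInt_minus _ _ _ _ _ _
      (CisRInt_cont (phi x) c b b2 (fun t Ht => Cx t (proj1 Ht))) (CisRInt_cont (phi x0) c b b2 (fun t Ht => C0 t (proj1 Ht))))).
    intros t Ht. left. apply HT; assumption. }
  assert (B4 : ((b - c) * (eps / (4 * (b - c + 1))) <= eps / 4)%R).
  { apply (Rmult_le_reg_r (4 * (b - c + 1))); [lra|].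
    replace ((b - c) * (eps / (4 * (b - c + 1))) * (4 * (b - c + 1)))%R with ((b - c) * eps)%R by (field; lra). nra. }
  replace (HL (phi x) c - HL (phi x0) c) with ((HL (phi x) c - CRInt (phi x) c b) +
     (CRInt (phi x) c b - CRInt (phi x0) c b) - (HL (phi x0) c - CRInt (phi x0) c b)) by ring.
  eapply Rle_lt_trans; [apply Cmod_triangle|]. rewrite Cmod_opp.
  eapply Rle_lt_trans; [apply Rplus_le_compat_r, Cmod_triangle|]. lra.
Qed.
End Param.

Lemma CRInt_param_continuous (phi : R -> R -> C) (x0 a b r : R) : (a <= b)%R -> (0 < r)%R ->
  (forall t, (a <= t <= b)%R -> continuous (fun p : R * R => phi (fst p) (snd p)) (x0, t)) ->
  (forall x t, (Rabs (x - x0) < r)%R -> (a <= t <= b)%R -> continuous (phi x) t) ->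
  forall eps, (0 < eps)%R -> exists d, (0 < d)%R /\
  forall x, (Rabs (x - x0) < d)%R -> (Cmod (CRInt (phi x) a b - CRInt (phi x0) a b) < eps)%R.
Proof.
  intros Hab Hr Hj Hs eps He.
  destruct (tube phi x0 a b Hj (eps / (2 * (b - a + 1)))%R ltac:(apply Rdiv_lt_0_compat; lra)) as [d [Hd HT]].
  exists (Rmin d r). split; [apply Rmin_pos; assumption|]. intros x Hx.
  assert (Hx1 : (Rabs (x - x0) < d)%R) by (eapply Rlt_le_trans; [exact Hx|apply Rmin_l]).
  assert (Hx2 : (Rabs (x - x0) < r)%R) by (eapply Rlt_le_trans; [exact Hx|apply Rmin_r]).
  assert (R0 : (Rabs (x0 - x0) < r)%R) by (rewrite Rminus_diag, Rabs_R0; exact Hr).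
  apply Rle_lt_trans with ((b - a) * (eps / (2 * (b - a + 1))))%R.
  - refine (CisRInt_bound _ a b _ _ Hab _ (CisRInt_minus _ _ _ _ _ _
      (CisRInt_cont (phi x) a b Hab (fun t Ht => Hs x t Hx2 Ht)) (CisRInt_cont (phi x0) a b Hab (fun t Ht => Hs x0 t R0 Ht)))).
    intros t Ht. left. apply HT; assumption.
  - apply Rle_lt_trans with (eps / 2)%R; [|lra].
    apply (Rmult_le_reg_r (2 * (b - a + 1))); [lra|].
    replace ((b - a) * (eps / (2 * (b - a + 1))) * (2 * (b - a + 1)))%R with ((b - a) * eps)%R by (field; lra). nra.
Qed.

(** * Residues at finitely many real poles *)

Definition rect (F : C -> C) (a b h : R) : C :=
  CRInt (fun t => F (t, - h)%R) a b + CRInt (fun t => F (b, t) * Ci) (- h) h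
  - CRInt (fun t => F (t, h)) a b - CRInt (fun t => F (a, t) * Ci) (- h) h.

Lemma Cc_horizontal (F : C -> C) (t y : R) : continuous F (t, y) -> continuous (fun u : R => F (u, y)) t.
Proof.
  intros H. apply (continuous_comp (fun u : R => (u, y) : C) F); [|exact H].
  apply Cc_pair; [apply continuous_id|apply continuous_const].
Qed.

Lemma Cc_vertical (F : C -> C) (x t : R) : continuous F (x, t) -> continuous (fun u : R => F (x, u)) t.
Proof.
  intros H. apply (continuous_comp (fun u : R => (x, u) : C) F); [|exact H].
  apply Cc_pair; [apply continuous_const|apply continuous_id].
Qed.

Lemma segI_line (F : C -> C) (g : R -> C) (P B : C) (a b : R) : a <= b ->
  (forall t, (a <= t <= b)%R -> continuous g t) ->
  (forall t, g t = F (P + RtoC t * B) * B) ->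
  segI F (P + RtoC a * B) (P + RtoC b * B) = CRInt g a b.
Proof.
  intros Hab Hc Hg. apply CRInt_unique.
  assert (I := CisRInt_cont g a b Hab Hc).
  assert (I' : CisRInt g ((b - a) * 0 + a) ((b - a) * 1 + a) (CRInt g a b)).
  { replace ((b - a) * 0 + a)%R with a by ring. replace ((b - a) * 1 + a)%R with b by ring. exact I. }
  apply (is_RInt_comp_lin (V := C_R_NormedModule)) in I'.
  eapply CisRInt_ext; [lra| |exact I'].
  intros t Ht. cbv beta. rewrite scal_R_Cmult, Hg.
  replace (P + RtoC a * B + RtoC t * (P + RtoC b * B - (P + RtoC a * B))) with (P + RtoC ((b - a) * t + a) * B)
    by (rewrite RtoC_plus, RtoC_mult, RtoC_minus; ring).
  rewrite RtoC_minus. ring.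
Qed.

Lemma segI_horizontal F (a b y : R) : (a <= b)%R -> (forall t, (a <= t <= b)%R -> continuous F (t, y)) ->
  segI F (a, y) (b, y) = CRInt (fun t => F (t, y)) a b.
Proof.
  intros Hab Hc.
  rewrite <- (segI_line F (fun t => F (t, y)) (0, y)%R (RtoC 1) a b Hab).
  - f_equal; apply C_ext; simpl; ring.
  - intros t Ht; apply Cc_horizontal, Hc, Ht.
  - intros t. rewrite Cmult_1_r, Cmult_1_r. f_equal. apply C_ext; simpl; ring.
Qed.

Lemma segI_vertical F (x a b : R) : (a <= b)%R -> (forall t, (a <= t <= b)%R -> continuous F (x, t)) ->
  segI F (x, a) (x, b) = CRInt (fun t => F (x, t) * Ci) a b.
Proof.
  intros Hab Hc.
  rewrite <- (segI_line F (fun t => F (x, t) * Ci) (x, 0)%R Ci a b Hab).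
  - f_equal; apply C_ext; simpl; ring.
  - intros t Ht; apply Cc_mult; [apply Cc_vertical, Hc, Ht|apply Cc_const].
  - intros t. f_equal. f_equal. apply C_ext; simpl; ring.
Qed.

Lemma segI_reverse F A B : (forall t, (0 <= t <= 1)%R -> continuous F (A + RtoC t * (B - A))) ->
  segI F B A = - segI F A B.
Proof.
  intros Hc. apply CRInt_unique.
  assert (I := segI_correct F A B Hc).
  apply (is_RInt_swap (V := C_R_NormedModule)) in I.
  assert (I' : CisRInt (fun t => F (A + RtoC t * (B - A)) * (B - A)) ((-1) * 0 + 1) ((-1) * 1 + 1) (- segI F A B)).
  { replace ((-1) * 0 + 1)%R with 1%R by ring. replace ((-1) * 1 + 1)%R with 0%R by ring. exact I. }
  apply (is_RInt_comp_lin (V := C_R_NormedModule)) in I'.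
  eapply CisRInt_ext; [lra| |exact I'].
  intros t Ht. cbv beta. rewrite scal_R_Cmult.
  replace (A + RtoC (-1 * t + 1) * (B - A)) with (B + RtoC t * (A - B)) by (rewrite RtoC_plus, RtoC_mult; ring).
  ring.
Qed.

Lemma rect_polyI F a b h : (a <= b)%R -> (0 < h)%R ->
  (forall t, (a <= t <= b)%R -> continuous F (t, - h)%R) ->
  (forall t, (a <= t <= b)%R -> continuous F (t, h)) ->
  (forall t, (- h <= t <= h)%R -> continuous F (a, t)) ->
  (forall t, (- h <= t <= h)%R -> continuous F (b, t)) ->
  polyI F (a, - h)%R (b, - h)%R (b, h) (a, h) = rect F a b h.
Proof.
  intros Hab Hh H1 H2 H3 H4. unfold polyI, rect.
  rewrite (segI_horizontal F a b (- h)) by assumption.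
  rewrite (segI_vertical F b (- h) h) by (try lra; assumption).
  rewrite (segI_reverse F (a, h) (b, h)), (segI_reverse F (a, - h)%R (a, h)).
  - rewrite (segI_horizontal F a b h) by assumption.
    rewrite (segI_vertical F a (- h) h) by (try lra; assumption). ring.
  - intros t Ht. replace (((a, - h)%R : C) + RtoC t * ((a, h) - (a, - h)%R)) with ((a, - h + t * (2 * h))%R : C)
      by (apply C_ext; simpl; ring). apply H3. nra.
  - intros t Ht. replace (((a, h) : C) + RtoC t * ((b, h) - (a, h))) with ((a + t * (b - a), h)%R : C)
      by (apply C_ext; simpl; ring). apply H2. nra.
Qed.

Definition strip (a b : R) (s : C) : Prop := (a < Re s < b)%R.

Lemma segI_translate (F G : C -> C) (p A B : C) :
  (forall t, (0 <= t <= 1)%R -> continuous G (A + RtoC t * (B - A))) ->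
  (forall t, (0 <= t <= 1)%R -> G (A + RtoC t * (B - A)) = F (p + (A + RtoC t * (B - A)))) ->
  segI F (p + A) (p + B) = segI G A B.
Proof.
  intros Hc HE. apply CRInt_unique. eapply CisRInt_ext; [lra| |apply (segI_correct G A B Hc)].
  intros t Ht. simpl.
  rewrite HE by lra. replace (p + A + RtoC t * (p + B - (p + A))) with (p + (A + RtoC t * (B - A))) by ring.
  ring.
Qed.

(** [residue_rectangle] translated to [p]. Writing [F = H / (s - p)^2] treats double poles, simple
    poles ([H p = 0]) and regular points alike; the residue is the derivative of [H]. *)
Lemma rect_pole (F H : C -> C) (al a p b be h : R) (r : C) :
  (al < a)%R -> (a < p)%R -> (p < b)%R -> (b < be)%R -> (0 < h)%R ->
  hol (strip al be) H -> Cder H (RtoC p) r ->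
  (forall s, strip al be s -> s <> RtoC p -> F s = H s * / ((s - RtoC p) * (s - RtoC p))) ->
  rect F a b h = RtoC (2 * PI) * Ci * r.
Proof.
  intros Ha Hap Hpb Hb Hh [H' HH] Hr HF.
  assert (Er : H' (RtoC p) = r).
  { eapply Cder_unique; [apply HH; split; simpl; lra|exact Hr]. }
  assert (CF : forall s, strip al be s -> s <> RtoC p -> continuous F s).
  { intros s Hs Hn.
    apply (Cc_ext_loc (fun s => H s * / ((s - RtoC p) * (s - RtoC p)))).
    - assert (P := Cmod_pos_ne _ (Cminus_eq_contra _ _ Hn)).
      apply locally_C_eps. destruct Hs as [Hs1 Hs2].
      exists (Rmin (Cmod (s - RtoC p)) (Rmin (Re s - al) (be - Re s))). split; [repeat apply Rmin_pos; lra|].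
      intros y Hy.
      assert (Y1 : (Cmod (y - s) < Cmod (s - RtoC p))%R) by (eapply Rlt_le_trans; [exact Hy|apply Rmin_l]).
      assert (Y2 : (Cmod (y - s) < Re s - al)%R)
        by (eapply Rlt_le_trans; [exact Hy|eapply Rle_trans; [apply Rmin_r|apply Rmin_l]]).
      assert (Y3 : (Cmod (y - s) < be - Re s)%R)
        by (eapply Rlt_le_trans; [exact Hy|eapply Rle_trans; [apply Rmin_r|apply Rmin_r]]).
      symmetry. apply HF.
      + assert (B := re_le_Cmod (y - s)). unfold Cminus in B at 1. rewrite re_plus, re_opp in B.
        unfold Rabs in B. split; destruct (Rcase_abs (Re y + - Re s)) in B; lra.
      + intros E. subst y. rewrite Cmod_minus_sym in Y1. lra.
    - apply Cc_mult.
      + destruct (HH s Hs) as [D _]. eapply Cder_cont, D.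
      + apply Cc_inv; [apply Cc_mult; (apply Cc_minus; [apply Cc_id|apply Cc_const])|].
        apply Cmult_neq_0; apply Cminus_eq_contra, Hn. }
  assert (NR : forall (t y : R), t <> p \/ y <> 0%R -> ((t, y) : C) <> RtoC p).
  { intros t y [h1|h1] E; [apply (f_equal Re) in E|apply (f_equal Im) in E]; simpl in E; contradiction. }
  rewrite <- rect_polyI; [|lra|exact Hh| | | | ].
  2-5: intros t Ht; apply CF; [unfold strip; simpl; lra|apply NR; try (left; lra); right; lra].
  assert (E := residue_rectangle (strip al be) H H' (RtoC p) (p - a) (b - p) h HH ltac:(lra) ltac:(lra) Hh).
  rewrite <- Er, <- E.
  2:{ intros u v Hu Hv. unfold strip. simpl. lra. }
  set (G := fun w => H (RtoC p + w) * / (w * w)).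
  assert (K : forall A B : C,
    (forall t, (0 <= t <= 1)%R -> (- (p - a) <= Re (A + RtoC t * (B - A)) <= b - p)%R /\ A + RtoC t * (B - A) <> RtoC 0) ->
    segI F (RtoC p + A) (RtoC p + B) = segI G A B).
  { intros A B HAB. apply segI_translate; intros t Ht; destruct (HAB t Ht) as [h1 h2].
    - unfold G. apply Cc_mult.
      + apply (continuous_comp (fun w => RtoC p + w) H); [apply Cc_plus; [apply Cc_const|apply Cc_id]|].
        destruct (HH (RtoC p + (A + RtoC t * (B - A)))) as [D _]; [|eapply Cder_cont, D].
        unfold strip. rewrite re_plus. simpl (Re (RtoC p)). lra.
      + apply Cc_inv; [apply Cc_mult; apply Cc_id|apply Cmult_neq_0; exact h2].
    - unfold G. rewrite HF.
      + replace (RtoC p + (A + RtoC t * (B - A)) - RtoC p) with (A + RtoC t * (B - A)) by ring. reflexivity.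
      + unfold strip. rewrite re_plus. simpl (Re (RtoC p)). lra.
      + intros X. apply h2. replace (A + RtoC t * (B - A)) with (RtoC p + (A + RtoC t * (B - A)) - RtoC p) by ring.
        rewrite X. ring. }
  assert (TR : forall x y : R, ((x, y) : C) = RtoC p + ((x - p)%R, y)) by (intros; apply C_ext; simpl; ring).
  unfold polyI. rewrite (TR a (- h)%R), (TR b (- h)%R), (TR b h), (TR a h).
  replace (a - p)%R with (- (p - a))%R by ring.
  rewrite !K; [reflexivity| | | |]; intros t Ht.
  - split; [|apply segment_neq_0_re; lra]. simpl. nra.
  - split; [|apply segment_neq_0_im; lra].
    replace (Re ((b - p, h)%R + RtoC t * ((- (p - a), h)%R - (b - p, h)%R)))
     with ((1 - t) * (b - p) + t * (- (p - a)))%R by (simpl; ring). nra.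
  - split; [|apply segment_neq_0_re; lra]. simpl. nra.
  - split; [|apply segment_neq_0_im; lra].
    replace (Re ((- (p - a), - h)%R + RtoC t * ((b - p, - h)%R - (- (p - a), - h)%R)))
     with ((1 - t) * (- (p - a)) + t * (b - p))%R by (simpl; ring). nra.
Qed.

(** Cauchy's theorem as the case [H = F * (s - p)^2] of [rect_pole], with [p] the midpoint: this [H]
    has derivative 0 at [p]. *)
Lemma rect_regular (F : C -> C) (al a b be h : R) : (al < a)%R -> (a < b)%R -> (b < be)%R -> (0 < h)%R ->
  hol (strip al be) F -> rect F a b h = RtoC 0.
Proof.
  intros Ha Hab Hb Hh HF.
  pose (p := ((a + b) / 2)%R).
  assert (Hp : (a < p < b)%R) by (unfold p; lra).
  assert (D : exists d, Cder F (RtoC p) d) by (apply (hol_der (strip al be)); [exact HF|unfold strip; simpl; lra]).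
  destruct D as [d D].
  rewrite (rect_pole F (fun s => F s * ((s - RtoC p) * (s - RtoC p))) al a p b be h (RtoC 0)); try lra.
  - ring.
  - apply hol_mult; [exact HF|]. apply hol_mult; apply hol_minus; try apply hol_id; apply hol_const.
  - assert (DD : Cder (fun s => s - RtoC p) (RtoC p) (RtoC 1)).
    { eapply Cder_eq; [apply Cder_minus; [apply Cder_id|apply Cder_const]|ring]. }
    eapply Cder_eq; [apply (Cder_mult F (fun s => (s - RtoC p) * (s - RtoC p))); [exact D|]|].
    + apply (Cder_mult (fun s => s - RtoC p) (fun s => s - RtoC p)); exact DD.
    + cbv beta. ring.
  - intros s Hs Hn. field. apply Cminus_eq_contra, Hn.
Qed.

Section Poles.
Variables (F : C -> C) (c0 h : R) (Pol : R -> Prop) (rho : R -> C).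
Hypothesis Hh : (0 < h)%R.
Let reg (s : C) : Prop := (c0 < Re s)%R /\ forall p, Pol p -> s <> RtoC p.
Hypothesis Hreg : hol reg F.
Hypothesis Hdis : forall x : R, exists d, (0 < d)%R /\ forall p, Pol p -> p <> x -> (d <= Rabs (p - x))%R.
Hypothesis Hpole : forall p, Pol p -> (c0 < p)%R -> exists (d : R) (H : C -> C), (0 < d)%R /\
  hol (strip (p - d) (p + d)) H /\ Cder H (RtoC p) (rho p) /\
  forall s, strip (p - d) (p + d) s -> s <> RtoC p -> F s = H s * / ((s - RtoC p) * (s - RtoC p)).

Lemma reg_cont s : reg s -> continuous F s.
Proof. apply hol_cont, Hreg. Qed.

Let no_pole_cont x y : (c0 < x)%R -> (y <> 0%R \/ ~ Pol x) -> continuous F (x, y).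
Proof.
  intros Hx Hy. apply reg_cont. split; [exact Hx|]. intros p Hp E.
  assert (E1 := f_equal Re E). assert (E2 := f_equal Im E). simpl in E1, E2.
  destruct Hy as [h1|h1]; [contradiction|]. apply h1. rewrite E1. exact Hp.
Qed.

Let rect_add a m b : (c0 < a)%R -> (a <= m <= b)%R -> rect F a b h = rect F a m h + rect F m b h.
Proof.
  intros Ha Hm.
  assert (K : forall y, y <> 0%R -> CRInt (fun t => F (t, y)) a b =
     CRInt (fun t => F (t, y)) a m + CRInt (fun t => F (t, y)) m b).
  { intros y Hy. apply CRInt_unique. apply (CisRInt_Chasles _ a m b); apply CisRInt_cont; try lra;
    intros t Ht; apply Cc_horizontal, no_pole_cont; try lra; left; exact Hy. }
  unfold rect. rewrite (K (- h)%R), (K h) by lra. ring.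
Qed.

Fixpoint lsum (l : list R) : C := match l with nil => RtoC 0 | p :: l' => rho p + lsum l' end.

Let lt_b (x p : R) : bool := if Rlt_dec x p then true else false.

Let lsum_split p l : ~ In p l -> lsum l = lsum (filter (fun x => lt_b x p) l) + lsum (filter (fun x => lt_b p x) l).
Proof.
  induction l as [|x l IH]; intros Hn; [simpl; ring|].
  assert (Hx : x <> p) by (intros E; apply Hn; left; exact E).
  assert (Hl : ~ In p l) by (intros E; apply Hn; right; exact E).
  cbn [filter lsum]. rewrite (IH Hl).
  destruct (Rlt_dec x p) as [h1|h1].
  - replace (lt_b x p) with true by (unfold lt_b; destruct (Rlt_dec x p); [reflexivity|contradiction]).
    replace (lt_b p x) with false by (unfold lt_b; destruct (Rlt_dec p x); [lra|reflexivity]).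
    cbn [lsum]. ring.
  - replace (lt_b x p) with false by (unfold lt_b; destruct (Rlt_dec x p); [contradiction|reflexivity]).
    replace (lt_b p x) with true by (unfold lt_b; destruct (Rlt_dec p x); [reflexivity|lra]).
    cbn [lsum]. ring.
Qed.

(** Two vertical cuts isolate the first listed pole in a thin rectangle; the remaining poles, in no
    particular order, are filtered into those on its left and on its right. Both lists are shorter,
    hence the induction on a bound for the length. *)
Theorem rect_poles : forall (n : nat) (l : list R) (a b : R), (length l <= n)%nat -> NoDup l ->
  (c0 < a)%R -> (a < b)%R -> ~ Pol a -> ~ Pol b ->
  (forall p, In p l <-> Pol p /\ (a < p < b)%R) ->
  rect F a b h = RtoC (2 * PI) * Ci * lsum l.
Proof.
  induction n; intros l a b Hlen Hnd Hca Hab Na Nb Hl.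
  - assert (El : l = nil) by (destruct l; [reflexivity|simpl in Hlen; lia]). subst l. simpl. rewrite Cmult_0_r.
    destruct (Hdis a) as [da [Hda Da]]. destruct (Hdis b) as [db [Hdb Db]].
    apply (rect_regular F (Rmax c0 (a - da)) a b (b + db)).
    + apply Rmax_lub_lt; lra.
    + exact Hab.
    + lra.
    + exact Hh.
    + apply (hol_sub reg); [|exact Hreg]. intros s [Hs1 Hs2].
      assert (M1 := Rmax_l c0 (a - da)). assert (M2 := Rmax_r c0 (a - da)).
      split; [lra|]. intros p Hp E. rewrite E in Hs1, Hs2. simpl in Hs1, Hs2.
      assert (Pa : p <> a) by (intros X; subst; contradiction).
      assert (Pb : p <> b) by (intros X; subst; contradiction).
      specialize (Da p Hp Pa). specialize (Db p Hp Pb).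
      destruct (Rle_dec p a) as [q|q].
      { rewrite Rabs_left1 in Da by lra. lra. }
      destruct (Rle_dec b p) as [q'|q'].
      { rewrite Rabs_pos_eq in Db by lra. lra. }
      apply (proj2 (Hl p)). split; [exact Hp|lra].
  - destruct l as [|p l].
    { apply (IHn nil); try assumption. simpl; lia. }
    inversion Hnd as [|p' l' Hnp Hnd']; subst p' l'.
    destruct (proj1 (Hl p) (or_introl eq_refl)) as [Pp Hp].
    destruct (Hpole p Pp ltac:(lra)) as (d & H & Hd & HH & HD & HF).
    destruct (Hdis p) as [d' [Hd' D']].
    (* Small enough for the local form of [F] to hold, for [p] to be the only pole in the closed
       strip, and for the cuts to lie inside [(a, b)]. *)
    pose (e := (Rmin (Rmin d d') (Rmin (p - a) (b - p)) / 2)%R).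
    assert (He : (0 < e)%R /\ (e < d)%R /\ (e < d')%R /\ (e < p - a)%R /\ (e < b - p)%R).
    { unfold e. generalize (Rmin_l (Rmin d d') (Rmin (p - a) (b - p))) (Rmin_r (Rmin d d') (Rmin (p - a) (b - p)))
       (Rmin_l d d') (Rmin_r d d') (Rmin_l (p - a) (b - p)) (Rmin_r (p - a) (b - p)).
      assert (0 < Rmin (Rmin d d') (Rmin (p - a) (b - p)))%R by (repeat apply Rmin_pos; lra). lra. }
    destruct He as (He & h1 & h2 & h3 & h4).
    assert (NE : forall q, Pol q -> (p - e <= q <= p + e)%R -> q = p).
    { intros q Hq Hqe. destruct (Req_dec q p) as [E|E]; [exact E|exfalso].
      specialize (D' q Hq E). assert (Rabs (q - p) <= e)%R by (apply Rabs_le; lra). lra. }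
    assert (N1 : ~ Pol (p - e)%R) by (intros X; specialize (NE _ X ltac:(lra)); lra).
    assert (N2 : ~ Pol (p + e)%R) by (intros X; specialize (NE _ X ltac:(lra)); lra).
    rewrite (rect_add a (p - e) b) by lra. rewrite (rect_add (p - e) (p + e) b) by lra.
    rewrite (rect_pole F H (p - d) (p - e) p (p + e) (p + d) h (rho p)) by (try lra; assumption).
    assert (FL : forall f : R -> bool, (length (filter f l) <= n)%nat).
    { intros f. generalize (filter_length_le f l). simpl in Hlen. lia. }
    rewrite (IHn (filter (fun x => lt_b x p) l) a (p - e)%R); try assumption; try lra.
    + rewrite (IHn (filter (fun x => lt_b p x) l) (p + e)%R b); try assumption; try lra.
      * simpl lsum. rewrite (lsum_split p l Hnp). ring.
      * apply FL.
      * apply NoDup_filter, Hnd'.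
      * intros q. rewrite filter_In. unfold lt_b. split.
        -- intros [Hq Hb']. destruct (Rlt_dec p q) as [k|k]; [|discriminate].
           destruct (proj1 (Hl q) (or_intror Hq)) as [Pq Rq]. split; [exact Pq|].
           split; [|lra]. destruct (Rlt_dec (p + e) q) as [k'|k']; [exact k'|].
           specialize (NE q Pq ltac:(lra)). lra.
        -- intros [Pq Rq]. destruct (Rlt_dec p q) as [k|k]; [|exfalso; lra].
           split; [|reflexivity]. assert (Rq2 : (a < q < b)%R) by (split; lra). destruct (proj2 (Hl q) (conj Pq Rq2)) as [E|Hq]; [exfalso; lra|exact Hq].
    + apply FL.
    + apply NoDup_filter, Hnd'.
    + intros q. rewrite filter_In. unfold lt_b. split.
      * intros [Hq Hb']. destruct (Rlt_dec q p) as [k|k]; [|discriminate].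
        destruct (proj1 (Hl q) (or_intror Hq)) as [Pq Rq]. split; [exact Pq|].
        split; [lra|]. destruct (Rlt_dec q (p - e)) as [k'|k']; [exact k'|].
        specialize (NE q Pq ltac:(lra)). lra.
      * intros [Pq Rq]. destruct (Rlt_dec q p) as [k|k]; [|exfalso; lra].
        split; [|reflexivity]. assert (Rq2 : (a < q < b)%R) by (split; lra). destruct (proj2 (Hl q) (conj Pq Rq2)) as [E|Hq]; [exfalso; lra|exact Hq].
Qed.
End Poles.

(** * Loop integrals *)

Definition loopI (F : C -> C) (c h : R) : C :=
  - HL (fun t => F (t, - h)%R) c + CRInt (fun t => F (c, t) * Ci) (- h) h + HL (fun t => F (t, h)) c.

Definition contour_cont (F : C -> C) (c h : R) : Prop :=
  (forall t, (c <= t)%R -> continuous F (t, - h)%R) /\ (forall t, (c <= t)%R -> continuous F (t, h)) /\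
  (forall t, (- h <= t <= h)%R -> continuous F (c, t)).

(** The only growth condition imposed on the integrands. It follows from their functional equation,
    and with a bound on one unit interval it gives exponential decay to the right. *)
Definition shift_decay (F : C -> C) (T : R) : Prop :=
  forall s, (T <= Re s)%R -> (Cmod (F (s + RtoC 1)%C) <= exp (-1) * Cmod (F s))%R.

Lemma horizontal_decay (F : C -> C) (c T y : R) : shift_decay F T ->
  (forall t, (c <= t)%R -> continuous F (t, y)) ->
  exists K, forall t, (c <= t)%R -> (Cmod (F (t, y)) <= K * exp (- t))%R.
Proof.
  intros Hd Hc. set (T1 := Rmax c T).
  assert (h1 : (c <= T1)%R) by apply Rmax_l. assert (h2 : (T <= T1)%R) by apply Rmax_r.
  destruct (compact_bound (fun t => F (t, y)) c (T1 + 1) ltac:(lra)) as [B HB].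
  { intros t Ht. apply Cc_horizontal, Hc; lra. }
  exists (B * exp (T1 + 1))%R. apply (decay_extend (fun t => F (t, y)) c T1 B h1); [|exact HB].
  intros t Ht. replace (((t + 1)%R, y) : C) with ((t, y) + RtoC 1) by (apply C_ext; simpl; ring).
  apply Hd. simpl. lra.
Qed.

Lemma loopI_spec (F : C -> C) (c h T : R) : (0 < h)%R -> contour_cont F c h -> shift_decay F T ->
  is_loop_int F c h (loopI F c h) /\ forall g, is_loop_int F c h g -> g = loopI F c h.
Proof.
  intros Hh (H1 & H2 & H3) Hd.
  destruct (horizontal_decay F c T (- h) Hd H1) as [K1 HK1]. destruct (horizontal_decay F c T h Hd H2) as [K2 HK2].
  destruct (HL_spec (fun t => F (t, - h)%R) c K1 (fun t Ht => Cc_horizontal F t (- h) (H1 t Ht)) HK1) as [G1 _].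
  destruct (HL_spec (fun t => F (t, h)) c K2 (fun t Ht => Cc_horizontal F t h (H2 t Ht)) HK2) as [G2 _].
  assert (G3 : CisRInt (fun t => F (c, t) * Ci) (- h) h (CRInt (fun t => F (c, t) * Ci) (- h) h)).
  { apply CisRInt_cont; [lra|]. intros t Ht. apply Cc_mult; [apply Cc_vertical, H3, Ht|apply Cc_const]. }
  assert (G1' : @is_RInt_gen C_R_NormedModule (fun t => F (t, - h)%R) (Rbar_locally p_infty) (at_point c)
      (- HL (fun t => F (t, - h)%R) c)).
  { exact (is_RInt_gen_swap (V := C_R_NormedModule) _ _ G1). }
  split.
  - exists (- HL (fun t => F (t, - h)%R) c), (CRInt (fun t => F (c, t) * Ci) (- h) h), (HL (fun t => F (t, h)) c).
    split; [exact G1'|]. split; [exact G3|]. split; [exact G2|]. reflexivity.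
  - intros g (g1 & g2 & g3 & X1 & X2 & X3 & E).
    assert (E1 : g1 = - HL (fun t => F (t, - h)%R) c).
    { rewrite <- (is_RInt_gen_unique (V := C_R_CompleteNormedModule) _ _ G1').
      symmetry. exact (is_RInt_gen_unique (V := C_R_CompleteNormedModule) _ _ X1). }
    assert (E3 : g3 = HL (fun t => F (t, h)) c).
    { symmetry. exact (is_RInt_gen_unique (V := C_R_CompleteNormedModule) _ _ X3). }
    assert (E2 : g2 = CRInt (fun t => F (c, t) * Ci) (- h) h) by (symmetry; apply CRInt_unique, X2).
    rewrite E, E1, E2, E3. reflexivity.
Qed.

Lemma up_spec_noninteger x (k : nat) : noninteger x -> ((k < Z.to_nat (up x))%nat <-> (INR k < x)%R).
Proof.
  intros Hx. destruct (archimed x) as [A1 A2]. split.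
  - intros Hk. assert (Hk' : (Z.of_nat k <= up x - 1)%Z) by lia.
    apply IZR_le in Hk'. rewrite minus_IZR, <- INR_IZR_INZ in Hk'.
    destruct (Rle_lt_or_eq_dec (INR k) x ltac:(lra)) as [h|h]; [exact h|].
    exfalso. apply (Hx (Z.of_nat k)). rewrite <- INR_IZR_INZ. symmetry; exact h.
  - intros Hk. assert ((Z.of_nat k < up x)%Z) by (apply lt_IZR; rewrite <- INR_IZR_INZ; lra). lia.
Qed.

Lemma noninteger_shift x (k : Z) : noninteger x -> noninteger (x + IZR k).
Proof. intros H j E. apply (H (j - k)%Z). rewrite minus_IZR. lra. Qed.

(** Supplies an abscissa [b] such that no line [Re s = b + n] meets a pole. In the induction [b] is
    moved slightly to avoid a new class; the classes already avoided stay avoided, as the condition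
    on [b] is open. *)
Lemma avoid_classes (qs : list R) : forall c c', (c < c')%R ->
  exists b, (c < b < c')%R /\ forall q, In q qs -> noninteger (b - q).
Proof.
  induction qs as [|q qs IH]; intros c c' Hc.
  - exists ((c + c') / 2)%R. split; [lra|]. intros q [].
  - destruct (IH c c' Hc) as [b [Hb HN]].
    assert (Op : exists d, (0 < d)%R /\ forall u, (Rabs (u - b) < d)%R -> forall q, In q qs -> noninteger (u - q)).
    { clear IH. revert HN. induction qs as [|q' qs IH']; intros HN.
      - exists 1%R. split; [lra|]. intros u _ q' [].
      - destruct (IH' (fun q Hq => HN q (or_intror Hq))) as [d1 [Hd1 HH1]].
        destruct (noninteger_locally (b - q') (HN q' (or_introl eq_refl))) as [d2 [Hd2 HH2]].
        exists (Rmin d1 d2). split; [apply Rmin_pos; assumption|]. intros u Hu p [E|Hp].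
        + subst p. apply HH2. replace (u - q' - (b - q'))%R with (u - b)%R by ring.
          eapply Rlt_le_trans; [exact Hu|apply Rmin_r].
        + apply HH1; [|exact Hp]. eapply Rlt_le_trans; [exact Hu|apply Rmin_l]. }
    destruct Op as [d [Hd HO]].
    destruct (classic (noninteger (b - q))) as [h|h].
    + exists b. split; [exact Hb|]. intros p [E|Hp]; [subst; exact h|apply HN, Hp].
    + apply not_all_ex_not in h. destruct h as [k Hk]. apply NNPP in Hk.
      pose (e := (Rmin (Rmin d 1) (c' - b) / 2)%R).
      assert (He : (0 < e)%R /\ (e < d)%R /\ (e < 1)%R /\ (e < c' - b)%R).
      { unfold e. generalize (Rmin_l (Rmin d 1) (c' - b)) (Rmin_r (Rmin d 1) (c' - b)) (Rmin_l d 1) (Rmin_r d 1).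
        assert (0 < Rmin (Rmin d 1) (c' - b))%R by (repeat apply Rmin_pos; lra). lra. }
      exists (b + e)%R. split; [lra|]. intros p [E|Hp].
      * subst p. apply (noninteger_near _ k); [lra|].
        replace (b + e - q - IZR k)%R with e by lra. rewrite Rabs_pos_eq; lra.
      * apply HO; [|exact Hp]. replace (b + e - b)%R with e by ring. rewrite Rabs_pos_eq; lra.
Qed.

Lemma class_gap (q x : R) : exists d, (0 < d)%R /\ forall k : nat, (q + INR k)%R <> x -> (d <= Rabs (q + INR k - x))%R.
Proof.
  destruct (archimed (x - q)) as [A1 A2]. set (m := up (x - q)) in *.
  pose (f := (x - q - (IZR m - 1))%R).
  pose (d2 := if Rle_dec f 0 then 1%R else f).
  assert (Hd2 : (0 < d2)%R) by (unfold d2; destruct (Rle_dec f 0); lra).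
  exists (Rmin (Rmin (IZR m - (x - q)) d2) 1). split; [repeat apply Rmin_pos; lra|].
  intros k Hk.
  assert (B1 := Rmin_l (Rmin (IZR m - (x - q)) d2) 1). assert (B2 := Rmin_r (Rmin (IZR m - (x - q)) d2) 1).
  assert (B3 := Rmin_l (IZR m - (x - q)) d2). assert (B4 := Rmin_r (IZR m - (x - q)) d2).
  rewrite INR_IZR_INZ in *. set (z := Z.of_nat k) in *.
  destruct (Z.le_gt_cases m z) as [E|E].
  - apply IZR_le in E. rewrite Rabs_pos_eq by lra. lra.
  - destruct (Z.eq_dec z (m - 1)) as [E2|E2].
    + assert (E3 : IZR z = (IZR m - 1)%R) by (rewrite E2, minus_IZR; reflexivity).
      rewrite Rabs_left1 by lra. unfold d2, f in *. destruct (Rle_dec (x - q - (IZR m - 1)) 0); lra.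
    + assert (E3 : (z <= m - 2)%Z) by lia. apply IZR_le in E3. rewrite minus_IZR in E3.
      rewrite Rabs_left1 by lra. lra.
Qed.

Section Residues.
Variables (F : C -> C) (c0 c h T : R) (qs : list R) (rho : R -> C) (sigma : R -> C).
Let Pol (p : R) : Prop := exists q k, In q qs /\ p = (q + INR k)%R.
Hypothesis Hh : (0 < h)%R.
Hypothesis Hc : (c0 < c)%R.
Hypothesis Hreg : hol (fun s => (c0 < Re s)%R /\ forall p, Pol p -> s <> RtoC p) F.
Hypothesis Hdec : shift_decay F T.
Hypothesis Hqs : NoDup qs.
Hypothesis Hq : forall q, In q qs -> (c < q)%R.
Hypothesis Hsep : forall q q' k k', In q qs -> In q' qs -> (q + INR k = q' + INR k')%R -> q = q'.
Hypothesis Hpole : forall p, Pol p -> (c0 < p)%R -> exists (d : R) (H : C -> C), (0 < d)%R /\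
  hol (strip (p - d) (p + d)) H /\ Cder H (RtoC p) (rho p) /\
  forall s, strip (p - d) (p + d) s -> s <> RtoC p -> F s = H s * / ((s - RtoC p) * (s - RtoC p)).
Hypothesis Hsum : forall q, In q qs -> is_Csum (fun k => rho (q + INR k)) (sigma q).

Let Hdis x : exists d, (0 < d)%R /\ forall p, Pol p -> p <> x -> (d <= Rabs (p - x))%R.
Proof.
  assert (K : forall l : list R, exists d, (0 < d)%R /\ forall q k, In q l -> (q + INR k)%R <> x -> (d <= Rabs (q + INR k - x))%R).
  { induction l as [|q l [d [Hd IH]]]; [exists 1%R; split; [lra|]; intros q k []|].
    destruct (class_gap q x) as [d' [Hd' H']].
    exists (Rmin d d'). split; [apply Rmin_pos; assumption|]. intros q' k [E|Hin] Hne.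
    - subst q'. eapply Rle_trans; [apply Rmin_r|apply H', Hne].
    - eapply Rle_trans; [apply Rmin_l|apply IH; assumption]. }
  destruct (K qs) as [d [Hd HH]]. exists d. split; [exact Hd|].
  intros p (q & k & Hin & E) Hne. subst p. apply HH; assumption.
Qed.

Let ccont x y : (c <= x)%R -> (y <> 0%R \/ ~ Pol x) -> continuous F (x, y).
Proof.
  intros Hx Hy. apply (reg_cont F c0 Pol Hreg). split; [simpl; lra|].
  intros p Hp E. assert (E1 := f_equal Re E). assert (E2 := f_equal Im E). simpl in E1, E2.
  destruct Hy as [h1|h1]; [contradiction|]. apply h1. rewrite E1. exact Hp.
Qed.

Let Kdec : exists K, forall t y, (c <= t)%R -> (y = h \/ y = - h)%R -> (Cmod (F (t, y)) <= K * exp (- t))%R.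
Proof.
  destruct (horizontal_decay F c T (- h) Hdec) as [K1 HK1]; [intros; apply ccont; [assumption|left; lra]|].
  destruct (horizontal_decay F c T h Hdec) as [K2 HK2]; [intros; apply ccont; [assumption|left; lra]|].
  exists (Rmax K1 K2). intros t y Ht [E|E]; subst y.
  - eapply Rle_trans; [apply HK2, Ht|]. apply Rmult_le_compat_r; [left; apply exp_pos|apply Rmax_r].
  - eapply Rle_trans; [apply HK1, Ht|]. apply Rmult_le_compat_r; [left; apply exp_pos|apply Rmax_l].
Qed.

(** The two loops differ by a rectangle. It appears with a minus sign: the loop is clockwise, [rect]
    counterclockwise. *)
Let loop_shift b : (c <= b)%R -> loopI F c h = loopI F b h - rect F c b h.
Proof.
  intros Hb. destruct Kdec as [K HK].
  unfold loopI, rect.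
  rewrite (HL_Chasles (fun t => F (t, - h)%R) c b K Hb), (HL_Chasles (fun t => F (t, h)) c b K Hb).
  - ring.
  - intros t Ht. apply Cc_horizontal, ccont; [exact Ht|left; lra].
  - intros t Ht. apply HK; [exact Ht|left; reflexivity].
  - intros t Ht. apply Cc_horizontal, ccont; [exact Ht|left; lra].
  - intros t Ht. apply HK; [exact Ht|right; reflexivity].
Qed.

Let CRInt_point f b : CRInt f b b = RtoC 0.
Proof. apply CRInt_unique. apply (is_RInt_point (V := C_R_NormedModule)). Qed.

(** Each unit step to the right divides the integrand on the vertical side by at least [e], and the
    horizontal sides are tails of convergent integrals. *)
Let loop_vanish b : (c <= b)%R -> (forall n : nat, ~ Pol (b + INR n)%R) ->
  is_Clim (fun n => loopI F (b + INR n) h) (RtoC 0).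
Proof.
  intros Hb HN. destruct Kdec as [K HK].
  destruct (INR_unbounded (T - b)) as [N0 HN0].
  assert (P0 : forall n : nat, (0 <= INR n)%R) by (intros; apply pos_INR).
  destruct (compact_bound (fun t => F (b + INR N0, t)%R) (- h) h ltac:(lra)) as [B HB].
  { intros t Ht. apply Cc_vertical, ccont; [generalize (P0 N0); lra|right; apply HN]. }
  assert (VB : forall j t, (- h <= t <= h)%R -> (Cmod (F (b + INR (N0 + j), t)%R) <= B * exp (- INR j))%R).
  { induction j; intros t Ht.
    - rewrite Nat.add_0_r. simpl (INR 0). rewrite Ropp_0, exp_0, Rmult_1_r. apply HB, Ht.
    - replace (((b + INR (N0 + S j))%R, t) : C) with (((b + INR (N0 + j))%R, t) + RtoC 1)
        by (rewrite Nat.add_succ_r, S_INR; apply C_ext; simpl; ring).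
      eapply Rle_trans; [apply Hdec; simpl; rewrite plus_INR; generalize (P0 j); lra|].
      rewrite S_INR. replace (- (INR j + 1))%R with (-1 + - INR j)%R by ring. rewrite exp_plus.
      specialize (IHj t Ht). generalize (exp_pos (-1)). nra. }
  assert (B0 : (0 <= B)%R) by (eapply Rle_trans; [apply Cmod_ge_0|apply (HB 0%R); lra]).
  assert (K0 : (0 <= K)%R).
  { specialize (HK c h ltac:(lra) (or_introl eq_refl)). generalize (Cmod_ge_0 (F (c, h))) (exp_pos (- c)). intros.
    destruct (Rle_dec 0 K) as [q|q]; [exact q|]. nra. }
  assert (HLb : forall y n, (y = h \/ y = - h)%R -> (Cmod (HL (fun t => F (t, y)) (b + INR n)) <= K * exp (- b) * exp (- INR n))%R).
  { intros y n Hy.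
    destruct (HL_spec (fun t => F (t, y)) (b + INR n)%R K) as [_ X].
    - intros t Ht. apply Cc_horizontal, ccont; [generalize (P0 n); lra|left; destruct Hy; lra].
    - intros t Ht. apply HK; [generalize (P0 n); lra|exact Hy].
    - specialize (X (b + INR n)%R ltac:(lra)). rewrite CRInt_point in X.
      replace (HL (fun t => F (t, y)) (b + INR n) - RtoC 0) with (HL (fun t => F (t, y)) (b + INR n)) in X by ring.
      eapply Rle_trans; [exact X|]. right. rewrite Ropp_plus_distr, exp_plus. ring. }
  apply (is_Clim_shift _ _ N0).
  set (M := (2 * K * exp (- b) + (h - - h) * B)%R).
  assert (M0 : (0 <= M)%R).
  { unfold M. generalize (exp_pos (- b)). intros. assert (0 <= K * exp (- b))%R by (apply Rmult_le_pos; lra). nra. }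
  intros eps He.
  destruct (exp_neg_small (eps / (M + 1)) ltac:(apply Rdiv_lt_0_compat; lra)) as [x Hx].
  destruct (INR_unbounded x) as [N HNx]. exists N. intros n Hn.
  assert (INR N <= INR n)%R by (apply le_INR, Hn).
  specialize (Hx (INR n) ltac:(lra)).
  assert (En := exp_pos (- INR n)).
  replace (loopI F (b + INR (N0 + n)) h - RtoC 0) with (loopI F (b + INR (N0 + n)) h) by ring.
  assert (V : (Cmod (CRInt (fun t => (F (b + INR (N0 + n), t)%R * Ci)%C) (- h) h) <= (h - - h) * (B * exp (- INR n)))%R).
  { refine (CisRInt_bound _ _ _ _ _ _ _ (CisRInt_cont _ _ _ _ _)); try lra.
    - intros t Ht. rewrite Cmod_mult. replace (Cmod Ci) with 1%R.
      + rewrite Rmult_1_r. apply VB, Ht.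
      + unfold Cmod; simpl. replace (0 * (0 * 1) + 1 * (1 * 1))%R with 1%R by ring. symmetry; apply sqrt_1.
    - intros t Ht. apply Cc_mult; [|apply Cc_const].
      apply Cc_vertical, ccont; [generalize (P0 (N0 + n)%nat); lra|right; apply HN]. }
  assert (Emono : (exp (- INR (N0 + n)) <= exp (- INR n))%R).
  { rewrite plus_INR. generalize (P0 N0). intros [q|q]; [left; apply exp_increasing; lra|right; f_equal; lra]. }
  assert (W1 := HLb (- h)%R (N0 + n)%nat (or_intror eq_refl)). assert (W2 := HLb h (N0 + n)%nat (or_introl eq_refl)).
  assert (Kb : (0 <= K * exp (- b))%R) by (apply Rmult_le_pos; [exact K0|left; apply exp_pos]).
  apply Rle_lt_trans with (M * exp (- INR n))%R.
  - unfold loopI. eapply Rle_trans; [apply Cmod_triangle|].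
    eapply Rle_trans; [apply Rplus_le_compat_r, Cmod_triangle|]. rewrite Cmod_opp.
    unfold M. nra.
  - apply (Rmult_lt_compat_l (M + 1)) in Hx; [|lra].
    replace ((M + 1) * (eps / (M + 1)))%R with eps in Hx by (field; lra). nra.
Qed.

Fixpoint csig (l : list R) : C := match l with nil => RtoC 0 | q :: l' => sigma q + csig l' end.

(** The vertical side is moved to [b + n]: the rectangles in between contain finitely many poles,
    and the remaining loop tends to 0. Each class [q + k] contributes the partial sums of its own
    series. *)
Theorem loopI_residues : loopI F c h = - (RtoC (2 * PI) * Ci) * csig qs.
Proof.
  assert (HC : exists c', (c < c')%R /\ forall q, In q qs -> (c' <= q)%R).
  { clear - Hq. induction qs as [|q l IH]; [exists (c + 1)%R; split; [lra|]; intros q []|].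
    destruct IH as [c' [h1 h2]]; [intros; apply Hq; right; assumption|].
    exists (Rmin c' q). split; [apply Rmin_glb_lt; [exact h1|apply Hq; left; reflexivity]|].
    intros q' [E|Hin]; [subst; apply Rmin_r|eapply Rle_trans; [apply Rmin_l|apply h2, Hin]]. }
  destruct HC as (c' & Hcc' & Hc').
  destruct (avoid_classes qs c c' Hcc') as (b & Hb & HbN).
  assert (NPol : forall n : nat, ~ Pol (b + INR n)%R).
  { intros n (q & k & Hin & E). apply (HbN q Hin (Z.of_nat k - Z.of_nat n)%Z).
    rewrite minus_IZR, <- !INR_IZR_INZ. lra. }
  assert (NPc : ~ Pol c).
  { intros (q & k & Hin & E). specialize (Hq q Hin). generalize (pos_INR k). lra. }
  (* The number of poles of the class of [q] to the left of [b + n]; exact because [b + n - q] is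
     never an integer. *)
  pose (cnt := fun q (n : nat) => Z.to_nat (up (b + INR n - q))).
  assert (Hcnt : forall q n k, In q qs -> ((k < cnt q n)%nat <-> (q + INR k < b + INR n)%R)).
  { intros q n k Hin. unfold cnt. rewrite up_spec_noninteger; [lra|].
    replace (b + INR n - q)%R with (b - q + IZR (Z.of_nat n))%R by (rewrite <- INR_IZR_INZ; ring).
    apply noninteger_shift, HbN, Hin. }
  pose (lst := fun l n => flat_map (fun q => map (fun k => (q + INR k)%R) (seq 0 (cnt q n))) l).
  assert (Hlst : forall l n p, (forall q, In q l -> In q qs) ->
     (In p (lst l n) <-> (exists q k, In q l /\ p = (q + INR k)%R) /\ (p < b + INR n)%R)).
  { intros l n p Hl. unfold lst. rewrite in_flat_map. split.
    - intros (q & Hin & Hp). apply in_map_iff in Hp. destruct Hp as (k & E & Hk).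
      apply in_seq in Hk. split; [exists q, k; split; [exact Hin|symmetry; exact E]|].
      rewrite <- E. apply Hcnt; [apply Hl, Hin|lia].
    - intros ((q & k & Hin & E) & Hp). exists q. split; [exact Hin|]. apply in_map_iff. exists k.
      split; [symmetry; exact E|]. apply in_seq. split; [lia|]. simpl. apply Hcnt; [apply Hl, Hin|lra]. }
  assert (Hnd : forall l n, (forall q, In q l -> In q qs) -> NoDup l -> NoDup (lst l n)).
  { intros l n. induction l as [|q l IH]; intros Hl Hn; [constructor|].
    inversion Hn as [|x y Hnq Hn' [Ex Ey]]. simpl. apply NoDup_app.
    - apply Injective_map_NoDup; [|apply seq_NoDup]. intros x' y' E. apply INR_eq. lra.
    - apply IH; [intros; apply Hl; right; assumption|exact Hn'].
    - intros p Hp Hp'. apply in_map_iff in Hp. destruct Hp as (k & E & _).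
      apply (Hlst l n p) in Hp'; [|intros; apply Hl; right; assumption].
      destruct Hp' as ((q' & k' & Hin & E') & _).
      assert (q = q') by (apply (Hsep q q' k k'); [apply Hl; left; reflexivity|apply Hl; right; exact Hin|lra]).
      subst q'. contradiction. }
  assert (Hls : forall l n, lsum rho (lst l n) =
     fold_right Cplus (RtoC 0) (map (fun q => csum (fun k => rho (q + INR k)%R) (cnt q n)) l)).
  { assert (LA : forall l1 l2, lsum rho (l1 ++ l2) = lsum rho l1 + lsum rho l2).
    { induction l1; intros l2; simpl; [ring|]. rewrite IHl1; ring. }
    assert (LS : forall q m, lsum rho (map (fun k => (q + INR k)%R) (seq 0 m)) = csum (fun k => rho (q + INR k)%R) m).
    { intros q m. induction m; [reflexivity|]. rewrite seq_S, map_app, LA, IHm. simpl. ring. }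
    intros l n. induction l as [|q l IH]; [reflexivity|]. change (lst (q :: l) n) with (map (fun k => (q + INR k)%R) (seq 0 (cnt q n)) ++ lst l n).
    rewrite LA, LS, IH. reflexivity. }
  assert (HR : forall n, rect F c (b + INR n) h = RtoC (2 * PI) * Ci * lsum rho (lst qs n)).
  { intros n. assert (0 <= INR n)%R by apply pos_INR.
    apply (rect_poles F c0 h Pol rho Hh Hreg Hdis Hpole (length (lst qs n)) (lst qs n) c (b + INR n)); try lra.
    - lia.
    - apply Hnd; [auto|exact Hqs].
    - exact NPc.
    - apply NPol.
    - intros p. rewrite Hlst by auto. split.
      + intros [(q & k & Hin & E) Hp]. split; [exists q, k; split; assumption|].
        split; [|exact Hp]. specialize (Hq q Hin). generalize (pos_INR k). lra.
      + intros [HP Hp]. split; [exact HP|lra]. }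
  apply (is_Clim_unique (fun n => loopI F (b + INR n) h - rect F c (b + INR n) h)).
  - apply (is_Clim_ext (fun _ => loopI F c h)); [|apply is_Clim_const].
    exists 0%nat. intros n _. apply loop_shift. generalize (pos_INR n); lra.
  - apply (is_Clim_eq _ (RtoC 0 - RtoC (2 * PI) * Ci * csig qs)); [|ring].
    apply is_Clim_minus; [apply loop_vanish; [lra|exact NPol]|].
    apply (is_Clim_ext (fun n => RtoC (2 * PI) * Ci * lsum rho (lst qs n))); [exists 0%nat; intros; symmetry; apply HR|].
    apply is_Clim_scal.
    apply (is_Clim_ext (fun n => fold_right Cplus (RtoC 0) (map (fun q => csum (fun k => rho (q + INR k)%R) (cnt q n)) qs))).
    { exists 0%nat; intros n _; symmetry; apply Hls. }
    assert (LL : forall l, (forall q, In q l -> In q qs) ->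
      is_Clim (fun n => fold_right Cplus (RtoC 0) (map (fun q => csum (fun k => rho (q + INR k)%R) (cnt q n)) l)) (csig l)).
    { induction l as [|q l IH]; intros Hl; [exact (is_Clim_const (RtoC 0))|]. simpl.
      apply is_Clim_plus; [|apply IH; intros; apply Hl; right; assumption].
      assert (Hin : In q qs) by (apply Hl; left; reflexivity).
      intros eps He. destruct (Hsum q Hin eps He) as [N0 HN0].
      destruct (INR_unbounded (q + INR N0 - b)) as [N HN]. exists N. intros n Hn. apply HN0.
      assert (INR N <= INR n)%R by (apply le_INR, Hn).
      assert ((N0 < cnt q n)%nat) by (apply Hcnt; [exact Hin|lra]). lia. }
    apply LL. auto.
Qed.
End Residues.

(** * The Gamma function *)

Lemma Cinv_0 : / RtoC 0 = RtoC 0.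
Proof. apply C_ext; simpl; unfold Rdiv; ring. Qed.

Lemma Cinv_mult (a b : C) : / (a * b) = / a * / b.
Proof.
  destruct (Ceq_dec a (RtoC 0)) as [E|E]; [subst; rewrite Cmult_0_l, Cinv_0; ring|].
  destruct (Ceq_dec b (RtoC 0)) as [E'|E']; [subst; rewrite Cmult_0_r, Cinv_0; ring|].
  field; auto.
Qed.

Definition nonpole (w : C) : Prop := forall k : nat, w <> - RtoC (INR k).

Lemma nonpole_Im w : Im w <> 0%R -> nonpole w.
Proof. intros H k E. apply H. rewrite E. simpl. ring. Qed.

Lemma nonpole_Re w : (0 < Re w)%R -> nonpole w.
Proof. intros H k E. rewrite E in H. simpl in H. generalize (pos_INR k); lra. Qed.

Lemma nonpole_neq_0 w : nonpole w -> w <> RtoC 0.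
Proof. intros H E. apply (H 0%nat). rewrite E. simpl. ring. Qed.

Lemma nonpole_near (w : C) : nonpole w -> Im w = 0%R -> exists d, (0 < d)%R /\
  forall v, (Rabs (Re v - Re w) < d)%R -> nonpole v.
Proof.
  intros Hw Iw. destruct (class_gap (Re w) 0) as [d [Hd HD]]. exists d. split; [exact Hd|].
  intros v Hv k E.
  assert (Hk : (Re w + INR k)%R <> 0%R).
  { intros X. apply (Hw k). apply C_ext; simpl; [lra|rewrite Iw; ring]. }
  specialize (HD k Hk). rewrite E in Hv. simpl in Hv.
  replace (- INR k - Re w)%R with (- (Re w + INR k - 0))%R in Hv by ring. rewrite Rabs_Ropp in Hv. lra.
Qed.

Lemma Gamma_rec s : Gamma s = Gamma (s + RtoC 1) * / s.
Proof. unfold Gamma. rewrite (rGamma_rec s), Cinv_mult. ring. Qed.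

Lemma hol_Gamma (U : C -> Prop) (f : C -> C) : hol U f -> (forall s, U s -> nonpole (f s)) ->
  hol U (fun s => Gamma (f s)).
Proof.
  intros Hf Hn. unfold Gamma. apply hol_inv.
  - apply (hol_comp U (fun _ => True) rGamma f); [apply entire_rGamma|exact Hf|trivial].
  - intros s Hs. apply rGamma_neq_0, Hn, Hs.
Qed.

Lemma hol_rGamma (U : C -> Prop) (f : C -> C) : hol U f -> hol U (fun s => rGamma (f s)).
Proof. intros Hf. apply (hol_comp U (fun _ => True) rGamma f); [apply entire_rGamma|exact Hf|trivial]. Qed.

Lemma Cc_rGamma {U : UniformSpace} (f : U -> C) (x : U) :
  continuous f x -> continuous (fun y => rGamma (f y)) x.
Proof.
  intros Hf. apply (continuous_comp f rGamma); [exact Hf|].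
  apply (hol_cont (fun _ => True)); [apply entire_rGamma|trivial].
Qed.

Lemma Cc_Gamma {U : UniformSpace} (f : U -> C) (x : U) :
  continuous f x -> nonpole (f x) -> continuous (fun y => Gamma (f y)) x.
Proof. intros Hf Hn. apply Cc_inv; [apply Cc_rGamma, Hf|apply rGamma_neq_0, Hn]. Qed.

(** * The two integrands *)

(** The integrand of the first G-function, with [x ^ s = Cexp (s * l)]. The two lower parameters 0
    and the upper parameter 1 are merged into [Gamma (- s) / (- s)], whose only double pole is 0. *)
Definition phi31 (l nu s : C) : C :=
  Gamma (- s) * / (- s) * Gamma (nu - s) * Gamma (RtoC (1/2) + s) * rGamma (RtoC 1 + nu + s) * Cexp (s * l).

Definition phi40 (l nu s : C) : C :=
  Gamma (- s) * / (- s) * Gamma (nu - s) * Gamma (- nu - s) * rGamma (RtoC (1/2) - s) * Cexp (s * l).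

(* With [Gamma = / rGamma] and [/ 0 = 0], this holds even at the poles. *)
Lemma Gamma_square s : Gamma (- s) * Gamma (- s) * rGamma (RtoC 1 - s) = Gamma (- s) * / (- s).
Proof.
  destruct (Ceq_dec (rGamma (- s)) (RtoC 0)) as [E|E].
  { unfold Gamma. rewrite E, Cinv_0. ring. }
  assert (S0 : - s <> RtoC 0) by (intros X; apply E; rewrite X; apply rGamma_0).
  replace (rGamma (RtoC 1 - s)) with (rGamma (- s) * / (- s)).
  - unfold Gamma. field. split; [intros X; apply S0; rewrite X; ring|exact E].
  - rewrite (rGamma_rec (- s)). replace (- s + RtoC 1) with (RtoC 1 - s) by ring. field.
    intros X; apply S0. rewrite X; ring.
Qed.

Lemma integrand_31 (nu : R) (x s : C) :
  MeijerG_integrand 3 1 [RtoC (1 / 2); RtoC 1] [RtoC 0; RtoC 0; RtoC nu; RtoC (- nu)] x s =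
  phi31 (Clog x) (RtoC nu) s.
Proof.
  unfold MeijerG_integrand, Cpower; simpl. unfold phi31. rewrite <- Gamma_square.
  replace (RtoC 0 - s) with (- s) by ring.
  replace (RtoC 1 - RtoC (1 / 2) + s) with (RtoC (1/2) + s) by (rewrite RtoC_div by lra; field).
  rewrite RtoC_opp. replace (RtoC 1 - - RtoC nu + s) with (RtoC 1 + RtoC nu + s) by ring. ring.
Qed.

Lemma integrand_40 (nu : R) (x s : C) :
  MeijerG_integrand 4 0 [RtoC (1 / 2); RtoC 1] [RtoC 0; RtoC 0; RtoC nu; RtoC (- nu)] x s =
  phi40 (Clog x) (RtoC nu) s.
Proof.
  unfold MeijerG_integrand, Cpower; simpl. unfold phi40. rewrite <- Gamma_square.
  replace (RtoC 0 - s) with (- s) by ring. rewrite RtoC_opp. ring.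
Qed.

Lemma phi40_even l nu s : phi40 l (- nu) s = phi40 l nu s.
Proof. unfold phi40. replace (- - nu - s) with (nu - s) by ring. ring. Qed.

Definition ratio (l nu s : C) : C :=
  Cexp l * s * (s + RtoC (1/2)) * / ((s + RtoC 1) * (s + RtoC 1) * (s + RtoC 1 - nu) * (s + RtoC 1 + nu)).

Lemma neq_0_eq (A B : C) : B <> RtoC 0 -> A = B -> A <> RtoC 0.
Proof. intros H E X. apply H. rewrite <- E. exact X. Qed.

Lemma neq_0_opp (A B : C) : B <> RtoC 0 -> A = - B -> A <> RtoC 0.
Proof. intros H E X. apply H. replace B with (- A) by (rewrite E; ring). rewrite X. ring. Qed.

(** Settles the side conditions of [field]: the term is, up to sign and [ring], one already known to
    be nonzero. *)
Ltac nz H := first [apply (neq_0_eq _ _ H); cbv beta; ring | apply (neq_0_opp _ _ H); cbv beta; ring].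

Lemma phi31_shift l nu s : s <> RtoC 0 -> s + RtoC 1 <> RtoC 0 -> s + RtoC 1 - nu <> RtoC 0 ->
  s + RtoC 1 + nu <> RtoC 0 -> s + RtoC (1/2) <> RtoC 0 -> phi31 l nu (s + RtoC 1) = ratio l nu s * phi31 l nu s.
Proof.
  intros H0 H1 H2 H3 H4. unfold phi31, ratio.
  rewrite (Gamma_rec (- (s + RtoC 1))). replace (- (s + RtoC 1) + RtoC 1) with (- s) by ring.
  rewrite (Gamma_rec (nu - (s + RtoC 1))). replace (nu - (s + RtoC 1) + RtoC 1) with (nu - s) by ring.
  rewrite (Gamma_rec (RtoC (1/2) + s)). replace (RtoC (1/2) + (s + RtoC 1)) with (RtoC (1/2) + s + RtoC 1) by ring.
  rewrite (rGamma_rec (RtoC 1 + nu + s)). replace (RtoC 1 + nu + (s + RtoC 1)) with (RtoC 1 + nu + s + RtoC 1) by ring.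
  replace ((s + RtoC 1) * l) with (s * l + l) by ring. rewrite Cexp_plus.
  set (G1 := Gamma _). set (G2 := Gamma _). set (G3 := Gamma _). set (G4 := rGamma _). set (E := Cexp l). set (E' := Cexp _).
  set (hf := RtoC (1/2)) in *. field.
  repeat split; first [nz H0 | nz H1 | nz H2 | nz H3 | nz H4].
Qed.

Lemma phi40_shift l nu s : s <> RtoC 0 -> s + RtoC 1 <> RtoC 0 -> s + RtoC 1 - nu <> RtoC 0 ->
  s + RtoC 1 + nu <> RtoC 0 -> phi40 l nu (s + RtoC 1) = ratio l nu s * phi40 l nu s.
Proof.
  intros H0 H1 H2 H3. unfold phi40, ratio.
  rewrite (Gamma_rec (- (s + RtoC 1))). replace (- (s + RtoC 1) + RtoC 1) with (- s) by ring.
  rewrite (Gamma_rec (nu - (s + RtoC 1))). replace (nu - (s + RtoC 1) + RtoC 1) with (nu - s) by ring.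
  rewrite (Gamma_rec (- nu - (s + RtoC 1))). replace (- nu - (s + RtoC 1) + RtoC 1) with (- nu - s) by ring.
  rewrite (rGamma_rec (RtoC (1/2) - (s + RtoC 1))).
  replace (RtoC (1/2) - (s + RtoC 1) + RtoC 1) with (RtoC (1/2) - s) by ring.
  replace (RtoC (1/2) - (s + RtoC 1)) with (- (s + RtoC (1/2))) by (rewrite RtoC_div by lra; field).
  replace ((s + RtoC 1) * l) with (s * l + l) by ring. rewrite Cexp_plus.
  set (G1 := Gamma _). set (G2 := Gamma _). set (G3 := Gamma _). set (G4 := rGamma _). set (E := Cexp l). set (E' := Cexp _).
  set (hf := RtoC (1/2)) in *. field.
  repeat split; first [nz H0 | nz H1 | nz H2 | nz H3].
Qed.

Lemma Re_neq_0 (w : C) : Re w <> 0%R -> w <> RtoC 0.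
Proof. intros H E; apply H; rewrite E; reflexivity. Qed.

Lemma Cmod_ge_Re (w : C) (r : R) : (r <= Re w)%R -> (r <= Cmod w)%R.
Proof. intros H. generalize (re_le_Cmod w) (Rle_abs (Re w)). lra. Qed.

Lemma Cmod_le_shift (s : C) (a b : R) : (0 <= Re s)%R -> (0 <= a <= b)%R ->
  (Cmod (s + RtoC a) <= Cmod (s + RtoC b))%R.
Proof.
  intros Hs Hab. apply Rsqr_incr_0; try apply Cmod_ge_0. unfold Rsqr. rewrite !Cmod_sqr.
  rewrite !re_plus, !im_plus. simpl. nra.
Qed.

(** The two numerator factors are dominated by [s + 1], the factor [s + 1 + nu] is at least 1 in
    modulus, and [s + 1 - nu] exceeds [3 * Cmod (Cexp l)]. This leaves at most [1/3], which is below
    [exp (-1)]. *)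
Lemma ratio_small (l : C) (nu : R) (s : C) : (0 <= nu)%R -> (nu + 3 * Cmod (Cexp l) <= Re s)%R ->
  (Cmod (ratio l (RtoC nu) s) <= exp (-1))%R.
Proof.
  intros Hnu Hs. assert (P := Cmod_ge_0 (Cexp l)).
  assert (E3 : (1/3 <= exp (-1))%R).
  { replace (-1)%R with (- (1))%R by ring. rewrite exp_Ropp. unfold Rdiv. rewrite Rmult_1_l. apply Rinv_le_contravar; [apply exp_pos|apply exp_le_3]. }
  assert (S0 : (0 <= Re s)%R) by lra.
  assert (A1 : (Cmod s <= Cmod (s + RtoC 1))%R).
  { replace s with (s + RtoC 0) at 1 by ring. apply Cmod_le_shift; lra. }
  assert (A2 : (Cmod (s + RtoC (1/2)) <= Cmod (s + RtoC 1))%R) by (apply Cmod_le_shift; lra).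
  assert (A3 : (1 <= Cmod (s + RtoC 1))%R) by (apply Cmod_ge_Re; rewrite re_plus; simpl; lra).
  assert (A4 : (1 + 3 * Cmod (Cexp l) <= Cmod (s + RtoC 1 - RtoC nu))%R).
  { apply Cmod_ge_Re. unfold Cminus. rewrite !re_plus, re_opp. simpl. lra. }
  assert (A5 : (1 <= Cmod (s + RtoC 1 + RtoC nu))%R) by (apply Cmod_ge_Re; rewrite !re_plus; simpl; lra).
  unfold ratio.
  assert (NZ : (s + RtoC 1) * (s + RtoC 1) * (s + RtoC 1 - RtoC nu) * (s + RtoC 1 + RtoC nu) <> RtoC 0).
  { repeat apply Cmult_neq_0; apply Cmod_gt_0; lra. }
  rewrite Cmod_mult, Cmod_inv by exact NZ. rewrite !Cmod_mult.
  set (u := Cmod (s + RtoC 1)) in *. set (v := Cmod (s + RtoC 1 - RtoC nu)) in *. set (w := Cmod (s + RtoC 1 + RtoC nu)) in *.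
  set (x := Cmod (Cexp l)) in *. set (a := Cmod s) in *. set (b := Cmod (s + RtoC (1/2))) in *.
  assert (a0 : (0 <= a)%R) by apply Cmod_ge_0. assert (b0 : (0 <= b)%R) by apply Cmod_ge_0.
  assert (Pd : (0 < u * u * v * w)%R) by (repeat apply Rmult_lt_0_compat; lra).
  apply Rle_trans with (1/3)%R; [|exact E3].
  apply (Rmult_le_reg_r (u * u * v * w)); [exact Pd|]. rewrite Rmult_assoc, Rinv_l, Rmult_1_r by lra.
  apply Rle_trans with (x * (u * u))%R.
  - rewrite Rmult_assoc. apply Rmult_le_compat_l; [exact P|]. apply Rmult_le_compat; assumption.
  - replace (1/3 * (u * u * v * w))%R with ((u * u) * (1/3 * (v * w)))%R by ring.
    rewrite Rmult_comm. apply Rmult_le_compat_l; [nra|]. assert (v <= v * w)%R by nra. lra.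
Qed.

Lemma phi31_decay l (nu : R) T : (0 <= nu)%R -> (nu + 3 * Cmod (Cexp l) + 1 <= T)%R -> shift_decay (phi31 l (RtoC nu)) T.
Proof.
  intros Hnu HT s Hs. assert (P := Cmod_ge_0 (Cexp l)).
  rewrite phi31_shift; try (apply Re_neq_0; unfold Cminus; rewrite ?re_plus, ?re_opp; simpl; lra).
  rewrite Cmod_mult. apply Rmult_le_compat_r; [apply Cmod_ge_0|]. apply ratio_small; lra.
Qed.

Lemma phi40_decay l (nu : R) T : (0 <= nu)%R -> (nu + 3 * Cmod (Cexp l) + 1 <= T)%R -> shift_decay (phi40 l (RtoC nu)) T.
Proof.
  intros Hnu HT s Hs. assert (P := Cmod_ge_0 (Cexp l)).
  rewrite phi40_shift; try (apply Re_neq_0; unfold Cminus; rewrite ?re_plus, ?re_opp; simpl; lra).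
  rewrite Cmod_mult. apply Rmult_le_compat_r; [apply Cmod_ge_0|]. apply ratio_small; lra.
Qed.

Lemma Cc_phi31 {U : UniformSpace} l (N S : U -> C) (x : U) : continuous N x -> continuous S x ->
  nonpole (- S x) -> nonpole (N x - S x) -> nonpole (RtoC (1/2) + S x) ->
  continuous (fun y => phi31 l (N y) (S y)) x.
Proof.
  intros HN HS H1 H2 H3. unfold phi31.
  assert (HS' : continuous (fun y => - S y) x) by (apply Cc_opp, HS).
  apply Cc_mult; [apply Cc_mult; [apply Cc_mult; [apply Cc_mult; [apply Cc_mult|]|]|]|].
  - apply (Cc_Gamma (fun y => - S y)); assumption.
  - apply (Cc_inv (fun y => - S y)); [exact HS'|apply nonpole_neq_0, H1].
  - apply (Cc_Gamma (fun y => N y - S y)); [apply Cc_minus; assumption|exact H2].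
  - apply (Cc_Gamma (fun y => RtoC (1/2) + S y)); [apply Cc_plus; [apply Cc_const|exact HS]|exact H3].
  - apply Cc_rGamma. apply Cc_plus; [apply Cc_plus; [apply Cc_const|exact HN]|exact HS].
  - apply Cc_exp, Cc_mult; [exact HS|apply Cc_const].
Qed.

Lemma Cc_phi40 {U : UniformSpace} l (N S : U -> C) (x : U) : continuous N x -> continuous S x ->
  nonpole (- S x) -> nonpole (N x - S x) -> nonpole (- N x - S x) ->
  continuous (fun y => phi40 l (N y) (S y)) x.
Proof.
  intros HN HS H1 H2 H3. unfold phi40.
  assert (HS' : continuous (fun y => - S y) x) by (apply Cc_opp, HS).
  apply Cc_mult; [apply Cc_mult; [apply Cc_mult; [apply Cc_mult; [apply Cc_mult|]|]|]|].
  - apply (Cc_Gamma (fun y => - S y)); assumption.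
  - apply (Cc_inv (fun y => - S y)); [exact HS'|apply nonpole_neq_0, H1].
  - apply (Cc_Gamma (fun y => N y - S y)); [apply Cc_minus; assumption|exact H2].
  - apply (Cc_Gamma (fun y => - N y - S y)); [apply Cc_minus; [apply Cc_opp|]; assumption|exact H3].
  - apply Cc_rGamma. apply Cc_minus; [apply Cc_const|exact HS].
  - apply Cc_exp, Cc_mult; [exact HS|apply Cc_const].
Qed.

(** * Residue data *)

Definition holnear (p : R) (f : C -> C) : Prop :=
  exists d, (0 < d)%R /\ hol (strip (p - d) (p + d)) f.

Lemma holnear_mult p f g : holnear p f -> holnear p g -> holnear p (fun s => f s * g s).
Proof.
  intros [d [Hd Hf]] [e [He Hg]]. exists (Rmin d e). split; [apply Rmin_pos; assumption|].
  assert (B1 := Rmin_l d e). assert (B2 := Rmin_r d e).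
  apply hol_mult; [apply (hol_sub (strip (p - d) (p + d)))|apply (hol_sub (strip (p - e) (p + e)))]; try assumption;
   intros s Hs; unfold strip in *; lra.
Qed.

Lemma holnear_of_entire p f : entire f -> holnear p f.
Proof.
  intros H. exists 1%R. split; [lra|]. apply (hol_sub (fun _ => True)); [trivial|exact H].
Qed.

Lemma holnear_Gamma_plus p b : nonpole (RtoC (b + p)) -> holnear p (fun s => Gamma (RtoC b + s)).
Proof.
  intros H. destruct (nonpole_near (RtoC (b + p)) H eq_refl) as [d [Hd HD]]. exists d. split; [exact Hd|].
  apply hol_Gamma.
  - apply hol_plus; [apply hol_const|apply hol_id].
  - intros s [Hs1 Hs2]. apply HD. rewrite re_plus. simpl. apply Rabs_def1; lra.
Qed.

Lemma holnear_Gamma_minus p b : nonpole (RtoC (b - p)) -> holnear p (fun s => Gamma (RtoC b - s)).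
Proof.
  intros H. destruct (nonpole_near (RtoC (b - p)) H eq_refl) as [d [Hd HD]]. exists d. split; [exact Hd|].
  apply hol_Gamma.
  - apply hol_minus; [apply hol_const|apply hol_id].
  - intros s [Hs1 Hs2]. apply HD. unfold Cminus. rewrite re_plus, re_opp. simpl. apply Rabs_def1; lra.
Qed.

Lemma holnear_inv p f : holnear p f -> (exists d, (0 < d)%R /\ forall s, strip (p - d) (p + d) s -> f s <> RtoC 0) ->
  holnear p (fun s => / f s).
Proof.
  intros [d [Hd Hf]] [e [He Hg]]. exists (Rmin d e). split; [apply Rmin_pos; assumption|].
  assert (B1 := Rmin_l d e). assert (B2 := Rmin_r d e).
  apply hol_inv; [apply (hol_sub (strip (p - d) (p + d))); [|exact Hf]; intros s Hs; unfold strip in *; lra|].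
  intros s Hs; apply Hg; unfold strip in *; lra.
Qed.

(* [r = H'(p)] is the residue of [F] at [p]. The coefficient [v] of the double pole is recorded because
   the recurrence [F (s + 1) = Rt s * F s] turns it into a contribution to the residue at [p + 1]. *)
Definition resdata (F : C -> C) (p : R) (v r : C) : Prop :=
  exists (d : R) (H : C -> C), (0 < d)%R /\ hol (strip (p - d) (p + d)) H /\ H (RtoC p) = v /\
  Cder H (RtoC p) r /\
  forall s, strip (p - d) (p + d) s -> s <> RtoC p -> F s = H s * / ((s - RtoC p) * (s - RtoC p)).

Lemma resdata_intro F p v r H : holnear p H -> H (RtoC p) = v -> Cder H (RtoC p) r ->
  (exists d, (0 < d)%R /\ forall s, strip (p - d) (p + d) s -> s <> RtoC p -> F s = H s * / ((s - RtoC p) * (s - RtoC p))) ->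
  resdata F p v r.
Proof.
  intros [d [Hd HH]] Hv Hr [e [He HE]]. exists (Rmin d e), H.
  assert (B1 := Rmin_l d e). assert (B2 := Rmin_r d e).
  split; [apply Rmin_pos; assumption|]. split; [|split; [exact Hv|split; [exact Hr|]]].
  - apply (hol_sub (strip (p - d) (p + d))); [|exact HH]. intros s Hs; unfold strip in *; lra.
  - intros s Hs. apply HE. unfold strip in *; lra.
Qed.

(** Two numerators agree off [p], hence at [p] by continuity, hence have the same derivative
    there. *)
Lemma resdata_unique F p v r v' r' : resdata F p v r -> resdata F p v' r' -> r = r'.
Proof.
  intros (d & H & Hd & HH & Hv & Hr & HE) (d' & H' & Hd' & HH' & Hv' & Hr' & HE').
  pose (e := Rmin d d').
  assert (He : (0 < e)%R) by (apply Rmin_pos; assumption).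
  assert (B1 : (e <= d)%R) by apply Rmin_l. assert (B2 : (e <= d')%R) by apply Rmin_r.
  assert (St : forall s, (Cmod (s - RtoC p) < e)%R -> strip (p - e) (p + e) s).
  { intros s Hs. assert (B := re_le_Cmod (s - RtoC p)).
    replace (Re (s - RtoC p)) with (Re s - p)%R in B by (unfold Cminus; rewrite re_plus, re_opp; reflexivity).
    unfold strip. unfold Rabs in B. destruct (Rcase_abs (Re s - p)); lra. }
  assert (Off : forall s, (Cmod (s - RtoC p) < e)%R -> s <> RtoC p -> H s = H' s).
  { intros s Hs Hn. assert (S := St s Hs). unfold strip in S.
    assert (E1 := HE s ltac:(unfold strip; lra) Hn). assert (E2 := HE' s ltac:(unfold strip; lra) Hn).
    assert (N : s - RtoC p <> RtoC 0) by (apply Cminus_eq_contra, Hn).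
    replace (H s) with (H s * / ((s - RtoC p) * (s - RtoC p)) * ((s - RtoC p) * (s - RtoC p))) by (field; exact N).
    rewrite <- E1, E2. field. exact N. }
  assert (On : H (RtoC p) = H' (RtoC p)).
  { assert (L : forall G : C -> C, continuous G (RtoC p) ->
       is_Clim (fun n => G (RtoC p + / RtoC (INR n))) (G (RtoC p))).
    { intros G HG. apply (is_Clim_comp G); [exact HG|].
      apply (is_Clim_eq _ (RtoC p + RtoC 0)); [|ring]. apply is_Clim_plus; [apply is_Clim_const|apply is_Clim_inv_INR]. }
    apply (is_Clim_unique (fun n => H (RtoC p + / RtoC (INR n)))).
    - apply L. eapply Cder_cont, Hr.
    - apply (is_Clim_ext (fun n => H' (RtoC p + / RtoC (INR n)))); [|apply L; eapply Cder_cont, Hr'].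
      destruct (is_Clim_inv_INR e He) as [N HN]. exists (S N). intros n Hn. symmetry. apply Off.
      + replace (RtoC p + / RtoC (INR n) - RtoC p) with (/ RtoC (INR n) - RtoC 0) by ring. apply HN; lia.
      + intros E. assert (Z : / RtoC (INR n) = RtoC 0) by (replace (/ RtoC (INR n)) with (RtoC p + / RtoC (INR n) - RtoC p) by ring; rewrite E; ring).
        apply (f_equal (fun w => RtoC (INR n) * w)) in Z. rewrite Cinv_r, Cmult_0_r in Z by (apply RtoC_INR_neq_0; lia).
        apply RtoC_inj in Z. lra. }
  apply (Cder_unique H' (RtoC p)); [|exact Hr'].
  apply (Cder_ext_loc H); [|exact Hr]. exists e. split; [exact He|]. intros w Hw.
  destruct (Ceq_dec w (RtoC p)) as [E|E]; [rewrite E; exact On|apply Off; assumption].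
Qed.

(** The numerator at [p + 1] is the translate of [Rt * H]; the product rule mixes the double-pole
    coefficient into the new residue. *)
Lemma resdata_shift F p v r Rt R' : resdata F p v r -> holnear p Rt -> Cder Rt (RtoC p) R' ->
  (exists d, (0 < d)%R /\ forall s, strip (p - d) (p + d) s -> s <> RtoC p -> F (s + RtoC 1) = Rt s * F s) ->
  resdata F (p + 1) (Rt (RtoC p) * v) (R' * v + Rt (RtoC p) * r).
Proof.
  intros (d & H & Hd & HH & Hv & Hr & HE) HR HR' [e [He HF]].
  pose (K := fun s => Rt (s - RtoC 1) * H (s - RtoC 1)).
  assert (Ep : RtoC (p + 1) - RtoC 1 = RtoC p) by (rewrite RtoC_plus; ring).
  assert (Dm : forall s : C, Cder (fun s => s - RtoC 1) s (RtoC 1)).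
  { intros s. eapply Cder_eq; [apply Cder_minus; [apply Cder_id|apply Cder_const]|ring]. }
  apply (resdata_intro F (p + 1) _ _ K).
  - destruct (holnear_mult p Rt H HR (ex_intro _ d (conj Hd HH))) as [d1 [Hd1 HH1]].
    exists d1. split; [exact Hd1|].
    apply (hol_comp _ (strip (p - d1) (p + d1)) (fun s => Rt s * H s) (fun s => s - RtoC 1)); [exact HH1| |].
    + apply hol_minus; [apply hol_id|apply hol_const].
    + intros s Hs. unfold strip in *. unfold Cminus; rewrite re_plus, re_opp; simpl. lra.
  - unfold K. rewrite Ep, Hv. reflexivity.
  - unfold K. eapply Cder_eq.
    + apply (Cder_comp (fun s => Rt s * H s) (fun s => s - RtoC 1)); [|apply Dm].
      rewrite Ep. apply Cder_mult; eassumption.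
    + rewrite Hv. ring.
  - exists (Rmin d e). assert (B1 := Rmin_l d e). assert (B2 := Rmin_r d e).
    split; [apply Rmin_pos; assumption|]. intros s Hs Hn.
    assert (Rs : Re (s - RtoC 1) = (Re s - 1)%R) by (unfold Cminus; rewrite re_plus, re_opp; reflexivity).
    assert (Hs' : strip (p - Rmin d e) (p + Rmin d e) (s - RtoC 1)) by (unfold strip in *; rewrite Rs; lra).
    assert (Hn' : s - RtoC 1 <> RtoC p).
    { intros E. apply Hn. rewrite RtoC_plus, <- E. ring. }
    replace s with (s - RtoC 1 + RtoC 1) at 1 by ring.
    rewrite HF; [|unfold strip in *; lra|exact Hn'].
    rewrite (HE (s - RtoC 1)); [|unfold strip in *; lra|exact Hn'].
    unfold K. replace (s - RtoC (p + 1)) with (s - RtoC 1 - RtoC p) by (rewrite RtoC_plus; ring). ring.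
Qed.

(** Value together with logarithmic derivative [m]. Products add the [m] and inverses negate them,
    so the derivative of a long product of Gamma factors is assembled mechanically. *)
Definition logder (f : C -> C) (s v m : C) : Prop := f s = v /\ Cder f s (v * m).

Lemma logder_eq f s v m v' m' : logder f s v m -> v = v' -> m = m' -> logder f s v' m'.
Proof. intros H -> ->. exact H. Qed.

Lemma logder_const c s : logder (fun _ => c) s c (RtoC 0).
Proof. split; [reflexivity|]. eapply Cder_eq; [apply Cder_const|ring]. Qed.

Lemma logder_mult f g s v m w n : logder f s v m -> logder g s w n ->
  logder (fun u => f u * g u) s (v * w) (m + n).
Proof.
  intros [E1 H1] [E2 H2]. split; [rewrite E1, E2; reflexivity|].
  eapply Cder_eq; [apply (Cder_mult f g s _ _ H1 H2)|]. rewrite E1, E2. ring.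
Qed.

Lemma logder_inv f s v m : logder f s v m -> v <> RtoC 0 -> logder (fun u => / f u) s (/ v) (- m).
Proof.
  intros [E1 H1] N. split; [rewrite E1; reflexivity|].
  eapply Cder_eq; [apply (Cder_comp Cinv f s (- / (v * v)) (v * m)); [rewrite E1; apply Cder_inv, N|exact H1]|].
  field. exact N.
Qed.

Lemma Cder_affine c k s : Cder (fun u => c + k * u) s k.
Proof.
  eapply Cder_eq; [apply Cder_plus; [apply Cder_const|apply Cder_scal, Cder_id]|ring].
Qed.

Lemma logder_affine c k s p : c + k * s = p -> p <> RtoC 0 -> logder (fun u => c + k * u) s p (k / p).
Proof. intros <- N. split; [reflexivity|]. eapply Cder_eq; [apply Cder_affine|field; exact N]. Qed.

Lemma logder_rGamma c k s p g : c + k * s = p -> Cder rGamma p g -> rGamma p <> RtoC 0 ->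
  logder (fun u => rGamma (c + k * u)) s (rGamma p) (k * g / rGamma p).
Proof.
  intros E Hg N. split; [rewrite E; reflexivity|].
  eapply Cder_eq; [apply (Cder_comp rGamma (fun u => c + k * u) s g k); [rewrite E; exact Hg|apply Cder_affine]|].
  field. exact N.
Qed.

Lemma logder_exp l s : logder (fun u => Cexp (u * l)) s (Cexp (s * l)) l.
Proof.
  split; [reflexivity|].
  eapply Cder_eq; [apply (Cder_comp Cexp (fun u => u * l) s (Cexp (s * l)) l); [apply Cder_Cexp|]|ring].
  eapply Cder_eq; [apply (Cder_mult (fun u => u) (fun _ => l) s (RtoC 1) (RtoC 0)); [apply Cder_id|apply Cder_const]|ring].
Qed.

Lemma logder_near f g p v m : logder g (RtoC p) v m ->
  (exists d, (0 < d)%R /\ forall s, strip (p - d) (p + d) s -> g s = f s) -> logder f (RtoC p) v m.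
Proof.
  intros [E1 H1] [d [Hd HD]].
  assert (St : forall s, (Cmod (s - RtoC p) < d)%R -> strip (p - d) (p + d) s).
  { intros s Hs. assert (B := re_le_Cmod (s - RtoC p)).
    replace (Re (s - RtoC p)) with (Re s - p)%R in B by (unfold Cminus; rewrite re_plus, re_opp; reflexivity).
    unfold strip. unfold Rabs in B. destruct (Rcase_abs (Re s - p)); lra. }
  split.
  - rewrite <- E1. symmetry. apply HD. unfold strip; simpl; lra.
  - apply (Cder_ext_loc g); [|exact H1]. exists d. split; [exact Hd|]. intros w Hw. apply HD, St, Hw.
Qed.

(** Duplication replaces the argument near [1/2] by arguments near 1, so that at [s = 0] the only
    unknown is the derivative of [rGamma] at 1, which will cancel; the price is the exponential of
    [- 2 s ln 2]. *)
Lemma Gamma_half_plus s : rGamma (s + RtoC 1) <> RtoC 0 -> Gamma (RtoC (1/2) + s) =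
  RtoC (sqrt PI) * Cexp (s * (- (RtoC 2 * RtoC (ln 2)))) * rGamma (s + RtoC 1) * Gamma (RtoC 2 * s + RtoC 1).
Proof.
  intros N. assert (NP : RtoC (sqrt PI) <> RtoC 0) by (apply RtoC_neq_0; generalize (sqrt_lt_R0 _ PI_RGT_0); lra).
  unfold Gamma. replace (RtoC (1/2) + s) with (s + RtoC (1/2)) by ring.
  assert (D := rGamma_duplication s).
  replace (rGamma (s + RtoC (1/2))) with (rGamma (s + RtoC (1/2)) * rGamma (s + RtoC 1) * / rGamma (s + RtoC 1)) by (field; exact N).
  rewrite D. unfold Cdiv. rewrite !Cinv_mult.
  replace (s * - (RtoC 2 * RtoC (ln 2))) with (- (RtoC 2 * s * RtoC (ln 2))) by ring. rewrite Cexp_opp.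
  replace (/ / RtoC (sqrt PI)) with (RtoC (sqrt PI)) by (field; exact NP).
  replace (/ / rGamma (s + RtoC 1)) with (rGamma (s + RtoC 1)) by (field; exact N). ring.
Qed.

Lemma rGamma_half_minus s : rGamma (RtoC 1 - s) <> RtoC 0 -> rGamma (RtoC (1/2) - s) =
  / RtoC (sqrt PI) * Cexp (s * (- (RtoC 2 * RtoC (ln 2)))) * rGamma (RtoC 1 - RtoC 2 * s) * Gamma (RtoC 1 - s).
Proof.
  intros N. assert (NP : RtoC (sqrt PI) <> RtoC 0) by (apply RtoC_neq_0; generalize (sqrt_lt_R0 _ PI_RGT_0); lra).
  assert (D := rGamma_duplication (- s)).
  replace (- s + RtoC (1/2)) with (RtoC (1/2) - s) in D by ring.
  replace (- s + RtoC 1) with (RtoC 1 - s) in D by ring.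
  replace (RtoC 2 * - s + RtoC 1) with (RtoC 1 - RtoC 2 * s) in D by ring.
  replace (RtoC 2 * - s * RtoC (ln 2)) with (s * - (RtoC 2 * RtoC (ln 2))) in D by ring.
  unfold Gamma.
  replace (rGamma (RtoC (1/2) - s)) with (rGamma (RtoC (1/2) - s) * rGamma (RtoC 1 - s) * / rGamma (RtoC 1 - s)) by (field; exact N).
  rewrite D. unfold Cdiv. ring.
Qed.

Lemma noninteger_nonpole t : noninteger t -> nonpole (RtoC t).
Proof.
  intros H k E. rewrite <- RtoC_opp in E. apply RtoC_inj in E. apply (H (- Z.of_nat k)%Z).
  rewrite opp_IZR, <- INR_IZR_INZ. exact E.
Qed.

Lemma noninteger_affine t (a b : Z) : noninteger t -> noninteger (IZR a + t)%R /\ noninteger (IZR a - t)%R.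
Proof.
  intros H. split; intros k E.
  - apply (H (k - a)%Z). rewrite minus_IZR. lra.
  - apply (H (a - k)%Z). rewrite minus_IZR. lra.
Qed.

Lemma holnear_exp p l : holnear p (fun s => Cexp (s * l)).
Proof. apply holnear_of_entire, hol_exp, hol_mult; [apply hol_id|apply hol_const]. Qed.

Lemma holnear_rGamma_plus p b : holnear p (fun s => rGamma (b + s)).
Proof. apply holnear_of_entire, hol_rGamma, hol_plus; [apply hol_const|apply hol_id]. Qed.

Lemma holnear_rGamma_minus p b : holnear p (fun s => rGamma (b - s)).
Proof. apply holnear_of_entire, hol_rGamma, hol_minus; [apply hol_const|apply hol_id]. Qed.

Lemma noninteger_double t : noninteger (2 * t) -> noninteger t.
Proof. intros H k E. apply (H (2 * k)%Z). rewrite mult_IZR, E. reflexivity. Qed.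

Lemma noninteger_opp t : noninteger t -> noninteger (- t).
Proof. intros H. replace (- t)%R with (0 - t)%R by ring. apply (noninteger_affine t 0 0 H). Qed.

Lemma holnear_Gamma_opp p : noninteger p -> holnear p (fun s => Gamma (- s) * / - s).
Proof.
  intros H. destruct (noninteger_locally p H) as [d [Hd HD]]. exists d. split; [exact Hd|].
  assert (X : forall s, strip (p - d) (p + d) s -> nonpole (- s)).
  { intros s Hs k E. apply (HD (Re s)) with (k := Z.of_nat k).
    - unfold strip in Hs. apply Rabs_def1; lra.
    - apply (f_equal Re) in E. rewrite !re_opp in E. simpl in E. rewrite <- INR_IZR_INZ. lra. }
  apply hol_mult; [apply hol_Gamma|apply hol_inv]; try (apply hol_opp, hol_id); try assumption.
  intros s Hs. apply nonpole_neq_0, X, Hs.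
Qed.

Ltac holnear_split := repeat lazymatch goal with
  | |- holnear _ (fun s => Gamma (- s) * / - s) => apply holnear_Gamma_opp; assumption
  | |- holnear _ (fun s => _ * _) => apply holnear_mult
  | |- holnear _ (fun s => Cexp _) => apply holnear_exp
  end.

Section Base.
Variables (l : C) (nu : R) (g gm : C).
Let N := RtoC nu.
Let ra := rGamma (N + RtoC 1).
Let rb := rGamma (- N + RtoC 1).
Let lam := l - RtoC 2 * RtoC (ln 2).
Hypothesis Hnu : noninteger nu.
Hypothesis Hg : Cder rGamma (N + RtoC 1) g.
Hypothesis Hgm : Cder rGamma (- N + RtoC 1) gm.

(** [phi31 = H / s^2], as [Gamma (- s) / (- s) = Gamma (1 - s) / s^2]. After duplication the factors
    near argument 1 have arguments [1 + s], [1 + 2 s] and [1 - s]; their contributions to the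
    logarithmic derivative of [H] are [1], [-2] and [1] times the derivative of [rGamma] at 1, with
    sum 0. *)
Lemma phi31_residue_0 : resdata (phi31 l N) 0 (RtoC (sqrt PI) / N)
  (RtoC (sqrt PI) / N * (lam + RtoC 2 * g / ra + / N)).
Proof.
  destruct (noninteger_generic nu Hnu) as (G1 & G2 & N0). fold N in G1, G2, N0.
  assert (Ra := generic_rGamma N G1). fold ra in Ra.
  pose (H := fun s => Gamma (RtoC 1 - s) * Gamma (N - s) * Gamma (RtoC (1/2) + s) * rGamma (RtoC 1 + N + s) * Cexp (s * l)).
  destruct (entire_rGamma) as [dG HdG].
  assert (Hg1 := proj1 (HdG (RtoC 1) I)). set (g1 := dG (RtoC 1)) in *.
  assert (LD : logder H (RtoC 0) (RtoC (sqrt PI) / N) (lam + RtoC 2 * g / ra + / N)).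
  { apply (logder_near _ (fun s => RtoC (sqrt PI) *
       (rGamma (RtoC 1 + RtoC 1 * s) * (/ rGamma (RtoC 1 + RtoC 2 * s) * / rGamma (RtoC 1 + RtoC (-1) * s))) *
       (/ (N + RtoC (-1) * s) * / rGamma ((N + RtoC 1) + RtoC (-1) * s)) *
       rGamma ((N + RtoC 1) + RtoC 1 * s) * Cexp (s * lam))).
    - eapply logder_eq; [repeat first [apply logder_exp | apply logder_const | apply logder_mult];
       [apply (logder_rGamma _ _ _ (RtoC 1) g1); [ring|exact Hg1|rewrite rGamma_1; apply RtoC_neq_0; lra]
       |apply logder_inv; [apply (logder_rGamma _ _ _ (RtoC 1) g1); [ring|exact Hg1|]|]; rewrite rGamma_1; apply RtoC_neq_0; lra
       |apply logder_inv; [apply (logder_rGamma _ _ _ (RtoC 1) g1); [ring|exact Hg1|]|]; rewrite rGamma_1; apply RtoC_neq_0; lra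
       |apply logder_inv; [apply (logder_affine _ _ _ N); [ring|exact N0]|exact N0]
       |apply logder_inv; [apply (logder_rGamma _ _ _ (N + RtoC 1) g); [ring|exact Hg|exact Ra]|exact Ra]
       |apply (logder_rGamma _ _ _ (N + RtoC 1) g); [ring|exact Hg|exact Ra]]| |].
      + fold ra. rewrite rGamma_1, Cmult_0_l, Cexp_0. field. split; assumption.
      + fold ra. rewrite rGamma_1. field. split; assumption.
    - exists 1%R. split; [lra|]. intros s Hs. unfold strip in Hs. unfold H.
      rewrite Gamma_half_plus by (apply rGamma_neq_0, nonpole_Re; rewrite re_plus; simpl; lra).
      rewrite (Gamma_rec (N - s)). unfold Gamma, lam.
      replace (s * (l - RtoC 2 * RtoC (ln 2))) with (s * l + s * - (RtoC 2 * RtoC (ln 2))) by ring.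
      rewrite Cexp_plus.
      replace (RtoC 1 + RtoC 1 * s) with (s + RtoC 1) by ring. replace (RtoC 1 + RtoC 2 * s) with (RtoC 2 * s + RtoC 1) by ring.
      replace (RtoC 1 + RtoC (-1) * s) with (RtoC 1 - s) by ring. replace (N + RtoC (-1) * s) with (N - s) by ring.
      replace (N + RtoC 1 + RtoC (-1) * s) with (N - s + RtoC 1) by ring.
      replace (N + RtoC 1 + RtoC 1 * s) with (RtoC 1 + N + s) by ring. ring. }
  apply (resdata_intro _ _ _ _ H).
  - unfold H. holnear_split.
    + apply holnear_Gamma_minus, nonpole_Re. simpl; lra.
    + apply holnear_Gamma_minus, noninteger_nonpole. rewrite Rminus_0_r. exact Hnu.
    + apply holnear_Gamma_plus, nonpole_Re. simpl; lra.
    + apply (holnear_rGamma_plus 0 (RtoC 1 + N)).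
  - apply LD.
  - apply LD.
  - exists 1%R. split; [lra|]. intros s _ Hs. unfold phi31, H. rewrite (Gamma_rec (- s)).
    replace (- s + RtoC 1) with (RtoC 1 - s) by ring.
    set (G1' := Gamma _). set (G2' := Gamma _). set (G3 := Gamma _). field. exact Hs.
Qed.

(** As for [phi31]: the factor with argument [1 - 2 s] contributes [-2] and the two with [1 - s]
    contribute [1] each, so the derivative of [rGamma] at 1 cancels again; so do [1 / N] and
    [- 1 / N]. *)
Lemma phi40_residue_0 : resdata (phi40 l N) 0 (- / (RtoC (sqrt PI) * N * N * ra * rb))
  (- / (RtoC (sqrt PI) * N * N * ra * rb) * (lam + g / ra + gm / rb)).
Proof.
  destruct (noninteger_generic nu Hnu) as (G1 & G2 & N0). fold N in G1, G2, N0.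
  assert (Ra := generic_rGamma N G1). fold ra in Ra.
  assert (Rb := generic_rGamma (- N) G2). fold rb in Rb.
  assert (N0' : - N <> RtoC 0) by nz N0.
  assert (NP : RtoC (sqrt PI) <> RtoC 0) by (apply RtoC_neq_0; generalize (sqrt_lt_R0 _ PI_RGT_0); lra).
  pose (H := fun s => Gamma (RtoC 1 - s) * Gamma (N - s) * Gamma (- N - s) * rGamma (RtoC (1/2) - s) * Cexp (s * l)).
  destruct (entire_rGamma) as [dG HdG].
  assert (Hg1 := proj1 (HdG (RtoC 1) I)). set (g1 := dG (RtoC 1)) in *.
  assert (LD : logder H (RtoC 0) (- / (RtoC (sqrt PI) * N * N * ra * rb)) (lam + g / ra + gm / rb)).
  { apply (logder_near _ (fun s => / RtoC (sqrt PI) *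
       (rGamma (RtoC 1 + RtoC (-2) * s) * (/ rGamma (RtoC 1 + RtoC (-1) * s) * / rGamma (RtoC 1 + RtoC (-1) * s))) *
       (/ (N + RtoC (-1) * s) * / rGamma ((N + RtoC 1) + RtoC (-1) * s)) *
       (/ (- N + RtoC (-1) * s) * / rGamma ((- N + RtoC 1) + RtoC (-1) * s)) * Cexp (s * lam))).
    - eapply logder_eq; [repeat first [apply logder_exp | apply logder_const | apply logder_mult];
       [apply (logder_rGamma _ _ _ (RtoC 1) g1); [ring|exact Hg1|rewrite rGamma_1; apply RtoC_neq_0; lra]
       |apply logder_inv; [apply (logder_rGamma _ _ _ (RtoC 1) g1); [ring|exact Hg1|]|]; rewrite rGamma_1; apply RtoC_neq_0; lra
       |apply logder_inv; [apply (logder_rGamma _ _ _ (RtoC 1) g1); [ring|exact Hg1|]|]; rewrite rGamma_1; apply RtoC_neq_0; lra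
       |apply logder_inv; [apply (logder_affine _ _ _ N); [ring|exact N0]|exact N0]
       |apply logder_inv; [apply (logder_rGamma _ _ _ (N + RtoC 1) g); [ring|exact Hg|exact Ra]|exact Ra]
       |apply logder_inv; [apply (logder_affine _ _ _ (- N)); [ring|exact N0']|exact N0']
       |apply logder_inv; [apply (logder_rGamma _ _ _ (- N + RtoC 1) gm); [ring|exact Hgm|exact Rb]|exact Rb]]| |].
      + fold ra rb. rewrite rGamma_1, Cmult_0_l, Cexp_0. field. repeat split; assumption.
      + fold ra rb. rewrite rGamma_1. field. repeat split; assumption.
    - exists 1%R. split; [lra|]. intros s Hs. unfold strip in Hs. unfold H.
      rewrite rGamma_half_minus by (apply rGamma_neq_0, nonpole_Re; unfold Cminus; rewrite re_plus, re_opp; simpl; lra).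
      rewrite (Gamma_rec (N - s)), (Gamma_rec (- N - s)). unfold Gamma, lam.
      replace (s * (l - RtoC 2 * RtoC (ln 2))) with (s * l + s * - (RtoC 2 * RtoC (ln 2))) by ring.
      rewrite Cexp_plus.
      replace (RtoC 1 + RtoC (-2) * s) with (RtoC 1 - RtoC 2 * s) by ring.
      replace (RtoC 1 + RtoC (-1) * s) with (RtoC 1 - s) by ring. replace (N + RtoC (-1) * s) with (N - s) by ring.
      replace (- N + RtoC (-1) * s) with (- N - s) by ring.
      replace (N + RtoC 1 + RtoC (-1) * s) with (N - s + RtoC 1) by ring.
      replace (- N + RtoC 1 + RtoC (-1) * s) with (- N - s + RtoC 1) by ring. ring. }
  apply (resdata_intro _ _ _ _ H).
  - unfold H, N. rewrite <- RtoC_opp. holnear_split.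
    + apply holnear_Gamma_minus, nonpole_Re. simpl; lra.
    + apply holnear_Gamma_minus, noninteger_nonpole. rewrite Rminus_0_r. exact Hnu.
    + apply holnear_Gamma_minus, noninteger_nonpole. rewrite Rminus_0_r.
      replace (- nu)%R with (0 - nu)%R by ring. apply (noninteger_affine nu 0 0 Hnu).
    + apply holnear_rGamma_minus.
  - apply LD.
  - apply LD.
  - exists 1%R. split; [lra|]. intros s _ Hs. unfold phi40, H. rewrite (Gamma_rec (- s)).
    replace (- s + RtoC 1) with (RtoC 1 - s) by ring.
    set (G1' := Gamma _). set (G2' := Gamma _). set (G3 := Gamma _). field. exact Hs.
Qed.

End Base.

(* A simple pole, written as a double one. *)
Lemma resdata_simple F (p : R) v K : holnear p K ->
  (exists d, (0 < d)%R /\ forall s, strip (p - d) (p + d) s -> s <> RtoC p -> F s = K s * / (RtoC p - s)) ->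
  v = RtoC 0 -> resdata F p v (- K (RtoC p)).
Proof.
  intros HK [d [Hd HD]] ->.
  assert (M : forall s, Cder (fun s => RtoC p - s) s (RtoC (-1))).
  { intros s. eapply Cder_eq; [apply Cder_minus; [apply Cder_const|apply Cder_id]|ring]. }
  apply (resdata_intro F p _ _ (fun s => (RtoC p - s) * K s)).
  - apply (holnear_mult p (fun s => RtoC p - s) K); [|exact HK].
    apply holnear_of_entire, hol_minus; [apply hol_const|apply hol_id].
  - ring.
  - destruct HK as [e [He [K' HK]]].
    eapply Cder_eq; [apply (Cder_mult (fun s => RtoC p - s) K _ _ _ (M _) (proj1 (HK (RtoC p) ltac:(unfold strip; simpl; lra))))|ring].
  - exists d. split; [exact Hd|]. intros s Hs Hn. rewrite HD by assumption.
    field. split; [apply Cminus_eq_contra, Hn|apply Cminus_eq_contra, not_eq_sym, Hn].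
Qed.

Section Base2.
Variables (l : C) (nu : R).
Let N := RtoC nu.
Let ra := rGamma (N + RtoC 1).
Let rb := rGamma (- N + RtoC 1).
Let lam := l - RtoC 2 * RtoC (ln 2).
Hypothesis Hnu : noninteger nu.

(** The pole is that of [Gamma (nu - s) = Gamma (nu + 1 - s) / (nu - s)]; duplication simplifies the
    other factors at [nu]. *)
Lemma phi31_residue_nu : (0 < nu)%R -> resdata (phi31 l N) nu (RtoC 0) (- (RtoC (sqrt PI) / (N * N)) * (Cexp (N * lam) * ra / rb)).
Proof.
  intros Hp.
  destruct (noninteger_generic nu Hnu) as (G1 & G2 & N0). fold N in G1, G2, N0.
  assert (Ra := generic_rGamma N G1). fold ra in Ra.
  assert (Rb := generic_rGamma (- N) G2). fold rb in Rb.
  pose (K := fun s => Gamma (- s) * / (- s) * Gamma (N + RtoC 1 - s) * Gamma (RtoC (1/2) + s) * rGamma (RtoC 1 + N + s) * Cexp (s * l)).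
  assert (E : - (RtoC (sqrt PI) / (N * N)) * (Cexp (N * lam) * ra / rb) = - K (RtoC nu)).
  { fold N. unfold K. rewrite Gamma_half_plus by exact Ra. fold ra.
    replace (N + RtoC 1 - N) with (RtoC 1) by ring. unfold Gamma. rewrite rGamma_1.
    rewrite (rGamma_rec (- N)). fold rb. rewrite Cinv_mult.
    replace (RtoC 2 * N + RtoC 1) with (RtoC 1 + N + N) by ring.
    unfold lam. replace (N * (l - RtoC 2 * RtoC (ln 2))) with (N * l + N * - (RtoC 2 * RtoC (ln 2))) by ring.
    rewrite Cexp_plus. set (E1 := Cexp _). set (E2 := Cexp _). field.
    repeat split; try assumption. apply rGamma_neq_0, nonpole_Re. unfold N. rewrite !re_plus. simpl. lra. }
  rewrite E. apply resdata_simple; [| |reflexivity].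
  - unfold K, N. rewrite <- RtoC_plus. holnear_split.
    + apply holnear_Gamma_minus, nonpole_Re; simpl; lra.
    + apply holnear_Gamma_plus, nonpole_Re; simpl; lra.
    + apply holnear_rGamma_plus.
  - exists 1%R. split; [lra|]. intros s _ Hs. unfold phi31, K. rewrite (Gamma_rec (N - s)).
    replace (N - s + RtoC 1) with (N + RtoC 1 - s) by ring. unfold N. ring.
Qed.

(** As [2 nu] is not an integer, [Gamma (- nu - s)] is regular at [s = nu] and the pole is simple.
    No sign of [nu] is imposed, so the lemma serves the class of [- nu] too. *)
Lemma phi40_residue_nu : noninteger (2 * nu) -> resdata (phi40 l N) nu (RtoC 0)
  (Cexp (N * lam) / (RtoC 2 * N * N * N * RtoC (sqrt PI) * rb * rb)).
Proof.
  intros H2.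
  destruct (noninteger_generic nu Hnu) as (G1 & G2 & N0). fold N in G1, G2, N0.
  assert (Rb := generic_rGamma (- N) G2). fold rb in Rb.
  assert (NP : RtoC (sqrt PI) <> RtoC 0) by (apply RtoC_neq_0; generalize (sqrt_lt_R0 _ PI_RGT_0); lra).
  pose (K := fun s => Gamma (- s) * / (- s) * Gamma (N + RtoC 1 - s) * Gamma (- N - s) * rGamma (RtoC (1/2) - s) * Cexp (s * l)).
  assert (E : Cexp (N * lam) / (RtoC 2 * N * N * N * RtoC (sqrt PI) * rb * rb) = - K (RtoC nu)).
  { fold N. unfold K. rewrite rGamma_half_minus by (replace (RtoC 1 - N) with (- N + RtoC 1) by ring; exact Rb).
    replace (RtoC 1 - N) with (- N + RtoC 1) by ring.
    replace (N + RtoC 1 - N) with (RtoC 1) by ring. unfold Gamma. rewrite rGamma_1.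
    rewrite (rGamma_rec (- N)). fold rb. rewrite (rGamma_rec (- N - N)), !Cinv_mult.
    replace (- N - N + RtoC 1) with (RtoC 1 - RtoC 2 * N) by ring.
    unfold lam. replace (N * (l - RtoC 2 * RtoC (ln 2))) with (N * l + N * - (RtoC 2 * RtoC (ln 2))) by ring.
    rewrite Cexp_plus. set (E1 := Cexp _). set (E2 := Cexp _).
    assert (NN : - N - N <> RtoC 0) by (apply (neq_0_eq _ (RtoC (-2) * N)); [apply Cmult_neq_0; [apply RtoC_neq_0; lra|exact N0]|ring]).
    assert (R2 : rGamma (RtoC 1 - RtoC 2 * N) <> RtoC 0).
    { apply rGamma_neq_0. replace (RtoC 1 - RtoC 2 * N) with (RtoC (1 - 2 * nu)) by (rewrite RtoC_minus, RtoC_mult; reflexivity).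
      apply noninteger_nonpole. apply (noninteger_affine (2 * nu) 1 0 H2). }
    field. repeat split; assumption. }
  rewrite E. apply resdata_simple; [| |reflexivity].
  - unfold K, N. rewrite <- RtoC_plus, <- RtoC_opp. holnear_split.
    + apply holnear_Gamma_minus, nonpole_Re; simpl; lra.
    + apply holnear_Gamma_minus, noninteger_nonpole. replace (- nu - nu)%R with (- (2 * nu))%R by ring. apply noninteger_opp, H2.
    + apply holnear_rGamma_minus.
  - exists 1%R. split; [lra|]. intros s _ Hs. unfold phi40, K. rewrite (Gamma_rec (N - s)).
    replace (N - s + RtoC 1) with (N + RtoC 1 - s) by ring. unfold N. ring.
Qed.
End Base2.

(** * Residues along the classes of poles, propagated by the functional equation *)

Lemma fscale_0 x a : fscale x a 0 = a 0%nat.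
Proof. unfold fscale. simpl. ring. Qed.

Section Classes.
Variables (l x : C) (nu : R).
Let N := RtoC nu.
Hypothesis Hx : Cexp l = RtoC 4 * x.
Hypothesis H2nu : noninteger (2 * nu).

Definition shiftable (F : C -> C) : Prop := forall s, s <> RtoC 0 -> s + RtoC 1 <> RtoC 0 ->
  s + RtoC 1 - N <> RtoC 0 -> s + RtoC 1 + N <> RtoC 0 -> s + RtoC (1/2) <> RtoC 0 ->
  F (s + RtoC 1) = ratio l N s * F s.

(** Points from which a residue can be carried to [p + 1]. The point [p = 0] is among them: the
    functional equation is used only at [s <> p]. *)
Definition step_point (p : R) : Prop :=
  (p + 1 <> 0 /\ p + 1 - nu <> 0 /\ p + 1 + nu <> 0 /\ p + 1/2 <> 0)%R.

Lemma step_point_near p : step_point p -> exists d, (0 < d)%R /\ forall s, strip (p - d) (p + d) s ->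
  ((s <> RtoC p -> s <> RtoC 0) /\ s + RtoC 1 <> RtoC 0 /\ s + RtoC 1 - N <> RtoC 0 /\ s + RtoC 1 + N <> RtoC 0 /\ s + RtoC (1/2) <> RtoC 0).
Proof.
  intros (h1 & h2 & h3 & h4).
  assert (Z : exists d0, (0 < d0)%R /\ forall s, strip (p - d0) (p + d0) s -> s <> RtoC p -> s <> RtoC 0).
  { destruct (Req_dec p 0) as [E|E].
    - exists 1%R. split; [lra|]. intros s _ Hs; rewrite E in Hs; exact Hs.
    - exists (Rabs p). split; [apply Rabs_pos_lt, E|]. intros s Hs _ X. unfold strip in Hs. rewrite X in Hs. simpl in Hs.
      unfold Rabs in Hs. destruct (Rcase_abs p); lra. }
  destruct Z as (d0 & Hd0 & Z).
  exists (Rmin d0 (Rmin (Rmin (Rabs (p + 1)) (Rabs (p + 1 - nu))) (Rmin (Rabs (p + 1 + nu)) (Rabs (p + 1/2))))).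
  set (m1 := Rmin (Rabs (p + 1)) (Rabs (p + 1 - nu))). set (m2 := Rmin (Rabs (p + 1 + nu)) (Rabs (p + 1/2))).
  assert (b1 := Rmin_l d0 (Rmin m1 m2)). assert (b2 := Rmin_r d0 (Rmin m1 m2)).
  assert (b3 := Rmin_l m1 m2). assert (b4 := Rmin_r m1 m2).
  assert (b5 : (m1 <= Rabs (p + 1))%R) by apply Rmin_l. assert (b6 : (m1 <= Rabs (p + 1 - nu))%R) by apply Rmin_r.
  assert (b7 : (m2 <= Rabs (p + 1 + nu))%R) by apply Rmin_l. assert (b8 : (m2 <= Rabs (p + 1/2))%R) by apply Rmin_r.
  split; [repeat apply Rmin_pos; try (apply Rabs_pos_lt; assumption); exact Hd0|].
  intros s Hs. set (d := Rmin d0 (Rmin m1 m2)) in *.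
  assert (A : forall c, (d <= Rabs (p + c))%R -> s + RtoC c <> RtoC 0).
  { intros c Hc X. apply (f_equal Re) in X. rewrite re_plus in X. simpl in X. unfold strip in Hs.
    unfold Rabs in Hc. destruct (Rcase_abs (p + c)); lra. }
  split; [apply Z; unfold strip in *; lra|].
  split; [apply A; lra|]. split; [|split; [|apply A; lra]].
  - replace (s + RtoC 1 - N) with (s + RtoC (1 - nu)) by (unfold N; rewrite RtoC_minus; ring).
    apply A. replace (p + (1 - nu))%R with (p + 1 - nu)%R by ring. lra.
  - replace (s + RtoC 1 + N) with (s + RtoC (1 + nu)) by (unfold N; rewrite RtoC_plus; ring).
    apply A. replace (p + (1 + nu))%R with (p + 1 + nu)%R by ring. lra.
Qed.

Lemma hol_strip_der p f : holnear p f -> exists d, Cder f (RtoC p) d.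
Proof.
  intros [d [Hd [f' H]]]. exists (f' (RtoC p)). apply H. unfold strip; simpl; lra.
Qed.

Lemma holnear_inv_denominator p : step_point p -> holnear p (fun s =>
  / ((s + RtoC 1) * (s + RtoC 1) * (s + RtoC 1 - N) * (s + RtoC 1 + N))).
Proof.
  intros Hp.
  assert (E : forall c, entire (fun s => s + c)) by (intros; apply hol_plus; [apply hol_id|apply hol_const]).
  apply holnear_inv.
  - apply holnear_of_entire. repeat apply hol_mult; try apply E.
    + apply hol_minus; [apply E|apply hol_const].
    + apply hol_plus; [apply E|apply hol_const].
  - destruct (step_point_near p Hp) as (d & Hd & D). exists d. split; [exact Hd|].
    intros s Hs. destruct (D s Hs) as (_ & a2 & a3 & a4 & _). repeat apply Cmult_neq_0; assumption.
Qed.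

Lemma holnear_ratio p : step_point p -> holnear p (ratio l N).
Proof.
  intros Hp. unfold ratio. apply holnear_mult; [|apply holnear_inv_denominator, Hp].
  apply holnear_of_entire, hol_mult; [apply hol_mult; [apply hol_const|apply hol_id]|].
  apply hol_plus; [apply hol_id|apply hol_const].
Qed.

Lemma resdata_step F p v r R' : shiftable F -> step_point p -> resdata F p v r -> Cder (ratio l N) (RtoC p) R' ->
  resdata F (p + 1) (ratio l N (RtoC p) * v) (R' * v + ratio l N (RtoC p) * r).
Proof.
  intros HF Hp Hr HR. apply resdata_shift; [exact Hr|apply holnear_ratio, Hp|exact HR|].
  destruct (step_point_near p Hp) as (d & Hd & D). exists d. split; [exact Hd|].
  intros s Hs Hn. destruct (D s Hs) as (a1 & a2 & a3 & a4 & a5). apply HF; try assumption. apply a1, Hn.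
Qed.

Lemma resdata_step_simple F p r : shiftable F -> step_point p -> resdata F p (RtoC 0) r ->
  resdata F (p + 1) (RtoC 0) (ratio l N (RtoC p) * r).
Proof.
  intros HF Hp Hr. destruct (hol_strip_der p _ (holnear_ratio p Hp)) as [R' HR].
  assert (X := resdata_step F p _ _ _ HF Hp Hr HR).
  replace (ratio l N (RtoC p) * RtoC 0) with (RtoC 0) in X by ring.
  replace (R' * RtoC 0 + ratio l N (RtoC p) * r) with (ratio l N (RtoC p) * r) in X by ring. exact X.
Qed.

Lemma ratio_0 : ratio l N (RtoC 0) = RtoC 0.
Proof. unfold ratio. ring. Qed.

Lemma noninteger_nu : noninteger nu.
Proof. apply noninteger_double, H2nu. Qed.

Lemma step_point_0 (k : nat) : step_point (INR k).
Proof.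
  assert (P := pos_INR k). assert (H := noninteger_nu). repeat split; try lra.
  - intros E. apply (H (Z.of_nat (S k))). rewrite <- INR_IZR_INZ, S_INR. lra.
  - intros E. apply (H (- Z.of_nat (S k))%Z). rewrite opp_IZR, <- INR_IZR_INZ, S_INR. lra.
Qed.

Lemma step_point_nu (q : R) (k : nat) : q = nu \/ q = (- nu)%R -> step_point (q + INR k).
Proof.
  assert (H := noninteger_nu).
  intros Hq.
  assert (X : forall z : Z, (2 * q)%R <> IZR z).
  { intros z E. destruct Hq as [->| ->]; [apply (H2nu z); lra|apply (H2nu (- z)%Z); rewrite opp_IZR; lra]. }
  assert (Y : forall z : Z, q <> IZR z).
  { intros z E. apply (X (2 * z)%Z). rewrite mult_IZR, E. reflexivity. }
  assert (P := pos_INR k). rewrite INR_IZR_INZ in *. repeat split; intros E.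
  - apply (Y (- Z.of_nat k - 1)%Z). rewrite minus_IZR, opp_IZR. lra.
  - destruct Hq as [->| ->]; [lra|]. apply (X (- Z.of_nat k - 1)%Z). rewrite minus_IZR, opp_IZR. lra.
  - destruct Hq as [->| ->]; [|lra]. apply (X (- Z.of_nat k - 1)%Z). rewrite minus_IZR, opp_IZR. lra.
  - apply (X (- 2 * Z.of_nat k - 1)%Z). rewrite minus_IZR, mult_IZR. lra.
Qed.

Lemma Cder_ratio_0 : Cder (ratio l N) (RtoC 0) (RtoC 2 * x / (RtoC 1 - N * N)).
Proof.
  destruct (noninteger_generic nu noninteger_nu) as (G1 & G2 & N0). fold N in G1, G2, N0.
  assert (A1 := G1 0%nat). assert (A2 := G2 0%nat). simpl in A1, A2.
  pose (G := fun s => (s + RtoC (1/2)) * / ((s + RtoC 1) * (s + RtoC 1) * (s + RtoC 1 - N) * (s + RtoC 1 + N))).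
  assert (HG : holnear 0 G).
  { apply holnear_mult; [|apply (holnear_inv_denominator 0), (step_point_0 0)].
    apply holnear_of_entire, hol_plus; [apply hol_id|apply hol_const]. }
  destruct (hol_strip_der 0 G HG) as [G' HG'].
  apply (Cder_ext (fun s => (Cexp l * s) * G s)); [intros s; unfold G, ratio; ring|].
  eapply Cder_eq; [apply (Cder_mult (fun s => Cexp l * s) G); [apply Cder_scal, Cder_id|exact HG']|].
  unfold G. rewrite Hx, RtoC_div by lra. field.
  assert (A3 : (N + RtoC 1) * (- N + RtoC 1) <> RtoC 0) by (apply Cmult_neq_0; assumption).
  repeat split; first [nz N0|nz A1|nz A2|nz A3|apply RtoC_neq_0; lra].
Qed.

(** The recurrence of the product series, with [4 (k + 1) - 2 = 4 (k + 1/2)]; the divisions by [2 k]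
    in [coefM] account for the factor [s] and one factor [s + 1] of the ratio. *)
Lemma coefM_step (k : nat) : ratio l N (RtoC (INR (S k))) * coefM N (S k) = x * coefM N (S (S k)).
Proof.
  destruct (noninteger_generic nu noninteger_nu) as (G1 & G2 & N0). fold N in G1, G2, N0.
  assert (A1 := G1 (S k)). assert (A2 := G2 (S k)).
  assert (B := bes_product_rec N (S k) G1 G2). cbv zeta in B.
  assert (K1 := INR_S_neq_0 k). assert (K2 := INR_S_neq_0 (S k)).
  unfold coefM. set (w := (bes N * bes (- N))%fps) in *.
  unfold ratio. rewrite Hx.
  rewrite S_INR, RtoC_plus in A1, A2, B, K2. rewrite (S_INR (S k)), RtoC_plus.
  set (n := RtoC (INR (S k))) in *.
  assert (E : w (S (S k)) = (RtoC 4 * (n + RtoC 1) - RtoC 2) * w (S k) / ((n + RtoC 1) * ((n + RtoC 1) * (n + RtoC 1) - N * N))).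
  { rewrite <- B. field.
    assert (A3 : (N + (n + RtoC 1)) * (- N + (n + RtoC 1)) <> RtoC 0) by (apply Cmult_neq_0; assumption).
    split; first [nz K2|nz A3]. }
  rewrite E, RtoC_div by lra. field.
  assert (A3 : (N + (n + RtoC 1)) * (- N + (n + RtoC 1)) <> RtoC 0) by (apply Cmult_neq_0; assumption).
  repeat split; first [nz K1|nz K2|nz A1|nz A2|nz A3|apply RtoC_neq_0; lra].
Qed.

(** Since the ratio vanishes at 0, the pole at 1 is simple and its residue is the derivative of the
    ratio times [v]; the residue [r] at 0 does not propagate. From 1 on, ratio and coefficients
    advance together. *)
Lemma residues_class_0 F v r : shiftable F -> resdata F 0 v r ->
  forall k, resdata F (INR (S k)) (RtoC 0) (RtoC 2 * v * fscale x (coefM N) (S k)).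
Proof.
  intros HF Hr k. induction k as [|k IH].
  - assert (X := resdata_step F 0 v r _ HF (step_point_0 0) Hr Cder_ratio_0).
    rewrite ratio_0 in X. replace (0 + 1)%R with (INR 1) in X by (simpl; ring).
    replace (RtoC 0 * v) with (RtoC 0) in X by ring.
    replace (RtoC 2 * v * fscale x (coefM N) 1) with (RtoC 2 * x / (RtoC 1 - N * N) * v + RtoC 0 * r); [exact X|].
    destruct (noninteger_generic nu noninteger_nu) as (G1 & G2 & N0). fold N in G1, G2, N0.
    assert (A1 := G1 0%nat). assert (A2 := G2 0%nat).
    assert (B := bes_product_rec N 0 G1 G2). cbv zeta in B. simpl in A1, A2.
    assert (W0 : (bes N * bes (- N))%fps 0%nat = RtoC 1) by (unfold conv; cbn [conv_aux]; rewrite !bes_0; ring).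
    rewrite W0 in B. change (INR 1) with 1%R in B.
    unfold fscale, coefM. change (INR 1) with 1%R.
    set (w := (bes N * bes (- N))%fps 1%nat) in *. simpl.
    assert (A3 : (N + RtoC 1) * (- N + RtoC 1) <> RtoC 0) by (apply Cmult_neq_0; assumption).
    assert (E : w = RtoC 2 / (RtoC 1 - N * N)).
    { replace (RtoC 2) with (RtoC 4 * RtoC 1 - RtoC 2 * RtoC 1) by ring.
      replace (RtoC 4 * RtoC 1 - RtoC 2 * RtoC 1) with ((RtoC 4 * RtoC 1 - RtoC 2) * RtoC 1) by ring.
      rewrite <- B. field. nz A3. }
    rewrite E. field. repeat split; first [nz A3|apply RtoC_neq_0; lra].
  - assert (X := resdata_step_simple F _ _ HF (step_point_0 (S k)) IH).
    rewrite <- S_INR in X.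
    replace (RtoC 2 * v * fscale x (coefM N) (S (S k))) with (ratio l N (RtoC (INR (S k))) * (RtoC 2 * v * fscale x (coefM N) (S k))); [exact X|].
    unfold fscale. change (x ^ S (S k)) with (x * x ^ S k).
    replace (ratio l N (RtoC (INR (S k))) * (RtoC 2 * v * (coefM N (S k) * x ^ S k)))
      with (RtoC 2 * v * (ratio l N (RtoC (INR (S k))) * coefM N (S k)) * x ^ S k) by ring.
    rewrite coefM_step. ring.
Qed.

(** The ratio is even in [nu], so one computation with the recurrence of the square series serves
    both classes. *)
Lemma coefP_step (q : R) (k : nat) : q = nu \/ q = (- nu)%R ->
  ratio l N (RtoC (q + INR k)) * coefP (RtoC q) k = x * coefP (RtoC q) (S k).
Proof.
  intros Hq.
  assert (EN : forall s, ratio l N s = ratio l (RtoC q) s).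
  { intros s. destruct Hq as [->| ->]; [reflexivity|]. rewrite RtoC_opp. unfold ratio. fold N. f_equal. f_equal. ring. }
  rewrite EN.
  assert (Hn : noninteger q) by (destruct Hq as [->| ->]; [exact noninteger_nu|apply noninteger_opp, noninteger_nu]).
  assert (H2 : noninteger (2 * q)).
  { destruct Hq as [->| ->]; [exact H2nu|]. replace (2 * - nu)%R with (- (2 * nu))%R by ring. apply noninteger_opp, H2nu. }
  destruct (noninteger_generic q Hn) as (G1 & _ & N0). destruct (noninteger_generic (2 * q) H2) as (G3 & _ & _).
  assert (A1 := G1 k). assert (A3 := G3 k). assert (K := INR_S_neq_0 k).
  assert (A0 : RtoC q + RtoC (INR k) <> RtoC 0).
  { destruct k; [simpl; replace (RtoC q + RtoC 0) with (RtoC q) by ring; exact N0|apply G1]. }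
  assert (B := bes_square_rec (RtoC q) k G1). cbv zeta in B.
  unfold coefP. set (w := (bes (RtoC q) * bes (RtoC q))%fps) in *.
  unfold ratio. rewrite Hx, RtoC_plus. rewrite RtoC_mult in A3.
  rewrite S_INR, RtoC_plus in A1, A3, B, K. rewrite S_INR, RtoC_plus.
  set (n := RtoC (INR k)) in *. set (Q := RtoC q) in *.
  assert (E : w (S k) = (RtoC 4 * (n + RtoC 1) - RtoC 2 + RtoC 4 * Q) * w k / ((n + RtoC 1) * (n + RtoC 1 + Q) * (n + RtoC 1 + RtoC 2 * Q))).
  { rewrite <- B. field. repeat split; first [nz K|nz A1|nz A3]. }
  rewrite E, RtoC_div by lra. field.
  repeat split; first [nz K|nz A0|nz A1|nz A3|apply RtoC_neq_0; lra].
Qed.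

Lemma residues_class_nu F (q : R) r : q = nu \/ q = (- nu)%R -> shiftable F -> resdata F q (RtoC 0) r ->
  forall k, resdata F (q + INR k) (RtoC 0) (RtoC 2 * RtoC q * r * fscale x (coefP (RtoC q)) k).
Proof.
  intros Hq HF Hr k. induction k as [|k IH].
  - simpl. rewrite Rplus_0_r. rewrite fscale_0. unfold coefP, conv. cbn [conv_aux]. rewrite bes_0. simpl.
    assert (Hn : noninteger q) by (destruct Hq as [->| ->]; [exact noninteger_nu|apply noninteger_opp, noninteger_nu]).
    destruct (noninteger_generic q Hn) as (_ & _ & N0).
    replace (RtoC 2 * RtoC q * r * (RtoC 1 * RtoC 1 / (RtoC 2 * (RtoC q + RtoC 0)))) with r; [exact Hr|].
    rewrite Cplus_0_r. field. exact N0.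
  - assert (X := resdata_step_simple F _ _ HF (step_point_nu q k Hq) IH).
    replace (q + INR (S k))%R with (q + INR k + 1)%R by (rewrite S_INR; ring).
    replace (RtoC 2 * RtoC q * r * fscale x (coefP (RtoC q)) (S k)) with
      (ratio l N (RtoC (q + INR k)) * (RtoC 2 * RtoC q * r * fscale x (coefP (RtoC q)) k)); [exact X|].
    unfold fscale. change (x ^ S k) with (x * x ^ k).
    replace (ratio l N (RtoC (q + INR k)) * (RtoC 2 * RtoC q * r * (coefP (RtoC q) k * x ^ k)))
      with (RtoC 2 * RtoC q * r * (ratio l N (RtoC (q + INR k)) * coefP (RtoC q) k) * x ^ k) by ring.
    rewrite coefP_step by exact Hq. ring.
Qed.

(** [loopI_residues] takes the residues as a function on all reals; choice provides one, and
    uniqueness identifies it at each known pole. *)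
Definition residue (F : C -> C) (p : R) : C := epsilon (inhabits (RtoC 0)) (fun r => exists v, resdata F p v r).

Lemma residue_eq F p v r : resdata F p v r -> residue F p = r.
Proof.
  intros H. destruct (epsilon_spec (inhabits (RtoC 0)) (fun r => exists v, resdata F p v r)) as [v' H'].
  - exists r, v. exact H.
  - exact (resdata_unique _ _ _ _ _ _ H' H).
Qed.

(** Only the term at 0 departs from the pattern [2 v coefM]: that pattern would give [v / N] there
    in place of [r], hence the correction. *)
Lemma residue_sum_0 F v r M : shiftable F -> resdata F 0 v r -> is_Csum (fscale x (coefM N)) M ->
  is_Csum (fun k => residue F (0 + INR k)) (RtoC 2 * v * M + (r - v / N)).
Proof.
  intros HF Hr HM.
  destruct (noninteger_generic nu noninteger_nu) as (G1 & G2 & N0). fold N in G1, G2, N0.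
  apply (is_Csum_ext (fun k => RtoC 2 * v * fscale x (coefM N) k + fconst (r - v / N) k)).
  - intros k. rewrite Rplus_0_l. symmetry. destruct k.
    + rewrite (residue_eq _ _ v r) by exact Hr. rewrite fscale_0. simpl. field. exact N0.
    + rewrite (residue_eq _ _ _ _ (residues_class_0 F v r HF Hr k)). simpl. ring.
  - apply is_Csum_plus; [apply is_Csum_scal, HM|apply is_Csum_const].
Qed.

Lemma residue_sum_nu F (q : R) r P : q = nu \/ q = (- nu)%R -> shiftable F -> resdata F q (RtoC 0) r ->
  is_Csum (fscale x (coefP (RtoC q))) P -> is_Csum (fun k => residue F (q + INR k)) (RtoC 2 * RtoC q * r * P).
Proof.
  intros Hq HF Hr HP.
  apply (is_Csum_ext (fun k => RtoC 2 * RtoC q * r * fscale x (coefP (RtoC q)) k)); [|apply is_Csum_scal, HP].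
  intros k. symmetry. apply (residue_eq _ _ (RtoC 0)). apply residues_class_nu; assumption.
Qed.

End Classes.

Lemma shiftable_phi31 l nu : shiftable l nu (phi31 l (RtoC nu)).
Proof. intros s H0 H1 H2 H3 H4. apply phi31_shift; assumption. Qed.

Lemma shiftable_phi40 l nu : shiftable l nu (phi40 l (RtoC nu)).
Proof. intros s H0 H1 H2 H3 H4. apply phi40_shift; assumption. Qed.

(** The differences between [0], [nu] and [- nu] are [nu] and [2 nu] up to sign; none of them is an
    integer. *)
Lemma pole_offset_unique (nu q q' : R) (k k' : nat) : noninteger (2 * nu) ->
  q = 0%R \/ q = nu \/ q = (- nu)%R -> q' = 0%R \/ q' = nu \/ q' = (- nu)%R ->
  (q + INR k = q' + INR k')%R -> q = q'.
Proof.
  intros H Hq Hq' E. assert (H1 := noninteger_double nu H). rewrite !INR_IZR_INZ in E.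
  set (z := Z.of_nat k) in *. set (z' := Z.of_nat k') in *.
  destruct Hq as [->|[->| ->]], Hq' as [->|[->| ->]]; try reflexivity; exfalso.
  - apply (H1 (z - z')%Z); rewrite minus_IZR; lra.
  - apply (H1 (z' - z)%Z); rewrite minus_IZR; lra.
  - apply (H1 (z' - z)%Z); rewrite minus_IZR; lra.
  - apply (H (z' - z)%Z); rewrite minus_IZR; lra.
  - apply (H1 (z - z')%Z); rewrite minus_IZR; lra.
  - apply (H (z - z')%Z); rewrite minus_IZR; lra.
Qed.

Lemma resdata_residue F p v r : resdata F p v r -> exists (d : R) (H : C -> C), (0 < d)%R /\
  hol (strip (p - d) (p + d)) H /\ Cder H (RtoC p) (residue F p) /\
  forall s, strip (p - d) (p + d) s -> s <> RtoC p -> F s = H s * / ((s - RtoC p) * (s - RtoC p)).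
Proof.
  intros Hr. rewrite (residue_eq _ _ _ _ Hr). destruct Hr as (d & H & Hd & HH & _ & Hc & HE).
  exists d, H. repeat split; assumption.
Qed.

Lemma nonpole_minus (q : R) (s : C) : (forall k : nat, s <> RtoC (q + INR k)) -> nonpole (RtoC q - s).
Proof.
  intros H k E. apply (H k). rewrite RtoC_plus.
  replace s with (RtoC q - (RtoC q - s)) by ring. rewrite E. ring.
Qed.

(** * Values of the two loop integrals when [2 nu] is not an integer *)

Section Values.
Variables (l L x M P Q g gm : C) (nu c h : R).
Let N := RtoC nu.
Let ra := rGamma (N + RtoC 1).
Let rb := rGamma (- N + RtoC 1).
Let a := Cexp (N * L) * ra.
Let b := Cexp (- N * L) * rb.
Hypothesis Hl : l = RtoC 2 * L + RtoC 2 * RtoC (ln 2).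
Hypothesis Hx : Cexp l = RtoC 4 * x.
Hypothesis Hnu : (0 < nu)%R.
Hypothesis H2nu : noninteger (2 * nu).
Hypothesis Hh : (0 < h)%R.
Hypothesis HM : is_Csum (fscale x (coefM N)) M.
Hypothesis HP : is_Csum (fscale x (coefP N)) P.
Hypothesis HQ : is_Csum (fscale x (coefP (- N))) Q.
Hypothesis Hg : Cder rGamma (N + RtoC 1) g.
Hypothesis Hgm : Cder rGamma (- N + RtoC 1) gm.

Let Hn : noninteger nu := noninteger_double nu H2nu.

Let SPi : RtoC (sqrt PI) <> RtoC 0.
Proof. apply RtoC_neq_0. generalize (sqrt_lt_R0 _ PI_RGT_0). lra. Qed.

Let Lam : l - RtoC 2 * RtoC (ln 2) = RtoC 2 * L.
Proof. rewrite Hl. ring. Qed.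

Let E2 : Cexp (N * (RtoC 2 * L)) = Cexp (N * L) * Cexp (N * L).
Proof. rewrite <- Cexp_plus. f_equal. ring. Qed.

(** To the right of [c] the only poles are the classes of [0] and [nu]: the parameter [- nu] enters
    through the entire [rGamma], and the poles of [Gamma (1/2 + s)] start at [-1/2]. *)
Lemma loopI_phi31 : (-1/2 < c < 0)%R -> loopI (phi31 l N) c h = RtoC 2 * RtoC PI * Ci *
  (RtoC (sqrt PI) * (- (RtoC 2 / N) * (L + g / ra + M - a / b * P))).
Proof.
  intros Hc.
  destruct (noninteger_generic nu Hn) as (G1 & G2 & N0). fold N in G1, G2, N0.
  assert (Ra := generic_rGamma N G1). fold ra in Ra. assert (Rb := generic_rGamma (- N) G2). fold rb in Rb.
  assert (D0 := phi31_residue_0 l nu g Hn Hg). assert (D1 := phi31_residue_nu l nu Hn Hnu). fold N in D0, D1. fold ra in D0, D1. fold rb in D1.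
  rewrite Lam in D0, D1.
  (* Sums of the residues over the classes of [0] and [nu]. The term [/ N] in the residue at 0
     cancels against the correction from [residue_sum_0]. *)
  pose (sigma := fun q => if Req_EM_T q 0 then
     RtoC 2 * (RtoC (sqrt PI) / N) * M + (RtoC (sqrt PI) / N * (RtoC 2 * L + RtoC 2 * g / ra + / N) - RtoC (sqrt PI) / N / N)
     else RtoC 2 * N * (- (RtoC (sqrt PI) / (N * N)) * (Cexp (N * (RtoC 2 * L)) * ra / rb)) * P).
  rewrite (loopI_residues (phi31 l N) (-1/2) c h (nu + 3 * Cmod (Cexp l) + 1) [0%R; nu] (residue (phi31 l N)) sigma).
  - cbn [csig]. unfold sigma. destruct (Req_EM_T 0 0) as [_|X]; [|exfalso; lra].
    destruct (Req_EM_T nu 0) as [X|_]; [exfalso; lra|].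
    unfold a, b. rewrite E2, RtoC_mult. replace (- N * L) with (- (N * L)) by ring. rewrite Cexp_opp.
    assert (EN := Cexp_neq_0 (N * L)). set (e := Cexp (N * L)) in *. field. repeat split; assumption.
  - exact Hh.
  - lra.
  - unfold phi31.
    assert (PN : forall q s, In q [0%R; nu] -> ((-1/2 < Re s)%R /\
      forall p, (exists (q : R) (k : nat), In q [0%R; nu] /\ p = (q + INR k)%R) -> s <> RtoC p) -> nonpole (RtoC q - s)).
    { intros q s Hq [_ Hs]. apply nonpole_minus. intros k. apply Hs. exists q, k. split; [exact Hq|reflexivity]. }
    assert (PN0 : forall s, ((-1/2 < Re s)%R /\
      forall p, (exists (q : R) (k : nat), In q [0%R; nu] /\ p = (q + INR k)%R) -> s <> RtoC p) -> nonpole (- s)).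
    { intros s Hs. replace (- s) with (RtoC 0 - s) by ring. apply PN; [left; reflexivity|exact Hs]. }
    apply hol_mult; [apply hol_mult; [apply hol_mult; [apply hol_mult; [apply hol_mult|]|]|]|].
    + apply hol_Gamma; [apply hol_opp, hol_id|exact PN0].
    + apply hol_inv; [apply hol_opp, hol_id|]. intros s Hs. apply nonpole_neq_0, PN0, Hs.
    + apply hol_Gamma; [apply hol_minus; [apply hol_const|apply hol_id]|]. intros s Hs. apply PN; [right; left; reflexivity|exact Hs].
    + apply hol_Gamma; [apply hol_plus; [apply hol_const|apply hol_id]|]. intros s [Hs _]. apply nonpole_Re. rewrite re_plus. simpl. lra.
    + apply hol_rGamma, hol_plus; [apply hol_const|apply hol_id].
    + apply hol_exp, hol_mult; [apply hol_id|apply hol_const].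
  - apply phi31_decay; lra.
  - repeat constructor; simpl; intuition lra.
  - intros q [<-|[<-|[]]]; lra.
  - intros q q' k k' Hq Hq'. apply (pole_offset_unique nu); [exact H2nu| |];
     [destruct Hq as [<-|[<-|[]]]|destruct Hq' as [<-|[<-|[]]]]; tauto.
  - intros p (q & k & Hq & ->) _. destruct Hq as [<-|[<-|[]]].
    + rewrite Rplus_0_l. destruct k.
      * eapply resdata_residue. exact D0.
      * eapply resdata_residue. eapply (residues_class_0 l x nu Hx H2nu); [apply shiftable_phi31|exact D0].
    + eapply resdata_residue. eapply (residues_class_nu l x nu Hx H2nu); [left; reflexivity|apply shiftable_phi31|exact D1].
  - intros q [<-|[<-|[]]]; unfold sigma.
    + destruct (Req_EM_T 0 0) as [_|X]; [|exfalso; lra].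
      apply (residue_sum_0 l x nu Hx H2nu); [apply shiftable_phi31|exact D0|exact HM].
    + destruct (Req_EM_T nu 0) as [X|_]; [exfalso; lra|].
      apply (residue_sum_nu l x nu Hx H2nu); [left; reflexivity|apply shiftable_phi31|exact D1|exact HP].
Qed.

(** Three classes of poles now lie inside; those of [nu] and [- nu] produce the series [P] and [Q],
    and the class of [0] produces [2 M] and the logarithmic terms. *)
Lemma loopI_phi40 : (c < - nu)%R -> loopI (phi40 l N) c h = RtoC 2 * RtoC PI * Ci *
  (/ RtoC (sqrt PI) * (RtoC 2 * / (RtoC 2 * N * ra * rb) / N *
    (RtoC 2 * L + g / ra + gm / rb + RtoC 2 * M - / N - a / b * P - b / a * Q))).
Proof.
  intros Hc.
  destruct (noninteger_generic nu Hn) as (G1 & G2 & N0). fold N in G1, G2, N0.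
  assert (Ra := generic_rGamma N G1). fold ra in Ra. assert (Rb := generic_rGamma (- N) G2). fold rb in Rb.
  assert (D0 := phi40_residue_0 l nu g gm Hn Hg Hgm). assert (D1 := phi40_residue_nu l nu Hn H2nu).
  (* The integrand is even in [nu], so the residue at [- nu] is the one at [nu] for the opposite
     order. *)
  assert (D2 := phi40_residue_nu l (- nu) (noninteger_opp nu Hn)).
  replace (2 * - nu)%R with (- (2 * nu))%R in D2 by ring. specialize (D2 (noninteger_opp _ H2nu)).
  replace (phi40 l (RtoC (- nu))) with (phi40 l N) in D2
    by (apply functional_extensionality; intros s; rewrite RtoC_opp; symmetry; apply phi40_even).
  fold N in D0, D1. fold ra in D0. fold rb in D0, D1.
  rewrite Lam in D0, D1, D2.
  set (v0 := - / (RtoC (sqrt PI) * N * N * ra * rb)) in *.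
  set (r1 := _ / _) in D1. set (r2 := _ / _) in D2.
  assert (R2 : r2 = / (Cexp (N * L) * Cexp (N * L)) / (- RtoC 2 * N * N * N * RtoC (sqrt PI) * ra * ra)).
  { unfold r2. rewrite RtoC_opp. fold N. replace (- - N + RtoC 1) with (N + RtoC 1) by ring. fold ra.
    replace (- N * (RtoC 2 * L)) with (- (N * (RtoC 2 * L))) by ring. rewrite Cexp_opp, E2.
    assert (EN := Cexp_neq_0 (N * L)). set (e := Cexp (N * L)) in *. field. repeat split; assumption. }
  pose (sigma := fun q => if Req_EM_T q 0 then RtoC 2 * v0 * M + (v0 * (RtoC 2 * L + g / ra + gm / rb) - v0 / N)
     else if Req_EM_T q nu then RtoC 2 * N * r1 * P else RtoC 2 * RtoC (- nu) * r2 * Q).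
  rewrite (loopI_residues (phi40 l N) (c - 1) c h (nu + 3 * Cmod (Cexp l) + 1) [0%R; nu; (- nu)%R] (residue (phi40 l N)) sigma).
  - cbn [csig]. unfold sigma. destruct (Req_EM_T 0 0) as [_|X]; [|exfalso; lra].
    destruct (Req_EM_T nu 0) as [X|_]; [exfalso; lra|].
    destruct (Req_EM_T (- nu) 0) as [X|_]; [exfalso; lra|].
    destruct (Req_EM_T nu nu) as [_|X]; [|exfalso; lra].
    destruct (Req_EM_T (- nu) nu) as [X|_]; [exfalso; lra|].
    rewrite R2. unfold r1, v0, a, b. rewrite E2, RtoC_mult, RtoC_opp. fold N.
    replace (- N * L) with (- (N * L)) by ring. rewrite Cexp_opp.
    assert (EN := Cexp_neq_0 (N * L)). set (e := Cexp (N * L)) in *. field. repeat split; assumption.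
  - exact Hh.
  - lra.
  - unfold phi40.
    assert (PN : forall q s, In q [0%R; nu; (- nu)%R] -> ((c - 1 < Re s)%R /\
      forall p, (exists (q : R) (k : nat), In q [0%R; nu; (- nu)%R] /\ p = (q + INR k)%R) -> s <> RtoC p) -> nonpole (RtoC q - s)).
    { intros q s Hq [_ Hs]. apply nonpole_minus. intros k. apply Hs. exists q, k. split; [exact Hq|reflexivity]. }
    assert (PN0 : forall s, ((c - 1 < Re s)%R /\
      forall p, (exists (q : R) (k : nat), In q [0%R; nu; (- nu)%R] /\ p = (q + INR k)%R) -> s <> RtoC p) -> nonpole (- s)).
    { intros s Hs. replace (- s) with (RtoC 0 - s) by ring. apply PN; [left; reflexivity|exact Hs]. }
    apply hol_mult; [apply hol_mult; [apply hol_mult; [apply hol_mult; [apply hol_mult|]|]|]|].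
    + apply hol_Gamma; [apply hol_opp, hol_id|exact PN0].
    + apply hol_inv; [apply hol_opp, hol_id|]. intros s Hs. apply nonpole_neq_0, PN0, Hs.
    + apply hol_Gamma; [apply hol_minus; [apply hol_const|apply hol_id]|]. intros s Hs. apply PN; [right; left; reflexivity|exact Hs].
    + apply hol_Gamma; [apply hol_minus; [apply hol_const|apply hol_id]|]. intros s Hs. unfold N. rewrite <- RtoC_opp.
      apply PN; [right; right; left; reflexivity|exact Hs].
    + apply hol_rGamma, hol_minus; [apply hol_const|apply hol_id].
    + apply hol_exp, hol_mult; [apply hol_id|apply hol_const].
  - apply phi40_decay; lra.
  - repeat constructor; simpl; intuition lra.
  - intros q [<-|[<-|[<-|[]]]]; lra.
  - intros q q' k k' Hq Hq'. apply (pole_offset_unique nu); [exact H2nu| |];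
     [destruct Hq as [<-|[<-|[<-|[]]]]|destruct Hq' as [<-|[<-|[<-|[]]]]]; tauto.
  - intros p (q & k & Hq & ->) _. destruct Hq as [<-|[<-|[<-|[]]]].
    + rewrite Rplus_0_l. destruct k.
      * eapply resdata_residue. exact D0.
      * eapply resdata_residue. eapply (residues_class_0 l x nu Hx H2nu); [apply shiftable_phi40|exact D0].
    + eapply resdata_residue. eapply (residues_class_nu l x nu Hx H2nu); [left; reflexivity|apply shiftable_phi40|exact D1].
    + eapply resdata_residue. eapply (residues_class_nu l x nu Hx H2nu); [right; reflexivity|apply shiftable_phi40|exact D2].
  - intros q [<-|[<-|[<-|[]]]]; unfold sigma.
    + destruct (Req_EM_T 0 0) as [_|X]; [|exfalso; lra].
      apply (residue_sum_0 l x nu Hx H2nu); [apply shiftable_phi40|exact D0|exact HM].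
    + destruct (Req_EM_T nu 0) as [X|_]; [exfalso; lra|].
      destruct (Req_EM_T nu nu) as [_|X]; [|exfalso; lra].
      apply (residue_sum_nu l x nu Hx H2nu); [left; reflexivity|apply shiftable_phi40|exact D1|exact HP].
    + destruct (Req_EM_T (- nu) 0) as [X|_]; [exfalso; lra|].
      destruct (Req_EM_T (- nu) nu) as [X|_]; [exfalso; lra|].
      apply (residue_sum_nu l x nu Hx H2nu); [right; reflexivity|apply shiftable_phi40|exact D2|].
      rewrite RtoC_opp. exact HQ.
Qed.
End Values.

(** * Continuity of the loop integrals in the order, and independence of the loop *)

Definition onloop (c h : R) (s : C) : Prop :=
  ((c <= Re s)%R /\ (Im s = h \/ Im s = - h)%R) \/ (Re s = c).

Section LoopFamily.
Variables (F : R -> C -> C) (nu0 c h T r : R).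
Hypothesis Hr : (0 < r)%R.
Hypothesis Hh : (0 < h)%R.
(** Quantified over the space of parameters, so that one hypothesis yields joint continuity in the
    order and the position as well as continuity in the position alone. *)
Hypothesis Hcont : forall (U : UniformSpace) (n : U -> R) (S : U -> C) (x : U),
  continuous n x -> continuous S x -> (Rabs (n x - nu0) < r)%R -> onloop c h (S x) ->
  continuous (fun y => F (n y) (S y)) x.
Hypothesis Hdecay : forall nu, (Rabs (nu - nu0) < r)%R -> shift_decay (F nu) T.

Lemma contour_cont_family nu : (Rabs (nu - nu0) < r)%R -> contour_cont (F nu) c h.
Proof.
  intros Hn. repeat split; intros t Ht; apply (Hcont C_UniformSpace (fun _ => nu) (fun s => s));
   try apply continuous_const; try apply continuous_id; try exact Hn; unfold onloop; simpl; auto.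
Qed.

Lemma loopI_continuous : forall eps, (0 < eps)%R -> exists d, (0 < d)%R /\
  forall nu, (Rabs (nu - nu0) < d)%R -> (Cmod (loopI (F nu) c h - loopI (F nu0) c h) < eps)%R.
Proof.
  intros eps He.
  assert (HL_side : forall y, (y = h \/ y = - h)%R -> exists d, (0 < d)%R /\ forall nu, (Rabs (nu - nu0) < d)%R ->
    (Cmod (HL (fun t => F nu (t, y)) c - HL (fun t => F nu0 (t, y)) c) < eps / 3)%R).
  { intros y Hy. apply (HL_continuous (fun nu t => F nu (t, y)) nu0 c (Rmax c T) r Hr (Rmax_l _ _)).
    - intros t Ht. apply (Hcont (prod_UniformSpace R_UniformSpace R_UniformSpace) (fun p => fst p) (fun p => (snd p, y))).
      + apply continuous_fst.
      + apply Cc_pair; [apply continuous_snd|apply continuous_const].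
      + simpl. rewrite Rminus_diag, Rabs_R0. exact Hr.
      + left; simpl; tauto.
    - intros nu t Hn Ht. apply (Hcont R_UniformSpace (fun _ => nu) (fun t => (t, y))).
      + apply continuous_const.
      + apply Cc_pair; [apply continuous_id|apply continuous_const].
      + exact Hn.
      + left; simpl; tauto.
    - intros nu t Hn Ht. replace (((t + 1)%R, y) : C) with ((t, y) + RtoC 1) by (apply C_ext; simpl; ring).
      apply Hdecay; [exact Hn|]. simpl. eapply Rle_trans; [apply Rmax_r|exact Ht].
    - lra. }
  destruct (HL_side h (or_introl eq_refl)) as (d1 & Hd1 & B1).
  destruct (HL_side (- h)%R (or_intror eq_refl)) as (d2 & Hd2 & B2).
  destruct (CRInt_param_continuous (fun nu t => F nu (c, t) * Ci) nu0 (- h) h r ltac:(lra) Hr) with (eps := (eps / 3)%R)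
    as (d3 & Hd3 & B3).
  - intros t Ht. apply Cc_mult; [|apply Cc_const].
    apply (Hcont (prod_UniformSpace R_UniformSpace R_UniformSpace) (fun p => fst p) (fun p => (c, snd p))).
    + apply continuous_fst.
    + apply Cc_pair; [apply continuous_const|apply continuous_snd].
    + simpl. rewrite Rminus_diag, Rabs_R0. exact Hr.
    + right; reflexivity.
  - intros nu t Hn Ht. apply Cc_mult; [|apply Cc_const].
    apply (Hcont R_UniformSpace (fun _ => nu) (fun t => (c, t))).
    + apply continuous_const.
    + apply Cc_pair; [apply continuous_const|apply continuous_id].
    + exact Hn.
    + right; reflexivity.
  - lra.
  - exists (Rmin d1 (Rmin d2 d3)). split; [repeat apply Rmin_pos; assumption|]. intros nu Hn.
    assert (C1 := Rmin_l d1 (Rmin d2 d3)). assert (C2 := Rmin_r d1 (Rmin d2 d3)).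
    assert (C3 := Rmin_l d2 d3). assert (C4 := Rmin_r d2 d3).
    specialize (B1 nu ltac:(lra)). specialize (B2 nu ltac:(lra)). specialize (B3 nu ltac:(lra)).
    unfold loopI.
    set (u1 := HL (fun t => F nu (t, h)) c) in *. set (v1 := HL (fun t => F nu0 (t, h)) c) in *.
    set (u2 := HL (fun t => F nu (t, (- h)%R)) c) in *. set (v2 := HL (fun t => F nu0 (t, (- h)%R)) c) in *.
    set (u3 := CRInt _ _ _) in *. set (v3 := CRInt (fun t => F nu0 (c, t) * Ci) _ _) in *.
    replace (- u2 + u3 + u1 - (- v2 + v3 + v1)) with (- (u2 - v2) + (u3 - v3) + (u1 - v1)) by ring.
    eapply Rle_lt_trans; [apply Cmod_triangle|].
    assert (X := Cmod_triangle (- (u2 - v2)) (u3 - v3)). rewrite Cmod_opp in X. lra.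
Qed.
End LoopFamily.

Lemma Rabs_ball (u v r : R) : (Rabs (u - v) < r)%R -> (v - r < u < v + r)%R.
Proof. intros H. apply Rabs_def2 in H. lra. Qed.

Lemma Cc_RtoC_comp {U : UniformSpace} (n : U -> R) (x : U) : continuous n x -> continuous (fun y => RtoC (n y)) x.
Proof. intros H. apply Cc_RtoC, H. Qed.

Lemma phi31_loop_cont l nu0 c h : (0 < h)%R -> (-1/2 < c < 0)%R ->
  forall (U : UniformSpace) (n : U -> R) (S : U -> C) (x : U),
  continuous n x -> continuous S x -> (Rabs (n x - nu0) < nu0)%R -> onloop c h (S x) ->
  continuous (fun y => phi31 l (RtoC (n y)) (S y)) x.
Proof.
  intros Hh Hc U n S x Hn HS Hr Ho. apply Rabs_ball in Hr.
  assert (D : (Im (S x) <> 0 \/ Re (S x) = c)%R) by (destruct Ho as [[_ [E|E]]|E]; [left; lra|left; lra|right; exact E]).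
  apply (Cc_phi31 l (fun y => RtoC (n y)) S x); try assumption; [apply Cc_RtoC_comp, Hn| | |];
   (destruct D as [D|D]; [apply nonpole_Im|apply nonpole_Re]); unfold Cminus; rewrite ?re_plus, ?im_plus, ?re_opp, ?im_opp; simpl; lra.
Qed.

(** The radius keeps the order positive and below [- c], so that the leftmost pole [- nu] never
    reaches the vertical side. *)
Lemma phi40_loop_cont l nu0 c h : (0 < h)%R -> (c < - nu0)%R ->
  forall (U : UniformSpace) (n : U -> R) (S : U -> C) (x : U),
  continuous n x -> continuous S x -> (Rabs (n x - nu0) < Rmin nu0 (- c - nu0))%R -> onloop c h (S x) ->
  continuous (fun y => phi40 l (RtoC (n y)) (S y)) x.
Proof.
  intros Hh Hc U n S x Hn HS Hr Ho. apply Rabs_ball in Hr.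
  assert (m1 := Rmin_l nu0 (- c - nu0)). assert (m2 := Rmin_r nu0 (- c - nu0)).
  assert (D : (Im (S x) <> 0 \/ Re (S x) = c)%R) by (destruct Ho as [[_ [E|E]]|E]; [left; lra|left; lra|right; exact E]).
  apply (Cc_phi40 l (fun y => RtoC (n y)) S x); try assumption; [apply Cc_RtoC_comp, Hn| | |];
   (destruct D as [D|D]; [apply nonpole_Im|apply nonpole_Re]); unfold Cminus; rewrite ?re_plus, ?im_plus, ?re_opp, ?im_opp; simpl; lra.
Qed.

Lemma phi31_family_decay l nu0 nu : (Rabs (nu - nu0) < nu0)%R ->
  shift_decay (phi31 l (RtoC nu)) (2 * nu0 + 3 * Cmod (Cexp l) + 1).
Proof. intros H. apply Rabs_ball in H. apply phi31_decay; lra. Qed.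

Lemma phi40_family_decay l nu0 c nu : (Rabs (nu - nu0) < Rmin nu0 (- c - nu0))%R ->
  shift_decay (phi40 l (RtoC nu)) (2 * nu0 + 3 * Cmod (Cexp l) + 1).
Proof.
  intros H. apply Rabs_ball in H. assert (m1 := Rmin_l nu0 (- c - nu0)). apply phi40_decay; lra.
Qed.

Lemma generic_near nu0 d : (0 < d)%R -> exists nu, (Rabs (nu - nu0) < d)%R /\ noninteger (2 * nu).
Proof.
  intros Hd. destruct (classic (noninteger (2 * nu0))) as [H|H].
  - exists nu0. rewrite Rminus_diag, Rabs_R0. split; assumption.
  - apply not_all_ex_not in H. destruct H as [k Hk]. apply NNPP in Hk.
    assert (m1 := Rmin_l d (1/2)). assert (m2 := Rmin_r d (1/2)). assert (m3 : (0 < Rmin d (1/2))%R) by (apply Rmin_pos; lra).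
    exists (nu0 + Rmin d (1/2) / 2)%R. split.
    + replace (nu0 + Rmin d (1/2) / 2 - nu0)%R with (Rmin d (1/2) / 2)%R by ring. rewrite Rabs_pos_eq; lra.
    + apply (noninteger_near _ k).
      * lra.
      * replace (2 * (nu0 + Rmin d (1/2) / 2) - IZR k)%R with (Rmin d (1/2))%R by lra. rewrite Rabs_pos_eq; lra.
Qed.

(* For generic order, both loops compute the same residue sum; the other orders are limits of generic ones. *)
Lemma loop_independent (F : R -> C -> C) nu0 c h c' h' :
  (forall eps, (0 < eps)%R -> exists d, (0 < d)%R /\
    forall nu, (Rabs (nu - nu0) < d)%R -> (Cmod (loopI (F nu) c h - loopI (F nu0) c h) < eps)%R) ->
  (forall eps, (0 < eps)%R -> exists d, (0 < d)%R /\
    forall nu, (Rabs (nu - nu0) < d)%R -> (Cmod (loopI (F nu) c' h' - loopI (F nu0) c' h') < eps)%R) ->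
  (exists d, (0 < d)%R /\ forall nu, (Rabs (nu - nu0) < d)%R -> noninteger (2 * nu) ->
    loopI (F nu) c h = loopI (F nu) c' h') ->
  loopI (F nu0) c h = loopI (F nu0) c' h'.
Proof.
  intros H1 H2 [d3 [Hd3 H3]]. apply Cmod_le_eps_eq. intros eps He.
  destruct (H1 (eps / 2)%R ltac:(lra)) as (d1 & Hd1 & B1). destruct (H2 (eps / 2)%R ltac:(lra)) as (d2 & Hd2 & B2).
  destruct (generic_near nu0 (Rmin d1 (Rmin d2 d3))) as (nu & Hn & Hg); [repeat apply Rmin_pos; assumption|].
  assert (C1 := Rmin_l d1 (Rmin d2 d3)). assert (C2 := Rmin_r d1 (Rmin d2 d3)).
  assert (C3 := Rmin_l d2 d3). assert (C4 := Rmin_r d2 d3).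
  specialize (B1 nu ltac:(lra)). specialize (B2 nu ltac:(lra)). rewrite (H3 nu ltac:(lra) Hg) in B1.
  rewrite Cmod_minus_sym in B1.
  eapply Rle_trans; [apply (Cmod_triangle3 _ (loopI (F nu) c' h'))|]. lra.
Qed.

Lemma residue_data_exist l nu : noninteger nu -> exists g gm M P Q,
  let N := RtoC nu in let x := Cexp l / RtoC 4 in
  Cder rGamma (N + RtoC 1) g /\ Cder rGamma (- N + RtoC 1) gm /\ is_Csum (fscale x (coefM N)) M /\
  is_Csum (fscale x (coefP N)) P /\ is_Csum (fscale x (coefP (- N))) Q.
Proof.
  intros H. destruct (noninteger_generic nu H) as (G1 & G2 & N0). destruct entire_rGamma as [dG HdG].
  assert (N0' : - RtoC nu <> RtoC 0) by nz N0.
  destruct (geo_cv _ (geo_coefM (RtoC nu) (Cexp l / RtoC 4) G1 G2)) as [M HM].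
  destruct (geo_cv _ (geo_coefP (RtoC nu) (Cexp l / RtoC 4) G1 N0)) as [P HP].
  destruct (geo_cv _ (geo_coefP (- RtoC nu) (Cexp l / RtoC 4) G2 N0')) as [Q HQ].
  exists (dG (RtoC nu + RtoC 1)), (dG (- RtoC nu + RtoC 1)), M, P, Q. cbv zeta.
  split; [apply HdG; trivial|]. split; [apply HdG; trivial|]. split; [exact HM|]. split; assumption.
Qed.

Lemma loopI_phi31_independent l nu c h c' h' : (0 < nu)%R -> (0 < h)%R -> (0 < h')%R ->
  (-1/2 < c < 0)%R -> (-1/2 < c' < 0)%R -> loopI (phi31 l (RtoC nu)) c h = loopI (phi31 l (RtoC nu)) c' h'.
Proof.
  intros Hnu Hh Hh' Hc Hc'.
  apply (loop_independent (fun nu => phi31 l (RtoC nu))).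
  - apply (loopI_continuous (fun nu => phi31 l (RtoC nu)) nu c h (2 * nu + 3 * Cmod (Cexp l) + 1) nu Hnu Hh);
      [apply phi31_loop_cont; assumption|intros; apply phi31_family_decay; assumption].
  - apply (loopI_continuous (fun nu => phi31 l (RtoC nu)) nu c' h' (2 * nu + 3 * Cmod (Cexp l) + 1) nu Hnu Hh');
      [apply phi31_loop_cont; assumption|intros; apply phi31_family_decay; assumption].
  - exists nu. split; [exact Hnu|]. intros mu Hm H2. apply Rabs_ball in Hm.
    destruct (residue_data_exist l mu (noninteger_double _ H2)) as (g & gm & M & P & Q & Hg & Hgm & HM & HP & HQ).
    assert (Hx : Cexp l = RtoC 4 * (Cexp l / RtoC 4)) by (field; apply RtoC_neq_0; lra).
    (* Here [l] is arbitrary; [L] and [x] are merely solved from the relations that the residue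
       computation assumes. *)
    pose (L := (l - RtoC 2 * RtoC (ln 2)) / RtoC 2).
    assert (Hl : l = RtoC 2 * L + RtoC 2 * RtoC (ln 2)) by (unfold L; field; apply RtoC_neq_0; lra).
    rewrite (loopI_phi31 l L _ M P g mu c h Hl Hx ltac:(lra) H2 Hh HM HP Hg Hc).
    rewrite (loopI_phi31 l L _ M P g mu c' h' Hl Hx ltac:(lra) H2 Hh' HM HP Hg Hc'). reflexivity.
Qed.

Lemma loopI_phi40_independent l nu c h c' h' : (0 < nu)%R -> (0 < h)%R -> (0 < h')%R ->
  (c < - nu)%R -> (c' < - nu)%R -> loopI (phi40 l (RtoC nu)) c h = loopI (phi40 l (RtoC nu)) c' h'.
Proof.
  intros Hnu Hh Hh' Hc Hc'.
  apply (loop_independent (fun nu => phi40 l (RtoC nu))).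
  - apply (loopI_continuous (fun nu => phi40 l (RtoC nu)) nu c h (2 * nu + 3 * Cmod (Cexp l) + 1) (Rmin nu (- c - nu)));
      [apply Rmin_pos; lra|exact Hh|apply phi40_loop_cont; assumption|intros; apply (phi40_family_decay l nu c); assumption].
  - apply (loopI_continuous (fun nu => phi40 l (RtoC nu)) nu c' h' (2 * nu + 3 * Cmod (Cexp l) + 1) (Rmin nu (- c' - nu)));
      [apply Rmin_pos; lra|exact Hh'|apply phi40_loop_cont; assumption|intros; apply (phi40_family_decay l nu c'); assumption].
  - exists (Rmin nu (Rmin (- c - nu) (- c' - nu))). split; [repeat apply Rmin_pos; lra|]. intros mu Hm H2. apply Rabs_ball in Hm.
    assert (m1 := Rmin_l nu (Rmin (- c - nu) (- c' - nu))). assert (m2 := Rmin_r nu (Rmin (- c - nu) (- c' - nu))).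
    assert (m3 := Rmin_l (- c - nu) (- c' - nu)). assert (m4 := Rmin_r (- c - nu) (- c' - nu)).
    destruct (residue_data_exist l mu (noninteger_double _ H2)) as (g & gm & M & P & Q & Hg & Hgm & HM & HP & HQ).
    assert (Hx : Cexp l = RtoC 4 * (Cexp l / RtoC 4)) by (field; apply RtoC_neq_0; lra).
    pose (L := (l - RtoC 2 * RtoC (ln 2)) / RtoC 2).
    assert (Hl : l = RtoC 2 * L + RtoC 2 * RtoC (ln 2)) by (unfold L; field; apply RtoC_neq_0; lra).
    rewrite (loopI_phi40 l L _ M P Q g gm mu c h Hl Hx ltac:(lra) H2 Hh HM HP HQ Hg Hgm ltac:(lra)).
    rewrite (loopI_phi40 l L _ M P Q g gm mu c' h' Hl Hx ltac:(lra) H2 Hh' HM HP HQ Hg Hgm ltac:(lra)). reflexivity.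
Qed.

(** * The G-functions as integrals over any admissible loop *)

Lemma separating_loop_31 nu c h : separating_loop 3 1 [RtoC (1 / 2); RtoC 1] [RtoC 0; RtoC 0; RtoC nu; RtoC (- nu)] c h ->
  (0 < h /\ -1/2 < c < 0)%R.
Proof.
  intros (Hh & H1 & H2). split; [exact Hh|].
  (* The extreme poles decide: 0 must be inside and [-1/2] outside. Being real, the latter cannot be
     outside by its height, so it is to the left of [c]. *)
  destruct (H1 (RtoC 0) 0%nat) as [X _]; [simpl; tauto|]. destruct (H2 (RtoC (1/2)) 0%nat) as [Y|Y]; [simpl; tauto| |];
   simpl in *; [lra|]. exfalso. replace (0 + - 0 + - 0)%R with 0%R in Y by ring. rewrite Rabs_R0 in Y. lra.
Qed.

Lemma separating_loop_31_intro nu c h : (0 < nu)%R -> (0 < h)%R -> (-1/2 < c < 0)%R ->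
  separating_loop 3 1 [RtoC (1 / 2); RtoC 1] [RtoC 0; RtoC 0; RtoC nu; RtoC (- nu)] c h.
Proof.
  intros Hnu Hh Hc. split; [exact Hh|]. split.
  - intros bl k Hb. assert (P := pos_INR k). simpl in Hb. destruct Hb as [<-|[<-|[<-|[]]]]; split; simpl; rewrite ?Rplus_0_r, ?Rabs_R0; lra.
  - intros al k Ha. assert (P := pos_INR k). simpl in Ha. destruct Ha as [<-|[]]. left. simpl. lra.
Qed.

Lemma separating_loop_40 nu c h : separating_loop 4 0 [RtoC (1 / 2); RtoC 1] [RtoC 0; RtoC 0; RtoC nu; RtoC (- nu)] c h ->
  (0 < h /\ c < - nu)%R.
Proof.
  intros (Hh & H1 & _). split; [exact Hh|]. destruct (H1 (RtoC (- nu)) 0%nat) as [X _]; [simpl; tauto|]. simpl in X. lra.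
Qed.

Lemma separating_loop_40_intro nu c h : (0 < nu)%R -> (0 < h)%R -> (c < - nu)%R ->
  separating_loop 4 0 [RtoC (1 / 2); RtoC 1] [RtoC 0; RtoC 0; RtoC nu; RtoC (- nu)] c h.
Proof.
  intros Hnu Hh Hc. split; [exact Hh|]. split.
  - intros bl k Hb. assert (P := pos_INR k). simpl in Hb. destruct Hb as [<-|[<-|[<-|[<-|[]]]]]; split; simpl; rewrite ?Rplus_0_r, ?Rabs_R0; lra.
  - intros al k [].
Qed.

Lemma loopI_phi31_spec l nu c h : (0 < nu)%R -> (0 < h)%R -> (-1/2 < c < 0)%R ->
  is_loop_int (phi31 l (RtoC nu)) c h (loopI (phi31 l (RtoC nu)) c h) /\
  forall g, is_loop_int (phi31 l (RtoC nu)) c h g -> g = loopI (phi31 l (RtoC nu)) c h.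
Proof.
  intros Hnu Hh Hc. assert (Z : (Rabs (nu - nu) < nu)%R) by (rewrite Rminus_diag, Rabs_R0; exact Hnu).
  apply (loopI_spec _ c h (2 * nu + 3 * Cmod (Cexp l) + 1) Hh).
  - apply (contour_cont_family (fun nu => phi31 l (RtoC nu)) nu c h nu); [apply phi31_loop_cont; assumption|exact Z].
  - apply phi31_family_decay, Z.
Qed.

Lemma loopI_phi40_spec l nu c h : (0 < nu)%R -> (0 < h)%R -> (c < - nu)%R ->
  is_loop_int (phi40 l (RtoC nu)) c h (loopI (phi40 l (RtoC nu)) c h) /\
  forall g, is_loop_int (phi40 l (RtoC nu)) c h g -> g = loopI (phi40 l (RtoC nu)) c h.
Proof.
  intros Hnu Hh Hc. assert (Z : (Rabs (nu - nu) < Rmin nu (- c - nu))%R) by (rewrite Rminus_diag, Rabs_R0; apply Rmin_pos; lra).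
  apply (loopI_spec _ c h (2 * nu + 3 * Cmod (Cexp l) + 1) Hh).
  - apply (contour_cont_family (fun nu => phi40 l (RtoC nu)) nu c h (Rmin nu (- c - nu))); [apply phi40_loop_cont; assumption|exact Z].
  - apply (phi40_family_decay l nu c), Z.
Qed.

(** [iota] yields the value once it is unique, and uniqueness over all separating loops is
    [loopI_phi31_independent]; existence is the loop at hand. *)
Lemma MeijerG_31 nu x c h : (0 < nu)%R -> (0 < h)%R -> (-1/2 < c < 0)%R ->
  MeijerG 3 1 [RtoC (1 / 2); RtoC 1] [RtoC 0; RtoC 0; RtoC nu; RtoC (- nu)] x =
  loopI (phi31 (Clog x) (RtoC nu)) c h / (RtoC 2 * RtoC PI * Ci).
Proof.
  intros Hnu Hh Hc. unfold MeijerG.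
  assert (EF : MeijerG_integrand 3 1 [RtoC (1 / 2); RtoC 1] [RtoC 0; RtoC 0; RtoC nu; RtoC (- nu)] x = phi31 (Clog x) (RtoC nu))
    by (apply functional_extensionality; intros s; apply integrand_31).
  apply (iota_unique (V := C_CompleteNormedModule)).
  - intros y [_ (c' & h' & Hs & g & Hg & ->)]. apply separating_loop_31 in Hs. rewrite EF in Hg.
    rewrite (proj2 (loopI_phi31_spec (Clog x) nu c' h' Hnu (proj1 Hs) (proj2 Hs)) g Hg).
    rewrite (loopI_phi31_independent (Clog x) nu c' h' c h Hnu (proj1 Hs) Hh (proj2 Hs) Hc). reflexivity.
  - split; [simpl; lia|]. exists c, h. split; [apply separating_loop_31_intro; assumption|].
    exists (loopI (phi31 (Clog x) (RtoC nu)) c h). split; [rewrite EF; apply loopI_phi31_spec; assumption|reflexivity].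
Qed.

Lemma MeijerG_40 nu x c h : (0 < nu)%R -> (0 < h)%R -> (c < - nu)%R ->
  MeijerG 4 0 [RtoC (1 / 2); RtoC 1] [RtoC 0; RtoC 0; RtoC nu; RtoC (- nu)] x =
  loopI (phi40 (Clog x) (RtoC nu)) c h / (RtoC 2 * RtoC PI * Ci).
Proof.
  intros Hnu Hh Hc. unfold MeijerG.
  assert (EF : MeijerG_integrand 4 0 [RtoC (1 / 2); RtoC 1] [RtoC 0; RtoC 0; RtoC nu; RtoC (- nu)] x = phi40 (Clog x) (RtoC nu))
    by (apply functional_extensionality; intros s; apply integrand_40).
  apply (iota_unique (V := C_CompleteNormedModule)).
  - intros y [_ (c' & h' & Hs & g & Hg & ->)]. apply separating_loop_40 in Hs. rewrite EF in Hg.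
    rewrite (proj2 (loopI_phi40_spec (Clog x) nu c' h' Hnu (proj1 Hs) (proj2 Hs)) g Hg).
    rewrite (loopI_phi40_independent (Clog x) nu c' h' c h Hnu (proj1 Hs) Hh (proj2 Hs) Hc). reflexivity.
  - split; [simpl; lia|]. exists c, h. split; [apply separating_loop_40_intro; assumption|].
    exists (loopI (phi40 (Clog x) (RtoC nu)) c h). split; [rewrite EF; apply loopI_phi40_spec; assumption|reflexivity].
Qed.

(** * Derivative at an exceptional order as a limit of derivatives *)

Lemma Cc_R_eps (g : R -> C) (t : R) : continuous g t -> forall eps, (0 < eps)%R -> exists d, (0 < d)%R /\
  forall u, (Rabs (u - t) < d)%R -> (Cmod (g u - g t) < eps)%R.
Proof.
  intros H eps He. destruct (proj1 (Cc_eps g t) H eps He) as [d Hd]. exists d. split; [apply cond_pos|].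
  intros u Hu. apply Hd. exact Hu.
Qed.

Lemma eps_Cc_R (g : R -> C) (t : R) : (forall eps, (0 < eps)%R -> exists d, (0 < d)%R /\
  forall u, (Rabs (u - t) < d)%R -> (Cmod (g u - g t) < eps)%R) -> continuous g t.
Proof.
  intros H. apply Cc_eps. intros eps He. destruct (H eps He) as [d [Hd HD]]. exists (mkposreal d Hd). exact HD.
Qed.

(* Mean value theorem on one side of [t], then a limit at the end point [t]. *)
Lemma RCder_punctured (g dg : R -> C) (t r : R) : (0 < r)%R -> continuous g t -> continuous dg t ->
  (forall u, u <> t -> (Rabs (u - t) < r)%R -> RCder g u (dg u)) -> RCder g t (dg t).
Proof.
  intros Hr Hg Hdg HD. apply RCder_eps. intros eps He.
  destruct (Cc_R_eps dg t Hdg eps He) as (d & Hd & B).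
  exists (Rmin d r). split; [apply Rmin_pos; assumption|]. intros u Hu.
  assert (m1 := Rmin_l d r). assert (m2 := Rmin_r d r).
  pose (phi := fun w => g w - RtoC w * dg t).
  replace (g u - g t - dg t * RtoC (u - t)) with (phi u - phi t) by (unfold phi; rewrite RtoC_minus; ring).
  destruct (Req_dec u t) as [E|E].
  { rewrite E, Rminus_diag, Rabs_R0, Rmult_0_r. replace (phi t - phi t) with (RtoC 0) by ring. rewrite Cmod_0R. lra. }
  assert (Hphi : continuous phi t).
  { apply Cc_minus; [exact Hg|]. apply Cc_mult; [apply Cc_RtoC, continuous_id|apply Cc_const]. }
  assert (Dphi : forall w, w <> t -> (Rabs (w - t) < r)%R -> RCder phi w (dg w - dg t)).
  { intros w Hw Hwr. apply (RCder_minus g (fun v => RtoC v * dg t)); [apply HD; assumption|].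
    apply RCder_id. }
  assert (Mid : forall w, (Rabs (w - t) <= Rabs (u - t))%R -> w <> t -> (0 < (w - t) * (u - t))%R ->
    (Cmod (phi u - phi w) <= eps * Rabs (u - t))%R).
  { intros w Hw Hwt Hs. apply Rabs_ball in Hu.
    assert (S1 : forall v, (Rmin w u <= v <= Rmax w u)%R -> v <> t /\ (Rabs (v - t) < Rmin d r)%R).
    { intros v Hv. destruct (Rlt_dec t u) as [h|h].
      - assert (t < w)%R by nra. rewrite !Rabs_pos_eq in Hw by lra. rewrite Rmin_left, Rmax_right in Hv by lra.
        split; [lra|]. rewrite Rabs_pos_eq; lra.
      - assert (w < t)%R by nra. rewrite !Rabs_left1 in Hw by lra. rewrite Rmin_right, Rmax_left in Hv by lra.
        split; [lra|]. rewrite Rabs_left1; lra. }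
    assert (Z : (Cmod (phi (Rmax w u) - phi (Rmin w u)) <= eps * (Rmax w u - Rmin w u))%R).
    { apply (Cmod_MVT phi (fun v => dg v - dg t)).
      - eapply Rle_trans; [apply Rmin_l|apply Rmax_l].
      - intros v Hv. destruct (S1 v Hv) as [h1 h2]. apply Dphi; [exact h1|lra].
      - intros v Hv. destruct (S1 v Hv) as [h1 h2]. left. apply B. lra. }
    apply Rle_trans with (eps * (Rmax w u - Rmin w u))%R.
    - destruct (Rle_dec w u) as [h|h].
      + rewrite Rmax_right, Rmin_left in * by lra. exact Z.
      + rewrite Rmax_left, Rmin_right in * by lra. rewrite Cmod_minus_sym. exact Z.
    - apply Rmult_le_compat_l; [lra|]. destruct (Rlt_dec t u) as [h|h].
      + assert (t < w)%R by nra. rewrite !Rabs_pos_eq in * by lra. rewrite Rmin_left, Rmax_right by lra. lra.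
      + assert (w < t)%R by nra. rewrite !Rabs_left1 in * by lra. rewrite Rmin_right, Rmax_left by lra. lra. }
  apply le_epsilon. intros e He'.
  destruct (Cc_R_eps phi t Hphi e He') as (d' & Hd' & B').
  assert (Pu : (0 < Rabs (u - t))%R) by (apply Rabs_pos_lt; lra).
  (* Places [w] between [t] and [u], so close to [t] that [phi w] is within [e] of [phi t]; the mean
     value inequality covers the segment from [w] to [u], which avoids [t]. *)
  pose (la := Rmin (1/2) (d' / (2 * Rabs (u - t)))%R).
  assert (L1 : (la <= 1/2)%R) by apply Rmin_l. assert (L2 : (la <= d' / (2 * Rabs (u - t)))%R) by apply Rmin_r.
  assert (L0 : (0 < la)%R) by (apply Rmin_pos; [lra|apply Rdiv_lt_0_compat; lra]).
  pose (w := (t + la * (u - t))%R).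
  assert (Ew : (w - t = la * (u - t))%R) by (unfold w; ring).
  assert (Aw : Rabs (w - t) = (la * Rabs (u - t))%R) by (rewrite Ew, Rabs_mult, (Rabs_pos_eq la) by lra; reflexivity).
  assert (X1 : (Cmod (phi u - phi w) <= eps * Rabs (u - t))%R).
  { apply Mid.
    - rewrite Aw. nra.
    - intros Q. rewrite Q, Rminus_diag, Rabs_R0 in Aw. nra.
    - rewrite Ew. replace (la * (u - t) * (u - t))%R with (la * (u - t) ^ 2)%R by ring.
      apply Rmult_lt_0_compat; [exact L0|]. apply pow2_gt_0. lra. }
  assert (X2 : (Cmod (phi w - phi t) < e)%R).
  { apply B'. rewrite Aw. apply (Rmult_le_compat_r (Rabs (u - t))) in L2; [|lra].
    replace (d' / (2 * Rabs (u - t)) * Rabs (u - t))%R with (d' / 2)%R in L2 by (field; lra). lra. }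
  eapply Rle_trans; [apply (Cmod_triangle3 _ (phi w))|]. lra.
Qed.

(** * Assembly of the formula *)

Section Final.
Variable z : C.
Hypothesis Hz : (0 < Re z)%R.
Let l := Clog (z ^ 2).
Let L := Clog (z / RtoC 2).
Let x := (z / RtoC 2) ^ 2.

Definition G31 (u : R) (y : C) : C := MeijerG 3 1 [RtoC (1 / 2); RtoC 1] [RtoC 0; RtoC 0; RtoC u; RtoC (- u)] y.
Definition G40 (u : R) (y : C) : C := MeijerG 4 0 [RtoC (1 / 2); RtoC 1] [RtoC 0; RtoC 0; RtoC u; RtoC (- u)] y.

Definition order_derivative (u : R) : C :=
  RtoC (u / 2) * (BesselK (RtoC u) z / RtoC (sqrt PI) * G31 u (z ^ 2)
    - RtoC (sqrt PI) * BesselI (RtoC u) z * G40 u (z ^ 2)).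

Let z0 : z <> RtoC 0 := Re_pos_neq_0 z Hz.

Let two0 : RtoC 2 <> RtoC 0.
Proof. apply RtoC_neq_0; lra. Qed.

Let Npi : RtoC PI <> RtoC 0.
Proof. apply RtoC_neq_0, PI_neq0. Qed.

Let Nsp : RtoC (sqrt PI) <> RtoC 0.
Proof. apply RtoC_neq_0. generalize (sqrt_lt_R0 _ PI_RGT_0). lra. Qed.

(** The place where [Re z > 0] matters for the branch: the principal logarithm of [z^2] is twice
    that of [z]. *)
Let Hl : l = RtoC 2 * L + RtoC 2 * RtoC (ln 2).
Proof. unfold l, L. rewrite (Clog_sqr z Hz), (Clog_half z Hz). ring. Qed.

Let Hx : Cexp l = RtoC 4 * x.
Proof.
  unfold l, x. rewrite Cexp_Clog; [simpl; field; exact two0|]. simpl. apply Cmult_neq_0; [exact z0|].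
  rewrite Cmult_1_r. exact z0.
Qed.

Lemma BesselK_derivative_order_generic u : (0 < u)%R -> noninteger (2 * u) ->
  RCder (fun t : R => BesselK (RtoC t) z) u (order_derivative u).
Proof.
  intros Hu H2. assert (H := noninteger_double u H2).
  destruct (residue_data_exist l u H) as (g & gm & M & P & Q & Hg & Hgm & HM & HP & HQ). cbv zeta in HM, HP, HQ.
  replace (Cexp l / RtoC 4) with x in HM, HP, HQ by (rewrite Hx; field; apply RtoC_neq_0; lra).
  eapply RCder_eq; [exact (BesselK_derivative_generic u z M P Q g gm H HM HP HQ Hg Hgm)|].
  unfold order_derivative, G31, G40.
  (* Any admissible loops will do: [-1/4] lies between the poles [-1/2] and [0], and [- u - 1] to
     the left of [- u]. *)
  rewrite (MeijerG_31 u (z ^ 2) (-1/4) 1 Hu ltac:(lra) ltac:(lra)).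
  rewrite (MeijerG_40 u (z ^ 2) (- u - 1) 1 Hu ltac:(lra) ltac:(lra)).
  fold l. rewrite (loopI_phi31 l L x M P g u (-1/4) 1 Hl Hx Hu H2 ltac:(lra) HM HP Hg ltac:(lra)).
  rewrite (loopI_phi40 l L x M P Q g gm u (- u - 1) 1 Hl Hx Hu H2 ltac:(lra) HM HP HQ Hg Hgm ltac:(lra)).
  fold L. rewrite RtoC_div by lra. set (K := BesselK _ _). set (I := BesselI _ _).
  set (A := _ + M - _). set (B := _ - _ / _ * Q). set (ka := / (_ * _)).
  destruct (noninteger_generic u H) as (_ & _ & N0).
  field. repeat split; try assumption; apply Ci_neq_0.
Qed.

Lemma G31_continuous nu : (0 < nu)%R -> continuous (fun u => G31 u (z ^ 2)) nu.
Proof.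
  intros Hnu. apply (continuous_ext_loc _ (fun u => loopI (phi31 l (RtoC u)) (-1/4) 1 / (RtoC 2 * RtoC PI * Ci))).
  - exists (mkposreal nu Hnu). intros u Hu. apply Rabs_ball in Hu. simpl in Hu. symmetry.
    apply MeijerG_31; lra.
  - apply Cc_mult; [|apply Cc_const]. apply eps_Cc_R.
    apply (loopI_continuous (fun u => phi31 l (RtoC u)) nu (-1/4) 1 (2 * nu + 3 * Cmod (Cexp l) + 1) nu Hnu ltac:(lra));
      [apply phi31_loop_cont; lra|intros; apply phi31_family_decay; assumption].
Qed.

Lemma G40_continuous nu : (0 < nu)%R -> continuous (fun u => G40 u (z ^ 2)) nu.
Proof.
  (* One loop for all nearby orders: [u < 2 nu] keeps the pole [- u] to the right of [- 2 nu]. *)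
  intros Hnu. apply (continuous_ext_loc _ (fun u => loopI (phi40 l (RtoC u)) (- (2 * nu)) 1 / (RtoC 2 * RtoC PI * Ci))).
  - exists (mkposreal nu Hnu). intros u Hu. apply Rabs_ball in Hu. simpl in Hu. symmetry.
    apply MeijerG_40; lra.
  - apply Cc_mult; [|apply Cc_const]. apply eps_Cc_R.
    apply (loopI_continuous (fun u => phi40 l (RtoC u)) nu (- (2 * nu)) 1 (2 * nu + 3 * Cmod (Cexp l) + 1) (Rmin nu (- - (2 * nu) - nu)));
      [apply Rmin_pos; lra|lra|apply phi40_loop_cont; lra|intros; apply (phi40_family_decay l nu (- (2 * nu))); assumption].
Qed.

Lemma order_derivative_continuous nu : (0 < nu)%R -> continuous order_derivative nu.
Proof.
  intros Hnu. unfold order_derivative.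
  apply Cc_mult.
  - apply (continuous_ext (fun u => RtoC u * / RtoC 2)); [intros u; rewrite RtoC_div by lra; reflexivity|].
    apply Cc_mult; [apply Cc_RtoC, continuous_id|apply Cc_const].
  - apply Cc_minus; apply Cc_mult.
    + apply Cc_mult; [apply BesselK_continuous; [exact z0|exact Hnu]|apply Cc_const].
    + apply G31_continuous, Hnu.
    + apply Cc_mult; [apply Cc_const|].
      apply (continuous_comp (fun u : R => RtoC u) (fun s => BesselI s z)); [apply Cc_RtoC, continuous_id|].
      apply (hol_cont (fun _ => True)); [apply entire_BesselI|trivial].
    + apply G40_continuous, Hnu.
Qed.

End Final.

Theorem mainTheorem10 :
  forall (nu : R) (z : C),
    (0 < nu)%R ->
    (0 < Re z)%R ->
    @is_derive R_AbsRing C_R_NormedModule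
      (fun t : R => BesselK (RtoC t) z) nu
      (RtoC (nu / 2) *
        (BesselK (RtoC nu) z / RtoC (sqrt PI)
           * MeijerG 3 1 [RtoC (1 / 2); RtoC 1]
               [RtoC 0; RtoC 0; RtoC nu; RtoC (- nu)] (z ^ 2)
         - RtoC (sqrt PI) * BesselI (RtoC nu) z
           * MeijerG 4 0 [RtoC (1 / 2); RtoC 1]
               [RtoC 0; RtoC 0; RtoC nu; RtoC (- nu)] (z ^ 2))).
Proof.
  intros nu z Hnu Hz. change (RCder (fun t : R => BesselK (RtoC t) z) nu (order_derivative z nu)).
  destruct (classic (noninteger (2 * nu))) as [H|H]; [apply BesselK_derivative_order_generic; assumption|].
  apply not_all_ex_not in H. destruct H as [k Hk]. apply NNPP in Hk.
  (* Within this radius [u] stays positive and [2 u] stays within 1 of the integer [2 nu], so every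
     [u <> nu] is generic. *)
  apply (RCder_punctured _ _ nu (Rmin nu (1/2))); [apply Rmin_pos; lra| | |].
  - apply BesselK_continuous; [apply Re_pos_neq_0, Hz|exact Hnu].
  - apply order_derivative_continuous; assumption.
  - intros u Hu Hr. assert (m1 := Rmin_l nu (1/2)). assert (m2 := Rmin_r nu (1/2)). apply Rabs_ball in Hr.
    apply BesselK_derivative_order_generic; [exact Hz|lra|]. apply (noninteger_near _ k); [lra|]. apply Rabs_def1; lra.
Qed.
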